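(* Let $p$ be a prime and let $G$ be a topologically finitely generated pro-$p$ group. Then each of the following three constructions (described in the context) yields a pro-unipotent group over $\mathbb{Q}_p$ that is canonically isomorphic to the continuous Mal'cev $\mathbb{Q}_p$-completion $G\widehat{\otimes}\mathbb{Q}_p$ of $G$. (1) (Tannakian) The affine group scheme $U_{G,\mathbb{Q}_p}=\underline{\mathrm{Aut}}^{\otimes}(\omega)$, with the canonical homomorphism $G\to U_{G,\mathbb{Q}_p}(\mathbb{Q}_p)$, is pro-unipotent and is the continuous Mal'cev $\mathbb{Q}_p$-completion of $G$. (2) (Hopf-algebraic) The affine group scheme $\mathrm{Spec}\big((\mathbb{Q}_p[[G]]^{\wedge}_I)^{\vee}\big)$ is pro-unipotent and canonically isomorphic to $G\widehat{\otimes}\mathbb{Q}_p$; and the group $\mathcal{G}(\mathbb{Q}_p[[G]]^{\wedge}_I)$ of grouplike elements is canonically isomorphic to the group of $\mathbb{Q}_p$-points $(G\widehat{\otimes}\mathbb{Q}_p)(\mathbb{Q}_p)$. (3) ($p$-adic analytic) The canonical homomorphism $G\to\varprojlim_i U_{G_i/\mathrm{Tor}(G_i),v^i}$ is the continuous Mal'cev $\mathbb{Q}_p$-completion of $G$.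
   Context: **Unipotent groups.** Let $k$ be a Hausdorff topological field of characteristic zero (here $k=\mathbb{Q}_p$). An affine algebraic group over $k$ is unipotent if it has a closed embedding into the group of upper-unitriangular $m\times m$ matrices for some $m$. An affine group scheme over $k$ is pro-unipotent if all its finite-dimensional (algebraic) quotient group schemes are unipotent; equivalently it is an inverse limit of unipotent groups. For $U$ unipotent, $U(k)$ carries the topology transported from $\mathrm{Lie}(U)\cong k^r$ (product topology) via the bijection $\exp:\mathrm{Lie}(U)\to U(k)$; for $U=\varprojlim_i U_i$ pro-unipotent, $U(k)=\varprojlim_i U_i(k)$ has the inverse limit topology. **Continuous Mal'cev completion.** $G\widehat{\otimes}k$ is the pro-unipotent group over $k$ representing the functor $U\mapsto \mathrm{Hom}_{\mathrm{cont}}(G,U(k))$ on pro-unipotent groups over $k$; it comes with a universal continuous homomorphism $G\to (G\widehat{\otimes}k)(k)$. ''Canonically isomorphic'' means isomorphic compatibly with the canonical homomorphisms from $G$. ''Topologically finitely generated'' means containing a dense finitely generated subgroup. **Construction 1.** Let $\mathbf{URep}_{\mathbb{Q}_p,\mathrm{cont}}(G)$ be the category of finite-dimensional continuous unipotent $\mathbb{Q}_p$-representations of $G$ (unipotent: there is a $G$-stable flag with trivial action on successive quotients), with forgetful functor $\omega$ to finite-dimensional $\mathbb{Q}_p$-vector spaces. $U_{G,\mathbb{Q}_p}$ is the affine group scheme representing the functor $\underline{\mathrm{Aut}}^{\otimes}(\omega)$ of tensor automorphisms of $\omega$ (for a $\mathbb{Q}_p$-algebra $R$: families of $R$-linear automorphisms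 $\lambda_X$ of $\omega(X)\otimes R$, natural in $X$, compatible with $\otimes$ and with $\lambda_{\mathbf 1}=\mathrm{id}$). The map $G\to U_{G,\mathbb{Q}_p}(\mathbb{Q}_p)$ sends $g$ to its action on all representations. **Construction 2.** $\mathbb{Z}_p[[G]]=\varprojlim_H\mathbb{Z}_p[G/H]$, with $H$ ranging over open normal subgroups; it is a topological Hopf algebra with coproduct valued in $\varprojlim_H(\mathbb{Z}_p[G/H]\otimes_{\mathbb{Z}_p}\mathbb{Z}_p[G/H])$, induced by the usual Hopf structures on $\mathbb{Z}_p[G/H]$. $I$ is its augmentation ideal, $\overline{I^n}$ the closure of $I^n$. Put $\mathbb{Q}_p[[G]]^{\wedge}_I=\varprojlim_n \mathbb{Q}_p\otimes_{\mathbb{Z}_p}(\mathbb{Z}_p[[G]]/\overline{I^n})$, regarded as a pro-object in finite-dimensional $\mathbb{Q}_p$-vector spaces; with the induced operations it is a cocommutative Hopf algebra object in pro-finite-dimensional vector spaces with completed tensor product $(\varprojlim_i V_i)\widehat\otimes(\varprojlim_j W_j)=\varprojlim_{i,j}V_i\otimes W_j$. The decompleted dual of $V=\varprojlim_i V_i$ is $V^{\vee}=\varinjlim_i \mathrm{Hom}(V_i,\mathbb{Q}_p)$; $(\mathbb{Q}_p[[G]]^{\wedge}_I)^{\vee}$ is a commutative Hopf algebra. The grouplike elements $\mathcal{G}(\mathbb{Q}_p[[G]]^{\wedge}_I)$ are the morphisms of pro-finite-dimensional coalgebras $\mathbb{Q}_p\to\mathbb{Q}_p[[G]]^{\wedge}_I$;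 they form a group under the product induced by the multiplication of $\mathbb{Q}_p[[G]]^{\wedge}_I$. **Construction 3.** Let $\Gamma^1G=G$, $\Gamma^{n}G=(G,\Gamma^{n-1}G)$ be the lower central series (each term is closed) and $G_i=G/\Gamma^iG$ for $i\ge1$. The torsion elements $\mathrm{Tor}(G_i)$ form a finite normal subgroup. For a topologically finitely generated torsion-free nilpotent pro-$p$ group $N$ with upper central series $1=Z_0\subset Z_1\subset\cdots$, a Mal'cev basis is an ordered collection $v=(v_1,\dots,v_r)$ obtained by choosing for each $i$ elements $x_{i1},\dots,x_{ir_i}\in Z_i(N)$ whose images form a $\mathbb{Z}_p$-basis of $Z_i(N)/Z_{i-1}(N)$. Then $\phi_v:\mathbb{Z}_p^r\to N$, $(\lambda_1,\dots,\lambda_r)\mapsto v_1^{\lambda_1}\cdots v_r^{\lambda_r}$ is a homeomorphism, and in these coordinates multiplication is a polynomial map $F_v$ with coefficients in $\mathbb{Q}_p$; $U_{N,v}=(\mathbb{Q}_p^r,F_v)$ is the resulting (unipotent algebraic) group, with homomorphism $N\xrightarrow{\phi_v^{-1}}(\mathbb{Z}_p^r,F_v)\hookrightarrow U_{N,v}$. Choose a Mal'cev basis $v^i$ of $G_i/\mathrm{Tor}(G_i)$ for every $i$. The tower $G_1\twoheadleftarrow G_2\twoheadleftarrow\cdots$ induces a tower of the groups $U_{G_i/\mathrm{Tor}(G_i),v^i}$ compatible with the maps $G_i\to U_{G_i/\mathrm{Tor}(G_i),v^i}$, and one takes its inverse limit. *)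

(* Defs.v *)
From HB Require Import structures.
From mathcomp Require Import all_boot all_order all_algebra.
From mathcomp Require Import finmap.
From mathcomp Require Import all_classical topology.
From mathcomp Require Import monalg.
From mathcomp Require mpoly mxtens.

Set Implicit Arguments.
Unset Strict Implicit.
Unset Printing Implicit Defensive.

Import Order.TTheory GRing.Theory Num.Theory.
Local Open Scope classical_set_scope.
Local Open Scope ring_scope.

(* An element of Z_p = lim_n Z/p^n is the sequence of its canonical
   representatives 0 <= x n < p ^ n modulo p ^ n. *)
Definition padic_seq (p : nat) (x : nat -> int) :=
  forall n, x n = (x n.+1 %% (p ^ n)%N)%Z.

Record Zp (p : nat) (p_pr : prime p) :=
  MkZp { zpval :> nat -> int; _ : `[< padic_seq p zpval >] }.

Section PadicIntegers.
Variables (p : nat) (p_pr : prime p).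
Local Notation Zp := (Zp p_pr).
Implicit Types (x y : nat -> int).

HB.instance Definition _ := [isSub of Zp for @zpval p p_pr].
HB.instance Definition _ := [Choice of Zp by <:].

Lemma zpvalP (a : Zp) : padic_seq p a.
Proof. by case: a => x /= /asboolP. Qed.

Lemma zp_mod (a : Zp) n : (a n %% (p ^ n)%N)%Z = a n.
Proof. by rewrite zpvalP modz_mod. Qed.

Lemma zpP (a b : Zp) : (forall n, a n = b n) -> a = b.
Proof. by move=> ab; apply/val_inj/funext. Qed.

Definition coherent x := forall n, (x n.+1 = x n %[mod (p ^ n)%N])%Z.

Lemma modz_exp (a : int) n : (modz a (p ^ n.+1)%N = a %[mod (p ^ n)%N])%Z.
Proof.
rewrite {2}(divz_eq a (p ^ n.+1)%N) expnSr PoszM mulrA -mulrA (mulrC (p ^ n)%:Z).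
by rewrite mulrA modzMDl.
Qed.

Lemma Zp_of_subproof x (cx : coherent x) :
  `[< padic_seq p (fun n => (x n %% (p ^ n)%N)%Z) >].
Proof. by apply/asboolP => n; rewrite modz_exp cx. Qed.

Definition Zp_of x (cx : coherent x) : Zp := MkZp p_pr (Zp_of_subproof cx).

Lemma zp_coherent (a : Zp) : coherent a.
Proof. by move=> n; rewrite -zpvalP zp_mod. Qed.

Lemma coherentD (a b : Zp) : coherent (fun n => a n + b n).
Proof. by move=> n; rewrite -modzDm !zp_coherent modzDm. Qed.
Lemma coherentN (a : Zp) : coherent (fun n => - a n).
Proof. by move=> n; rewrite -modzNm zp_coherent modzNm. Qed.
Lemma coherentM (a b : Zp) : coherent (fun n => a n * b n).
Proof. by move=> n; rewrite -modzMm !zp_coherent modzMm. Qed.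
Lemma coherentC (c : int) : coherent (fun => c).
Proof. by []. Qed.

Definition zp_zero := Zp_of (coherentC 0).
Definition zp_one := Zp_of (coherentC 1).
Definition zp_add a b := Zp_of (coherentD a b).
Definition zp_opp a := Zp_of (coherentN a).
Definition zp_mul a b := Zp_of (coherentM a b).

Lemma zp_addA : associative zp_add.
Proof. by move=> a b c; apply: zpP => n /=; rewrite modzDmr modzDml addrA. Qed.
Lemma zp_addC : commutative zp_add.
Proof. by move=> a b; apply: zpP => n /=; rewrite addrC. Qed.
Lemma zp_add0 : left_id zp_zero zp_add.
Proof. by move=> a; apply: zpP => n /=; rewrite modzDml add0r zp_mod. Qed.
Lemma zp_addN : left_inverse zp_zero zp_opp zp_add.
Proof. by move=> a; apply: zpP => n /=; rewrite modzDml addNr. Qed.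
Lemma zp_mulA : associative zp_mul.
Proof. by move=> a b c; apply: zpP => n /=; rewrite modzMmr modzMml mulrA. Qed.
Lemma zp_mulC : commutative zp_mul.
Proof. by move=> a b; apply: zpP => n /=; rewrite mulrC. Qed.
Lemma zp_mul1 : left_id zp_one zp_mul.
Proof. by move=> a; apply: zpP => n /=; rewrite modzMml mul1r zp_mod. Qed.
Lemma zp_mulD : left_distributive zp_mul zp_add.
Proof. by move=> a b c; apply: zpP => n /=; rewrite modzMml modzDm mulrDl. Qed.
Lemma zp_one_neq0 : zp_one != zp_zero.
Proof.
apply/eqP => /(congr1 (fun a : Zp => a 1%N)) /=; rewrite mod0z.
by rewrite modz_small //= expn1 ltz_nat prime_gt1.
Qed.

HB.instance Definition _ :=
  GRing.isZmodule.Build Zp zp_addA zp_addC zp_add0 zp_addN.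
HB.instance Definition _ := GRing.Zmodule_isComNzRing.Build Zp
  zp_mulA zp_mulC zp_mul1 zp_mulD zp_one_neq0.

Definition zp_unit : pred Zp := fun a => `[< exists b, b * a = 1 >].
Definition zp_inv (a : Zp) : Zp := xget a [set b | b * a = 1].

Lemma zp_mulV : {in zp_unit, left_inverse 1 zp_inv *%R}.
Proof. by move=> a /asboolP [b ba]; rewrite /zp_inv; case: xgetP => [c _ //|/(_ b)]. Qed.
Lemma zp_unitP (a b : Zp) : b * a = 1 -> zp_unit a.
Proof. by move=> ba; apply/asboolP; exists b. Qed.
Lemma zp_inv_out : {in [predC zp_unit], zp_inv =1 id}.
Proof.
move=> a /= /negP aN; rewrite /zp_inv; case: xgetP => // b _ ba.
by case: aN; exact: zp_unitP ba.
Qed.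

HB.instance Definition _ :=
  GRing.ComNzRing_hasMulInverse.Build Zp zp_mulV zp_unitP zp_inv_out.

Lemma zp_val_mod (a : Zp) n k : (a (n + k)%N = a n %[mod (p ^ n)%N])%Z.
Proof.
elim: k => [|k IH]; first by rewrite addn0.
rewrite addnS -IH; have := zp_coherent a (n + k).
move/eqP; rewrite eqz_mod_dvd => /dvdzP [q qE]; apply/eqP.
by rewrite eqz_mod_dvd qE expnD PoszM mulrCA dvdz_mulr.
Qed.

Lemma zp_neq0 (a : Zp) : a != 0 -> exists n, forall k, ~~ ((p ^ n)%N %| a (n + k)%N)%Z.
Proof.
move=> a0; have [n an0] : exists n, a n <> 0.
  apply/not_existsP => a0'; move/eqP: a0; apply; apply: zpP => n /=.
  by rewrite mod0z; have := a0' n; apply: contra_notP.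
exists n => k; apply/negP => /dvdz_mod0P; rewrite zp_val_mod zp_mod.
exact: an0.
Qed.

Lemma zp_idomain : GRing.integral_domain_axiom Zp.
Proof.
move=> a b ab0; apply/norP => -[/zp_neq0[n an] /zp_neq0[m bm]].
have := congr1 (fun c : Zp => c (n + m)%N) ab0; rewrite /= mod0z.
move/dvdz_mod0P; have := an m; have := bm n; rewrite (addnC m n).
move: (a _) (b _) => x y; rewrite !dvdzE abszM /= => ym xn.
have x0 : (0 < `|x|)%N by rewrite lt0n; apply: contraNneq xn => ->.
have y0 : (0 < `|y|)%N by rewrite lt0n; apply: contraNneq ym => ->.
rewrite pfactor_dvdn ?muln_gt0 ?x0// lognM// => nm.
move: xn ym; rewrite !pfactor_dvdn// -!ltnNge => xn ym.
by move: nm; rewrite leqNgt -addSn leq_add// ltnW.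
Qed.

HB.instance Definition _ := GRing.ComUnitRing_isIntegral.Build Zp zp_idomain.

End PadicIntegers.

Definition Qp (p : nat) (p_pr : prime p) : Type := {fraction (Zp p_pr)}.

Section PadicNumbers.
Variables (p : nat) (p_pr : prime p).
Local Notation Zp := (Zp p_pr).
Local Notation Qp := (Qp p_pr).

HB.instance Definition _ := GRing.Field.on Qp.

Definition Zp_Qp (z : Zp) : Qp := FracField.tofrac z.

HB.instance Definition _ := GRing.RMorphism.copy Zp_Qp (@FracField.tofrac Zp).

Definition Qp_open : set_system Qp :=
  [set A | forall a, A a -> exists n, forall z, A (a + p%:R ^+ n * Zp_Qp z)].

Lemma Qp_openT : Qp_open setT.
Proof. by move=> a _; exists 0%N. Qed.

Lemma Qp_openI : setI_closed Qp_open.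
Proof.
move=> A B oA oB a [/oA[n An] /oB[m Bm]]; exists (n + m)%N => z; split.
  by have := An (p%:R ^+ m * z); rewrite rmorphM rmorphXn rmorph_nat mulrA -exprD.
by have := Bm (p%:R ^+ n * z); rewrite rmorphM rmorphXn rmorph_nat mulrA -exprD addnC.
Qed.

Lemma Qp_open_bigcup (I : Type) (f : I -> set Qp) :
  (forall i, Qp_open (f i)) -> Qp_open (\bigcup_i f i).
Proof. by move=> fo a [i _ /(fo i)[n fn]]; exists n => z; exists i. Qed.

HB.instance Definition _ :=
  isOpenTopological.Build Qp Qp_openT Qp_openI Qp_open_bigcup.

End PadicNumbers.
HB.mixin Record Group_isTopGroup G of Group G & Topological G := {
  mulg_continuous : continuous (fun xy : G * G => (xy.1 * xy.2)%g);
  invg_continuous : continuous (fun x : G => (x^-1)%g)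
}.

#[short(type="topGroupType")]
HB.structure Definition TopGroup :=
  {G of Group G & Topological G & Group_isTopGroup G}.

Section Subgroups.
Local Open Scope group_scope.
Variable G : groupType.
Implicit Types (S H : set G).

Definition subgroup H :=
  [/\ H 1, forall x y, H x -> H y -> H (x * y) & forall x, H x -> H x^-1].

Definition normal_subgroup H := subgroup H /\ forall x y, H x -> H (x ^ y).

Definition generated_subgroup S : set G := smallest subgroup S.

Definition normal_closure S : set G := smallest normal_subgroup S.

Lemma normal_closureP S : normal_subgroup (normal_closure S).
Proof.
split; last by move=> x y Hx H [nH SH]; apply: (nH.2); exact: Hx.
split=> [H [[[]]]//|x y Hx Hy H [nH SH]|x Hx H [nH SH]]; have [_ HM HV] := nH.1.
  by apply: HM; [exact: Hx|exact: Hy].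
by apply: HV; exact: Hx.
Qed.

Definition quot_rel S : rel G := fun x y => `[< normal_closure S (x^-1 * y) >].

Lemma quot_rel_refl S : reflexive (quot_rel S).
Proof. by move=> x; apply/asboolP; rewrite mulVg; have [[]] := normal_closureP S. Qed.

Lemma quot_rel_sym S : symmetric (quot_rel S).
Proof.
have [[_ _ HV] _] := normal_closureP S.
by move=> x y; apply/asboolP/asboolP => /HV; rewrite invgM invgK.
Qed.

Lemma quot_rel_trans S : transitive (quot_rel S).
Proof.
have [[_ HM _] _] := normal_closureP S.
move=> y x z /asboolP xy /asboolP yz; apply/asboolP.
by have := HM _ _ xy yz; rewrite mulgA mulgK.
Qed.

Canonical quot_equiv S :=
  EquivRel (quot_rel S) (@quot_rel_refl S) (@quot_rel_sym S) (@quot_rel_trans S).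

End Subgroups.

(* S need not be a subgroup: we divide by its normal closure, which is S itself
   in all the uses below. *)
Definition quot_group (G : topGroupType) (S : set G) : Type :=
  quotient_topology {eq_quot (quot_rel S)}%qT.

Section QuotGroup.
Local Open Scope group_scope.
Local Open Scope quotient_scope.
Variables (G : topGroupType) (S : set G).
Local Notation Q := (quot_group S).

HB.instance Definition _ := Topological.on Q.
HB.instance Definition _ := Quotient.on Q.

Definition to_quot (x : G) : Q := \pi_Q x.

Lemma to_quotP x y : to_quot x = to_quot y <-> normal_closure S (x^-1 * y).
Proof.
have xyE : to_quot x = to_quot y <-> quot_rel S x y.
  exact: (rwP (eqmodP (quot_equiv S) x y)).
by rewrite xyE; split=> [/asboolP|/asboolP].
Qed.

Lemma repr_to_quot x : normal_closure S ((repr (to_quot x))^-1 * x).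
Proof. by apply/to_quotP; rewrite /to_quot reprK. Qed.

Definition quot_mul (a b : Q) := to_quot (repr a * repr b).
Definition quot_inv (a : Q) := to_quot (repr a)^-1.

Lemma quot_mulE x y : quot_mul (to_quot x) (to_quot y) = to_quot (x * y).
Proof.
apply/to_quotP; have [[_ HM _] HJ] := normal_closureP S.
have := HM _ _ (HJ _ (repr (to_quot y)) (repr_to_quot x)) (repr_to_quot y).
by rewrite conjgE !mulgA mulgK invgM.
Qed.

Lemma quot_invE x : quot_inv (to_quot x) = to_quot x^-1.
Proof.
apply/to_quotP; have [[_ _ HV] HJ] := normal_closureP S.
have := HJ _ x^-1 (HV _ (repr_to_quot x)).
by rewrite conjgE !invgM !invgK mulgA mulVKg.
Qed.

Lemma quot_ind (P : Q -> Prop) : (forall x, P (to_quot x)) -> forall a, P a.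
Proof. by move=> Px a; rewrite -[a]reprK; exact: Px. Qed.

Lemma quot_mulA : associative quot_mul.
Proof.
elim/quot_ind=> x; elim/quot_ind=> y; elim/quot_ind=> z.
by rewrite !quot_mulE mulgA.
Qed.
Lemma quot_mul1g : left_id (to_quot 1) quot_mul.
Proof. by elim/quot_ind=> x; rewrite quot_mulE mul1g. Qed.
Lemma quot_mulg1 : right_id (to_quot 1) quot_mul.
Proof. by elim/quot_ind=> x; rewrite quot_mulE mulg1. Qed.
Lemma quot_mulVg : left_inverse (to_quot 1) quot_inv quot_mul.
Proof. by elim/quot_ind=> x; rewrite quot_invE quot_mulE mulVg. Qed.
Lemma quot_mulgV : right_inverse (to_quot 1) quot_inv quot_mul.
Proof. by elim/quot_ind=> x; rewrite quot_invE quot_mulE mulgV. Qed.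

HB.instance Definition _ := isGroup.Build Q
  quot_mulA quot_mul1g quot_mulg1 quot_mulVg quot_mulgV.

Lemma to_quotM : {morph to_quot : x y / x * y}.
Proof. by move=> x y; rewrite -quot_mulE. Qed.

Lemma to_quotV : {morph to_quot : x / x^-1}.
Proof. by move=> x; rewrite -quot_invE. Qed.

Lemma to_quot_continuous : continuous to_quot.
Proof. exact: pi_continuous. Qed.

Lemma to_quot_open (A : set G) : open A -> open (to_quot @` A).
Proof.
move=> oA.
have -> : open (to_quot @` A) = open (to_quot @^-1` (to_quot @` A)) by [].
have -> : to_quot @^-1` (to_quot @` A) =
    \bigcup_(n in normal_closure S) ((fun x => x * n) @^-1` A).
  apply/seteqP; split=> [x [y Ay /to_quotP yx]|x [n Sn /= Axn]] /=.
    exists (x^-1 * y) => /=; last by rewrite mulVKg.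
    by have [[_ _ HV] _] := normal_closureP S; have := HV _ yx; rewrite invgM invgK.
  exists (x * n) => //; apply/to_quotP; rewrite invgM mulgVK.
  by have [[_ _ HV] _] := normal_closureP S; exact: HV.
apply: bigcup_open => n _; apply: open_comp => // x _.
apply: (@continuous_comp _ _ _ (fun x => (x, n)) (fun xy : G * G => xy.1 * xy.2)).
  by apply: cvg_pair => //=; exact: cvg_cst.
exact: mulg_continuous.
Qed.

Lemma quot_mul_continuous : continuous (fun ab : Q * Q => ab.1 * ab.2).
Proof.
move=> -[a b]; elim/quot_ind: a => x; elim/quot_ind: b => y W /=.
rewrite -to_quotM => /(to_quot_continuous)/(mulg_continuous (x, y)).
rewrite nbhs_simpl => -[[A B] /= [xA yB] AB].
exists (to_quot @` A°, to_quot @` B°) => /=.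
  split; apply: open_nbhs_nbhs; (split; first by apply: to_quot_open; exact: open_interior).
    by exists x.
  by exists y.
move=> [a b] /= [[x' /interior_subset Ax' <-] [y' /interior_subset By' <-]].
by rewrite -to_quotM; exact: (AB (x', y')).
Qed.

Lemma quot_inv_continuous : continuous (fun a : Q => a^-1).
Proof.
apply/quotient_continuous => x.
have -> : (fun a : Q => a^-1) \o \pi_Q = to_quot \o (fun x : G => x^-1).
  by apply/funext => y /=; rewrite to_quotV.
apply: (@continuous_comp _ _ _ (fun x : G => x^-1) to_quot).
  exact: invg_continuous.
exact: to_quot_continuous.
Qed.

HB.instance Definition _ :=
  Group_isTopGroup.Build Q quot_mul_continuous quot_inv_continuous.

End QuotGroup.
Arguments to_quot {G} S x.

Definition open_normal (G : topGroupType) (H : set G) :=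
  open H /\ normal_subgroup H.

Definition pro_p_group (p : nat) (G : topGroupType) :=
  [/\ compact [set: G], hausdorff_space G, totally_disconnected [set: G] &
      forall H : set G, open_normal H ->
        exists n, ([set: quot_group H] #= `I_(p ^ n))%card].

Definition top_finitely_generated (G : topGroupType) :=
  exists s : seq G, dense (generated_subgroup [set` s]).

Section QuotModule.
Local Open Scope quotient_scope.
Variables (A : nzRingType) (M : lmodType A).
Implicit Types (J : set M) (x y : M).

Definition submodule J := J 0 /\ forall a x y, J x -> J y -> J (a *: x + y).

Definition span J : set M := smallest submodule J.

Lemma spanP J : submodule (span J).
Proof.
split=> [L [[]]//|a x y Jx Jy L [sL JL]].
by apply: sL.2; [exact: Jx|exact: Jy].
Qed.

Lemma span_sub J : J `<=` span J.
Proof. by move=> x Jx L [_]; exact. Qed.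

Lemma spanD J x y : span J x -> span J y -> span J (x + y).
Proof. by move=> Jx Jy; have := (spanP J).2 1 x y Jx Jy; rewrite scale1r. Qed.

Lemma spanZ J a x : span J x -> span J (a *: x).
Proof. by move=> Jx; have := (spanP J).2 a x 0 Jx (spanP J).1; rewrite addr0. Qed.

Lemma spanN J x : span J x -> span J (- x).
Proof. by move=> /(spanZ (-1)); rewrite scaleN1r. Qed.

Definition modrel J : rel M := fun x y => `[< span J (x - y) >].

Lemma modrel_refl J : reflexive (modrel J).
Proof. by move=> x; apply/asboolP; rewrite subrr; exact: (spanP J).1. Qed.
Lemma modrel_sym J : symmetric (modrel J).
Proof. by move=> x y; apply/asboolP/asboolP => /spanN; rewrite opprB. Qed.
Lemma modrel_trans J : transitive (modrel J).
Proof.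
move=> y x z /asboolP xy /asboolP yz; apply/asboolP.
by have := spanD xy yz; rewrite addrA subrK.
Qed.

Canonical modrel_equiv J :=
  EquivRel (modrel J) (@modrel_refl J) (@modrel_sym J) (@modrel_trans J).

Definition quot_mod J : Type := {eq_quot (modrel J)}.

HB.instance Definition _ J := Quotient.on (quot_mod J).
HB.instance Definition _ J := Choice.on (quot_mod J).

Definition to_qmod J x : quot_mod J := \pi x.

Lemma to_qmodP J x y : to_qmod J x = to_qmod J y <-> span J (x - y).
Proof.
have xyE : to_qmod J x = to_qmod J y <-> modrel J x y.
  exact: (rwP (eqmodP (modrel_equiv J) x y)).
by rewrite xyE; split=> /asboolP.
Qed.

Lemma repr_qmod J x : span J (repr (to_qmod J x) - x).
Proof. by apply/to_qmodP; rewrite /to_qmod reprK. Qed.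

Lemma qmod_ind J (P : quot_mod J -> Prop) :
  (forall x, P (to_qmod J x)) -> forall u, P u.
Proof. by move=> Px u; rewrite -[u]reprK; exact: Px. Qed.

Section Operations.
Variable J : set M.
Local Notation Q := (quot_mod J).
Local Notation to_q := (to_qmod J).

Definition qmod_add (u v : Q) := to_q (repr u + repr v).
Definition qmod_opp (u : Q) := to_q (- repr u).
Definition qmod_scale (a : A) (u : Q) := to_q (a *: repr u).

Lemma qmod_addE x y : qmod_add (to_q x) (to_q y) = to_q (x + y).
Proof.
apply/to_qmodP; rewrite opprD addrACA.
by apply: spanD; exact: repr_qmod.
Qed.
Lemma qmod_oppE x : qmod_opp (to_q x) = to_q (- x).
Proof. by apply/to_qmodP; rewrite -opprD; apply: spanN; exact: repr_qmod. Qed.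
Lemma qmod_scaleE a x : qmod_scale a (to_q x) = to_q (a *: x).
Proof. by apply/to_qmodP; rewrite -scalerBr; apply: spanZ; exact: repr_qmod. Qed.

Lemma qmod_addA : associative qmod_add.
Proof.
by elim/qmod_ind=> x; elim/qmod_ind=> y; elim/qmod_ind=> z; rewrite !qmod_addE addrA.
Qed.
Lemma qmod_addC : commutative qmod_add.
Proof. by elim/qmod_ind=> x; elim/qmod_ind=> y; rewrite !qmod_addE addrC. Qed.
Lemma qmod_add0 : left_id (to_q 0) qmod_add.
Proof. by elim/qmod_ind=> x; rewrite qmod_addE add0r. Qed.
Lemma qmod_addN : left_inverse (to_q 0) qmod_opp qmod_add.
Proof. by elim/qmod_ind=> x; rewrite qmod_oppE qmod_addE addNr. Qed.

HB.instance Definition _ :=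
  GRing.isZmodule.Build Q qmod_addA qmod_addC qmod_add0 qmod_addN.

Lemma qmod_scaleA a b u : qmod_scale a (qmod_scale b u) = qmod_scale (a * b) u.
Proof. by elim/qmod_ind: u => x; rewrite !qmod_scaleE scalerA. Qed.
Lemma qmod_scale1 : left_id 1 qmod_scale.
Proof. by elim/qmod_ind=> x; rewrite qmod_scaleE scale1r. Qed.
Lemma qmod_scaleDr : right_distributive qmod_scale +%R.
Proof.
by move=> a; elim/qmod_ind=> x; elim/qmod_ind=> y;
  rewrite /GRing.add/= !(qmod_addE, qmod_scaleE) scalerDr.
Qed.
Lemma qmod_scaleDl u : {morph qmod_scale^~ u : a b / a + b}.
Proof.
by elim/qmod_ind: u => x a b; rewrite [RHS]/GRing.add/= !(qmod_addE, qmod_scaleE) scalerDl.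
Qed.

HB.instance Definition _ := GRing.Zmodule_isLmodule.Build A Q
  qmod_scaleA qmod_scale1 qmod_scaleDr qmod_scaleDl.

Lemma to_qmod_is_linear : linear to_q.
Proof. by move=> a x y; rewrite -qmod_addE -qmod_scaleE. Qed.

HB.instance Definition _ :=
  GRing.isLinear.Build A M Q _ to_q to_qmod_is_linear.

(* Independent of the representative when f is linear and kills J
   (qmod_liftE). *)
Definition qmod_lift (W : Type) (f : M -> W) (u : Q) : W := f (repr u).

Variables (W : lmodType A) (f : {linear M -> W}).
Hypothesis fJ : forall x, J x -> f x = 0.

Lemma qmod_liftE x : qmod_lift f (to_q x) = f x.
Proof.
apply/eqP; rewrite -subr_eq0 -linearB; apply/eqP.
have /(_ [set y | f y = 0]) := @repr_qmod J x; apply; split=> //.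
split=> /= [|a u v fu fv]; first exact: linear0.
by rewrite linearP fu fv scaler0 addr0.
Qed.

Lemma qmod_lift_is_linear : linear (qmod_lift f).
Proof.
move=> a; elim/qmod_ind=> x; elim/qmod_ind=> y.
by rewrite -linearP !qmod_liftE linearP.
Qed.

End Operations.
End QuotModule.

Section FreeModule.
Variables (A : nzRingType) (T : choiceType).

Definition free_lift (W : lmodType A) (f : T -> W) (g : {malg A[T]}) : W :=
  \sum_(t <- msupp g) g@_t *: f t.

Variables (W : lmodType A) (f : T -> W).

Lemma free_liftEw (d : {fset T}) g : (msupp g `<=` d)%fset ->
  free_lift f g = \sum_(t <- d) g@_t *: f t.
Proof.
move=> gd; rewrite /free_lift (big_fset_incl _ gd)// => t _ tg.
by rewrite mcoeff_outdom// scale0r.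
Qed.

Lemma free_lift_is_linear : linear (free_lift f).
Proof.
move=> a g h; pose d := (msupp (a *: g + h) `|` (msupp g `|` msupp h))%fset.
have sd u : u \in [:: a *: g + h; g; h] -> (msupp u `<=` d)%fset.
  by rewrite !inE => /or3P[]/eqP->; apply/fsubsetP => t; rewrite !inE => ->; rewrite ?orbT.
rewrite !(@free_liftEw d) ?sd ?inE ?eqxx ?orbT//.
rewrite scaler_sumr -big_split; apply: eq_bigr => t _ /=.
by rewrite mcoeffD mcoeffZ scalerDl scalerA.
Qed.

HB.instance Definition _ :=
  GRing.isLinear.Build A {malg A[T]} W _ (free_lift f) free_lift_is_linear.

Lemma free_liftU t : free_lift f << t >> = f t.
Proof. by rewrite /free_lift msuppU oner_eq0 big_seq_fset1 mcoeffUU scale1r. Qed.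

Lemma linear_free_lift (W' : lmodType A) (L : {linear W -> W'}) g :
  L (free_lift f g) = free_lift (L \o f) g.
Proof. by rewrite /free_lift linear_sum; apply: eq_bigr => t _; rewrite linearZ. Qed.

Lemma eq_free_lift f' : f =1 f' -> free_lift f =1 free_lift f'.
Proof. by move=> ff' g; apply: eq_bigr => t _; rewrite ff'. Qed.

End FreeModule.

Section Tensor.
Variables (A : comNzRingType) (M N : lmodType A).

Definition bilinear_rel : set {malg A[(M * N)%type]} :=
  [set r | exists a x x' y,
     r = << (a *: x + x', y) >> - (a *: << (x, y) >> + << (x', y) >>)] `|`
  [set r | exists a x y y',
     r = << (x, a *: y + y') >> - (a *: << (x, y) >> + << (x, y') >>)].

Definition tensor : Type := quot_mod bilinear_rel.
HB.instance Definition _ := GRing.Lmodule.on tensor.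

Definition tens (x : M) (y : N) : tensor := to_qmod bilinear_rel << (x, y) >>.

Definition bilin (W : lmodType A) (f : M -> N -> W) :=
  (forall y, linear (f^~ y)) /\ (forall x, linear (f x)).

Definition tensor_lift (W : lmodType A) (f : M -> N -> W) : tensor -> W :=
  qmod_lift (free_lift (fun xy => f xy.1 xy.2)).

Section Lift.
Variables (W : lmodType A) (f : M -> N -> W) (bf : bilin f).

Lemma bilinear_rel_lift r :
  bilinear_rel r -> free_lift (fun xy => f xy.1 xy.2) r = 0.
Proof.
move=> [[a [x [x' [y ->]]]]|[a [x [y [y' ->]]]]];
  rewrite linearB linearP /= !free_liftU /=.
  by rewrite bf.1 subrr.
by rewrite bf.2 subrr.
Qed.

Lemma tensor_liftE x y : tensor_lift f (tens x y) = f x y.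
Proof. by rewrite /tensor_lift /tens (qmod_liftE bilinear_rel_lift)/= free_liftU. Qed.

Lemma tensor_lift_is_linear : linear (tensor_lift f).
Proof. exact: (qmod_lift_is_linear bilinear_rel_lift). Qed.

End Lift.

Lemma tens_bilin : bilin tens.
Proof.
split=> [y a x x'|x a y y']; rewrite /tens -linearP; apply: (to_qmodP _ _ _).2; apply: span_sub.
  by left; exists a, x, x', y.
by right; exists a, x, y, y'.
Qed.

End Tensor.

Section TensorMap.
Variables (A : comNzRingType) (M N M' N' : lmodType A).
Variables (f : {linear M -> M'}) (g : {linear N -> N'}).

Definition tensor_map : tensor M N -> tensor M' N' :=
  tensor_lift (fun x y => tens (f x) (g y)).

Lemma tensor_map_bilin : bilin (fun x y => tens (f x) (g y)).
Proof.
have [tl tr] := tens_bilin M' N'.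
by split=> [y a x x'|x a y y']; rewrite linearP ?tl ?tr.
Qed.

HB.instance Definition _ := GRing.isLinear.Build A (tensor M N) (tensor M' N') _
  tensor_map (tensor_lift_is_linear tensor_map_bilin).

Lemma tensor_mapE x y : tensor_map (tens x y) = tens (f x) (g y).
Proof. exact: (tensor_liftE tensor_map_bilin). Qed.

End TensorMap.

Section ExtScalars.
Variables (A B : comNzRingType) (phi : {rmorphism A -> B}).

Section Def.
Variable M : lmodType A.

Definition ext_rel : set {malg B[M]} :=
  [set r | exists a x y, r = << a *: x + y >> - (phi a *: << x >> + << y >>)].

Definition ext_scalars : Type := quot_mod ext_rel.
HB.instance Definition _ := GRing.Lmodule.on ext_scalars.

Definition to_ext (x : M) : ext_scalars := to_qmod ext_rel << x >>.

Lemma to_extP a x y : to_ext (a *: x + y) = phi a *: to_ext x + to_ext y.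
Proof.
rewrite /to_ext -linearP; apply: (to_qmodP _ _ _).2; apply: span_sub.
by exists a, x, y.
Qed.

Definition ext_lift (W : lmodType B) (f : M -> W) : ext_scalars -> W :=
  qmod_lift (free_lift f).

Variables (W : lmodType B) (f : M -> W).
Hypothesis f_semilinear : forall a x y, f (a *: x + y) = phi a *: f x + f y.

Lemma ext_rel_lift r : ext_rel r -> free_lift f r = 0.
Proof.
by move=> [a [x [y ->]]]; rewrite linearB linearP /= !free_liftU f_semilinear subrr.
Qed.

Lemma ext_liftE x : ext_lift f (to_ext x) = f x.
Proof. by rewrite /ext_lift /to_ext (qmod_liftE ext_rel_lift)/= free_liftU. Qed.

Lemma ext_lift_is_linear : linear (ext_lift f).
Proof. exact: (qmod_lift_is_linear ext_rel_lift). Qed.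

End Def.

Variables (M N : lmodType A) (f : {linear M -> N}).

Definition ext_map : ext_scalars M -> ext_scalars N := ext_lift (fun x => to_ext (f x)).

Lemma ext_map_semilinear a x y :
  to_ext (f (a *: x + y)) = phi a *: to_ext (f x) + to_ext (f y).
Proof. by rewrite linearP to_extP. Qed.

HB.instance Definition _ := GRing.isLinear.Build B (ext_scalars M) (ext_scalars N) _
  ext_map (ext_lift_is_linear ext_map_semilinear).

Lemma ext_mapE x : ext_map (to_ext x) = to_ext (f x).
Proof. exact: (ext_liftE ext_map_semilinear). Qed.

End ExtScalars.
Arguments to_ext {A B} phi {M} x.
Arguments ext_map {A B} phi {M N} f u.

Section ModuleLimit.
Variables (A : nzRingType) (I : choiceType) (le : rel I) (M : I -> lmodType A).
Variable t : forall i j, le i j -> {linear M i -> M j}.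

Definition coherent_family (x : forall i, M i) := forall i j (ij : le i j), t ij (x i) = x j.

Record mod_lim := ModLim {
  proj_lim :> forall i, M i; _ : `[< coherent_family proj_lim >] }.

HB.instance Definition _ := [isSub of mod_lim for proj_lim].
HB.instance Definition _ := [Choice of mod_lim by <:].

Implicit Types x y z : mod_lim.

Lemma mod_limP x : coherent_family x.
Proof. by case: x => x /= /asboolP. Qed.

Lemma mod_lim_eq x y : (forall i, x i = y i) -> x = y.
Proof. by move=> xy; apply/val_inj/functional_extensionality_dep. Qed.

Lemma lim_zero_subproof : `[< coherent_family (fun i => 0) >].
Proof. by apply/asboolP => i j ij; rewrite linear0. Qed.
Lemma lim_add_subproof x y : `[< coherent_family (fun i => x i + y i) >].
Proof. by apply/asboolP => i j ij; rewrite linearD !mod_limP. Qed.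
Lemma lim_opp_subproof x : `[< coherent_family (fun i => - x i) >].
Proof. by apply/asboolP => i j ij; rewrite linearN !mod_limP. Qed.
Lemma lim_scale_subproof a x : `[< coherent_family (fun i => a *: x i) >].
Proof. by apply/asboolP => i j ij; rewrite linearZ/= !mod_limP. Qed.

Definition lim_zero := ModLim lim_zero_subproof.
Definition lim_add x y := ModLim (lim_add_subproof x y).
Definition lim_opp x := ModLim (lim_opp_subproof x).
Definition lim_scale a x := ModLim (lim_scale_subproof a x).

Lemma lim_addA : associative lim_add.
Proof. by move=> x y z; apply: mod_lim_eq => i /=; rewrite addrA. Qed.
Lemma lim_addC : commutative lim_add.
Proof. by move=> x y; apply: mod_lim_eq => i /=; rewrite addrC. Qed.
Lemma lim_add0 : left_id lim_zero lim_add.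
Proof. by move=> x; apply: mod_lim_eq => i /=; rewrite add0r. Qed.
Lemma lim_addN : left_inverse lim_zero lim_opp lim_add.
Proof. by move=> x; apply: mod_lim_eq => i /=; rewrite addNr. Qed.

HB.instance Definition _ :=
  GRing.isZmodule.Build mod_lim lim_addA lim_addC lim_add0 lim_addN.

Lemma lim_scaleA a b x : lim_scale a (lim_scale b x) = lim_scale (a * b) x.
Proof. by apply: mod_lim_eq => i /=; rewrite scalerA. Qed.
Lemma lim_scale1 : left_id 1 lim_scale.
Proof. by move=> x; apply: mod_lim_eq => i /=; rewrite scale1r. Qed.
Lemma lim_scaleDr : right_distributive lim_scale +%R.
Proof. by move=> a x y; apply: mod_lim_eq => i /=; rewrite scalerDr. Qed.
Lemma lim_scaleDl x : {morph lim_scale^~ x : a b / a + b}.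
Proof. by move=> a b; apply: mod_lim_eq => i /=; rewrite scalerDl. Qed.

HB.instance Definition _ := GRing.Zmodule_isLmodule.Build A mod_lim
  lim_scaleA lim_scale1 lim_scaleDr lim_scaleDl.

End ModuleLimit.

(* An inverse limit of Z_p-modules carries the limit of the p-adic topologies. *)
Section PadicLimit.
Variables (p : nat) (p_pr : prime p) (I : choiceType) (le : rel I).
Variables (M : I -> lmodType (Zp p_pr)).
Variable t : forall i j, le i j -> {linear M i -> M j}.
Local Notation L := (mod_lim t).

Definition lim_ball (s : seq I) (n : nat) (x : L) : set L :=
  [set y | forall i, i \in s -> exists z : M i, y i - x i = p%:R ^+ n *: z].

Definition lim_open : set_system L :=
  [set U | forall x, U x -> exists s n, lim_ball s n x `<=` U].

Lemma lim_openT : lim_open setT.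
Proof. by move=> x _; exists [::], 0%N. Qed.

Lemma lim_openI : setI_closed lim_open.
Proof.
move=> U V oU oV x [/oU[s [n sU]] /oV[s' [n' sV]]].
exists (s ++ s'), (n + n')%N => y sy; split.
  apply: sU => i si; have [|z ->] := sy i; first by rewrite mem_cat si.
  by exists (p%:R ^+ n' *: z); rewrite scalerA -exprD.
apply: sV => i si; have [|z ->] := sy i; first by rewrite mem_cat si orbT.
by exists (p%:R ^+ n *: z); rewrite scalerA -exprD addnC.
Qed.

Lemma lim_open_bigcup (J : Type) (f : J -> set L) :
  (forall j, lim_open (f j)) -> lim_open (\bigcup_j f j).
Proof.
move=> fo x [j _ /(fo j)[s [n sf]]]; exists s, n => y /sf fy.
by exists j.
Qed.

HB.instance Definition _ :=
  isOpenTopological.Build L lim_openT lim_openI lim_open_bigcup.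

End PadicLimit.

(* A representable functor from commutative k-algebras to groups; coord is the
   coordinate ring and {lrmorphism coord -> R} the set of R-points. *)
Record affGrpSch (k : fieldType) := AffGrpSch {
  coord : comAlgType k;
  smul : forall R : comAlgType k,
    {lrmorphism coord -> R} -> {lrmorphism coord -> R} -> {lrmorphism coord -> R};
  sone : forall R : comAlgType k, {lrmorphism coord -> R};
  sinv : forall R : comAlgType k, {lrmorphism coord -> R} -> {lrmorphism coord -> R};
  smulA : forall R, associative (@smul R);
  smul1x : forall R, left_id (sone R) (@smul R);
  smulVx : forall R, left_inverse (sone R) (@sinv R) (@smul R);
  smul_comp : forall (R S : comAlgType k) (h : {lrmorphism R -> S})
    (x y : {lrmorphism coord -> R}),
    h \o smul x y = smul (h \o x) (h \o y) :> {lrmorphism coord -> S}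
}.

Section AffineGroups.
Variable k : fieldType.
Implicit Types U V : affGrpSch k.

Definition points U (R : comAlgType k) := {lrmorphism coord U -> R}.

(* The homomorphism U -> V with comorphism f. *)
Definition is_hom U V (f : {lrmorphism coord V -> coord U}) :=
  forall (R : comAlgType k) (x y : points U R),
    smul x y \o f = smul (x \o f) (y \o f) :> points V R.

Definition subalgebra (A : comAlgType k) (P : set A) :=
  [/\ P 1, forall (c : k) x y, P x -> P y -> P (c *: x + y) &
      forall x y, P x -> P y -> P (x * y)].

Definition alg_generated (A : comAlgType k) (S : set A) : set A :=
  smallest (@subalgebra A) S.

Definition algebraic U := exists s : seq (coord U), alg_generated [set` s] = setT.

(* By Yoneda, a homomorphism from U to the group of upper unitriangular
   matrices of size m is a matrix rho over coord U; its comorphism sends the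
   coordinate functions X_ij, i < j, to the entries of rho, so that it is a
   closed embedding when these entries generate coord U. *)
Definition unitriangular_embedding U m (rho : 'M[coord U]_m) :=
  [/\ forall i j : 'I_m, (j <= i)%N -> rho i j = (i == j)%:R,
      forall (R : comAlgType k) (x y : points U R),
        map_mx (smul x y) rho = map_mx x rho *m map_mx y rho &
      alg_generated [set a | exists i j, a = rho i j] = setT].

Definition unipotent U := exists m (rho : 'M[coord U]_m), unitriangular_embedding rho.

(* Quotients of an affine group scheme correspond to injective comorphisms. *)
Definition quotient_map U V (q : {lrmorphism coord V -> coord U}) :=
  is_hom q /\ injective q.

Definition pro_unipotent U :=
  forall V (q : {lrmorphism coord V -> coord U}),
    quotient_map q -> algebraic V -> unipotent V.

(* Group functor whose points over R are the elements fpts R of the ambient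
   type fobj R; that fmul makes them a group is part of representability. *)
Record grpFunctor := GrpFunctor {
  fobj : comAlgType k -> Type;
  fpts : forall R, set (fobj R);
  fmap : forall R S : comAlgType k, {lrmorphism R -> S} -> fobj R -> fobj S;
  fmul : forall R, fobj R -> fobj R -> fobj R
}.

Definition represents U (F : grpFunctor) (Phi : forall R, points U R -> fobj F R) :=
  [/\ forall R, injective (Phi R),
      forall R, range (Phi R) = @fpts F R,
      forall R (x y : points U R), Phi R (smul x y) = fmul (Phi R x) (Phi R y) &
      forall (R S : comAlgType k) (h : {lrmorphism R -> S}) (x : points U R),
        Phi S (h \o x) = fmap h (Phi R x)].

End AffineGroups.

Section Malcev.
Variables (p : nat) (p_pr : prime p).
Local Notation K := (Qp p_pr).
Implicit Types U V : affGrpSch K.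

Definition rat_points U := points U K^o.

(* The tangent space at the unit element, as point derivations. *)
Definition Lie U : set (coord U -> K) :=
  [set d | (forall (c : K) a b, d (c *: a + b) = c * d a + d b) /\
           (forall a b, d (a * b) = sone U K^o a * d b + d a * sone U K^o b)].

Definition lin_comb (T : Type) r (b : 'I_r -> T -> K) (c : 'rV[K]_r) : T -> K :=
  fun a => \sum_i c 0 i * b i a.

Definition Lie_basis U r (b : 'I_r -> coord U -> K) :=
  (forall i, Lie (b i)) /\
  (forall d, Lie d -> exists! c : 'rV[K]_r, d = lin_comb b c).

Definition mx_exp m (X : 'M[K]_m) : 'M[K]_m :=
  \sum_(j < m) (j`!%:R : K)^-1 *: X ^+ j.

Definition is_exp U m (rho : 'M[coord U]_m) (d : coord U -> K) (x : rat_points U) :=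
  map_mx x rho = mx_exp (map_mx d rho).

(* W is open in U(Q_p), U unipotent, when its inverse image under
   Q_p ^ r = Lie U -> U(Q_p) is open. *)
Definition unipotent_open U (W : set (rat_points U)) :=
  exists m (rho : 'M[coord U]_m) r (b : 'I_r -> coord U -> K),
    [/\ unitriangular_embedding rho, Lie_basis b &
        open [set c : 'rV[K]_r | exists2 x, W x & is_exp rho (lin_comb b c) x]].

(* U(Q_p), U pro-unipotent, has the inverse limit topology: a map to it is
   continuous when its composites with U(Q_p) -> V(Q_p) are, for all algebraic
   quotients V of U. *)
Definition continuous_points (T : topologicalType) U (f : T -> rat_points U) :=
  forall V (q : {lrmorphism coord V -> coord U}),
    quotient_map q -> algebraic V ->
    forall W : set (rat_points V), unipotent_open W ->
      open [set t | W (f t \o q : rat_points V)].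

Variable G : topGroupType.

Definition continuous_hom U (f : G -> rat_points U) :=
  (forall g h, f (g * h)%g = smul (f g) (f h)) /\ continuous_points f.

Definition malcev_completion U (eta : G -> rat_points U) :=
  [/\ pro_unipotent U, continuous_hom eta &
      forall V (f : G -> rat_points V), pro_unipotent V -> continuous_hom f ->
        exists! phi : {lrmorphism coord V -> coord U},
          is_hom phi /\ forall g, eta g \o phi = f g :> rat_points V].

Definition canonically_isomorphic U (eta : G -> rat_points U)
    V (eta' : G -> rat_points V) :=
  exists phi : {lrmorphism coord V -> coord U},
    [/\ is_hom phi, bijective phi & forall g, eta g \o phi = eta' g :> rat_points V].

End Malcev.

Section Tannaka.
Variables (p : nat) (p_pr : prime p) (G : topGroupType).
Local Notation K := (Qp p_pr).

(* Representations on the spaces of column vectors Q_p ^ n, a skeleton of the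
   category of all finite-dimensional representations. *)
Definition unipotent_rep n (rho : G -> 'M[K]_n) :=
  [/\ rho 1%g = 1%:M, forall g h, rho (g * h)%g = rho g *m rho h,
      continuous rho &
      exists l (E : nat -> {vspace 'cV[K]_n}),
        [/\ E 0%N = 0%VS, E l = fullv, forall i, (E i <= E i.+1)%VS &
            forall i g v, v \in E i.+1 -> rho g *m v - v \in E i]].

Record urep := URep {
  udim : nat; uact : G -> 'M[K]_udim; _ : unipotent_rep uact }.

Definition intertwines X Y (f : 'M[K]_(udim Y, udim X)) :=
  forall g, f *m uact X g = uact Y g *m f.

(* omega (X (x) Y) is identified with omega X (x) omega Y through the Kronecker
   product. *)
Definition tensor_automorphism (R : comAlgType K)
    (lambda : forall X : urep, 'M[R]_(udim X)) :=
  [/\ forall X, exists B, lambda X *m B = 1%:M /\ B *m lambda X = 1%:M,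
      forall X Y f, intertwines f ->
        map_mx (in_alg R) f *m lambda X = lambda Y *m map_mx (in_alg R) f,
      forall X Y (XY : unipotent_rep (fun g => mxtens.tensmx (uact X g) (uact Y g))),
        lambda (URep XY) = mxtens.tensmx (lambda X) (lambda Y) &
      forall triv : unipotent_rep (fun _ : G => 1%:M : 'M[K]_1),
        lambda (URep triv) = 1%:M].

Definition Aut_tensor : grpFunctor K := {|
  fobj R := forall X : urep, 'M[R]_(udim X);
  fpts R := [set lambda | tensor_automorphism lambda];
  fmap R S h lambda X := map_mx h (lambda X);
  fmul R lambda mu X := lambda X *m mu X |}.

Definition tannakian_group (U : affGrpSch K) (eta : G -> rat_points U) :=
  exists2 Phi, represents (F := Aut_tensor) Phi &
    forall g X, Phi K^o (eta g) X = uact X g.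

End Tannaka.

Section Iwasawa.
Variables (p : nat) (p_pr : prime p) (G : topGroupType).
Local Notation Zp := (Zp p_pr).
Local Notation K := (Qp p_pr).

Record open_normal_subgroup := OpenNormal {
  on_set :> set G; _ : `[< open_normal on_set >] }.

HB.instance Definition _ := [isSub for on_set].
HB.instance Definition _ := [Choice of open_normal_subgroup by <:].
Implicit Types H : open_normal_subgroup.

Definition on_sub : rel open_normal_subgroup := fun H H' => `[< H `<=` H' >].

Definition quot_map H H' (c : quot_group H) : quot_group H' := to_quot H' (repr c).

Lemma quot_mapE H H' (HH' : on_sub H H') x : quot_map H' (to_quot H x) = to_quot H' x.
Proof.
apply/to_quotP; move/asboolP: HH' => HH'.
suff sub : normal_closure H `<=` normal_closure H' by apply: sub; exact: repr_to_quot.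
apply: smallest_sub; first exact: normal_closureP.
by move=> y /HH' H'y L [_]; apply.
Qed.

Lemma quot_mapM H H' (HH' : on_sub H H') :
  {morph @quot_map H H' : c d / (c * d)%g >-> (c * d)%g}.
Proof.
elim/quot_ind=> x; elim/quot_ind=> y.
by rewrite -to_quotM !quot_mapE// to_quotM.
Qed.

Definition group_alg H : lmodType Zp := {malg Zp[quot_group H]}.

Definition push H H' (_ : on_sub H H') : {linear group_alg H -> group_alg H'} :=
  free_lift (fun c : quot_group H => << quot_map H' c >> : group_alg H').

Lemma free_lift_push H H' (HH' : on_sub H H') (W : lmodType Zp)
    (f : quot_group H' -> W) (x : group_alg H) :
  free_lift f (push HH' x) = free_lift (f \o @quot_map H H') x.
Proof.
rewrite /push /= (linear_free_lift _ (free_lift f)).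
by apply: eq_free_lift => c /=; rewrite free_liftU.
Qed.

Definition iwasawa_alg : Type := mod_lim push.
HB.instance Definition _ := GRing.Lmodule.on iwasawa_alg.
HB.instance Definition _ := Topological.on iwasawa_alg.

Definition alg_mul H (x y : group_alg H) : group_alg H :=
  free_lift (fun c => free_lift (fun d => << (c * d)%g >> : group_alg H) y) x.

Lemma push_mul H H' (HH' : on_sub H H') (x y : group_alg H) :
  push HH' (alg_mul x y) = alg_mul (push HH' x) (push HH' y).
Proof.
rewrite /alg_mul free_lift_push (linear_free_lift _ (push HH')).
congr (free_lift _ x); apply/funext => c.
rewrite /comp free_lift_push [LHS](linear_free_lift _ (push HH')).
congr (free_lift _ y); apply/funext => d.
by rewrite /comp [LHS]free_liftU quot_mapM.
Qed.

Lemma iwasawa_mul_subproof (x y : iwasawa_alg) :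
  `[< coherent_family push (fun H => alg_mul (x H) (y H)) >].
Proof. by apply/asboolP => H H' HH'; rewrite push_mul !mod_limP. Qed.

Definition iwasawa_mul (x y : iwasawa_alg) : iwasawa_alg :=
  ModLim (iwasawa_mul_subproof x y).

Lemma grp_elt_subproof (g : G) :
  `[< coherent_family push (fun H => << to_quot H g >> : group_alg H) >].
Proof. by apply/asboolP => H H' HH'; rewrite /push/= free_liftU quot_mapE. Qed.

Definition grp_elt (g : G) : iwasawa_alg := ModLim (grp_elt_subproof g).

Lemma whole_subproof : `[< @open_normal G setT >].
Proof. by apply/asboolP; split; [exact: openT|]. Qed.

Definition augmentation (x : iwasawa_alg) : Zp :=
  free_lift (fun _ => 1 : Zp^o) (x (OpenNormal whole_subproof)).

Fixpoint aug_power (n : nat) : set iwasawa_alg :=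
  if n is n'.+1 then
    span [set z | exists x y,
      [/\ augmentation x = 0, aug_power n' y & z = iwasawa_mul x y]]
  else setT.

Lemma aug_power_sub m n : (m <= n)%N -> aug_power n `<=` aug_power m.
Proof.
have step k : aug_power k.+1 `<=` aug_power k.
  elim: k => [//|k IH]; apply: smallest_sub; first exact: spanP.
  by move=> _ [x [y [x0 /IH ky ->]]]; apply: span_sub; exists x, y.
move=> /subnK <-; elim: (n - m)%N => [//|d IH].
by rewrite addSn; exact: subset_trans (step _) IH.
Qed.

Definition iwasawa_quot n := quot_mod (closure (aug_power n)).

Definition iwasawa_quot_map m n (_ : (n <= m)%N) : iwasawa_quot m -> iwasawa_quot n :=
  qmod_lift (to_qmod (closure (aug_power n))).

Lemma iwasawa_quot_map_kills m n (nm : (n <= m)%N) x :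
  closure (aug_power m) x -> to_qmod (closure (aug_power n)) x = 0.
Proof.
move=> /(closure_subset (aug_power_sub nm)) nx.
rewrite -(linear0 (to_qmod (closure (aug_power n)))).
by apply: (to_qmodP _ _ _).2; rewrite subr0; exact: span_sub.
Qed.

HB.instance Definition _ m n (nm : (n <= m)%N) :=
  GRing.isLinear.Build Zp (iwasawa_quot m) (iwasawa_quot n) _ (iwasawa_quot_map nm)
    (qmod_lift_is_linear (iwasawa_quot_map_kills nm)).

(* Q_p (x) (Z_p[[G]] / closure (I ^ n)). *)
Definition level n : lmodType K := ext_scalars (@Zp_Qp p p_pr) (iwasawa_quot n).

Definition level_map m n (nm : (n <= m)%N) : {linear level m -> level n} :=
  ext_map (@Zp_Qp p p_pr) (iwasawa_quot_map nm).

Definition completed_alg : Type := mod_lim level_map.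
HB.instance Definition _ := GRing.Lmodule.on completed_alg.

Definition to_level n (x : iwasawa_alg) : level n :=
  to_ext (@Zp_Qp p p_pr) (to_qmod (closure (aug_power n)) x).

Lemma to_completed_subproof x : `[< coherent_family level_map (fun n => to_level n x) >].
Proof.
apply/asboolP => m n nm; rewrite /level_map/= /to_level ext_mapE.
congr (to_ext _ _); exact: (qmod_liftE (iwasawa_quot_map_kills nm)).
Qed.

Definition to_completed (x : iwasawa_alg) : completed_alg :=
  ModLim (to_completed_subproof x).

Definition level_mul n (u v : level n) : level n :=
  let mul (a b : iwasawa_quot n) : level n :=
    to_ext (@Zp_Qp p p_pr) (to_qmod _ (iwasawa_mul (repr a) (repr b))) in
  ext_lift (fun a => ext_lift (mul a) v) u.

Definition completed_mul (u v w : completed_alg) :=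
  forall n, w n = level_mul (u n) (v n).

Definition iwasawa_sq : Type :=
  mod_lim (fun H H' (HH' : on_sub H H') =>
    tensor_map (push HH') (push HH') :
      {linear tensor (group_alg H) (group_alg H) ->
              tensor (group_alg H') (group_alg H')}).
HB.instance Definition _ := GRing.Lmodule.on iwasawa_sq.
HB.instance Definition _ := Topological.on iwasawa_sq.

Definition alg_coprod H : group_alg H -> tensor (group_alg H) (group_alg H) :=
  free_lift (fun c : quot_group H => let e : group_alg H := << c >> in tens e e).

Lemma iwasawa_coprod_subproof (x : iwasawa_alg) :
  `[< coherent_family (fun H H' (HH' : on_sub H H') =>
    tensor_map (push HH') (push HH') :
      {linear tensor (group_alg H) (group_alg H) ->
              tensor (group_alg H') (group_alg H')})
    (fun H => alg_coprod (x H)) >].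
Proof.
apply/asboolP => H H' HH' /=; rewrite -(mod_limP x HH') /alg_coprod free_lift_push.
apply: etrans (linear_free_lift _ (tensor_map (push HH') (push HH')) _) _.
apply: (congr1 (fun f => free_lift f (x H))); apply/funext => c.
apply: etrans (tensor_mapE _ _ _ _) _.
by rewrite [push HH' _]free_liftU.
Qed.

Definition iwasawa_coprod (x : iwasawa_alg) : iwasawa_sq :=
  ModLim (iwasawa_coprod_subproof x).

Lemma iwasawa_tens_subproof (x y : iwasawa_alg) :
  `[< coherent_family (fun H H' (HH' : on_sub H H') =>
    tensor_map (push HH') (push HH') :
      {linear tensor (group_alg H) (group_alg H) ->
              tensor (group_alg H') (group_alg H')})
    (fun H => tens (x H) (y H)) >].
Proof.
by apply/asboolP => H H' HH'; rewrite [LHS]tensor_mapE !mod_limP.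
Qed.

Definition iwasawa_tens (x y : iwasawa_alg) : iwasawa_sq :=
  ModLim (iwasawa_tens_subproof x y).

(* D : V_m -> V_i (x) V_j, where V_n = level n, is induced by the coproduct of
   Z_p[[G]]: here T is the continuous extension to lim_H Z_p[G/H] (x) Z_p[G/H]
   of the map x (x) y |-> x_i (x) y_j; the finite-dimensional space V_i (x) V_j
   has the coarsest topology making its linear functionals continuous. *)
Definition induced_coprod i j m (D : {linear level m -> tensor (level i) (level j)}) :=
  exists T : iwasawa_sq -> tensor (level i) (level j),
    [/\ forall (a : Zp) x y, T (a *: x + y) = Zp_Qp a *: T x + T y,
        forall phi : {linear tensor (level i) (level j) -> K^o},
          continuous (fun x => phi (T x) : K),
        forall x y, T (iwasawa_tens x y) = tens (to_level i x) (to_level j y) &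
        forall x, D (to_level m x) = T (iwasawa_coprod x)].

(* The decompleted dual: its elements are the functionals which factor through
   a linear functional of some V_n. *)
Definition dual : set (completed_alg -> K) :=
  [set f | exists n (fn : {linear level n -> K^o}),
     forall v : completed_alg, f v = fn (v n)].

Definition dual_mul (f h q : completed_alg -> K) :=
  exists i j m (fi : {linear level i -> K^o}) (hj : {linear level j -> K^o})
      (D : {linear level m -> tensor (level i) (level j)}),
    [/\ forall v : completed_alg, f v = fi (v i),
        forall v : completed_alg, h v = hj (v j), induced_coprod D &
        forall v : completed_alg, q v = tensor_lift (fun a b => fi a * hj b : K^o) (D (v m))].

(* The unit of the dual is the counit of the completed algebra. *)
Definition dual_one (e : completed_alg -> K) :=
  dual e /\ forall x, e (to_completed x) = Zp_Qp (augmentation x).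

(* theta identifies the group scheme U with Spec of the Hopf algebra dual. *)
Definition spec_dual (U : affGrpSch K) (theta : coord U -> completed_alg -> K) :=
  [/\ forall (c : K) a b v, theta (c *: a + b) v = c * theta a v + theta b v,
      injective theta, range theta = dual &
  [/\ forall a b, dual_mul (theta a) (theta b) (theta (a * b)),
      dual_one (theta 1) &
      forall a, exists s : seq (coord U * coord U),
        (forall u v w, completed_mul u v w ->
           theta a w = \sum_(b <- s) theta b.1 u * theta b.2 v) /\
        (forall (R : comAlgType K) (x y : points U R),
           smul x y a = \sum_(b <- s) x b.1 * y b.2)]].

(* Coalgebra morphisms Q_p -> V are determined by the image v of 1. *)
Definition grouplike : set completed_alg :=
  [set v : completed_alg | (forall i j, exists m (D : {linear level m -> tensor (level i) (level j)}),
              induced_coprod D /\ D (v m) = tens (v i) (v j)) /\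
           (exists2 e, dual_one e & e v = 1)].

Definition hopf_group (U : affGrpSch K) (eta : G -> rat_points U) :=
  exists2 theta, spec_dual theta &
    forall g a, eta g a = theta a (to_completed (grp_elt g)).

Definition grouplike_isomorphic (U : affGrpSch K) (eta : G -> rat_points U) :=
  exists psi : rat_points U -> completed_alg,
    [/\ injective psi, range psi = grouplike,
        forall x y, completed_mul (psi x) (psi y) (psi (smul x y)) &
        forall g, psi (eta g) = to_completed (grp_elt g)].

End Iwasawa.

Section Analytic.
Variables (p : nat) (p_pr : prime p).
Local Notation Zp := (Zp p_pr).
Local Notation K := (Qp p_pr).

Section MalcevBasis.
Local Open Scope group_scope.
Variable N : topGroupType.

Fixpoint upper_central n : set N :=
  if n is n'.+1 then [set x | forall y, upper_central n' [~ x, y]] else [set 1].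

(* x ^ l is the limit of the powers of x by the residues of l modulo p ^ n. *)
Definition padic_power (x : N) (l : Zp) : N :=
  xget 1 [set y | (fun n => x ^+ `|l n|%N) @ \oo --> y].

Definition padic_word (v : seq N) (l : 'I_(size v) -> Zp) : N :=
  \prod_(i < size v) padic_power v`_i (l i).

(* The i-th block consists of elements of Z_(i+1) which form a basis of
   Z_(i+1) / Z_i; the Mal'cev basis is the concatenation of the blocks. *)
Definition malcev_basis (b : seq (seq N)) :=
  upper_central (size b) = setT /\
  forall i, (i < size b)%N -> let v := nth [::] b i in
    (forall x, x \in v -> upper_central i.+1 x) /\
    (forall x, upper_central i.+1 x ->
       exists! l : 'I_(size v) -> Zp, upper_central i ((padic_word l)^-1 * x)).

Definition word_of b : ('I_(size (flatten b)) -> Zp) -> N :=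
  @padic_word (flatten b).

End MalcevBasis.

Definition join_args (T : Type) m n (x : 'I_m -> T) (y : 'I_n -> T) (i : 'I_(m + n)) : T :=
  match fintype.split i with inl j => x j | inr j => y j end.

Definition poly_eval (R : comAlgType K) n (x : 'I_n -> R) (q : mpoly.mpoly n K) : R :=
  mpoly.mmap (in_alg R) x q.

Definition padic_point n (l : 'I_n -> Zp) : 'I_n -> K^o := fun i => Zp_Qp (l i).

Definition group_law (N : topGroupType) (b : seq (seq N))
    (F : 'I_(size (flatten b)) ->
         mpoly.mpoly (size (flatten b) + size (flatten b)) K) :=
  forall l l' l'', (word_of l * word_of l')%g = word_of l'' ->
    forall i, poly_eval (join_args (padic_point l) (padic_point l')) (F i) =
              padic_point l'' i.

Variable G : topGroupType.

(* Indices are shifted: lower_central 0 is the first term Gamma^1 G = G. *)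
Fixpoint lower_central n : set G :=
  if n is n'.+1 then
    generated_subgroup [set z | exists x y, lower_central n' y /\ z = [~ x, y]%g]
  else setT.

Definition lc_quot n : topGroupType := quot_group (lower_central n).

Definition torsion (N : groupType) : set N :=
  [set x | exists2 m, (0 < m)%N & (x ^+ m = 1)%g].

Definition lc_tf_quot n : topGroupType := quot_group (@torsion (lc_quot n)).

Definition to_tf_quot n (g : G) : lc_tf_quot n :=
  to_quot (@torsion (lc_quot n)) (to_quot (lower_central n) g).

Section Tower.
Variable b : forall n, seq (seq (lc_tf_quot n)).
Local Notation r n := (size (flatten (b n))).
Variables (F : forall n, 'I_(r n) -> mpoly.mpoly (r n + r n) K)
          (tau : forall n, 'I_(r n) -> mpoly.mpoly (r n.+1) K).

(* tau gives the projections G_(n+1) / Tor -> G_n / Tor in coordinates. *)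
Definition tower_map :=
  forall n g l l', word_of l = to_tf_quot n.+1 g -> word_of l' = to_tf_quot n g ->
    forall i, poly_eval (padic_point l) (@tau n i) = padic_point l' i.

Definition tower_limit : grpFunctor K := {|
  fobj R := forall n, 'I_(r n) -> R;
  fpts R := [set x | forall n i, poly_eval (x n.+1) (@tau n i) = x n i];
  fmap R S h x := fun n i => h (x n i);
  fmul R x y := fun n i => poly_eval (join_args (x n) (y n)) (@F n i) |}.

Definition analytic_group (U : affGrpSch K) (eta : G -> rat_points U) :=
  exists2 Phi, represents (F := tower_limit) Phi &
    forall g n, exists2 l, word_of l = to_tf_quot n g &
      Phi K^o (eta g) n = padic_point l.

End Tower.
End Analytic.

(* Main.v *)
(* All three constructions are Spec of one Hopf algebra A: the continuous functions
   f : G -> Q_p which are polynomial, i.e. killed by n iterated differences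
   f (x y) - f x for some n.

   Universal property: if rho embeds a unipotent V in unitriangular matrices, then
   a continuous homomorphism phi : G -> V(Q_p) pulls coord V back to A, because
   the entries of rho o phi are polynomial; the topology of V is controlled by exp
   and log, defined through locally nilpotent derivations.

   Tannaka: the functions of degree < n are a finite-dimensional unipotent
   representation of G under translation, and the matrix coefficients of all
   continuous unipotent representations are exactly A.

   Hopf: f of degree < n is integrated against Z_p[[G]] and kills the closure of
   I^n, which identifies functions of degree < n with the dual of
   Q_p (x) Z_p[[G]] / closure (I^n); the limits exist by compactness (ultrafilters).

   Analytic: a function of degree < n is invariant under Gamma^n and under its
   isolator, so it descends to N_n = G_n / Tor.  There Mal'cev coordinates are
   polynomial functions (induction along the central series), and conversely by
   Newton's formula f (v^l x) = sum_j binom(l, j) (Delta_v^j f)(x), extended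
   from natural l to l in Z_p by continuity, every polynomial function on N_n is a
   polynomial in the coordinates. *)
From HB Require Import structures.
From mathcomp Require Import all_boot all_order all_algebra.
From mathcomp Require all_fingroup all_solvable.
From mathcomp Require Import finmap.
From mathcomp Require Import all_classical topology.
From mathcomp Require Import monalg.
From mathcomp Require mpoly mxtens.
From mathcomp Require Import zify ring.
Require Import Defs.

Set Implicit Arguments.
Unset Strict Implicit.
Unset Printing Implicit Defensive.

Import Order.TTheory GRing.Theory Num.Theory.
Local Open Scope classical_set_scope.
Local Open Scope ring_scope.

(** * p-adic topology *)

(** Two obstacles shape the proof. An [affGrpSch] is only a group-valued functor represented by
    [coord], so its coproduct has to be recovered by Yoneda, from the two universal points with
    values in a tensor square; local finiteness and the supply of algebraic quotients, on which
    pro-unipotence and the topology of points are tested, rest on it. And Hopf identities live in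
    tensor products, which are quotients of huge free modules. They are controlled by realizing
    every algebra as functions, on G or on its own functionals: a finite-dimensional space of
    functions has a basis dual to evaluation at finitely many points, which reduces identities of
    tensors to identities of functions of several variables. For polynomial functions the finite
    dimension comes from topological finite generation: a function of degree < n vanishes once it
    vanishes on the words of length < n in the generators. That G is pro-p enters through its finite
    quotients, nilpotent of p-power exponent: this gives powers with exponents in Z_p and makes the
    terms of the lower central series closed. *)

Section PadicFacts.
Variables (p : nat) (p_pr : prime p).
Local Notation Zp := (Zp p_pr).
Local Notation K := (Qp p_pr).

Lemma zp_natE n k : (n%:R : Zp) k = (n%:Z %% (p ^ k)%N)%Z.
Proof.
elim: n => [|n IH]; first by [].
by rewrite -addn1 natrD /= IH modzDml modzDmr -PoszD.
Qed.

Lemma zp_addE (a b : Zp) k : (a + b) k = ((a k + b k) %% (p ^ k)%N)%Z.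
Proof. by []. Qed.
Lemma zp_mulE (a b : Zp) k : (a * b) k = ((a k * b k) %% (p ^ k)%N)%Z.
Proof. by []. Qed.
Lemma zp_oppE (a : Zp) k : (- a) k = ((- a k) %% (p ^ k)%N)%Z.
Proof. by []. Qed.

Lemma expp_neq0 k : (p ^ k)%N%:Z != 0.
Proof. by rewrite -lt0n expn_gt0 prime_gt0. Qed.

Lemma zp_ge0 (a : Zp) k : 0 <= a k.
Proof. by rewrite -zp_mod modz_ge0// expp_neq0. Qed.

Lemma zp_lt (a : Zp) k : a k < (p ^ k)%N.
Proof. by rewrite -zp_mod -[X in _ < X]ger0_norm// ltz_mod// expp_neq0. Qed.

Lemma zp_natr (a : Zp) k : (`|a k|%N%:R : Zp) k = a k.
Proof. by rewrite zp_natE abszE ger0_norm ?zp_ge0// zp_mod. Qed.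

Lemma zp_pE k : ((p%:R : Zp) ^+ k) k = 0.
Proof. by rewrite -natrX zp_natE modzz. Qed.

Lemma zp_dvdP (a : Zp) k : a k = 0 <-> exists b, a = p%:R ^+ k * b.
Proof.
split=> [ak|[b ->]]; last by rewrite zp_mulE zp_pE mul0r mod0z.
have dv n : ((p ^ k)%N %| a (n + k)%N)%Z.
  by apply/dvdz_mod0P; rewrite addnC zp_val_mod zp_mod.
(* Division by p ^ k costs k digits, so the quotient modulo p ^ n is read off the residue of a
   modulo p ^ (n + k). *)
have coh : coherent p (fun n => (a (n + k)%N %/ (p ^ k)%N)%Z).
  move=> n; apply/eqP; rewrite eqz_mod_dvd.
  have : ((p ^ (n + k))%N %| a (n.+1 + k)%N - a (n + k)%N)%Z.
    by rewrite -eqz_mod_dvd addSn; apply/eqP/zp_coherent.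
  case/dvdzP: (dv n) => r ->; case/dvdzP: (dv n.+1) => r' ->.
  rewrite !mulzK ?expp_neq0// -mulrBl expnD PoszM.
  by rewrite dvdz_mul2r// expp_neq0.
exists (Zp_of p_pr coh); apply: zpP => n; rewrite zp_mulE -natrX zp_natE /=.
rewrite modzMml modzMmr.
rewrite mulrC divzK// zp_val_mod zp_mod //.
Qed.

Lemma zp_eqP (a b : Zp) k : a k = b k <-> exists c, a - b = p%:R ^+ k * c.
Proof.
rewrite -zp_dvdP; split=> [ab|].
  by rewrite zp_addE zp_oppE ab modzDmr subrr mod0z.
rewrite zp_addE zp_oppE modzDmr => /dvdz_mod0P; rewrite -eqz_mod_dvd => /eqP.
by rewrite !zp_mod.
Qed.

Lemma zp_unit1 (a : Zp) : a 1%N != 0 -> exists b, b * a = 1.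
Proof.
move=> a1; have cop n : coprimez (a n) (p ^ n)%N.
  case: n => [|n]; first by rewrite /coprimez gcdzC gcd1z.
  rewrite coprimezE /= coprime_sym coprime_pexpl// prime_coprime//.
  apply: contraNN a1 => pa; have := zp_val_mod a 1 n; rewrite add1n !zp_mod expn1 => <-.
  by apply/eqP/dvdz_mod0P; rewrite dvdzE.
have inv n : exists w : int, ((w * a n)%R = 1 %[mod (p ^ n)%N])%Z.
  have /coprimezP[[u v] /= uv] := cop n; exists u.
  by rewrite -[in RHS]uv addrC modzMDl.
(* Bezout inverses modulo each p ^ n are chosen independently; they are coherent because an inverse
   modulo p ^ n is unique. *)
have /choice[w wP] := inv.
have coh : coherent p w.
  move=> n; have wa : ((w n.+1 * a n)%R = 1 %[mod (p ^ n)%N])%Z.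
    rewrite -modzMmr -(zp_mod a n) zpvalP modz_mod modzMmr.
    have /eqP := wP n.+1; rewrite eqz_mod_dvd => dv; rewrite modzMmr; apply/eqP.
    by rewrite eqz_mod_dvd; apply: dvdz_trans dv; rewrite expnS PoszM dvdz_mull.
  apply/eqP; rewrite eqz_mod_dvd -(@Gauss_dvdzl _ _ (a n)).
    by rewrite mulrBl -eqz_mod_dvd wa wP.
  by rewrite coprimez_sym.
exists (Zp_of p_pr coh); apply: zpP => n; rewrite zp_mulE /= modzMml.
exact: wP.
Qed.

Lemma zp_factor (a : Zp) : a != 0 ->
  exists k u u', [/\ a = p%:R ^+ k * u, u' * u = 1 & u 1%N != 0].
Proof.
move=> a0; have ex : exists n, a n != 0.
  have [n an] := zp_neq0 a0; exists n; apply: contraNneq (an 0%N) => an0.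
  by rewrite addn0 an0 dvdz0.
(* The valuation is one less than the first index with a nonzero residue, which is positive because
   residues modulo p ^ 0 vanish. *)
case: (ex_minnP ex) => -[|n] an min; first by have := zp_lt a 0; have := zp_ge0 a 0; lia.
have /zp_dvdP[u au] : a n = 0.
  by apply/eqP; apply: contraTT (ltnSn n) => /min; rewrite -leqNgt.
have u1 : u 1%N != 0.
  apply: contraNneq an => /zp_dvdP[v uv]; apply/eqP/zp_dvdP; exists v.
  by rewrite au uv mulrA expr1 -exprSr.
by have [u' u'u] := zp_unit1 u1; exists n, u, u'.
Qed.

Lemma Zp_Qp_inj : injective (@Zp_Qp p p_pr).
Proof. by move=> a b /eqP; rewrite tofrac_eq => /eqP. Qed.

Lemma zp_pchar : [pchar Zp] =i pred0.
Proof.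
move=> q; apply/negbTE/negP; rewrite inE => /andP[q_pr /eqP q0].
have q0' : (0 < q)%N by apply: prime_gt0.
have lt : (0 <= q%:Z < (p ^ q)%N)%R by rewrite ltz_nat ltn_expl ?prime_gt1.
have := congr1 (fun z : Zp => z q) q0; rewrite zp_natE modz_small// => qz.
by move: q0'; rewrite -ltz_nat qz /= mod0z.
Qed.

Lemma qp_natr_eq0 n : ((n%:R : K) == 0) = (n == 0)%N.
Proof.
rewrite -(rmorph_nat (@Zp_Qp p p_pr)) -(rmorph0 (@Zp_Qp p p_pr)) (inj_eq Zp_Qp_inj).
by have /pcharf0P -> := zp_pchar.
Qed.

Lemma qp_p_neq0 : (p%:R : K) != 0.
Proof. by rewrite qp_natr_eq0 -lt0n prime_gt0. Qed.

(** A basis of neighbourhoods of 0 indexed by the precision; continuity is tested on it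
    throughout. *)
Definition pid n : set K := [set x | exists z, x = p%:R ^+ n * Zp_Qp z].

Lemma pid0 n : pid n 0.
Proof. by exists 0; rewrite rmorph0 mulr0. Qed.
Lemma pidD n x y : pid n x -> pid n y -> pid n (x + y).
Proof. by move=> [z ->] [t ->]; exists (z + t); rewrite rmorphD mulrDr. Qed.
Lemma pidN n x : pid n x -> pid n (- x).
Proof. by move=> [z ->]; exists (- z); rewrite rmorphN mulrN. Qed.
Lemma pidB n x y : pid n x -> pid n y -> pid n (x - y).
Proof. by move=> nx ny; apply: pidD => //; apply: pidN. Qed.
Lemma pidM m n x y : pid m x -> pid n y -> pid (m + n) (x * y).
Proof. by move=> [z ->] [t ->]; exists (z * t); rewrite rmorphM exprD mulrACA. Qed.
Lemma pid_le m n x : (m <= n)%N -> pid n x -> pid m x.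
Proof.
move=> /subnKC <- [z ->]; exists (p%:R ^+ (n - m) * z).
by rewrite exprD rmorphM rmorphXn rmorph_nat mulrA.
Qed.

Lemma pid_Zp z : pid 0 (Zp_Qp z : K).
Proof. by exists z; rewrite expr0 mul1r. Qed.

Lemma pid_shift m n x : pid n (p%:R ^+ m * x) -> forall k, (k + m <= n)%N -> pid k x.
Proof.
move=> [z mx] k km; exists (p%:R ^+ (n - (k + m)) * z).
apply: (mulfI (expf_neq0 m qp_p_neq0)); rewrite mx rmorphM rmorphXn rmorph_nat !mulrA -!exprD.
by congr (_ ^+ _ * _); lia.
Qed.

Lemma pid_mull n z x : pid n x -> pid n (Zp_Qp z * x).
Proof. by move=> nx; rewrite -[n]add0n; apply: pidM => //; apply: pid_Zp. Qed.

Lemma zp_pid z n : pid n (Zp_Qp z : K) <-> z n = 0.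
Proof.
rewrite zp_dvdP; split=> [[t zt]|[t ->]].
  exists t; apply: Zp_Qp_inj; rewrite zt rmorphM rmorphXn rmorph_nat //.
by exists t; rewrite rmorphM rmorphXn rmorph_nat.
Qed.

Lemma pidBE z t n : pid n (Zp_Qp z - Zp_Qp t : K) <-> z n = t n.
Proof. by rewrite -rmorphB zp_pid zp_eqP zp_dvdP. Qed.

Lemma qp_bounded (x : K) : exists m z, p%:R ^+ m * x = Zp_Qp z.
Proof.
suff [a [b [b0 xE]]] : exists a b : Zp, b != 0 /\ x = Zp_Qp a / Zp_Qp b.
  have [k [u [u' [bE u'u _]]]] := zp_factor b0; exists k, (u' * a).
  have u0 : Zp_Qp u != 0 :> K.
    rewrite -(rmorph0 (@Zp_Qp p p_pr)) (inj_eq Zp_Qp_inj).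
    by apply: contraNneq b0 => u0; rewrite bE u0 mulr0.
  have uE : (Zp_Qp u)^-1 = Zp_Qp u' :> K.
    by apply: (mulIf u0); rewrite mulVf// -rmorphM u'u rmorph1.
  rewrite xE bE !rmorphM rmorphXn rmorph_nat invfM /= uE.
  rewrite mulrCA [RHS]mulrC; congr (_ * _).
  by rewrite mulrA mulfV ?expf_neq0 ?qp_p_neq0// mul1r.
elim/quotW: x => x; exists (\n_x), (\d_x); split; first exact: denom_ratioP.
apply: (mulIf (_ : Zp_Qp (\d_x) != 0 :> K)).
  by rewrite /Zp_Qp tofrac_eq0 denom_ratioP.
rewrite mulfVK; last by rewrite /Zp_Qp tofrac_eq0 denom_ratioP.
rewrite mulrC /Zp_Qp; unlock FracField.tofrac.
apply: (etrans (esym (FracField.pi_mul _ _))); apply/eqmodP; rewrite /= FracField.equivfE /FracField.mulf.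
by rewrite !numden_Ratio ?oner_neq0 ?mul1r ?mulr1// ?denom_ratioP// mulrC.
Qed.

Lemma qp_eq0 (x : K) : (forall n, pid n x) -> x = 0.
Proof.
move=> x0; have [m [z zx]] := qp_bounded x.
suff z0 : z = 0.
  by apply: (mulfI (expf_neq0 m qp_p_neq0)); rewrite zx z0 rmorph0 mulr0.
apply: zpP => n; rewrite [RHS]mod0z; apply/zp_pid; rewrite -zx.
apply: (@pid_le _ (m + n)%N); rewrite ?leq_addl//; apply: pidM (x0 n).
by exists 1; rewrite rmorph1 mulr1.
Qed.

(** Multiplication by a fixed x loses at most m digits, p ^ m being a power that clears the
    denominator of x; this is the modulus of continuity of products. *)
Lemma qp_pid_ex (x : K) : exists m, forall n, (m <= n)%N -> forall y, pid n y -> pid (n - m) (x * y).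
Proof.
have [m [z zx]] := qp_bounded x; exists m => n mn y ny.
apply: (@pid_shift m n); last by rewrite subnK.
by rewrite mulrA zx; apply: pid_mull.
Qed.

Lemma qp_nbhsP (x : K) (A : set K) :
  nbhs x A <-> exists n, forall y, pid n (y - x) -> A y.
Proof.
rewrite nbhsE; split=> [[B [oB Bx] BA]|[n nA]].
  have [n nB] := oB _ Bx; exists n => y [z yx]; apply: BA.
  by rewrite -[y](subrK x) yx addrC; apply: nB.
exists [set y | pid n (y - x)] => //; split; last by rewrite /= subrr; apply: pid0.
move=> y /= xy; exists n => z /=; rewrite addrAC.
by apply: pidD => //; exists z.
Qed.

Lemma qp_continuousP (T : topologicalType) (f : T -> K) :
  continuous f <-> forall x n, \forall y \near x, pid n (f y - f x).
Proof.
split=> [cf x n|cf x A /qp_nbhsP[n nA]].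
  by apply: (cf x [set y | pid n (y - f x)]); apply/qp_nbhsP; exists n.
by have := cf x n; apply: filterS => y /nA.
Qed.

Lemma qp_continuousD (T : topologicalType) (f g : T -> K) :
  continuous f -> continuous g -> continuous (fun x => f x + g x).
Proof.
move=> /qp_continuousP cf /qp_continuousP cg; apply/qp_continuousP => x n.
apply: filterS2 (cf x n) (cg x n) => y fy gy.
by rewrite opprD addrACA; apply: pidD.
Qed.

Lemma qp_continuousM (T : topologicalType) (f g : T -> K) :
  continuous f -> continuous g -> continuous (fun x => f x * g x).
Proof.
move=> /qp_continuousP cf /qp_continuousP cg; apply/qp_continuousP => x n.
have [m mf] := qp_pid_ex (f x); have [k kg] := qp_pid_ex (g x).
apply: filterS2 (cf x (n + k)%N) (cg x (n + m)%N) => y fy gy.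
have -> : f y * g y - f x * g x =
  (f y - f x) * (g y - g x) + f x * (g y - g x) + g x * (f y - f x) by ring.
apply: pidD; first apply: pidD.
- by apply: (@pid_le _ ((n + k) + (n + m))%N); [lia | apply: pidM].
- by rewrite -(addnK m n); apply: mf => //; rewrite leq_addl.
- by rewrite -(addnK k n); apply: kg => //; rewrite leq_addl.
Qed.

Lemma qp_continuous_sum (T : topologicalType) (I : Type) (s : seq I) (P : pred I)
    (f : I -> T -> K) :
  (forall i, P i -> continuous (f i)) -> continuous (fun x => \sum_(i <- s | P i) f i x).
Proof.
move=> cf; elim: s => [|i s IH].
  by under eq_fun do rewrite big_nil; exact: cst_continuous.
under eq_fun do rewrite big_cons; case Pi: (P i) => //.
exact: qp_continuousD (cf i Pi) IH.
Qed.

Lemma qp_closed_eq (T : topologicalType) (f g : T -> K) :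
  continuous f -> continuous g -> closed [set x | f x = g x].
Proof.
move=> /qp_continuousP cf /qp_continuousP cg x xc.
apply/eqP; rewrite -subr_eq0; apply/eqP/qp_eq0 => n.
have [y [/= fg [fy gy]]] := xc _ (filterI (cf x n) (cg x n)).
have -> : f x - g x = (g y - g x) - (f y - f x) by rewrite fg; ring.
exact: pidB.
Qed.

Lemma dense_eq (T : topologicalType) (D : set T) (f g : T -> K) :
  dense D -> continuous f -> continuous g -> (forall x, D x -> f x = g x) -> f = g.
Proof.
move=> dD cf cg fg; apply/funext => x.
have : closure D `<=` [set x | f x = g x].
  rewrite [X in _ `<=` X](_ : _ = closure [set x | f x = g x]); first exact: closure_subset.
  by apply/closure_id/qp_closed_eq.
apply=> B /nbhs_interior/= xB; have [y [yB Dy]] := dD _ (ex_intro _ x (nbhs_singleton xB)) (open_interior B).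
by exists y; split=> //; exact: interior_subset.
Qed.

(* The compactness of powers of Z_p. *)
Lemma zp_ultra (X : Type) (F : set_system X) (UF : UltraFilter F) (a : X -> Zp) :
  exists z : Zp, forall k, F [set x | a x k = z k].
Proof.
have ex k : exists c : int, F [set x | a x k = c].
  apply: contrapT => /forallNP nF.
  have fin (N : nat) : F [set x | forall i : nat, (i < N)%N -> a x k <> i].
    elim: N => [|N IH]; first by apply: filterS filterT.
    have [/nF//|nN] := in_ultra_setVsetC [set x | a x k = N] UF.
    apply: filterS (filterI IH nN) => x [/= IHx xN] i.
    by rewrite ltnS leq_eqVlt => /orP[/eqP->//|/IHx].
  have [x /=] := filter_ex (fin (p ^ k)%N); have := zp_lt (a x) k; have := zp_ge0 (a x) k.
  by case: (a x k) => // i _; rewrite ltz_nat => ik /(_ _ ik).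
have [c cF] := choice ex.
have cc : padic_seq p c.
  move=> k; have [x /= [<- <-]] := filter_ex (filterI (cF k) (cF k.+1)).
  by rewrite -zpvalP.
exists (MkZp p_pr (asboolT cc)) => k; exact: cF.
Qed.

(** If continuity fails at x, the neighbourhoods of x minus the preimage of A generate a filter; an
    ultrafilter above it converges to x but misses that preimage. Testing on ultrafilters lets
    [zp_ultra] supply limits of coordinates. *)
Lemma ultra_continuous (T U : topologicalType) (f : T -> U) (x : T) :
  (forall F : set_system T, UltraFilter F -> F --> x -> f @ F --> f x) -> {for x, continuous f}.
Proof.
move=> uf A Afx; apply: contrapT => nA.
pose B := [set C | exists2 D, nbhs x D & D `\` (f @^-1` A) `<=` C].
have PB : ProperFilter B.
  apply: Build_ProperFilter_ex.
    move=> C [D xD DC]; apply: contrapT => /forallNP C0; apply: nA.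
    by apply: filterS xD => y Dy; apply: contrapT => Ay; apply: (C0 y); apply: DC.
  split; first by exists setT => //; exact: filterT.
    move=> C C' [D xD DC] [D' xD' DC']; exists (D `&` D'); first exact: filterI.
    by move=> y [[Dy Dy'] Ay]; split; [apply: DC|apply: DC'].
  by move=> C C' CC' [D xD DC]; exists D => // y /DC /CC'.
have [F [UF BF]] := ultraFilterLemma PB.
have Fx : F --> x by move=> D xD; apply: BF; exists D => // y [].
have FA : F (f @^-1` A) := uf F UF Fx A Afx.
have /filter_ex[y []//] : F ((f @^-1` A) `&` ~` (f @^-1` A)).
by apply: filterI => //; apply: BF; exists setT; [exact: filterT|move=> y []].
Qed.

End PadicFacts.

(** * Polynomial functions on a topological group *)

Section Interpolation.
Variables (K : fieldType) (X : Type).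

Definition fsubspace (V : set (X -> K)) :=
  V (fun=> 0) /\ forall a f g, V f -> V g -> V (fun x => a * f x + g x).

Lemma fsubspace_sum V (I : Type) (s : seq I) (c : I -> K) (e : I -> X -> K) :
  fsubspace V -> (forall i, V (e i)) -> V (fun x => \sum_(i <- s) c i * e i x).
Proof.
move=> [V0 VD] Ve; elim: s => [|i s IH].
  by rewrite (_ : (fun x => _) = (fun=> 0))//; apply/funext => x; rewrite big_nil.
rewrite (_ : (fun x => _) = fun x => c i * e i x + \sum_(i <- s) c i * e i x).
  exact: VD.
by apply/funext => x; rewrite big_cons.
Qed.

Definition dual_family (V : set (X -> K)) r (x : 'I_r -> X) (e : 'I_r -> X -> K) :=
  (forall i, V (e i)) /\ (forall i j, e i (x j) = (i == j)%:R).

(** A dual family of maximal size interpolates: if f differed from its interpolant at y, the error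
    would vanish at all the points x_j and, normalized at y, would enlarge the family. *)
Lemma interpolation_max (V : set (X -> K)) R :
  fsubspace V ->
  (forall r (x : 'I_r -> X) (e : 'I_r -> X -> K), dual_family V x e -> (r <= R)%N) ->
  exists r (x : 'I_r -> X) (e : 'I_r -> X -> K),
    dual_family V x e /\ forall f, V f -> forall y, f y = \sum_i f (x i) * e i y.
Proof.
move=> sV bR; pose P r := exists (x : 'I_r -> X) (e : 'I_r -> X -> K), dual_family V x e.
have P0 : exists r, `[< P r >].
  have x0 : 'I_0 -> X by case.
  by exists 0%N; apply/asboolP; exists x0, (fun _ _ => 0); split; case.
have PR r : `[< P r >] -> (r <= R)%N by move=> /asboolP[x [e]]; exact: bR.
case: (ex_maxnP P0 PR) => r /asboolP[x [e [Ve ex]]] max.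
exists r, x, e; split=> // f Vf y; apply/eqP; rewrite -subr_eq0; apply/negPn/negP => h0.
pose h y := f y - \sum_i f (x i) * e i y.
have Vh : V h.
  have := sV.2 (-1) _ _ (fsubspace_sum (index_enum _) (fun i => f (x i)) sV Ve) Vf.
  by congr V; apply/funext => w; rewrite mulN1r addrC.
have hx j : h (x j) = 0.
  rewrite /h (bigD1 j)//= ex eqxx mulr1 big1 ?addr0 ?subrr// => i ij.
  by rewrite ex (negbTE ij) mulr0.
suff : (r.+1 <= r)%N by rewrite ltnn.
apply: max; apply/asboolP.
(* The new point is y, and each old e_j is corrected by a multiple of the error h so that it
   vanishes at y. *)
pose x' i := if unlift ord_max i is Some j then x j else y.
pose e' i := if unlift ord_max i is Some j then fun w => (- e j y / h y) * h w + e j w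
             else fun w => (h y)^-1 * h w + 0.
exists x', e'; split=> [i|i j]; rewrite /e' /x'.
  case: unliftP => [j _|_]; first exact: sV.2 (Ve j).
  by apply: sV.2 => //; exact: sV.1.
case: unliftP => [i' ->|->]; case: unliftP => [j' ->|->].
- by rewrite hx mulr0 add0r ex (inj_eq lift_inj).
- by rewrite mulfVK// addNr eq_sym (negbTE (neq_lift _ _)).
- by rewrite hx mulr0 addr0 (negbTE (neq_lift _ _)).
- by rewrite mulVf// addr0 eqxx.
Qed.

(** A row in the left kernel of M gives a vanishing combination of the e_i, and evaluation at the
    points x_j makes the row zero; so M has rank r, at most its number of columns. *)
Lemma dual_family_indep (V : set (X -> K)) r (x : 'I_r -> X) (e : 'I_r -> X -> K) R
    (M : 'M[K]_(r, R)) :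
  dual_family V x e ->
  (forall u : 'rV_r, u *m M = 0 -> forall y, \sum_i u 0 i * e i y = 0) -> (r <= R)%N.
Proof.
move=> [Ve ex] Me; rewrite leqNgt; apply/negP => Rr.
have : kermx M != 0.
  by rewrite kermx_eq0 /row_free; apply: contraTneq (rank_leq_col M) => ->; rewrite -ltnNge.
apply/negP; rewrite negbK; apply/eqP/row_matrixP => l; rewrite row0.
have u0 := Me (row l (kermx M)) (sub_kermxP (row_sub _ _)).
apply/rowP => j; have := u0 (x j); rewrite (bigD1 j)//= ex eqxx mulr1 big1 ?addr0.
  by rewrite !mxE.
by move=> i ij; rewrite ex (negbTE ij) mulr0.
Qed.

Lemma interpolation (V : set (X -> K)) R (z : 'I_R -> X) :
  fsubspace V -> (forall f, V f -> (forall k, f (z k) = 0) -> forall x, f x = 0) ->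
  exists r (x : 'I_r -> X) (e : 'I_r -> X -> K),
    dual_family V x e /\ forall f, V f -> forall y, f y = \sum_i f (x i) * e i y.
Proof.
move=> sV Vz; apply: (interpolation_max (R := R)) => // r x e dxe.
apply: (dual_family_indep (M := \matrix_(i < r, k < R) e i (z k)) dxe) => u uM.
apply: (Vz (fun y => \sum_i u 0 i * e i y)); first by apply: fsubspace_sum => //; case: dxe.
move=> k; have /matrixP/(_ 0 k) := uM; rewrite !mxE => uk; rewrite -[RHS]uk.
by apply: eq_bigr => i _; rewrite !mxE.
Qed.

End Interpolation.

Section TensorVanishing.
Variables (K : fieldType) (X Y : Type) (B : lmodType K) (q : B -> X -> K).

(** A substitute for choosing bases: finitely many elements lie in a span on which the coordinates
    are evaluations at points, which turns identities of tensors into identities of functions. *)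
Definition interpolated := forall t : seq B, exists r (x : 'I_r -> X) (e : 'I_r -> B),
  forall a, a \in t -> a = \sum_i q a (x i) *: e i.

Hypothesis qi : interpolated.
Variables (C : lmodType K) (q' : C -> Y -> K).
Hypothesis q'_lin : forall c a b y, q' (c *: a + b) y = c * q' a y + q' b y.
Hypothesis q'_inj : forall a, (forall y, q' a y = 0) -> a = 0.

Lemma interp_sum (I : Type) (s : seq I) (c : I -> K) (a : I -> C) y :
  q' (\sum_(i <- s) c i *: a i) y = \sum_(i <- s) c i * q' (a i) y.
Proof.
have q0 : q' 0 y = 0.
  by have := q'_lin (-1) 0 0 y; rewrite scaler0 addr0 mulN1r addNr.
elim: s => [|i s IH]; first by rewrite !big_nil q0.
by rewrite !big_cons q'_lin IH.
Qed.

(* Bilinear forms only depend on the function of two variables that a sum of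
   tensors defines. *)
Lemma tensor_vanishing (s : seq (B * C)) (W : lmodType K) (beta : B -> C -> W) :
  bilin beta ->
  (forall x y, \sum_(b <- s) q b.1 x * q' b.2 y = 0) ->
  \sum_(b <- s) beta b.1 b.2 = 0.
Proof.
move=> [bl br] s0; have [r [x [e eE]]] := qi [seq b.1 | b <- s].
pose lft y : {linear B -> W} := HB.pack (beta^~ y) (GRing.isLinear.Build _ _ _ _ (beta^~ y) (bl y)).
pose rgt a : {linear C -> W} := HB.pack (beta a) (GRing.isLinear.Build _ _ _ _ (beta a) (br a)).
have -> : \sum_(b <- s) beta b.1 b.2 = \sum_(b <- s) \sum_i q b.1 (x i) *: beta (e i) b.2.
  rewrite !big_seq; apply: eq_bigr => b bs; rewrite {1}(eE b.1) ?map_f//.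
  rewrite -[LHS]/(lft b.2 _) linear_sum; apply: eq_bigr => i _; exact: linearZ.
rewrite exchange_big big1//= => i _.
have -> : \sum_(b <- s) q b.1 (x i) *: beta (e i) b.2 = rgt (e i) (\sum_(b <- s) q b.1 (x i) *: b.2).
  by rewrite linear_sum; apply: eq_bigr => b _; rewrite linearZ.
rewrite (_ : \sum_(b <- s) _ = 0) ?linear0//; apply: q'_inj => y.
by rewrite interp_sum.
Qed.

End TensorVanishing.

(** * Degree of a function on a group *)

Section Degree.
Variables (G : groupType) (K : comNzRingType).
Implicit Types (f : G -> K).

(** For f extended linearly to the group ring, the iterated difference at x along y_1, ..., y_n is
    the value of f on x (y_n - 1) ... (y_1 - 1). So f has degree < n when it kills the n-th power of
    the augmentation ideal, whence the symmetry between left and right. *)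
Fixpoint deg_lt n f : Prop :=
  if n is n'.+1 then forall y, deg_lt n' (fun x => f (x * y)%g - f x)
  else forall x, f x = 0.

Lemma deg_lt_eq0 n f : (forall x, f x = 0) -> deg_lt n f.
Proof.
elim: n f => [//|n IH] f f0 y; apply: IH => x; by rewrite !f0 subrr.
Qed.

Lemma deg_ltD n f g a : deg_lt n f -> deg_lt n g -> deg_lt n (fun x => a * f x + g x).
Proof.
elim: n f g => [|n IH] f g fn gn /=; first by move=> x; rewrite fn gn mulr0 addr0.
move=> y; have := IH _ _ (fn y) (gn y); congr deg_lt; apply/funext => x; ring.
Qed.

Lemma deg_ltB n f g : deg_lt n f -> deg_lt n g -> deg_lt n (fun x => g x - f x).
Proof.
move=> fn gn; have := deg_ltD (-1) fn gn; congr deg_lt; apply/funext => x; ring.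
Qed.

Lemma deg_ltS n f : deg_lt n f -> deg_lt n.+1 f.
Proof.
elim: n f => [|n IH] f fn y; last by apply: IH; exact: fn.
by move=> x; rewrite !fn subrr.
Qed.

Lemma deg_lt_le m n f : (m <= n)%N -> deg_lt m f -> deg_lt n f.
Proof. by move=> /subnKC <-; elim: (n - m)%N => [|k IH]; rewrite ?addn0 ?addnS// => /IH/deg_ltS. Qed.

(** Induction on m + n with the product rule for differences, D(f g) = Df Dg + Df g + f Dg. *)
Lemma deg_ltM m n f g : deg_lt m f -> deg_lt n g -> deg_lt (m + n) (fun x => f x * g x).
Proof.
move: {2}(m + n)%N (leqnn (m + n)) => k; elim: k m n f g => [|k IH] m n f g.
  rewrite leqn0 addn_eq0 => /andP[/eqP-> /eqP->] /= f0 g0 x; by rewrite f0 mul0r.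
case: m => [|m]; first by move=> _ f0 _; apply: deg_lt_eq0 => x; rewrite f0 mul0r.
case: n => [|n]; first by move=> _ _ g0; apply: deg_lt_eq0 => x; rewrite g0 mulr0.
rewrite addSn ltnS => mnk fm gn y.
have h1 := deg_lt_le (leq_add (leqnn m) (leqnSn n)) (IH m n _ _ (leq_trans (leq_add (leqnn m) (leqnSn n)) mnk) (fm y) (gn y)).
have h2 := IH m n.+1 _ _ mnk (fm y) gn.
have h3 : deg_lt (m + n.+1) (fun x => f x * (g (x * y)%g - g x)).
  by rewrite addnS -addSn; apply: IH => //; rewrite addSnnS.
have := deg_ltD 1 h1 (deg_ltD 1 h2 h3); congr deg_lt; apply/funext => x; ring.
Qed.

Lemma deg_lt_cst n c : deg_lt n.+1 (fun=> c).
Proof. by move=> y; apply: deg_lt_eq0 => x; rewrite subrr. Qed.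

(** Translation by y turns the difference along z into the one along z ^ y, since x z y = x y z ^
    y. *)
Lemma deg_lt_right n f y : deg_lt n f -> deg_lt n (fun x => f (x * y)%g).
Proof.
elim: n f => [|n IH] f fn z //=.
have := IH _ (fn (z ^ y)%g); congr deg_lt; apply/funext => x.
by rewrite conjgE !mulgA mulgK.
Qed.

Lemma deg_lt_left n f y : deg_lt n f -> deg_lt n (fun x => f (y * x)%g).
Proof.
elim: n f => [|n IH] f fn z //=.
by have := IH _ (fn z); congr deg_lt; apply/funext => x; rewrite mulgA.
Qed.

(** Left and right differences commute, which gives the induction; a function of degree < 1 is
    invariant under right translations, and z x = x z ^ x. *)
Lemma deg_lt_leftB n f z : deg_lt n.+1 f -> deg_lt n (fun x => f (z * x)%g - f x).
Proof.
elim: n f => [|n IH] f fn /=.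
  move=> x; have := fn (x^-1 * z * x)%g x; by rewrite !mulgA mulgV mul1g.
move=> y; have := IH _ (fn y); congr deg_lt; apply/funext => x; rewrite mulgA; ring.
Qed.

Lemma deg_lt_inv n f : deg_lt n f -> deg_lt n (fun x => f x^-1%g).
Proof.
elim: n f => [|n IH] f fn z //=.
have := IH _ (deg_lt_leftB z^-1%g fn); congr deg_lt; apply/funext => x.
by rewrite invgM.
Qed.

End Degree.

Lemma deg_lt_hom (G H : groupType) (K : comNzRingType) (pi : G -> H) n (f : H -> K) :
  {morph pi : x y / (x * y)%g} -> deg_lt n f -> deg_lt n (f \o pi).
Proof.
move=> piM; elim: n f => [|n IH] f fn; first by move=> x /=.
move=> y; have := IH _ (fn (pi y)); congr deg_lt; apply/funext => x /=; by rewrite piM.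
Qed.

Section TopGroupFacts.
Variable G : topGroupType.
Local Open Scope group_scope.

Lemma mulg_cts (T : topologicalType) (f g : T -> G) :
  continuous f -> continuous g -> continuous (fun x => f x * g x).
Proof.
move=> cf cg x; apply: (@continuous_comp _ _ _ (fun x => (f x, g x)) (fun xy : G * G => xy.1 * xy.2)).
  by apply: cvg_pair; [exact: cf | exact: cg].
exact: mulg_continuous.
Qed.

Lemma invg_cts (T : topologicalType) (f : T -> G) :
  continuous f -> continuous (fun x => (f x)^-1).
Proof.
move=> cf x; apply: (@continuous_comp _ _ _ f (fun x : G => x^-1)); first exact: cf.
exact: invg_continuous.
Qed.

Lemma mulgr_cts (y : G) : continuous (fun x : G => x * y).
Proof. by apply: mulg_cts; [move=> x; exact: cvg_id | exact: cst_continuous]. Qed.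

Lemma mulgl_cts (y : G) : continuous (fun x : G => y * x).
Proof. by apply: mulg_cts; [exact: cst_continuous | move=> x; exact: cvg_id]. Qed.

Lemma comp_cts (S T U : topologicalType) (f : S -> T) (g : T -> U) :
  continuous f -> continuous g -> continuous (fun x => g (f x)).
Proof. by move=> cf cg x; apply: (@continuous_comp _ _ _ f g); [exact: cf|exact: cg]. Qed.

End TopGroupFacts.

Section PolynomialFunctions.
Variables (p : nat) (p_pr : prime p) (G : topGroupType).
Local Notation K := (Qp p_pr).

Fixpoint words (s : seq G) n : seq G :=
  if n is n'.+1 then (1%g :: words s n') ++ [seq (w * g)%g | w <- words s n', g <- s] else [::].

(** The difference along a generator has degree one less and vanishes on the shorter words, hence
    everywhere by induction. So f is invariant under right translation by the generators, constant
    on the subgroup that they generate, equal there to its value 0 at the empty word, and zero by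
    density. *)
Lemma deg_lt_words (s : seq G) n (f : G -> K) :
  dense (generated_subgroup [set` s]) -> continuous f -> deg_lt n f ->
  (forall w, w \in words s n -> f w = 0) -> forall x, f x = 0.
Proof.
move=> ds; elim: n f => [|n IH] f cf fn f0 x; first exact: fn.
have fs g y : g \in s -> f (y * g)%g = f y.
  move=> gs; apply/eqP; rewrite -subr_eq0; apply/eqP.
  apply: (IH (fun x => f (x * g)%g - f x)); last 1 first.
  - move=> w wn; rewrite (f0 w) ?(f0 (w * g)%g) ?subrr//= inE mem_cat ?wn ?orbT//.
    by apply/or3P; apply: Or33; apply/allpairsP; exists (w, g).
  - apply: qp_continuousD; first exact: comp_cts (@mulgr_cts _ g) cf.
    rewrite (_ : (fun x => _) = fun x => (-1) * f x); last by apply/funext => w; rewrite mulN1r.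
    by apply: qp_continuousM => //; exact: cst_continuous.
  - exact: fn.
have sub : subgroup [set h | forall y, f (y * h)%g = f y].
  split=> [y|h h' hf hf' y|h hf y] /=; first by rewrite mulg1.
    by rewrite mulgA hf' hf.
  by rewrite -[in LHS](hf (y * h^-1)%g) mulgVK.
have f1 h : generated_subgroup [set` s] h -> f h = 0.
  move=> gh; have : [set h | forall y, f (y * h)%g = f y] h.
    by apply: gh; split=> // g /= gs y; rewrite fs.
  by move/(_ 1%g); rewrite mul1g => ->; rewrite f0//= inE eqxx.
have -> // := dense_eq (g := fun=> 0) ds cf _ f1.
exact: cst_continuous.
Qed.

Definition polyfun (f : G -> K) := continuous f /\ exists n, deg_lt n f.

(** By [deg_lt_words], functions of degree < n are determined by finitely many values, so those in
    the image of q have a basis dual to points. An arbitrary B serves both the algebra of polynomial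
    functions and the coordinate rings of the quotients of its group. *)
Lemma polyfun_basis (B : lmodType K) (q : B -> G -> K) n :
  top_finitely_generated G ->
  (forall c a b y, q (c *: a + b) y = c * q a y + q b y) ->
  (forall a, (forall y, q a y = 0) -> a = 0) ->
  (forall a, continuous (q a)) ->
  exists r (x : 'I_r -> G) (e : 'I_r -> B),
    [/\ forall i, deg_lt n (q (e i)), forall i j, q (e i) (x j) = (i == j)%:R &
        forall a, deg_lt n (q a) -> a = \sum_i q a (x i) *: e i].
Proof.
move=> [s ds] q_lin q_inj qP.
have q0 y : q 0 y = 0.
  by have := q_lin (-1) 0 0 y; rewrite scaler0 addr0 mulN1r addNr.
pose V := [set f | deg_lt n f /\ exists b, f = q b].
have sV : fsubspace V.
  split; first by split; [exact: deg_lt_eq0 | exists 0; apply/funext].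
  move=> c f g [fn [a fa]] [gn [b gb]]; split; first exact: deg_ltD.
  by exists (c *: a + b); apply/funext => y; rewrite q_lin fa gb.
have [|r [x [e [[Ve ex] eE]]]] := @interpolation _ _ V (size (words s n)) (fun i => nth 1%g (words s n) i) sV.
  move=> f [fn [a fa]] f0 x; apply: (deg_lt_words ds _ fn); first by rewrite fa; exact: qP.
  by move=> w /(nthP 1%g)[i iw <-]; apply: (f0 (Ordinal iw)).
have /choice[b bE] : forall i, exists b, e i = q b by move=> i; exact: (Ve i).2.
exists r, x, b; split=> [i|i j|a na]; first by rewrite -bE; exact: (Ve i).1.
  by rewrite -bE.
apply/eqP; rewrite -subr_eq0; apply/eqP/q_inj => y.
rewrite addrC -scaleN1r q_lin (interp_sum q_lin) mulN1r [X in _ + X](eE (q a)).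
  by rewrite addrC -sumrB big1// => i _; rewrite bE subrr.
by split; [| exists a].
Qed.

Lemma deg_lt_bound (B : Type) (q : B -> G -> K) (t : seq B) :
  (forall a, polyfun (q a)) -> exists n, forall i, (i < size t)%N -> forall a0, deg_lt n (q (nth a0 t i)).
Proof.
move=> qP; elim: t => [|a t [n IH]]; first by exists 0%N.
have [m am] := (qP a).2; exists (m + n)%N => -[|i] it a0 /=.
  exact: deg_lt_le (leq_addr _ _) am.
by apply: deg_lt_le (leq_addl _ _) _; apply: IH.
Qed.

Lemma deg_lt_bound_fin (I : finType) (f : I -> G -> K) :
  (forall i, polyfun (f i)) -> exists n, forall i, deg_lt n (f i).
Proof.
move=> fP; have [n nP] := deg_lt_bound (enum I) fP; exists n => i.
by have := nP (index i (enum I)) _ i; rewrite nth_index ?mem_enum// index_mem mem_enum; apply.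
Qed.

Lemma polyfun_interp (B : lmodType K) (q : B -> G -> K) :
  top_finitely_generated G ->
  (forall c a b y, q (c *: a + b) y = c * q a y + q b y) ->
  (forall a, (forall y, q a y = 0) -> a = 0) ->
  (forall a, polyfun (q a)) -> interpolated q.
Proof.
move=> fg q_lin q_inj qP t; have [n nP] := deg_lt_bound t qP.
have [r [x [e [_ _ eE]]]] := polyfun_basis n fg q_lin q_inj (fun a => (qP a).1).
by exists r, x, e => a /(nthP 0)[i it <-]; apply: eE; exact: nP.
Qed.

Record polyA := PolyA { pval :> G -> K; _ : `[< polyfun pval >] }.
HB.instance Definition _ := [isSub of polyA for pval].
HB.instance Definition _ := [Choice of polyA by <:].

Lemma polyAP (a : polyA) : polyfun a.
Proof. by case: a => x /= /asboolP. Qed.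

Lemma polyA_eq (a b : polyA) : (forall x, a x = b x) -> a = b.
Proof. by move=> ab; apply/val_inj/funext. Qed.

Lemma polyfunD c f g : polyfun f -> polyfun g -> polyfun (fun x => c * f x + g x).
Proof.
move=> [cf [n fn]] [cg [m gm]]; split.
  by apply: qp_continuousD => //; apply: qp_continuousM => //; exact: cst_continuous.
exists (n + m)%N; apply: deg_ltD.
  exact: deg_lt_le (leq_addr _ _) fn.
exact: deg_lt_le (leq_addl _ _) gm.
Qed.

Lemma polyfunM f g : polyfun f -> polyfun g -> polyfun (fun x => f x * g x).
Proof.
move=> [cf [n fn]] [cg [m gm]]; split; first exact: qp_continuousM.
by exists (n + m)%N; exact: deg_ltM.
Qed.

Lemma polyfun_cst c : polyfun (fun=> c).
Proof. by split; [exact: cst_continuous | exists 1%N; exact: deg_lt_cst]. Qed.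

Lemma polyfun_right f y : polyfun f -> polyfun (fun x => f (x * y)%g).
Proof.
move=> [cf [n fn]]; split; last by exists n; exact: deg_lt_right.
exact: comp_cts (@mulgr_cts _ y) cf.
Qed.

Lemma polyfun_left f y : polyfun f -> polyfun (fun x => f (y * x)%g).
Proof.
move=> [cf [n fn]]; split; last by exists n; exact: deg_lt_left.
exact: comp_cts (@mulgl_cts _ y) cf.
Qed.

Lemma polyfun_inv f : polyfun f -> polyfun (fun x => f x^-1%g).
Proof.
move=> [cf [n fn]]; split; last by exists n; exact: deg_lt_inv.
exact: comp_cts (@invg_continuous G) cf.
Qed.

Definition mkA f (pf : polyfun f) : polyA := PolyA (asboolT pf).

Definition A_zero := mkA (polyfun_cst 0).
Definition A_one := mkA (polyfun_cst 1).
Definition A_add (a b : polyA) := mkA (polyfunD 1 (polyAP a) (polyAP b)).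
Definition A_opp (a : polyA) := mkA (polyfunD (-1) (polyAP a) (polyfun_cst 0)).
Definition A_mul (a b : polyA) := mkA (polyfunM (polyAP a) (polyAP b)).
Definition A_scale c (a : polyA) := mkA (polyfunD c (polyAP a) (polyfun_cst 0)).

Lemma A_addA : associative A_add.
Proof. by move=> a b c; apply: polyA_eq => x /=; rewrite !mul1r addrA. Qed.
Lemma A_addC : commutative A_add.
Proof. by move=> a b; apply: polyA_eq => x /=; rewrite !mul1r addrC. Qed.
Lemma A_add0 : left_id A_zero A_add.
Proof. by move=> a; apply: polyA_eq => x /=; rewrite mul1r add0r. Qed.
Lemma A_addN : left_inverse A_zero A_opp A_add.
Proof. by move=> a; apply: polyA_eq => x /=; rewrite mul1r mulN1r addr0 addNr. Qed.
Lemma A_mulA : associative A_mul.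
Proof. by move=> a b c; apply: polyA_eq => x /=; rewrite mulrA. Qed.
Lemma A_mulC : commutative A_mul.
Proof. by move=> a b; apply: polyA_eq => x /=; rewrite mulrC. Qed.
Lemma A_mul1 : left_id A_one A_mul.
Proof. by move=> a; apply: polyA_eq => x /=; rewrite mul1r. Qed.
Lemma A_mulD : left_distributive A_mul A_add.
Proof. by move=> a b c; apply: polyA_eq => x /=; rewrite !mul1r mulrDl. Qed.
Lemma A_one_neq0 : A_one != A_zero.
Proof. by apply/eqP => /(congr1 (fun a : polyA => a 1%g))/eqP /=; rewrite oner_eq0. Qed.

HB.instance Definition _ := GRing.isZmodule.Build polyA A_addA A_addC A_add0 A_addN.
HB.instance Definition _ := GRing.Zmodule_isComNzRing.Build polyA
  A_mulA A_mulC A_mul1 A_mulD A_one_neq0.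

Lemma A_scaleA c d a : A_scale c (A_scale d a) = A_scale (c * d) a.
Proof. by apply: polyA_eq => x /=; rewrite !addr0 mulrA. Qed.
Lemma A_scale1 : left_id 1 A_scale.
Proof. by move=> a; apply: polyA_eq => x /=; rewrite mul1r addr0. Qed.
Lemma A_scaleDr : right_distributive A_scale +%R.
Proof. by move=> c a b; apply: polyA_eq => x /=; rewrite !mul1r !addr0 mulrDr. Qed.
Lemma A_scaleDl a : {morph A_scale^~ a : c d / c + d}.
Proof. by move=> c d; apply: polyA_eq => x /=; rewrite mul1r !addr0 mulrDl. Qed.

HB.instance Definition _ := GRing.Zmodule_isLmodule.Build K polyA
  A_scaleA A_scale1 A_scaleDr A_scaleDl.

Lemma A_scaleAl c (a b : polyA) : c *: (a * b) = c *: a * b.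
Proof. by apply: polyA_eq => x /=; rewrite !addr0 mulrA. Qed.

HB.instance Definition _ := GRing.Lmodule_isLalgebra.Build K polyA A_scaleAl.
HB.instance Definition _ := GRing.Lalgebra_isComAlgebra.Build K polyA.

Lemma A_addE (a b : polyA) x : (a + b) x = a x + b x.
Proof. by rewrite /= mul1r. Qed.
Lemma A_mulE (a b : polyA) x : (a * b) x = a x * b x.
Proof. by []. Qed.
Lemma A_scaleE c (a : polyA) x : (c *: a) x = c * a x.
Proof. by rewrite /= addr0. Qed.
Lemma A_oneE x : (1 : polyA) x = 1.
Proof. by []. Qed.
Lemma A_zeroE x : (0 : polyA) x = 0.
Proof. by []. Qed.
Lemma A_linE c (a b : polyA) x : (c *: a + b) x = c * a x + b x.
Proof. by rewrite A_addE A_scaleE. Qed.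
Lemma A_sumE (I : Type) (s : seq I) (P : pred I) (f : I -> polyA) x :
  (\sum_(i <- s | P i) f i) x = \sum_(i <- s | P i) f i x.
Proof.
elim: s => [|i s IH]; first by rewrite !big_nil A_zeroE.
by rewrite !big_cons; case: ifP => // _; rewrite A_addE IH.
Qed.

Lemma A_eq0 (a : polyA) : (forall x, a x = 0) -> a = 0.
Proof. by move=> a0; apply: polyA_eq => x; rewrite a0. Qed.

Lemma A_interp : top_finitely_generated G -> interpolated (pval : polyA -> _).
Proof.
move=> fg; apply: polyfun_interp => //; [exact: A_linE|exact: A_eq0|exact: polyAP].
Qed.

End PolynomialFunctions.
Arguments pval : simpl never.

Lemma lrmorph_eq (k : nzRingType) (A : lalgType k) (B : lalgType k) (f g : {lrmorphism A -> B}) :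
  (forall a, f a = g a) -> f = g.
Proof.
move=> fg; have : f = g :> (A -> B) by apply/funext.
case: f {fg} => f [[fm] [fm1] [fm2]]; case: g => g [[gm] [gm1] [gm2]] /= fg.
case: _ / fg in gm gm1 gm2 *.
by rewrite (Prop_irrelevance fm gm) (Prop_irrelevance fm1 gm1) (Prop_irrelevance fm2 gm2).
Qed.

(* An affine group scheme from its coordinate ring [A], realized as functions
   [q a] on a set [X]: [D a s] says that the coproduct of [a] is the sum of the
   tensors in [s]. *)
(** * The affine group scheme of polynomial functions *)

Section HopfBuild.
Variables (k : fieldType) (A : comAlgType k) (X : Type) (q : A -> X -> k).
Hypothesis q_lin : forall c a b x, q (c *: a + b) x = c * q a x + q b x.
Hypothesis q_inj : forall a, (forall x, q a x = 0) -> a = 0.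
Hypothesis q_interp : interpolated q.
Variable D : A -> seq (A * A) -> Prop.
Hypothesis D_ex : forall a, exists s, D a s.
Hypothesis D_uniq : forall a s t, D a s -> D a t -> forall x y,
  \sum_(b <- s) q b.1 x * q b.2 y = \sum_(b <- t) q b.1 x * q b.2 y.
Hypothesis D_lin : forall c a b s t, D a s -> D b t ->
  D (c *: a + b) ([seq (c *: d.1, d.2) | d <- s] ++ t).
Hypothesis D_1 : D 1 [:: (1, 1)].
Hypothesis D_mul : forall a b s t, D a s -> D b t ->
  D (a * b) [seq (c.1 * d.1, c.2 * d.2) | c <- s, d <- t].
Variables (e : {lrmorphism A -> k^o}) (S : {lrmorphism A -> A}).
Hypothesis D_e : forall a s, D a s -> \sum_(b <- s) (e b.1 : k) *: b.2 = a.
Hypothesis D_S : forall a s, D a s -> \sum_(b <- s) S b.1 * b.2 = (e a : k)%:A.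
Hypothesis D_coassoc : forall a s d, D a s -> (forall b, D b (d b)) -> forall x y z,
  \sum_(b <- s) \sum_(c <- d b.2) q b.1 x * q c.1 y * q c.2 z =
  \sum_(b <- s) \sum_(c <- d b.1) q c.1 x * q c.2 y * q b.2 z.

Definition hb_cop (a : A) : seq (A * A) := projT1 (cid (D_ex a)).
Lemma hb_copP a : D a (hb_cop a).
Proof. by rewrite /hb_cop; case: cid. Qed.

Lemma q_opp a x : q (- a) x = - q a x.
Proof.
have q0 : q 0 x = 0 by have := q_lin (-1) 0 0 x; rewrite scaler0 addr0 mulN1r addNr.
by rewrite -[- a]addr0 -scaleN1r q_lin q0 addr0 mulN1r.
Qed.

Section Conv.
Variables (R : comAlgType k).

Definition hb_conv (x y : A -> R) (a : A) : R := \sum_(b <- hb_cop a) x b.1 * y b.2.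

Lemma prod_bilin (x y : {linear A -> R}) : bilin (fun a b => x a * y b).
Proof.
split=> [b c a a'|a c b b']; rewrite linearP.
  by rewrite mulrDl scalerAl.
by rewrite mulrDr scalerAr.
Qed.

Definition negs (s : seq (A * A)) := [seq (- b.1, b.2) | b <- s].

Lemma hb_conv_eq (x y : {linear A -> R}) (s t : seq (A * A)) :
  (forall g h, \sum_(b <- s) q b.1 g * q b.2 h = \sum_(b <- t) q b.1 g * q b.2 h) ->
  \sum_(b <- s) x b.1 * y b.2 = \sum_(b <- t) x b.1 * y b.2.
Proof.
move=> st; apply/eqP; rewrite -subr_eq0; apply/eqP.
have := @tensor_vanishing _ _ _ _ _ q_interp _ _ q_lin q_inj (s ++ negs t) _ _ (prod_bilin x y).
rewrite big_cat big_map /=.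
under [in X in _ + X]eq_bigr do rewrite linearN mulNr.
rewrite sumrN; apply=> g h; rewrite big_cat big_map /=.
under [in X in _ + X]eq_bigr do rewrite q_opp mulNr.
by rewrite sumrN st subrr.
Qed.

Lemma hb_convE (x y : {linear A -> R}) a (s : seq (A * A)) :
  D a s -> hb_conv x y a = \sum_(b <- s) x b.1 * y b.2.
Proof. by move=> as_; apply: hb_conv_eq; exact: D_uniq (hb_copP a) as_. Qed.

Lemma hb_conv_linear (x y : {linear A -> R}) : linear (hb_conv x y).
Proof.
move=> c a b; rewrite (hb_convE _ _ (D_lin c (hb_copP a) (hb_copP b))).
rewrite big_cat big_map /= scaler_sumr; congr (_ + _).
by apply: eq_bigr => d _; rewrite linearZ scalerAl.
Qed.

Lemma hb_conv_monoid (x y : {lrmorphism A -> R}) : monoid_morphism (hb_conv x y).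
Proof.
split; first by rewrite (hb_convE _ _ D_1) big_seq1 !rmorph1 mulr1.
move=> a b; rewrite (hb_convE _ _ (D_mul (hb_copP a) (hb_copP b))).
rewrite /hb_conv big_distrl big_allpairs_dep; apply: eq_bigr => c _.
by rewrite big_distrr; apply: eq_bigr => d _ /=; rewrite !rmorphM mulrACA.
Qed.

Definition hb_smul (x y : {lrmorphism A -> R}) : {lrmorphism A -> R} :=
  HB.pack (hb_conv x y) (GRing.isLinear.Build _ _ _ _ (hb_conv x y) (hb_conv_linear x y))
    (GRing.isMonoidMorphism.Build _ _ (hb_conv x y) (hb_conv_monoid x y)).

Definition hb_one_fun (a : A) : R := (e a : k)%:A.

Lemma hb_one_linear : linear hb_one_fun.
Proof. by move=> c a b; rewrite /hb_one_fun linearP scalerDl scalerA. Qed.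
Lemma hb_one_monoid : monoid_morphism hb_one_fun.
Proof.
split; first by rewrite /hb_one_fun rmorph1 scale1r.
by move=> a b; rewrite /hb_one_fun rmorphM -scalerAl mul1r scalerA.
Qed.

Definition hb_sone : {lrmorphism A -> R} :=
  HB.pack hb_one_fun (GRing.isLinear.Build _ _ _ _ hb_one_fun hb_one_linear)
    (GRing.isMonoidMorphism.Build _ _ hb_one_fun hb_one_monoid).

Definition hb_sinv (x : {lrmorphism A -> R}) : {lrmorphism A -> R} := x \o S.

(** Coassociativity is only given for functions of three variables. Expanding the third factors in
    an interpolating family leaves, for each of its members, an identity between tensors of two
    factors, to which [hb_conv_eq] applies. *)
Lemma hb_smulA : associative hb_smul.
Proof.
move=> x y z; apply: lrmorph_eq => a; rewrite /= /hb_conv.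
pose T := [seq (b.1, c.1, c.2) | b <- hb_cop a, c <- hb_cop b.2].
pose T' := [seq (c.1, c.2, b.2) | b <- hb_cop a, c <- hb_cop b.1].
pose U (s : seq (A * A * A)) := \sum_(t <- s) x t.1.1 * y t.1.2 * z t.2.
have -> : \sum_(b <- hb_cop a) x b.1 * hb_conv y z b.2 = U T.
  rewrite /U big_allpairs_dep; apply: eq_bigr => b _.
  by rewrite mulr_sumr; apply: eq_bigr => c _; rewrite mulrA.
have -> : \sum_(b <- hb_cop a) hb_conv x y b.1 * z b.2 = U T'.
  by rewrite /U big_allpairs_dep; apply: eq_bigr => b _; rewrite mulr_suml.
have [r [w [f fE]]] := q_interp [seq t.2 | t <- T ++ T'].
have UE s : {subset s <= T ++ T'} ->
    U s = \sum_i (\sum_(t <- s) x (q t.2 (w i) *: t.1.1) * y t.1.2) * z (f i).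
  move=> sT; under eq_bigr do rewrite mulr_suml.
  rewrite exchange_big /U !big_seq /=; apply: eq_bigr => t /sT tT.
  rewrite {1}(fE t.2) ?map_f// linear_sum mulr_sumr; apply: eq_bigr => i _.
  by rewrite !linearZ /= -!scalerAl scalerAr.
rewrite !UE; last by move=> t; rewrite mem_cat => ->.
  apply: eq_bigr => i _; congr (_ * _).
  pose sc (t : A * A * A) : A * A := (q t.2 (w i) *: t.1.1, t.1.2).
  have := @hb_conv_eq x y (map sc T) (map sc T').
  have qZ c b g : q (c *: b) g = c * q b g.
    rewrite -[_ *: _]addr0 q_lin; have := q_lin (-1) 0 0 g.
    by rewrite scaler0 addr0 mulN1r addNr => ->; rewrite addr0.
  rewrite !big_map; apply=> g h; rewrite !big_map !big_allpairs_dep /=.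
  under eq_bigr do under eq_bigr do rewrite qZ -mulrA mulrC.
  rewrite (D_coassoc (hb_copP a) hb_copP).
  by apply: eq_bigr => b _; apply: eq_bigr => c _; rewrite qZ; ring.
by move=> t; rewrite mem_cat => ->; rewrite orbT.
Qed.

Lemma hb_smul1x : left_id hb_sone hb_smul.
Proof.
move=> x; apply: lrmorph_eq => a /=; rewrite /hb_conv /hb_one_fun.
under eq_bigr do rewrite -scalerAl mul1r -linearZ.
by rewrite -linear_sum (D_e (hb_copP a)).
Qed.

Lemma hb_smulVx : left_inverse hb_sone hb_sinv hb_smul.
Proof.
move=> x; apply: lrmorph_eq => a /=; rewrite /hb_conv /hb_one_fun /=.
under eq_bigr do rewrite -rmorphM.
by rewrite -rmorph_sum -[in RHS](rmorph1 x) -linearZ (D_S (hb_copP a)).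
Qed.

End Conv.

Lemma hb_smul_comp (R R' : comAlgType k) (h : {lrmorphism R -> R'}) (x y : {lrmorphism A -> R}) :
  h \o hb_smul x y = hb_smul (h \o x) (h \o y) :> {lrmorphism A -> R'}.
Proof.
apply: lrmorph_eq => a /=; rewrite /hb_conv rmorph_sum.
by apply: eq_bigr => b _; rewrite rmorphM.
Qed.

Definition hopf_grp : affGrpSch k := AffGrpSch hb_smulA hb_smul1x hb_smulVx hb_smul_comp.

Lemma hopf_smulE (R : comAlgType k) (x y : points hopf_grp R) a s :
  D a s -> smul x y a = \sum_(b <- s) x b.1 * y b.2.
Proof. exact: hb_convE. Qed.

End HopfBuild.

Section SpecA.
Variables (p : nat) (p_pr : prime p) (G : topGroupType).
Hypothesis fgG : top_finitely_generated G.
Local Notation K := (Qp p_pr).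
Local Notation A := (polyA p_pr G).

Definition Aleft (y : G) (a : A) : A := mkA (polyfun_left y (polyAP a)).
Definition Aright (y : G) (a : A) : A := mkA (polyfun_right y (polyAP a)).
Definition Ainv (a : A) : A := mkA (polyfun_inv (polyAP a)).

Definition splits (a : A) (s : seq (A * A)) :=
  forall g h, a (g * h)%g = \sum_(b <- s) b.1 g * b.2 h.

(** The right translates of a stay in the finite-dimensional space of functions of degree < n.
    Interpolating the translate by h at points x_i gives a(g h) as the sum of the e_i(g) a(x_i h),
    and the second factor is a left translate of a. *)
Lemma A_splits a : exists s, splits a s.
Proof.
have [n an] := (polyAP a).2.
have [r [x [e eE]]] : exists r (x : 'I_r -> G) (e : 'I_r -> A),
    forall f : A, deg_lt n f -> f = \sum_i f (x i) *: e i.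
  have [s ds] := fgG; pose V := [set f : G -> K | deg_lt n f /\ exists b : A, f = b].
  have sV : fsubspace V.
    split; first by split; [exact: deg_lt_eq0 | exists 0; apply/funext].
    move=> c f g [fn [b fa]] [gn [b' gb]]; split; first exact: deg_ltD.
    by exists (c *: b + b'); apply/funext => y; rewrite A_linE fa gb.
  have [|r [x [e [[Ve _] eE]]]] := @interpolation _ _ V (size (words s n)) (fun i => nth 1%g (words s n) i) sV.
    move=> f [fn [b fa]] f0 x; apply: (deg_lt_words ds _ fn); first by rewrite fa; exact: (polyAP b).1.
    by move=> w /(nthP 1%g)[i iw <-]; apply: (f0 (Ordinal iw)).
  have /choice[b bE] : forall i, exists b : A, e i = b by move=> i; exact: (Ve i).2.
  exists r, x, b => f fn; apply: polyA_eq => y; rewrite A_sumE (eE f); last by split=> //; exists f.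
  by apply: eq_bigr => i _; rewrite A_scaleE bE.
exists [seq (e i, Aleft (x i) a) | i <- index_enum 'I_r] => g h.
transitivity (Aright h a g); first by [].
rewrite (eE (Aright h a) (deg_lt_right h an)) A_sumE big_map; apply: eq_bigr => i _.
rewrite A_scaleE; exact: mulrC.
Qed.

Lemma splits_uniq a s t : splits a s -> splits a t -> forall x y,
  \sum_(b <- s) (b.1 : A) x * (b.2 : A) y = \sum_(b <- t) (b.1 : A) x * (b.2 : A) y.
Proof. by move=> as_ at_ x y; rewrite -as_ -at_. Qed.

Lemma splits_lin c a b s t : splits a s -> splits b t ->
  splits (c *: a + b) ([seq (c *: d.1, d.2) | d <- s] ++ t).
Proof.
move=> as_ bt g h; rewrite A_linE as_ bt big_cat big_map mulr_sumr; congr (_ + _).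
by apply: eq_bigr => d _; rewrite A_scaleE mulrA.
Qed.

Lemma splits_1 : splits 1 [:: (1, 1)].
Proof. by move=> g h; rewrite big_seq1 /= mulr1. Qed.

Lemma splits_mul a b s t : splits a s -> splits b t ->
  splits (a * b) [seq (c.1 * d.1, c.2 * d.2) | c <- s, d <- t].
Proof.
move=> as_ bt g h; rewrite A_mulE as_ bt big_distrl big_allpairs_dep; apply: eq_bigr => c _.
by rewrite big_distrr; apply: eq_bigr => d _ /=; rewrite mulrACA.
Qed.

Section Eval.
Variable g : G.
Definition evA (a : A) : K^o := a g.
Lemma evA_linear : linear evA.
Proof. by move=> c a b; rewrite /evA A_linE. Qed.
Lemma evA_monoid : monoid_morphism evA.
Proof. by split. Qed.
Definition evAm : {lrmorphism A -> K^o} :=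
  HB.pack evA (GRing.isLinear.Build _ _ _ _ evA evA_linear)
    (GRing.isMonoidMorphism.Build _ _ evA evA_monoid).
End Eval.

Lemma Ainv_linear : linear Ainv.
Proof. by move=> c a b; apply: polyA_eq => g; rewrite [RHS]A_linE; exact: A_linE. Qed.
Lemma Ainv_monoid : monoid_morphism Ainv.
Proof. by split=> [|a b]; exact: polyA_eq. Qed.
Definition Ainvm : {lrmorphism A -> A} :=
  HB.pack Ainv (GRing.isLinear.Build _ _ _ _ Ainv Ainv_linear)
    (GRing.isMonoidMorphism.Build _ _ Ainv Ainv_monoid).

Lemma splits_e a s : splits a s -> \sum_(b <- s) (evAm 1%g b.1 : K) *: b.2 = a.
Proof.
move=> as_; apply: polyA_eq => g; rewrite A_sumE -[in RHS](mul1g g) as_.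
by apply: eq_bigr => b _; exact: A_scaleE.
Qed.

Lemma splits_S a s : splits a s -> \sum_(b <- s) Ainvm b.1 * b.2 = (evAm 1%g a : K)%:A.
Proof.
move=> as_; apply: polyA_eq => g.
by rewrite A_sumE A_scaleE A_oneE mulr1 /= /evA -(mulVg g) as_.
Qed.

Lemma splits_coassoc a s d : splits a s -> (forall b, splits b (d b)) -> forall x y z,
  \sum_(b <- s) \sum_(c <- d b.2) (b.1 : A) x * (c.1 : A) y * (c.2 : A) z =
  \sum_(b <- s) \sum_(c <- d b.1) (c.1 : A) x * (c.2 : A) y * (b.2 : A) z.
Proof.
move=> as_ dP x y z; transitivity (a (x * y * z)%g).
  rewrite -mulgA as_; apply: eq_bigr => b _; rewrite dP mulr_sumr.
  by apply: eq_bigr => c _; rewrite mulrA.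
by rewrite as_; apply: eq_bigr => b _; rewrite dP mulr_suml.
Qed.

Definition specA : affGrpSch K := hopf_grp (@A_linE p p_pr G) (@A_eq0 p p_pr G)
  (A_interp (p_pr := p_pr) fgG) A_splits splits_uniq splits_lin splits_1 splits_mul
  splits_e splits_S splits_coassoc.

Definition etaA (g : G) : rat_points specA := evAm g.

Lemma smulAE (R : comAlgType K) (x y : points specA R) a (s : seq (A * A)) :
  splits a s -> smul x y a = \sum_(b <- s) x b.1 * y b.2.
Proof. exact: hopf_smulE. Qed.

Lemma etaAM g h : etaA (g * h)%g = smul (etaA g) (etaA h).
Proof.
apply: lrmorph_eq => a; have [s as_] := A_splits a.
by rewrite (smulAE _ _ as_) /= /evA as_.
Qed.

Lemma sone_specA (R : comAlgType K) a : sone specA R a = (a 1%g : K)%:A.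
Proof. by []. Qed.

End SpecA.

(** * Coproducts and local finiteness *)

Section Functionals.
Variables (k : fieldType) (B : lmodType k).
Local Notation functional := {linear B -> k^o}.

(** A maximal subspace M above W that avoids v is a complement of the line of v: if no x - c v were
    in M, adding x to M would still avoid v. The coefficient c is the functional. *)
Lemma functional_ext (W : set B) (v : B) : submodule W -> ~ W v ->
  exists f : functional, f v = 1 /\ forall w, W w -> f w = 0.
Proof.
move=> sW Wv.
(* W is added in the condition rather than required inside L, so that the empty union of an empty
   chain still qualifies. *)
pose P := [set L : set B | [/\ submodule (L `|` W) & ~ (L `|` W) v]].
have [F FP totF|L [[sL Lv] max]] := @Zorn_bigcup B P.
  have [F0|/set0P[L0 FL0]] := eqVneq F set0.
    by rewrite F0 bigcup_set0; split; rewrite set0U.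
  have mem x : (\bigcup_(X in F) X `|` W) x -> exists2 X, F X & (X `|` W) x.
    by move=> [[X FX Xx]|Wx]; [exists X => //; left | exists L0 => //; right].
  split; last by move=> /mem[X FX]; have [] := FP _ FX.
  split; first by right; exact: sW.1.
  move=> a x y /mem[X FX Xx] /mem[Y FY Yy].
  have [Z [FZ Zx Zy]] : exists Z, [/\ F Z, (Z `|` W) x & (Z `|` W) y].
    have [XY|YX] := totF _ _ FX FY; [exists Y|exists X]; split=> //.
      by case: Xx => [/XY|]; [left|right].
    by case: Yy => [/YX|]; [left|right].
  have [sZ _] := FP _ FZ; have [?|?] := sZ.2 a x y Zx Zy; last by right.
  by left; exists Z.
set M := L `|` W in sL Lv.
have MZ a x : M x -> M (a *: x) by move=> Mx; rewrite -[_ *: _]addr0; apply: sL.2 => //; exact: sL.1.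
have MB x y : M x -> M y -> M (x - y).
  by move=> Mx My; rewrite addrC -scaleN1r; apply: sL.2.
have dec x : exists c, M (x - c *: v).
  apply: contrapT => /forallNP nx.
  pose L' := [set y | exists w c, M w /\ y = w + c *: x].
  have LL' : M `<=` L' by move=> w Mw; exists w, 0; rewrite scale0r addr0.
  have eL : L' `|` W = L'.
    by apply/seteqP; split=> y; [case=> // Wy; apply: LL'; right | left].
  apply: (max L'); last split; rewrite ?eL.
  - split=> [y Ly|/(_ x)]; first by apply: LL'; left.
    have L'x : L' x by exists 0, 1; rewrite add0r scale1r; split=> //; exact: sL.1.
    move=> /(_ L'x) Lx; have /= := nx 0; rewrite scale0r subr0; apply; by left.
  - split; first by apply: LL'; exact: sL.1.
    move=> a y y' [w [c [Mw ->]]] [w' [c' [Mw' ->]]]; exists (a *: w + w'), (a * c + c').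
    by split; [exact: sL.2 | rewrite scalerDr scalerDl scalerA addrACA].
  - move=> [w [c [Mw vE]]]; have c0 : c != 0.
      by apply/eqP => c0; apply: Lv; rewrite vE c0 scale0r addr0.
    apply: (nx c^-1); rewrite vE scalerDr scalerA mulVf// scale1r opprD addrCA subrr addr0.
    by rewrite -scaleN1r !scalerA; apply: MZ.
have uniq x c d : M (x - c *: v) -> M (x - d *: v) -> c = d.
  move=> Mc Md; apply/eqP; rewrite -subr_eq0; apply/negPn/negP => cd; apply: Lv.
  have := MZ (c - d)^-1 _ (MB _ _ Md Mc).
  rewrite (_ : x - d *: v - (x - c *: v) = (c - d) *: v).
    by rewrite scalerA mulVf// scale1r.
  by rewrite opprB scalerBl addrC addrA subrK.
have [f fP] := choice dec.
have f_lin : linear (f : B -> k^o).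
  move=> a x y; apply: (uniq (a *: x + y)); first exact: fP.
  rewrite (_ : _ - _ = a *: (x - f x *: v) + (y - f y *: v)); first exact: sL.2.
  by rewrite scalerBr scalerDl -scalerA opprD addrACA.
pose f' : B -> k^o := f.
pose F : functional := HB.pack f' (GRing.isLinear.Build _ _ _ _ f' f_lin).
exists F; rewrite -[F : B -> k^o]/f' /f'.
split=> [|w Ww]; first by apply: (uniq v); rewrite ?scale1r ?subrr//; exact: sL.1.
by apply: (uniq w) => //; rewrite scale0r subr0; right.
Qed.

Lemma functional_sep (v : B) : (forall f : functional, f v = 0) -> v = 0.
Proof.
move=> fv; apply: contrapT => v0; have [|f [f1 _]] := @functional_ext [set 0] v _ v0.
  by split=> [//|a x y -> ->]; rewrite scaler0 addr0.
by have /eqP := f1; rewrite fv eq_sym oner_eq0.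
Qed.

(** Vectors are viewed as functions on the space of functionals; in the span of the t_i a dual
    family has at most n members, and interpolation at functionals gives coordinates. *)
Lemma dual_basis n (t : 'I_n -> B) : exists r (phi : 'I_r -> functional) (C : 'I_r -> 'I_n -> k),
  forall i, t i = \sum_j phi j (t i) *: \sum_l C j l *: t l.
Proof.
pose V := [set f : functional -> k | exists c : 'I_n -> k, f = fun phi => phi (\sum_l c l *: t l)].
have sV : fsubspace V.
  split; first by exists (fun=> 0); apply/funext => phi; rewrite big1 ?linear0// => l _; rewrite scale0r.
  move=> a f g [c ->] [d ->]; exists (fun l => a * c l + d l); apply/funext => phi.
  rewrite -[a * _]/(a *: (_ : k^o)) -linearP scaler_sumr -big_split /=; congr (phi _).
  by apply: eq_bigr => l _; rewrite scalerDl scalerA.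
have [r x e dxe|r [x [e [[Ve _] eE]]]] := interpolation_max (R := n) sV.
  have /choice[C CE] := dxe.1.
  apply: (dual_family_indep (M := \matrix_(j < r, l < n) C j l) dxe) => u uM phi.
  transitivity (phi (\sum_l (u *m \matrix_(j < r, l < n) C j l) 0 l *: t l)).
    have -> : \sum_l (u *m \matrix_(j < r, l < n) C j l) 0 l *: t l =
        \sum_j u 0 j *: \sum_l C j l *: t l.
      under [RHS]eq_bigr do rewrite scaler_sumr.
      rewrite exchange_big; apply: eq_bigr => l _; rewrite mxE scaler_suml.
      by apply: eq_bigr => j _; rewrite mxE scalerA.
    by rewrite linear_sum; apply: eq_bigr => j _; rewrite CE linearZ.
  by rewrite uM big1 ?linear0// => l _; rewrite mxE scale0r.
have /choice[C CE] := Ve; exists r, x, C => i; apply/eqP; rewrite -subr_eq0; apply/eqP.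
apply: functional_sep => f; rewrite linearB linear_sum; apply/eqP; rewrite subr_eq0; apply/eqP.
have Vi : V (fun phi => phi (t i)).
  exists (fun l => (l == i)%:R); apply/funext => phi; congr (phi _).
  rewrite (bigD1 i)//= eqxx scale1r big1 ?addr0// => l /negbTE ->.
  by rewrite scale0r.
rewrite (eE _ Vi); apply: eq_bigr => j _.
by rewrite linearZ /= [in LHS]CE.
Qed.

(** Every vector space is thereby a space of functions, on functionals, to which [tensor_vanishing]
    applies. *)
Lemma functional_interpolated (B' : lmodType k) (iota : {linear B' -> B}) : injective iota ->
  interpolated (fun (a : B') (f : functional) => (f (iota a) : k)).
Proof.
move=> inj t; have [r [phi [C tE]]] := dual_basis (fun i : 'I_(size t) => iota (nth 0 t i)).
exists r, phi, (fun j => \sum_l C j l *: nth 0 t l) => a /(nthP 0)[i it <-].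
have /= tEi := tE (Ordinal it).
apply: inj; rewrite [LHS]tEi linear_sum; apply: eq_bigr => j _.
transitivity (phi j (iota t`_i) *: iota (\sum_l C j l *: t`_l)); last exact/esym/linearZ.
suff -> : iota (\sum_l C j l *: t`_l) = \sum_l C j l *: iota t`_l by [].
by rewrite linear_sum; apply: eq_bigr => l _; rewrite linearZ.
Qed.

End Functionals.

(** * Tensor products of algebras and universal points *)

Section TensorFacts.
Variables (A : comNzRingType) (M N : lmodType A).

Lemma malg_ind (T : choiceType) (P : {malg A[T]} -> Prop) :
  P 0 -> (forall a t g, P g -> P (a *: << t >> + g)) -> forall g, P g.
Proof.
move=> P0 PD g; rewrite (monalgE g); elim: (msupp g : seq T) => [|t s IH].
  by rewrite big_nil.
rewrite big_cons (_ : << g@_t *g t >> = g@_t *: << t >>); first exact: PD.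
by apply/malgP => u; rewrite mcoeffZ !mcoeffU mulrnAr mulr1.
Qed.

Lemma tensor_sum (u : tensor M N) : exists s, u = \sum_(b <- s) tens b.1 b.2.
Proof.
elim/qmod_ind: u => g; elim/malg_ind: g => [|a [x y] g [s sE]].
  by exists [::]; rewrite big_nil linear0.
exists ((a *: x, y) :: s); rewrite big_cons -sE linearP; congr (_ + _).
have [tl _] := tens_bilin M N.
have := tl y a x 0; rewrite addr0 => ->.
rewrite (_ : tens 0 y = 0) ?addr0//.
by have := tl y (-1) 0 0; rewrite scaler0 addr0 scaleN1r addNr.
Qed.

Lemma tensor_ind (P : tensor M N -> Prop) :
  P 0 -> (forall x y u, P u -> P (tens x y + u)) -> forall u, P u.
Proof.
move=> P0 PD u; have [s ->] := tensor_sum u.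
by elim: s => [|b s IH]; rewrite ?big_nil ?big_cons//; exact: PD.
Qed.

Lemma tensZl a x y : tens (a *: x) y = a *: tens x y :> tensor M N.
Proof.
have [tl _] := tens_bilin M N; have := tl y a x 0; rewrite addr0 => ->.
rewrite (_ : tens 0 y = 0) ?addr0//.
by have := tl y (-1) 0 0; rewrite scaler0 addr0 scaleN1r addNr.
Qed.

Lemma tensZr a x y : tens x (a *: y) = a *: tens x y :> tensor M N.
Proof.
have [_ tr] := tens_bilin M N; have := tr x a y 0; rewrite addr0 => ->.
rewrite (_ : tens x 0 = 0) ?addr0//.
by have := tr x (-1) 0 0; rewrite scaler0 addr0 scaleN1r addNr.
Qed.

Lemma tens_suml (I : Type) (s : seq I) (f : I -> M) y :
  tens (\sum_(i <- s) f i) y = \sum_(i <- s) tens (f i) y :> tensor M N.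
Proof.
have [tl _] := tens_bilin M N.
pose g : {linear M -> tensor M N} := HB.pack (fun x => tens x y) (GRing.isLinear.Build _ _ _ _ (fun x => tens x y) (tl y)).
exact: (linear_sum g).
Qed.

Lemma tens_sumr (I : Type) (s : seq I) (f : I -> N) x :
  tens x (\sum_(i <- s) f i) = \sum_(i <- s) tens x (f i) :> tensor M N.
Proof.
have [_ tr] := tens_bilin M N.
pose g : {linear N -> tensor M N} := HB.pack (fun y => tens x y) (GRing.isLinear.Build _ _ _ _ (fun y => tens x y) (tr x)).
exact: (linear_sum g).
Qed.

Definition tlift (W : lmodType A) (f : M -> N -> W) (bf : bilin f) : {linear tensor M N -> W} :=
  HB.pack (tensor_lift f) (GRing.isLinear.Build _ _ _ _ (tensor_lift f) (tensor_lift_is_linear bf)).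

Lemma tliftE (W : lmodType A) (f : M -> N -> W) (bf : bilin f) x y : tlift bf (tens x y) = f x y.
Proof. exact: tensor_liftE. Qed.

End TensorFacts.

(** All the axioms are additive in each argument, so they need only be checked on pure tensors, by
    nested inductions. *)
Lemma bilinear_mul_axioms (A R : comNzRingType) (T : zmodType) (t : A -> R -> T)
    (ind : forall P : T -> Prop, P 0 -> (forall x y u, P u -> P (t x y + u)) -> forall u, P u)
    (mul : T -> T -> T) :
  left_zero 0 mul -> right_zero 0 mul ->
  (forall u v w, mul (u + v) w = mul u w + mul v w) ->
  (forall u v w, mul u (v + w) = mul u v + mul u w) ->
  (forall a r a' r', mul (t a r) (t a' r') = t (a * a') (r * r')) ->
  [/\ associative mul, commutative mul, left_id (t 1 1) mul & left_distributive mul +%R].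
Proof.
move=> m0 mr0 mD mDr mE; split=> //.
- move=> u v w; elim/ind: u => [|a r u IH]; first by rewrite !m0.
  rewrite !mD IH; congr (_ + _); elim/ind: v {IH u} => [|a' r' v IH].
    by rewrite m0 !mr0 m0.
  rewrite mD !mDr mD IH; congr (_ + _).
  elim/ind: w {IH v} => [|a'' r'' w IH]; first by rewrite !mr0.
  by rewrite !mDr IH !mE !mulrA.
- move=> u v; elim/ind: u => [|a r u IH]; first by rewrite m0 mr0.
  rewrite mD IH mDr; congr (_ + _).
  elim/ind: v {IH u} => [|a' r' v IH]; first by rewrite m0 mr0.
  by rewrite mD mDr IH !mE (mulrC a) (mulrC r).
- elim/ind => [|a r u IH]; first exact: mr0.
  by rewrite mDr IH mE !mul1r.
Qed.

Lemma bilinear_mul_morph (A R T S : comNzRingType) (t : A -> R -> T)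
    (ind : forall P : T -> Prop, P 0 -> (forall x y u, P u -> P (t x y + u)) -> forall u, P u)
    (tM : forall a r a' r', t a r * t a' r' = t (a * a') (r * r')) (F : T -> S) (f : A -> R -> S) :
  F 0 = 0 -> (forall u v, F (u + v) = F u + F v) -> (forall a r, F (t a r) = f a r) ->
  (forall a r a' r', f (a * a') (r * r') = f a r * f a' r') -> {morph F : u v / u * v}.
Proof.
move=> F0 FD FE fM u v; elim/ind: u => [|a r u IH]; first by rewrite mul0r F0 mul0r.
rewrite mulrDl !FD mulrDl IH; congr (_ + _).
elim/ind: v {IH u} => [|a' r' v IH]; first by rewrite mulr0 F0 mulr0.
by rewrite mulrDr !FD mulrDr IH tM !FE fM.
Qed.

Section TensorAlgebra.
Variables (k : fieldType) (U : affGrpSch k) (R : comAlgType k).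
Local Notation A := (coord U).

Local Notation T := (tensor A R).
Implicit Types u v w : T.

Lemma tmul_bilin (a : A) (r : R) : bilin (fun a' r' => tens (a * a') (r * r') : T).
Proof.
have [tl tr] := tens_bilin A R; split=> [r' c x x'|a' c y y'].
  by rewrite mulrDr -scalerAr tl.
by rewrite mulrDr -scalerAr tr.
Qed.

Definition tmulr a r : {linear T -> T} := tlift (tmul_bilin a r).

Lemma tmulr0 a r : tmulr a r 0 = 0. Proof. exact: linear0. Qed.
Lemma tmulrD a r u v : tmulr a r (u + v) = tmulr a r u + tmulr a r v.
Proof. exact: linearD. Qed.
Lemma tmulrE a r a' r' : tmulr a r (tens a' r') = tens (a * a') (r * r').
Proof. exact: tliftE. Qed.

Lemma tmulr_bilin v : bilin (fun a r => tmulr a r v).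
Proof.
have [tl tr] := tens_bilin A R; split=> [r c a a'|a c r r'].
  elim/tensor_ind: v => [|x y v IH]; first by rewrite !tmulr0 scaler0 addr0.
  rewrite !tmulrD IH !tmulrE mulrDl -scalerAl tl scalerDr -!addrA; congr (_ + _).
  by rewrite addrCA.
elim/tensor_ind: v => [|x y v IH]; first by rewrite !tmulr0 scaler0 addr0.
rewrite !tmulrD IH !tmulrE mulrDl -scalerAl tr scalerDr -!addrA; congr (_ + _).
by rewrite addrCA.
Qed.

#[local] Opaque tens tmulr.
Definition tmul u v : T := tlift (tmulr_bilin v) u.

Lemma tmulDl u u' v : tmul (u + u') v = tmul u v + tmul u' v.
Proof. exact: linearD. Qed.
Lemma tmulZl c u v : tmul (c *: u) v = c *: tmul u v.
Proof. exact: linearZ. Qed.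
Lemma tmul0 v : tmul 0 v = 0.
Proof. exact: linear0. Qed.
Lemma tmul_tens a r v : tmul (tens a r) v = tmulr a r v.
Proof. exact: tliftE. Qed.
#[local] Opaque tmul.
Lemma tmulE a r a' r' : tmul (tens a r) (tens a' r') = tens (a * a') (r * r').
Proof. by rewrite tmul_tens tmulrE. Qed.
Lemma tmulr0' u : tmul u 0 = 0.
Proof.
elim/tensor_ind: u => [|a r u IH]; first exact: tmul0.
by rewrite (tmulDl (tens a r) u) IH tmul_tens tmulr0 addr0.
Qed.
Lemma tmulDr u v v' : tmul u (v + v') = tmul u v + tmul u v'.
Proof.
elim/tensor_ind: u => [|a r u IH]; first by rewrite !tmul0 addr0.
rewrite !(tmulDl (tens a r) u) IH.
rewrite !(tmul_tens a r).
rewrite (tmulrD a r).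
exact: addrACA.
Qed.
Lemma tmul_axioms : [/\ associative tmul, commutative tmul, left_id (tens 1 1) tmul &
  left_distributive tmul +%R].
Proof.
have H := @bilinear_mul_axioms A R T (@tens k A R) (@tensor_ind _ A R) tmul tmul0 tmulr0' tmulDl tmulDr tmulE.
refine H.
Qed.

#[local] Transparent tens tmulr tmul.
Definition talg : Type := tensor A R.
HB.instance Definition _ := GRing.Lmodule.on talg.

(** The unit point of U, evaluated at a and multiplied by r, is a bilinear map that takes the value
    1 on the unit tensor. *)
Lemma talg_one_neq0 : (tens 1 1 : talg) != 0.
Proof.
have be : bilin (fun (a : A) (r : R) => sone U R a * r).
  split=> [r c a a'|a c r r']; first by rewrite linearP mulrDl scalerAl.
  by rewrite mulrDr scalerAr.
apply/eqP => /(congr1 (tlift be)); rewrite tliftE linear0 mulr1 rmorph1 => /eqP.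
by rewrite oner_eq0.
Qed.

HB.instance Definition _ := GRing.Zmodule_isComNzRing.Build talg
  (let: And4 a _ _ _ := tmul_axioms in a) (let: And4 _ c _ _ := tmul_axioms in c)
  (let: And4 _ _ e _ := tmul_axioms in e) (let: And4 _ _ _ d := tmul_axioms in d)
  talg_one_neq0.

Lemma talg_scaleAl c (u v : talg) : c *: (u * v) = c *: u * v.
Proof. exact/esym/tmulZl. Qed.
HB.instance Definition _ := GRing.Lmodule_isLalgebra.Build k talg talg_scaleAl.
HB.instance Definition _ := GRing.Lalgebra_isComAlgebra.Build k talg.

Definition tfst_fun (a : A) : talg := tens a 1.
Lemma tfst_linear : linear tfst_fun.
Proof. by have [tl _] := tens_bilin A R; exact: tl. Qed.
Lemma tfst_monoid : monoid_morphism tfst_fun.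
Proof. by split=> // a b; rewrite [RHS]tmulE mulr1. Qed.
Definition tfst : {lrmorphism A -> talg} :=
  HB.pack tfst_fun (GRing.isLinear.Build _ _ _ _ tfst_fun tfst_linear)
    (GRing.isMonoidMorphism.Build _ _ tfst_fun tfst_monoid).

Definition tsnd_fun (r : R) : talg := tens 1 r.
Lemma tsnd_linear : linear tsnd_fun.
Proof. by have [_ tr] := tens_bilin A R; exact: tr. Qed.
Lemma tsnd_monoid : monoid_morphism tsnd_fun.
Proof. by split=> // a b; rewrite [RHS]tmulE mulr1. Qed.
Definition tsnd : {lrmorphism R -> talg} :=
  HB.pack tsnd_fun (GRing.isLinear.Build _ _ _ _ tsnd_fun tsnd_linear)
    (GRing.isMonoidMorphism.Build _ _ tsnd_fun tsnd_monoid).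

Lemma tfst_tsnd a r : tfst a * tsnd r = tens a r.
Proof. by rewrite [LHS]tmulE mulr1 mul1r. Qed.

Section Pair.
Variables (S : comAlgType k) (x : points U S) (h : {lrmorphism R -> S}).
Lemma tpair_bilin : bilin (fun a r => x a * h r).
Proof.
split=> [r c a a'|a c r r']; rewrite linearP.
  by rewrite mulrDl scalerAl.
by rewrite mulrDr scalerAr.
Qed.
Lemma tpair_monoid : monoid_morphism (tlift tpair_bilin : talg -> S).
Proof.
split=> [|u v]; first by rewrite [LHS]tliftE !rmorph1 mulr1.
pose F (w : talg) : S := tlift tpair_bilin w; rewrite -![tlift _ _]/(F _).
have FD (w w' : talg) : F (w + w') = F w + F w' by exact: (linearD (tlift tpair_bilin)).
have F0 : F 0 = 0 by exact: (linear0 (tlift tpair_bilin)).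
have FE a r : F (tens a r) = x a * h r by exact: (tliftE tpair_bilin).
apply: (@bilinear_mul_morph A R talg S (@tens k A R) (@tensor_ind _ A R) tmulE F _ F0 FD FE) => *.
by rewrite !rmorphM mulrACA.
Qed.
Definition tpair : {lrmorphism talg -> S} :=
  HB.pack (tlift tpair_bilin : talg -> S)
    (GRing.isMonoidMorphism.Build _ _ (tlift tpair_bilin : talg -> S) tpair_monoid)
    (GRing.isLinear.Build _ _ _ _ (tlift tpair_bilin : talg -> S) (tensor_lift_is_linear tpair_bilin)).
Lemma tpairE a r : tpair (tens a r) = x a * h r.
Proof. exact: (tliftE tpair_bilin). Qed.
Lemma tpair_sum (I : Type) (s : seq I) (a : I -> A) (r : I -> R) :
  tpair (\sum_(i <- s) (tens (a i) (r i) : tensor A R)) = \sum_(i <- s) x (a i) * h (r i).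
Proof.
rewrite (linear_sum (tlift tpair_bilin)); apply: eq_bigr => i _; exact: tliftE.
Qed.
End Pair.

(** The two inclusions into the tensor product are the universal pair of a point of U and a morphism
    from R; at this pair the hypothesis says that the sum of pure tensors vanishes. *)
Lemma points_tensor (s : seq (A * R)) :
  (forall (S : comAlgType k) (x : points U S) (h : {lrmorphism R -> S}),
    \sum_(b <- s) x b.1 * h b.2 = 0) ->
  forall (W : lmodType k) (beta : A -> R -> W), bilin beta -> \sum_(b <- s) beta b.1 b.2 = 0.
Proof.
move=> s0 W beta bb; have := s0 talg tfst tsnd.
under eq_bigr do rewrite tfst_tsnd.
move/(congr1 (tlift bb)); rewrite linear0 (linear_sum (tlift bb)) => e; rewrite -[RHS]e.
by apply: eq_bigr => b _; rewrite tliftE.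
Qed.

End TensorAlgebra.

Section Coproduct.
Variables (k : fieldType) (U : affGrpSch k).
Local Notation A := (coord U).

(** The coproduct, by Yoneda: the product of the two universal points with values in the tensor
    square of the coordinate ring. *)
Definition Delta (a : A) : talg U A := smul (tfst U A) (tsnd U A : points U _) a.

Lemma DeltaP (R : comAlgType k) (x y : points U R) a : smul x y a = tpair x y (Delta a).
Proof.
have /(congr1 (fun f : {lrmorphism A -> R} => f a)) := smul_comp (tpair x y) (tfst U A) (tsnd U A : points U _).
rewrite /= => ->; congr (smul _ _ a); apply: lrmorph_eq => b /=.
  by rewrite [RHS]tpairE rmorph1 mulr1.
by rewrite [RHS]tpairE rmorph1 mul1r.
Qed.

Lemma coproductP a : exists s : seq (A * A),
  forall (R : comAlgType k) (x y : points U R), smul x y a = \sum_(b <- s) x b.1 * y b.2.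
Proof.
have [s sE] := tensor_sum (Delta a); exists s => R x y.
by rewrite DeltaP sE tpair_sum.
Qed.

(** The axioms give unit and inverse on the left; the right versions follow by the classical
    argument with the inverse of the inverse. *)
Lemma smulx1 (R : comAlgType k) (x : points U R) : smul x (sone U R) = x.
Proof.
have xV : smul x (sinv x) = sone U R.
  rewrite -[LHS]smul1x -{1}(smulVx (sinv x)) -!smulA (smulA (sinv x)) smulVx smul1x.
  exact: smulVx.
by rewrite -(smulVx x) smulA xV smul1x.
Qed.

Lemma smulxV (R : comAlgType k) (x : points U R) : smul x (sinv x) = sone U R.
Proof.
rewrite -[LHS]smul1x -{1}(smulVx (sinv x)) -!smulA (smulA (sinv x)) smulVx smul1x.
exact: smulVx.
Qed.

Lemma smul_inv_uniq (R : comAlgType k) (x y : points U R) :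
  smul y x = sone U R -> y = sinv x.
Proof. by move=> yx; rewrite -[y]smulx1 -(smulxV x) smulA yx smul1x. Qed.

Lemma sone_comp (R S : comAlgType k) (h : {lrmorphism R -> S}) :
  h \o sone U R = sone U S :> points U S.
Proof.
have e := smul_comp h (sone U R) (sone U R); rewrite smul1x in e.
have := congr1 (smul (sinv (h \o sone U R : points U S))) e.
by rewrite smulA !smulVx smul1x => <-.
Qed.

Lemma sinv_comp (R S : comAlgType k) (h : {lrmorphism R -> S}) (x : points U R) :
  h \o sinv x = sinv (h \o x : points U S) :> points U S.
Proof. by apply: smul_inv_uniq; rewrite -smul_comp smulVx sone_comp. Qed.

Lemma sinvK (R : comAlgType k) (x : points U R) : sinv (sinv x) = x.
Proof. by apply/esym/smul_inv_uniq; rewrite smulxV. Qed.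

Lemma sinvM (R : comAlgType k) (x y : points U R) :
  sinv (smul x y) = smul (sinv y) (sinv x).
Proof.
by apply/esym/smul_inv_uniq; rewrite -smulA (smulA (sinv x)) smulVx smul1x smulVx.
Qed.

Definition idpt : points U A := idfun.

End Coproduct.

Section FunctionalBilinear.
Variables (k : fieldType) (A : lmodType k).

Lemma bilin_scale (B W : lmodType k) (f : {linear A -> k^o}) (g : {linear B -> W}) :
  bilin (fun a b => (f a : k) *: g b).
Proof.
split=> [b c a a'|a c b b'] /=; rewrite linearP; first by rewrite scalerDl scalerA.
by rewrite scalerDr !scalerA mulrC.
Qed.

Lemma bilin_scaler (B W : lmodType k) (f : {linear B -> k^o}) (g : {linear A -> W}) :
  bilin (fun a b => (f b : k) *: g a).
Proof.
split=> [b c a a'|a c b b'] /=; rewrite linearP; first by rewrite scalerDr !scalerA mulrC.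
by rewrite scalerDl scalerA.
Qed.

Lemma bilin_prod (B : lmodType k) (f : {linear A -> k^o}) (g : {linear B -> k^o}) :
  bilin (fun a b => (f a * g b : k^o)).
Proof. exact: (bilin_scale f g). Qed.

End FunctionalBilinear.

Section Scalars.
Variables (k : fieldType) (R : comAlgType k).
Definition scalar_fun (c : k^o) : R := (c : k)%:A.
Lemma scalar_linear : linear scalar_fun.
Proof. by move=> c a b; rewrite /scalar_fun scalerDl -scalerA. Qed.
Lemma scalar_monoid : monoid_morphism scalar_fun.
Proof.
split; first by rewrite /scalar_fun scale1r.
by move=> a b; rewrite /scalar_fun -scalerAl mul1r scalerA.
Qed.
Definition scalars : {lrmorphism k^o -> R} :=
  HB.pack scalar_fun (GRing.isLinear.Build _ _ _ _ scalar_fun scalar_linear)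
    (GRing.isMonoidMorphism.Build _ _ scalar_fun scalar_monoid).
Lemma soneE (U : affGrpSch k) a : sone U R a = (sone U k^o a : k)%:A.
Proof. by rewrite -(sone_comp U scalars). Qed.
End Scalars.

Section LocalFiniteness.
Variables (k : fieldType) (U : affGrpSch k).
Local Notation A := (coord U).
Local Notation functional := {linear A -> k^o}.

Definition decomposes (a : A) (s : seq (A * A)) :=
  forall (R : comAlgType k) (x y : points U R), smul x y a = \sum_(b <- s) x b.1 * y b.2.

Definition cdec (a : A) : seq (A * A) := projT1 (cid (coproductP a)).
Lemma cdecP a : decomposes a (cdec a).
Proof. by rewrite /cdec; case: cid. Qed.

Lemma points_tensor_eq (R : comAlgType k) (I J : Type) (s : seq I) (t : seq J)
    (a : I -> A) (r : I -> R) (a' : J -> A) (r' : J -> R) :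
  (forall (S : comAlgType k) (x : points U S) (h : {lrmorphism R -> S}),
    \sum_(i <- s) x (a i) * h (r i) = \sum_(i <- t) x (a' i) * h (r' i)) ->
  forall (W : lmodType k) (beta : A -> R -> W), bilin beta ->
    \sum_(i <- s) beta (a i) (r i) = \sum_(i <- t) beta (a' i) (r' i).
Proof.
move=> st W beta bb; apply/eqP; rewrite -subr_eq0; apply/eqP.
have bN b c : beta (- b) c = - beta b c.
  pose f : {linear A -> W} := HB.pack (beta^~ c) (GRing.isLinear.Build _ _ _ _ (beta^~ c) (bb.1 c)).
  exact: (linearN f).
have := @points_tensor k U R ([seq (a i, r i) | i <- s] ++ [seq (- a' i, r' i) | i <- t]) _ W beta bb.
rewrite big_cat !big_map /=; under [in X in _ + X]eq_bigr do rewrite bN.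
rewrite sumrN; apply=> S x h; rewrite big_cat !big_map /=.
by under [in X in _ + X]eq_bigr do rewrite linearN mulNr; rewrite sumrN st subrr.
Qed.

(** A morphism from [talg U R] is a point of U together with a morphism from R, so three factors
    reduce to two. *)
Lemma points_tensor3_eq (R : comAlgType k) (I J : Type) (s : seq I) (t : seq J)
    (a b : I -> A) (r : I -> R) (a' b' : J -> A) (r' : J -> R) :
  (forall (S : comAlgType k) (x y : points U S) (h : {lrmorphism R -> S}),
    \sum_(i <- s) x (a i) * y (b i) * h (r i) = \sum_(i <- t) x (a' i) * y (b' i) * h (r' i)) ->
  forall (W W' : lmodType k) (f : {linear A -> k^o}) (beta : A -> R -> W), bilin beta ->
    \sum_(i <- s) (f (a i) : k) *: beta (b i) (r i) = \sum_(i <- t) (f (a' i) : k) *: beta (b' i) (r' i).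
Proof.
move=> st W _ f beta bb.
pose g : {linear talg U R -> W} := tlift bb.
have gE b0 r0 : g (tens b0 r0) = beta b0 r0 by exact: (tliftE bb).
under eq_bigr do rewrite -gE.
under [RHS]eq_bigr do rewrite -gE.
apply: (@points_tensor_eq (talg U R) _ _ s t a (fun i => tens (b i) (r i)) a' (fun i => tens (b' i) (r' i)) _ _ _ (bilin_scale f g)).
move=> S x h; have := st S x (h \o tfst U R) (h \o tsnd U R).
have hE b0 r0 : h (tens b0 r0) = h (tfst U R b0) * h (tsnd U R r0).
  by rewrite -rmorphM; congr (h _); exact/esym/tfst_tsnd.
move=> e; under eq_bigr do rewrite hE mulrA.
by under [RHS]eq_bigr do rewrite hE mulrA.
Qed.

Section Contract.
Variables (W : lmodType k) (beta : A -> A -> W) (bb : bilin beta).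

Definition contract (a : A) : W := \sum_(b <- cdec a) beta b.1 b.2.

Lemma contractE a s : decomposes a s -> contract a = \sum_(b <- s) beta b.1 b.2.
Proof.
move=> as_; apply: (points_tensor_eq (a := fst) (r := snd) (a' := fst) (r' := snd)) => // S x h.
by rewrite -(cdecP a x (h : points U S)) (as_ _ x (h : points U S)).
Qed.

Lemma contract_linear : linear contract.
Proof.
move=> c a a'; rewrite (@contractE _ ([seq (c *: d.1, d.2) | d <- cdec a] ++ cdec a')).
  rewrite big_cat big_map scaler_sumr; congr (_ + _); apply: eq_bigr => d _ /=.
  by have := bb.1 d.2 c d.1 0; rewrite addr0 => ->;
    have := bb.1 d.2 (-1) 0 0; rewrite scaler0 addr0 scaleN1r addNr => ->; rewrite addr0.
move=> R x y.
have -> : smul x y (c *: a + a') = c *: smul x y a + smul x y a' by exact: linearP.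
rewrite (cdecP a) (cdecP a') big_cat big_map scaler_sumr; congr (_ + _).
by apply: eq_bigr => d _; rewrite linearZ scalerAl.
Qed.

Lemma contractl_sig : {L : {linear A -> W} |
  forall a s, decomposes a s -> L a = \sum_(b <- s) beta b.1 b.2}.
Proof.
pose L : {linear A -> W} := HB.pack contract (GRing.isLinear.Build _ _ _ _ contract contract_linear).
by exists L => a s /contractE.
Qed.
Definition contractl : {linear A -> W} := sval contractl_sig.
Lemma contractlE a s : decomposes a s -> contractl a = \sum_(b <- s) beta b.1 b.2.
Proof. exact: (svalP contractl_sig). Qed.
End Contract.

Definition id_lin : {linear A -> A} := idfun.
(** In Sweedler notation, [rmul f a] is f(a_2) a_1, [lmul f a] is f(a_1) a_2 and [fconv f g] is the
    convolution f(a_1) g(a_2). For a rational point f the first two are the translations by f. *)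
Definition rmul (f : functional) : {linear A -> A} := contractl (bilin_scaler f id_lin).
Definition lmul (f : functional) : {linear A -> A} := contractl (bilin_scale f id_lin).
Definition fconv (f g : functional) : functional := contractl (bilin_prod f g).

Lemma functional_comb n (c : 'I_n -> k) (f : 'I_n -> functional) :
  exists g : functional, forall x, g x = \sum_l c l * (f l x : k) :> k.
Proof.
pose g (x : A) : k^o := \sum_l c l * (f l x : k).
have g_lin : linear g.
  move=> d x y; rewrite /g scaler_sumr -big_split; apply: eq_bigr => l _ /=.
  by rewrite linearP mulrDr; congr (_ + _); rewrite mulrCA.
pose L : functional := HB.pack g (GRing.isLinear.Build _ _ _ _ g g_lin).
by exists L.
Qed.

Lemma functional_sum_scale (I : Type) (s : seq I) (c : I -> k) (a : I -> A) (f : functional)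
    (W : lmodType k) (v : W) :
  (f (\sum_(i <- s) c i *: a i) : k) *: v = \sum_(i <- s) (c i * (f (a i) : k)) *: v.
Proof.
rewrite -scaler_suml; congr (_ *: _); rewrite linear_sum; by apply: eq_bigr => i _; rewrite linearZ.
Qed.

(** Coassociativity contracted twice, read off associativity of points; it makes the set of
    translates of one element stable under further translation. *)
Lemma rmul_rmul f g a : rmul g (rmul f a) = rmul (fconv g f) a.
Proof.
rewrite [rmul f a](contractlE _ (cdecP a)) [RHS](contractlE _ (cdecP a)) linear_sum.
transitivity (\sum_(t <- [seq (c.2, b.2, c.1) | b <- cdec a, c <- cdec b.1])
    (g t.1.1 : k) *: ((f t.1.2 : k) *: id_lin t.2)).
  rewrite big_allpairs_dep; apply: eq_bigr => b _; rewrite linearZ /=.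
  rewrite [rmul g _](contractlE _ (cdecP _)) scaler_sumr.
  by apply: eq_bigr => c _ /=; rewrite !scalerA mulrC.
rewrite (@points_tensor3_eq A _ _ _ [seq (c.1, c.2, b.1) | b <- cdec a, c <- cdec b.2]
  (fun t => t.1.1) (fun t => t.1.2) (fun t => t.2) (fun t => t.1.1) (fun t => t.1.2)
  (fun t => t.2) _ A A g (fun b c => (f b : k) *: id_lin c) (bilin_scale f id_lin)); last first.
  move=> S x y z; pose z' : points U S := z.
  transitivity (smul (smul z' x) y a).
    rewrite cdecP big_allpairs_dep; apply: eq_bigr => b _; rewrite cdecP mulr_suml.
    by apply: eq_bigr => c _ /=; rewrite mulrC mulrA.
  rewrite -smulA cdecP big_allpairs_dep; apply: eq_bigr => b _; rewrite cdecP mulr_sumr.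
  by apply: eq_bigr => c _ /=; rewrite mulrC.
rewrite big_allpairs_dep; apply: eq_bigr => b _.
rewrite [fconv g f _](contractlE _ (cdecP _)) scaler_suml.
by apply: eq_bigr => c _ /=; rewrite scalerA.
Qed.

Lemma sone_rmul a : rmul (sone U k^o) a = a.
Proof.
have := congr1 (fun x : points U A => x a) (smulx1 (idpt U)); rewrite /= cdecP => e.
rewrite [LHS](contractlE _ (cdecP a)) -[RHS]e; apply: eq_bigr => b _ /=.
by rewrite (soneE A) mulr_algr.
Qed.

(** The translates [rmul f c] span a space of finite dimension, because finitely many second factors
    occur in a decomposition of c. On spanning vectors e_j the coproduct is the sum of the e_i
    tensor m_ij; coassociativity makes m a corepresentation, and the counit writes e_j in terms of
    the m_ij. *)
Lemma local_finiteness (c : A) :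
  exists r (e : 'I_r -> A) (m : 'I_r -> 'I_r -> A),
    [/\ exists d : 'I_r -> k, c = \sum_i d i *: e i,
        forall j, exists d : 'I_r -> k, e j = \sum_i d i *: m i j,
        forall (R : comAlgType k) (x y : points U R) j, smul x y (e j) = \sum_i x (e i) * y (m i j) &
        forall (R : comAlgType k) (x y : points U R) i j,
          smul x y (m i j) = \sum_l x (m i l) * y (m l j)].
Proof.
have [n [phi [C tE]]] := dual_basis (fun i : 'I_(size (cdec c)) => (nth (0, 0) (cdec c) i).2).
pose a j := rmul (phi j) c.
have rmulE f : rmul f c = \sum_j (f (\sum_l C j l *: (nth (0, 0) (cdec c) l).2) : k) *: a j.
  rewrite [LHS](contractlE _ (cdecP c)) (big_nth (0, 0)) big_mkord.
  transitivity (\sum_(i < size (cdec c)) \sum_j ((phi j (nth (0, 0) (cdec c) i).2 : k) *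
       (f (\sum_l C j l *: (nth (0, 0) (cdec c) l).2) : k)) *: (nth (0, 0) (cdec c) i).1).
    apply: eq_bigr => i _; rewrite {1}tE functional_sum_scale.
    by apply: eq_bigr => j _.
  rewrite exchange_big; apply: eq_bigr => j _.
  rewrite /a [rmul _ _](contractlE _ (cdecP c)) (big_nth (0, 0)) big_mkord scaler_sumr.
  by apply: eq_bigr => i _; rewrite /= !scalerA mulrC.
have [r [psi [D aE]]] := dual_basis a.
(* The coefficient m_ij extracts the i-th coordinate from the first factor of the coproduct of
   e_j. *)
pose e j := \sum_l D j l *: a l; pose m i j := lmul (psi i) (e j).
have spanE f : rmul f c = \sum_i (psi i (rmul f c) : k) *: e i.
  rewrite rmulE; under [RHS]eq_bigr do rewrite functional_sum_scale.
  rewrite exchange_big; apply: eq_bigr => j _ /=.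
  under [RHS]eq_bigr do rewrite -scalerA.
  by rewrite -scaler_sumr -aE.
have rmulD f j : rmul f (e j) = \sum_i (psi i (rmul f (e j)) : k) *: e i.
  have [g gE] : exists g, rmul f (e j) = rmul g c.
    have [g0 g0E] := functional_comb (D j) phi.
    have -> : e j = rmul g0 c.
      rewrite [RHS](contractlE _ (cdecP c)) /e.
      under eq_bigr do rewrite /a [rmul _ _](contractlE _ (cdecP c)) scaler_sumr.
      rewrite exchange_big; apply: eq_bigr => b _.
      under eq_bigr do rewrite scalerA; rewrite -scaler_suml; congr (_ *: _).
      exact/esym/g0E.
    by exists (fconv f g0); rewrite rmul_rmul.
  by rewrite gE -spanE.
have smulE (R : comAlgType k) (x y : points U R) j : smul x y (e j) = \sum_i x (e i) * y (m i j).
  rewrite cdecP; pose F (f : functional) := [seq (e i, m i j) | i <- index_enum 'I_r].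
  apply/eqP; rewrite -subr_eq0; apply/eqP.
  (* Both sides are compared as functions of two functionals f and g, where the identity is f
     applied to the expansion of [rmul g (e j)] in the e_i. *)
  have := @tensor_vanishing k functional functional A _
    (functional_interpolated (iota := id_lin) (fun _ _ h => h)) A (fun a f => (f a : k)) _ _
    (cdec (e j) ++ [seq (- e i, m i j) | i <- index_enum 'I_r]) _ _ (prod_bilin x y).
  rewrite big_cat big_map /=; under [in X in _ + X]eq_bigr do rewrite linearN mulNr.
  rewrite sumrN; apply.
  - by move=> d b b' f; rewrite linearP.
  - exact: functional_sep.
  move=> f g; rewrite big_cat big_map /=; under [in X in _ + X]eq_bigr do rewrite linearN mulNr.
  rewrite sumrN; apply/eqP; rewrite subr_eq0; apply/eqP.
  transitivity (f (rmul g (e j)) : k).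
    rewrite [rmul g _](contractlE _ (cdecP _)) linear_sum; apply: eq_bigr => b _.
    by rewrite linearZ /= mulrC.
  rewrite rmulD linear_sum; apply: eq_bigr => i _; rewrite linearZ /= mulrC; congr (_ * _).
  rewrite /m [lmul _ _](contractlE _ (cdecP _)) [rmul g _](contractlE _ (cdecP _)) !linear_sum.
  by apply: eq_bigr => b _; rewrite [LHS]linearZ [RHS]linearZ; exact: mulrC.
exists r, e, m; split=> //.
- exists (fun i => psi i c); rewrite -[LHS]sone_rmul (spanE (sone U k^o)).
  by under eq_bigr do rewrite [rmul _ c]sone_rmul.
- move=> j; exists (fun i => sone U k^o (e i)).
  have := congr1 (fun x : points U A => x (e j)) (smul1x (idpt U)); rewrite /= smulE => {1}<-.
  by apply: eq_bigr => i _; rewrite (soneE A) mulr_algl.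
move=> R y z i j.
pose yz (b c : A) : R := y b * z c.
transitivity (\sum_(t <- [seq (b.1, d.1, d.2) | b <- cdec (e j), d <- cdec b.2])
    (psi i t.1.1 : k) *: yz t.1.2 t.2).
  rewrite /m [lmul _ _](contractlE _ (cdecP _)) linear_sum big_allpairs_dep.
  apply: eq_bigr => b _; rewrite linearZ /= cdecP scaler_sumr; exact: eq_bigr.
rewrite (@points_tensor3_eq A _ _ _ [seq (b.1, b.2, m l j) | l <- index_enum 'I_r, b <- cdec (e l)]
  (fun t => t.1.1) (fun t => t.1.2) (fun t => t.2) (fun t => t.1.1) (fun t => t.1.2)
  (fun t => t.2) _ R R (psi i) yz (prod_bilin y z)); last first.
  move=> S x' y' h; pose z' : points U S := h.
  transitivity (smul x' (smul y' z') (e j)).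
    rewrite cdecP big_allpairs_dep; apply: eq_bigr => b _; rewrite cdecP mulr_sumr.
    by apply: eq_bigr => d _ /=; rewrite mulrA.
  rewrite smulA smulE big_allpairs_dep; apply: eq_bigr => l _; rewrite cdecP mulr_suml.
  by apply: eq_bigr => d _.
rewrite big_allpairs_dep; apply: eq_bigr => l _.
transitivity ((\sum_(b <- cdec (e l)) (psi i b.1 : k) *: y b.2) * z (m l j)).
  by rewrite mulr_suml; apply: eq_bigr => b _; rewrite /= -scalerAl.
rewrite /m [lmul _ (e l)](contractlE _ (cdecP _)) (linear_sum y); congr (_ * _).
by apply: eq_bigr => b _; rewrite [RHS]linearZ.
Qed.

End LocalFiniteness.

(** * Sub-Hopf algebras and algebraic quotients *)

Section SubAlgebra.
Variables (k : fieldType) (B : comAlgType k) (P : set B) (sP : subalgebra P).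

Lemma subalgZ c x : P x -> P (c *: x).
Proof.
have [P1 PD PM] := sP; move=> Px.
have P0 : P 0 by have := PD (-1) 1 1 P1 P1; rewrite scaleN1r addNr.
by have := PD c x 0 Px P0; rewrite addr0.
Qed.
Lemma subalg0 : P 0.
Proof. by have [P1 PD PM] := sP; have := PD (-1) 1 1 P1 P1; rewrite scaleN1r addNr. Qed.
Lemma subalgD x y : P x -> P y -> P (x + y).
Proof. by have [P1 PD PM] := sP; move=> Px /(PD 1 x y Px); rewrite scale1r. Qed.
Lemma subalgN x : P x -> P (- x).
Proof. by move/(subalgZ (-1)); rewrite scaleN1r. Qed.
Lemma subalgM x y : P x -> P y -> P (x * y).
Proof. by have [P1 PD PM] := sP; exact: PM. Qed.
Lemma subalg1 : P 1.
Proof. by have [] := sP. Qed.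
Lemma subalg_sum (I : Type) (s : seq I) (c : I -> k) (f : I -> B) :
  (forall i, P (f i)) -> P (\sum_(i <- s) c i *: f i).
Proof.
move=> Pf; elim: s => [|i s IH]; first by rewrite big_nil; exact: subalg0.
by rewrite big_cons; apply: subalgD => //; exact: subalgZ.
Qed.

(** The membership field is written as a function of [sP], so that the type carries the closure
    properties from which its ring structure is built. *)
Record subalg := SubAlg { subval : B; _ : (fun _ : subalgebra P => `[< P subval >]) sP }.
HB.instance Definition _ := [isSub of subalg for subval].
HB.instance Definition _ := [Choice of subalg by <:].

Lemma subalgP (a : subalg) : P (subval a).
Proof. by case: a => x /= /asboolP. Qed.
Definition mksub x (Px : P x) : subalg := @SubAlg x (asboolT Px).

Definition sub_zero := mksub subalg0.
Definition sub_one := mksub subalg1.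
Definition sub_add a b := mksub (subalgD (subalgP a) (subalgP b)).
Definition sub_opp a := mksub (subalgN (subalgP a)).
Definition sub_mul a b := mksub (subalgM (subalgP a) (subalgP b)).
Definition sub_scale c a := mksub (subalgZ c (subalgP a)).

Lemma sub_addA : associative sub_add.
Proof. by move=> a b c; apply/val_inj/addrA. Qed.
Lemma sub_addC : commutative sub_add.
Proof. by move=> a b; apply/val_inj/addrC. Qed.
Lemma sub_add0 : left_id sub_zero sub_add.
Proof. by move=> a; apply/val_inj/add0r. Qed.
Lemma sub_addN : left_inverse sub_zero sub_opp sub_add.
Proof. by move=> a; apply/val_inj/addNr. Qed.
Lemma sub_mulA : associative sub_mul.
Proof. by move=> a b c; apply/val_inj/mulrA. Qed.
Lemma sub_mulC : commutative sub_mul.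
Proof. by move=> a b; apply/val_inj/mulrC. Qed.
Lemma sub_mul1 : left_id sub_one sub_mul.
Proof. by move=> a; apply/val_inj/mul1r. Qed.
Lemma sub_mulD : left_distributive sub_mul sub_add.
Proof. by move=> a b c; apply/val_inj/mulrDl. Qed.
Lemma sub_one_neq0 : sub_one != sub_zero.
Proof. by apply/eqP => /(congr1 subval)/eqP; rewrite /= oner_eq0. Qed.

HB.instance Definition _ := GRing.isZmodule.Build subalg sub_addA sub_addC sub_add0 sub_addN.
HB.instance Definition _ := GRing.Zmodule_isComNzRing.Build subalg
  sub_mulA sub_mulC sub_mul1 sub_mulD sub_one_neq0.

Lemma sub_scaleA c d a : sub_scale c (sub_scale d a) = sub_scale (c * d) a.
Proof. exact/val_inj/scalerA. Qed.
Lemma sub_scale1 : left_id 1 sub_scale.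
Proof. by move=> a; apply/val_inj/scale1r. Qed.
Lemma sub_scaleDr : right_distributive sub_scale +%R.
Proof. by move=> c a b; apply/val_inj/scalerDr. Qed.
Lemma sub_scaleDl a : {morph sub_scale^~ a : c d / c + d}.
Proof. by move=> c d; apply/val_inj/scalerDl. Qed.
HB.instance Definition _ := GRing.Zmodule_isLmodule.Build k subalg
  sub_scaleA sub_scale1 sub_scaleDr sub_scaleDl.
Lemma sub_scaleAl c (a b : subalg) : c *: (a * b) = c *: a * b.
Proof. exact/val_inj/scalerAl. Qed.
HB.instance Definition _ := GRing.Lmodule_isLalgebra.Build k subalg sub_scaleAl.
HB.instance Definition _ := GRing.Lalgebra_isComAlgebra.Build k subalg.

Lemma subval_linear : linear subval. Proof. by []. Qed.
Lemma subval_monoid : monoid_morphism subval. Proof. by []. Qed.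
Definition subincl : {lrmorphism subalg -> B} :=
  HB.pack subval (GRing.isLinear.Build _ _ _ _ subval subval_linear)
    (GRing.isMonoidMorphism.Build _ _ subval subval_monoid).

Lemma subval_inj : injective subval. Proof. exact: val_inj. Qed.

Section Restrict.
Variables (C : comAlgType k) (f : {lrmorphism C -> B}) (fP : forall c, P (f c)).
Definition restr_fun c := mksub (fP c).
Lemma restr_linear : linear restr_fun.
Proof. by move=> c a b; apply: val_inj; rewrite /= linearP. Qed.
Lemma restr_monoid : monoid_morphism restr_fun.
Proof. by split=> [|a b]; apply: val_inj; rewrite /= ?rmorph1 ?rmorphM. Qed.
Definition restr : {lrmorphism C -> subalg} :=
  HB.pack restr_fun (GRing.isLinear.Build _ _ _ _ restr_fun restr_linear)
    (GRing.isMonoidMorphism.Build _ _ restr_fun restr_monoid).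
End Restrict.

End SubAlgebra.

Lemma alg_generatedP (k : fieldType) (A : comAlgType k) (S : set A) : subalgebra (alg_generated S).
Proof.
split=> [T [[]]//|c x y Sx Sy T [sT ST]|x y Sx Sy T [sT ST]].
  by apply: sT.1.2 || apply: (let: And3 _ h _ := sT in h); [exact: Sx|exact: Sy].
by apply: (let: And3 _ _ h := sT in h); [exact: Sx|exact: Sy].
Qed.

Lemma alg_generated_sub (k : fieldType) (A : comAlgType k) (S : set A) : S `<=` alg_generated S.
Proof. by move=> x Sx T [_]; exact. Qed.

Lemma alg_generated_min (k : fieldType) (A : comAlgType k) (S T : set A) :
  subalgebra T -> S `<=` T -> alg_generated S `<=` T.
Proof. by move=> sT ST x; apply. Qed.

Lemma lrmorph_generated (k : fieldType) (A B : comAlgType k) (S : set A) (f g : {lrmorphism A -> B}) :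
  (forall a, S a -> f a = g a) -> forall a, alg_generated S a -> f a = g a.
Proof.
move=> fg; apply: alg_generated_min => //; split=> /= [|c x y fx fy|x y fx fy].
- by rewrite !rmorph1.
- by rewrite 2!linearP /= fx fy.
- by rewrite 2!rmorphM /= fx fy.
Qed.

Section SubHopf.
Variables (k : fieldType) (U : affGrpSch k).
Local Notation A := (coord U).
Variables (P : set A) (sP : subalgebra P).
Local Notation B := (subalg sP).

Definition sub_dec (a : B) (s : seq (B * B)) :=
  decomposes (subval a) [seq (subval b.1, subval b.2) | b <- s].

Hypothesis P_dec : forall a : B, exists s, sub_dec a s.
Hypothesis P_inv : forall a : B, P (sinv (idpt U) (subval a)).

Local Notation functional := {linear A -> k^o}.
Definition sub_q (a : B) (f : functional) : k := f (subval a).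

Lemma sub_q_lin c a b f : sub_q (c *: a + b) f = c * sub_q a f + sub_q b f.
Proof. by rewrite /sub_q /= linearP. Qed.
Lemma sub_q_inj a : (forall f, sub_q a f = 0) -> a = 0.
Proof. by move=> /functional_sep a0; apply: val_inj. Qed.
Lemma sub_q_interp : interpolated sub_q.
Proof. exact: (@functional_interpolated k A B (subincl sP) (@subval_inj _ _ _ sP)). Qed.

Lemma sub_dec_uniq a s t : sub_dec a s -> sub_dec a t -> forall f g,
  \sum_(b <- s) sub_q b.1 f * sub_q b.2 g = \sum_(b <- t) sub_q b.1 f * sub_q b.2 g.
Proof.
move=> as_ at_ f g.
have := points_tensor_eq (a := fun b : B * B => subval b.1) (r := fun b => subval b.2)
  (a' := fun b : B * B => subval b.1) (r' := fun b => subval b.2) (s := s) (t := t) _ (bilin_prod f g).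
apply=> S x h; have := as_ S x (h : points U S); rewrite big_map /= => <-.
by have := at_ S x (h : points U S); rewrite big_map.
Qed.

Lemma sub_dec_lin c a b s t : sub_dec a s -> sub_dec b t ->
  sub_dec (c *: a + b) ([seq (c *: d.1, d.2) | d <- s] ++ t).
Proof.
move=> as_ bt R x y.
have -> : smul x y (subval (c *: a + b)) = c *: smul x y (subval a) + smul x y (subval b).
  by rewrite -linearP.
rewrite as_ bt map_cat big_cat !big_map scaler_sumr; congr (_ + _).
by apply: eq_bigr => d _ /=; rewrite linearZ scalerAl.
Qed.

Lemma sub_dec_1 : sub_dec 1 [:: (1, 1)].
Proof. by move=> R x y; rewrite big_seq1 /= !rmorph1 mulr1. Qed.

Lemma sub_dec_mul a b s t : sub_dec a s -> sub_dec b t ->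
  sub_dec (a * b) [seq (c.1 * d.1, c.2 * d.2) | c <- s, d <- t].
Proof.
move=> as_ bt R x y.
have -> : smul x y (subval (a * b)) = smul x y (subval a) * smul x y (subval b).
  by rewrite -rmorphM.
rewrite as_ bt !big_map big_distrl big_allpairs_dep; apply: eq_bigr => c _.
by rewrite big_distrr; apply: eq_bigr => d _ /=; rewrite !rmorphM mulrACA.
Qed.

Definition sub_e : {lrmorphism B -> k^o} := sone U k^o \o subincl sP.
Definition sub_S : {lrmorphism B -> B} := restr sP (f := sinv (idpt U) \o subincl sP) P_inv.

Lemma sub_dec_e a s : sub_dec a s -> \sum_(b <- s) (sub_e b.1 : k) *: b.2 = a.
Proof.
move=> as_; apply: val_inj; rewrite -[LHS]/(subincl sP _) linear_sum.
have e := congr1 (fun x : points U A => x (subval a)) (smul1x (idpt U)); rewrite -[RHS]e.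
rewrite as_ big_map; apply: eq_bigr => b _.
by rewrite linearZ /= soneE mulr_algl.
Qed.

Lemma sub_dec_S a s : sub_dec a s -> \sum_(b <- s) sub_S b.1 * b.2 = (sub_e a : k)%:A.
Proof.
move=> as_; apply: val_inj; rewrite -[LHS]/(subincl sP _) linear_sum.
have e := congr1 (fun x : points U A => x (subval a)) (smulVx (idpt U)).
transitivity (smul (sinv (idpt U)) (idpt U) (subval a)).
  by rewrite as_ big_map; apply: eq_bigr => b _.
by rewrite e soneE.
Qed.

Lemma sub_dec_coassoc a s d : sub_dec a s -> (forall b, sub_dec b (d b)) -> forall x y z,
  \sum_(b <- s) \sum_(c <- d b.2) sub_q b.1 x * sub_q c.1 y * sub_q c.2 z =
  \sum_(b <- s) \sum_(c <- d b.1) sub_q c.1 x * sub_q c.2 y * sub_q b.2 z.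
Proof.
move=> as_ dP f g h.
have := @points_tensor3_eq k U A _ _ [seq (b.1, c.1, c.2) | b <- s, c <- d b.2]
  [seq (c.1, c.2, b.2) | b <- s, c <- d b.1]
  (fun t => subval t.1.1) (fun t => subval t.1.2) (fun t => subval t.2) (fun t => subval t.1.1)
  (fun t => subval t.1.2) (fun t => subval t.2) _ k^o k^o f _ (bilin_prod g h).
rewrite !big_allpairs_dep /= => e.
under eq_bigr do under eq_bigr do rewrite -mulrA.
under [RHS]eq_bigr do under eq_bigr do rewrite -mulrA.
apply: e => S x y h'; pose z : points U S := h'.
rewrite !big_allpairs_dep /=; transitivity (smul (smul x y) z (subval a)).
  rewrite -smulA as_ big_map; apply: eq_bigr => b _; rewrite /= dP big_map mulr_sumr.
  by apply: eq_bigr => c _; rewrite mulrA.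
by rewrite as_ big_map; apply: eq_bigr => b _; rewrite /= dP big_map mulr_suml.
Qed.

Definition sub_hopf : affGrpSch k := hopf_grp sub_q_lin sub_q_inj sub_q_interp P_dec
  sub_dec_uniq sub_dec_lin sub_dec_1 sub_dec_mul sub_dec_e sub_dec_S sub_dec_coassoc.

Lemma sub_hopf_hom : @is_hom k U sub_hopf (subincl sP).
Proof.
move=> R x y; apply: lrmorph_eq => a; have [s as_] := P_dec a.
rewrite [RHS](hopf_smulE _ _ as_).
by rewrite [LHS]/= as_ big_map.
Qed.

End SubHopf.

(** The matrix coefficients m_ij of a finite-dimensional subcomodule through c, together with their
    antipodes, generate a sub-Hopf algebra: m is a corepresentation, and the antipode is an
    involution that reverses products. *)
Lemma algebraic_quotient_through (k : fieldType) (U : affGrpSch k) (c : coord U) :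
  exists (V : affGrpSch k) (q : {lrmorphism coord V -> coord U}),
    [/\ quotient_map q, algebraic V & exists c', q c' = c].
Proof.
have [r [e [m [cE eE _ mE]]]] := local_finiteness c.
set S := sinv (idpt U); pose gens := [set a | exists i j, a = m i j \/ a = S (m i j)].
have SS : forall a, S (S a) = a.
  move=> a; have := congr1 (fun x : points U (coord U) => x a) (sinv_comp S (idpt U)).
  by rewrite /= => ->; rewrite (_ : (S \o idpt U : points U _) = S) ?sinvK//; exact: lrmorph_eq.
have sinvE (R : comAlgType k) (x : points U R) a : sinv x a = x (S a).
  have /(congr1 (fun y : points U R => y a)) /= -> := sinv_comp x (idpt U).
  by congr (sinv _ a); exact: lrmorph_eq.
pose P := alg_generated gens; have sP : subalgebra P := alg_generatedP gens.
have decP : P `<=` [set a | exists s : seq (subalg sP * subalg sP),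
    decomposes a [seq (subval b.1, subval b.2) | b <- s]].
  apply: alg_generated_min.
    split=> [|d x y [s xs] [t yt]|x y [s xs] [t yt]].
    - by exists [:: (1, 1)] => R x y; rewrite big_seq1 /= !rmorph1 mulr1.
    - exists ([seq (d *: b.1, b.2) | b <- s] ++ t) => R u v.
      have -> : smul u v (d *: x + y) = d *: smul u v x + smul u v y by rewrite -linearP.
      rewrite map_cat big_cat xs yt !big_map scaler_sumr; congr (_ + _).
      by apply: eq_bigr => b _ /=; rewrite linearZ scalerAl.
    - exists [seq (b.1 * d.1, b.2 * d.2) | b <- s, d <- t] => R u v.
      have -> : smul u v (x * y) = smul u v x * smul u v y by rewrite -rmorphM.
      rewrite xs yt !big_map big_distrl big_allpairs_dep; apply: eq_bigr => b _.
      by rewrite big_distrr; apply: eq_bigr => d _ /=; rewrite !rmorphM mulrACA.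
  have Pm i j : P (m i j) by apply: alg_generated_sub; exists i, j; left.
  have PS i j : P (S (m i j)) by apply: alg_generated_sub; exists i, j; right.
  move=> _ [i [j [->|->]]].
    exists [seq (mksub sP (Pm i l), mksub sP (Pm l j)) | l <- index_enum 'I_r] => R x y.
    by rewrite mE !big_map.
  exists [seq (mksub sP (PS l j), mksub sP (PS i l)) | l <- index_enum 'I_r] => R x y.
  rewrite -sinvE sinvM mE !big_map; apply: eq_bigr => l _ /=.
  by rewrite (sinvE _ x) (sinvE _ y) mulrC.
have invP : P `<=` [set a | P (S a)].
  apply: alg_generated_min; last first.
    move=> _ [i [j [->|->]]]; apply: alg_generated_sub; exists i, j; [by right|left].
    by rewrite SS.
  have [P1 PD PM] := sP; split=> [|d x y Px Py|x y Px Py] /=.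
  - by rewrite rmorph1.
  - by rewrite linearP; exact: PD.
  - by rewrite rmorphM; exact: PM.
have Pdec (a : subalg sP) : exists s, sub_dec a s by exact: (decP _ (subalgP a)).
have Pinv (a : subalg sP) : P (sinv (idpt U) (subval a)) by exact: (invP _ (subalgP a)).
exists (sub_hopf Pdec Pinv), (subincl sP); split.
- by split; [exact: sub_hopf_hom | exact: subval_inj].
- have Pm i j : P (m i j) by apply: alg_generated_sub; exists i, j; left.
  have PS i j : P (S (m i j)) by apply: alg_generated_sub; exists i, j; right.
  exists ([seq mksub sP (Pm i j) | i <- enum 'I_r, j <- enum 'I_r] ++
          [seq mksub sP (PS i j) | i <- enum 'I_r, j <- enum 'I_r]).
  set s := _ ++ _; apply/seteqP; split=> // a _; case: a => a aP.
  have Pa : P a by apply/asboolP; exact: aP.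
  (* Generation is known inside [coord U]; Q transports it to the subalgebra, for every proof of
     membership. *)
  pose Q := [set x | forall Px : P x, alg_generated [set` s] (mksub sP Px)].
  suff Qa : Q a by have := Qa Pa; congr alg_generated; exact: val_inj.
  have [G1 GD GM] := alg_generatedP [set` s].
  suff : alg_generated gens a -> P a /\ Q a by move=> /(_ Pa)[].
  have [P1 PD PM] := sP.
  apply: (@alg_generated_min _ _ gens (P `&` Q)).
    split=> [|d x y [Px Qx] [Py Qy]|x y [Px Qx] [Py Qy]].
    - by split=> // P1'; move: G1; congr alg_generated; exact: val_inj.
    - split; first exact: PD.
      by move=> Pxy; have := GD d _ _ (Qx Px) (Qy Py); congr alg_generated; exact: val_inj.
    - split; first exact: PM.
      by move=> Pxy; have := GM _ _ (Qx Px) (Qy Py); congr alg_generated; exact: val_inj.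
  move=> _ [i [j [->|->]]]; (split; first by []) => Px; apply: alg_generated_sub; rewrite /= mem_cat.
    by apply/orP; left; apply/allpairsP; exists (i, j); rewrite !mem_enum; split=> //; exact: val_inj.
  by apply/orP; right; apply/allpairsP; exists (i, j); rewrite !mem_enum; split=> //; exact: val_inj.
have Pc : P c.
  have [d ->] := cE; apply: (subalg_sum sP) => i; have [d' ->] := eE i.
  by apply: (subalg_sum sP) => j; apply: alg_generated_sub; exists j, i; left.
by exists (mksub sP Pc).
Qed.

(** * Exponential and logarithm on unipotent groups *)

Section StrictlyUpper.
Variables (R : comNzRingType) (m : nat).

(** Each factor X moves at least one step above the diagonal. *)
Lemma strict_upper_exp (X : 'M[R]_m) : (forall i j : 'I_m, (j <= i)%N -> X i j = 0) ->
  forall n (i j : 'I_m), (j < i + n)%N -> (X ^+ n) i j = 0.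
Proof.
move=> X0; elim=> [|n IH] i j.
  rewrite addn0 expr0 => ji; rewrite mxE; case: eqP => // ij; by rewrite ij ltnn in ji.
rewrite exprS => ji; rewrite mxE big1// => l _.
have [li|il] := leqP l i; first by rewrite X0 ?mul0r.
by rewrite IH ?mulr0//; apply: (leq_trans ji); rewrite addnS -addSn leq_add2r.
Qed.

Lemma strict_upper_nilp (X : 'M[R]_m) n : (forall i j : 'I_m, (j <= i)%N -> X i j = 0) ->
  (m <= n)%N -> X ^+ n = 0.
Proof.
move=> X0 mn; apply/matrixP => i j; rewrite mxE (strict_upper_exp X0)//.
exact: (leq_trans (ltn_ord j) (leq_trans mn (leq_addl _ _))).
Qed.

End StrictlyUpper.

Section BinomialPolynomials.
Variables (K : fieldType) (ch0 : forall n, ((n%:R : K) == 0) = (n == 0)%N).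

Lemma fact_neq0 n : (n`!%:R : K) != 0.
Proof. by rewrite ch0 -lt0n fact_gt0. Qed.

(** The binomial coefficient X (X - 1) ... (X - j + 1) / j! as a polynomial, to be evaluated at
    p-adic integers as well. *)
Definition binp j : {poly K} := (j`!%:R)^-1 *: \prod_(i < j) ('X - i%:R%:P).

Lemma binpE j n : (binp j).[n%:R] = 'C(n, j)%:R.
Proof.
rewrite /binp hornerZ horner_prod; apply: (mulfI (fact_neq0 j)).
rewrite mulrA mulfV ?fact_neq0// mul1r -natrM mulnC bin_ffact.
elim: j => [|j IH]; first by rewrite big_ord0 ffactn0.
rewrite big_ord_recr /= IH ffactnSr natrM !hornerE.
have [jn|nj] := leqP j n; first by rewrite natrB.
by rewrite ffact_small// !mul0r.
Qed.

Lemma binp_size j : (size (binp j) <= j.+1)%N.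
Proof.
apply: (leq_trans (size_scale_leq _ _)).
elim: j => [|j IH]; first by rewrite big_ord0 size_poly1.
rewrite big_ord_recr /= (leq_trans (size_polyMleq _ _))// size_XsubC addn2 /=.
by rewrite ltnS.
Qed.

Lemma poly_nat_eq (P Q : {poly K}) : (forall n : nat, P.[n%:R] = Q.[n%:R]) -> P = Q.
Proof.
move=> PQ; apply/eqP; rewrite -subr_eq0; apply/negPn/negP => nz.
pose s := [seq (n%:R : K) | n <- iota 0 (size (P - Q))].
have us : uniq s.
  rewrite map_inj_uniq ?iota_uniq// => a b /eqP; rewrite -subr_eq0.
  wlog ab : a b / (b <= a)%N => [wl|].
    have [/wl//|/ltnW/wl h] := leqP b a; rewrite -oppr_eq0 opprB => /h.
    exact: esym.
  by rewrite -natrB// ch0 subn_eq0 => ba; apply/eqP; rewrite eqn_leq ab ba.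
have rs : all (root (P - Q)) s.
  by apply/allP => _ /mapP[n _ ->]; rewrite /root !hornerE PQ subrr.
by have := max_poly_roots nz rs us; rewrite size_map size_iota ltnn.
Qed.

End BinomialPolynomials.

Lemma add_self_eq0 (M : zmodType) (x : M) : x = x + x -> x = 0.
Proof. by move=> xx; apply: (addrI x); rewrite -xx addr0. Qed.

Section DerivationExp.
Variables (K : fieldType) (ch0 : forall n, ((n%:R : K) == 0) = (n == 0)%N).
Variables (A : comAlgType K) (D : {linear A -> A}).
Hypothesis D_der : forall a b, D (a * b) = D a * b + a * D b.

(** Divided powers D ^ n / n!, for which the Leibniz formula has no binomial coefficients. *)
Definition divpow n a : A := (n`!%:R : K)^-1 *: iter n D a.

Lemma divpow_linear n : linear (divpow n).
Proof.
move=> c a b; rewrite /divpow (_ : iter n D _ = c *: iter n D a + iter n D b).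
  by rewrite scalerDr !scalerA mulrC.
by elim: n => [//|n IH] /=; rewrite IH linearP.
Qed.

Lemma D_divpow n a : D (divpow n a) = (n.+1)%:R *: divpow n.+1 a.
Proof.
rewrite /divpow linearZ /= scalerA factS natrM invfM mulrA mulfV ?mul1r//.
by rewrite ch0.
Qed.

Lemma divpowM n a b : divpow n (a * b) = \sum_(i < n.+1) divpow i a * divpow (n - i) b.
Proof.
elim: n => [|n IH]; first by rewrite big_ord1 /divpow /= !fact0 invr1 !scale1r.
have nz : ((n.+1)%:R : K) != 0 by rewrite ch0.
apply: (scalerI nz); rewrite -D_divpow IH linear_sum scaler_sumr.
under eq_bigr => i _ do rewrite D_der !D_divpow -(scalerAl _ (divpow i.+1 a))
  -(scalerAr _ (divpow i a)).
rewrite big_split /= [RHS](_ : _ = \sum_(i < n.+2) i%:R *: (divpow i a * divpow (n.+1 - i) b) +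
   \sum_(i < n.+2) (n.+1 - i)%:R *: (divpow i a * divpow (n.+1 - i) b)).
  rewrite [X in _ = X + _]big_ord_recl [X in _ = _ + X]big_ord_recr /= subnn !scale0r add0r addr0.
  congr (_ + _); apply: eq_bigr => i _.
  by rewrite subSn // -ltnS.
rewrite -big_split; apply: eq_bigr => i _ /=.
by rewrite -scalerDl -natrD subnKC // -ltnS.
Qed.

Lemma iter_der0 n b : iter n D b = 0 -> forall j, (n <= j)%N -> iter j D b = 0.
Proof.
by move=> b0 j /subnK <-; rewrite iterD b0; elim: (j - n)%N => [//|i /= ->]; exact: linear0.
Qed.

Lemma divpow_eq0 n b : iter n D b = 0 -> forall j, (n <= j)%N -> divpow j b = 0.
Proof. by move=> b0 j nj; rewrite /divpow (iter_der0 b0 nj) scaler0. Qed.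

Lemma iter_der_lin n n' c x y : iter n D x = 0 -> iter n' D y = 0 ->
  iter (n + n') D (c *: x + y) = 0.
Proof.
move=> nx ny; rewrite (_ : iter _ _ _ = c *: iter (n + n') D x + iter (n + n') D y).
  by rewrite (iter_der0 nx (leq_addr _ _)) (iter_der0 ny (leq_addl _ _)) scaler0 addr0.
by elim: (n + n')%N => [//|i /= ->]; rewrite linearP.
Qed.

Lemma iter_der_mul n n' x y : iter n D x = 0 -> iter n' D y = 0 -> iter (n + n') D (x * y) = 0.
Proof.
move=> nx ny; have nz : (((n + n')`!%:R : K)^-1) != 0 by rewrite invr_eq0 fact_neq0.
apply: (scalerI nz); rewrite scaler0 -[LHS]/(divpow (n + n') (x * y)) divpowM big1// => i _.
have [ni|ni] := leqP n i; first by rewrite (divpow_eq0 nx ni) mul0r.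
by rewrite (divpow_eq0 ny) ?mulr0//; lia.
Qed.

Lemma der1 : D 1 = 0.
Proof. by apply: add_self_eq0; have := D_der 1 1; rewrite !mulr1 mul1r. Qed.

Hypothesis D_nil : forall a, exists n, iter n D a = 0.

Lemma divpow_nil a : exists n, forall j, (n <= j)%N -> divpow j a = 0.
Proof.
have [n an] := D_nil a; exists n => j nj.
exact: divpow_eq0 an _ nj.
Qed.

Definition nil_deg a := projT1 (cid (divpow_nil a)).
Lemma nil_degP a j : (nil_deg a <= j)%N -> divpow j a = 0.
Proof. by rewrite /nil_deg; case: cid => n /= h; exact: h. Qed.

(** This is exp(t D)(a) as a polynomial in t. By [divpowM] it is multiplicative in a, and so is its
    value at t = 1. *)
Definition exp_poly a : {poly A} := \poly_(j < nil_deg a) divpow j a.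
Lemma exp_polyE a j : (exp_poly a)`_j = divpow j a.
Proof. by rewrite coef_poly; case: ltnP => // /nil_degP ->. Qed.

Definition expD a : A := (exp_poly a).[1].

Lemma expD_sum a n : (forall j, (n <= j)%N -> divpow j a = 0) -> expD a = \sum_(j < n) divpow j a.
Proof.
move=> an; rewrite /expD (_ : exp_poly a = \poly_(j < n) divpow j a).
  by rewrite horner_poly; apply: eq_bigr => j _; rewrite expr1n mulr1.
by apply/polyP => j; rewrite exp_polyE coef_poly; case: ltnP => // /an.
Qed.

Lemma expD_linear : linear expD.
Proof.
move=> c a b; pose n := maxn (nil_deg a) (nil_deg b).
have na j : (n <= j)%N -> divpow j a = 0.
  by move=> nj; apply: nil_degP; apply: leq_trans nj; exact: leq_maxl.
have nb j : (n <= j)%N -> divpow j b = 0.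
  by move=> nj; apply: nil_degP; apply: leq_trans nj; exact: leq_maxr.
rewrite (expD_sum na) (expD_sum nb) (@expD_sum _ n).
  rewrite scaler_sumr -big_split; apply: eq_bigr => j _; exact: divpow_linear.
by move=> j nj; rewrite divpow_linear na// nb// scaler0 addr0.
Qed.

Lemma expD_monoid : monoid_morphism expD.
Proof.
split=> [|a b].
  have d1 : iter 1 D 1 = 0 by exact: der1.
  by rewrite (expD_sum (divpow_eq0 d1)) big_ord1 /divpow /= fact0 invr1 scale1r.
rewrite /expD -hornerM; congr (_.[_]); apply/polyP => n.
rewrite exp_polyE coefM divpowM; apply: eq_bigr => i _; by rewrite !exp_polyE.
Qed.

Definition expDm : {lrmorphism A -> A} :=
  HB.pack expD (GRing.isLinear.Build _ _ _ _ expD expD_linear)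
    (GRing.isMonoidMorphism.Build _ _ expD expD_monoid).

End DerivationExp.

Lemma mul_sums_add (R : comNzRingType) (I J : Type) (s : seq I) (t : seq J) (u v : I -> R) (w z : J -> R) :
  \sum_(i <- s) \sum_(j <- t) (u i * w j + v i * z j) =
  (\sum_(i <- s) u i) * (\sum_(j <- t) w j) + (\sum_(i <- s) v i) * (\sum_(j <- t) z j).
Proof.
rewrite !big_distrl -big_split; apply: eq_bigr => i _ /=.
by rewrite !big_distrr -big_split.
Qed.

Lemma scalerMM (R : comNzRingType) (A : comAlgType R) (a b : R) (x y : A) :
  (a *: x) * (b *: y) = (a * b) *: (x * y).
Proof. by rewrite -scalerAl -scalerAr scalerA. Qed.

Section UnipotentLie.
Variables (K : fieldType) (ch0 : forall n, ((n%:R : K) == 0) = (n == 0)%N).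
Variables (V : affGrpSch K) (m : nat) (rho : 'M[coord V]_m).
Hypothesis emb : unitriangular_embedding rho.
Local Notation A := (coord V).

Let rho_tri (i j : 'I_m) : (j <= i)%N -> rho i j = (i == j)%:R.
Proof. by have [h _ _] := emb; exact: h. Qed.
Let rho_mul (R : comAlgType K) (x y : points V R) :
  map_mx (smul x y) rho = map_mx x rho *m map_mx y rho.
Proof. by have [_ h _] := emb; exact: h. Qed.
Let rho_gen (a : A) : alg_generated [set a | exists i j, a = rho i j] a.
Proof. by have [_ _ ->] := emb. Qed.

Lemma rho_points_eq (R : comAlgType K) (x y : points V R) : map_mx x rho = map_mx y rho -> x = y.
Proof.
move=> xy; apply: lrmorph_eq => a; apply: lrmorph_generated (rho_gen a).
by move=> _ [i [j ->]]; have /matrixP/(_ i j) := xy; rewrite !mxE.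
Qed.

Definition point_der : set (A -> K) :=
  [set d | (forall (c : K) a b, d (c *: a + b) = c * d a + d b) /\
           (forall a b, d (a * b) = sone V K^o a * d b + d a * sone V K^o b)].

Lemma Lie0 : point_der (fun _ : A => 0 : K).
Proof. by split=> [c a b|a b]; rewrite !mulr0 ?mul0r ?addr0. Qed.

Lemma LieD c (d d' : A -> K) : point_der d -> point_der d' -> point_der (fun a => c * d a + d' a).
Proof.
move=> [dl dd] [dl' dd']; split=> [e a b|a b]; first by rewrite dl dl'; ring.
by rewrite dd dd'; ring.
Qed.

(** The zeros of a point derivation form a subalgebra, so the entries of [rho], which generate,
    decide. *)
Lemma Lie_eq0 (d : A -> K) : point_der d -> (forall i j, d (rho i j) = 0) -> forall a, d a = 0.
Proof.
move=> [dl dd] d0 a; move: (rho_gen a).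
have d1 : d 1 = 0.
  have := dd 1 1; rewrite mulr1 (rmorph1 (sone V K^o)) mul1r mulr1; exact: add_self_eq0.
apply: (@alg_generated_min _ _ _ [set a | d a = 0]); last by move=> _ [i [j ->]] /=.
split=> [|c x y dx dy|x y dx dy] //=.
  by rewrite dl dx dy mulr0 addr0.
by rewrite dd dx dy mulr0 mul0r addr0.
Qed.

Lemma point_der_basis : exists r (x : 'I_r -> A) (e : 'I_r -> A -> K),
  dual_family point_der x e /\ forall f, point_der f -> forall y, f y = \sum_i f (x i) * e i y.
Proof.
have sL : fsubspace (point_der).
  split; first exact: Lie0.
  by move=> c f g; exact: LieD.
pose z (i : 'I_#|[the finType of ('I_m * 'I_m)%type]|) := rho (enum_val i).1 (enum_val i).2.
have [|r [x [e [[Le ex] eE]]]] := @interpolation K A point_der _ z sL.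
  move=> d Ld d0; apply: Lie_eq0 => // i j.
  by have := d0 (enum_rank (i, j)); rewrite /z enum_rankK.
by exists r, x, e.
Qed.

Section Exp.
Variables (d : A -> K) (Ld : point_der d).

Let dl : A -> K^o := d.
Let dl_linear : linear dl.
Proof. by have [h _] := Ld; exact: h. Qed.
Definition lie_lin : {linear A -> K^o} :=
  HB.pack dl (GRing.isLinear.Build _ _ _ _ dl dl_linear).

(** The invariant derivation attached to the tangent vector d, sending a to d(a_2) a_1 in Sweedler
    notation. *)
Definition lie_der : {linear A -> A} := rmul lie_lin.

Lemma lie_derE a s : decomposes a s -> lie_der a = \sum_(b <- s) d b.2 *: b.1.
Proof. by move=> as_; rewrite [LHS](contractlE _ as_). Qed.

Lemma lie_der_der a b : lie_der (a * b) = lie_der a * b + a * lie_der b.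
Proof.
have dec : decomposes (a * b) [seq (c.1 * e.1, c.2 * e.2) | c <- cdec a, e <- cdec b].
  move=> R x y; have -> : smul x y (a * b) = smul x y a * smul x y b by exact: rmorphM.
  rewrite (cdecP a) (cdecP b) big_distrl big_allpairs_dep.
  by apply: eq_bigr => c _; rewrite big_distrr; apply: eq_bigr => e _ /=; rewrite !rmorphM mulrACA.
rewrite (lie_derE dec) (lie_derE (cdecP a)) (lie_derE (cdecP b)) big_allpairs_dep.
have idE x : x = \sum_(b <- cdec x) (sone V K^o b.2 : K) *: b.1.
  by rewrite -[LHS]sone_rmul [LHS](contractlE _ (cdecP x)).
transitivity ((\sum_(c <- cdec a) d c.2 *: c.1) * (\sum_(c <- cdec b) (sone V K^o c.2 : K) *: c.1) +
  (\sum_(c <- cdec a) (sone V K^o c.2 : K) *: c.1) * (\sum_(c <- cdec b) d c.2 *: c.1)); last first.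
  by rewrite -!idE.
rewrite -mul_sums_add; apply: eq_bigr => c _; apply: eq_bigr => e _.
by rewrite !scalerMM -scalerDl; congr (_ *: _); have [_ ->] := Ld; rewrite addrC.
Qed.

Definition lie_mx := map_mx d rho.

Lemma lie_mx_upper (i j : 'I_m) : (j <= i)%N -> lie_mx i j = 0.
Proof.
move=> ji; rewrite mxE rho_tri//; have [_ dd] := Ld.
have d1 : d 1 = 0.
  have := dd 1 1; rewrite mulr1 (rmorph1 (sone V K^o)) mul1r mulr1; exact: add_self_eq0.
by case: (i == j); rewrite ?d1//; exact: (linear0 lie_lin).
Qed.

(** Since the coproduct of rho_ij is the sum of the rho_il tensor rho_lj, the derivation multiplies
    the matrix [rho] on the right by its tangent matrix. *)
Lemma lie_der_iter n i j : iter n lie_der (rho i j) = \sum_l (lie_mx ^+ n) l j *: rho i l.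
Proof.
elim: n i j => [|n IH] i j.
  rewrite expr0 (bigD1 j)//= mxE eqxx scale1r big1 ?addr0// => l lj.
  by rewrite mxE (negbTE lj) scale0r.
have dec i' j' : decomposes (rho i' j') [seq (rho i' l, rho l j') | l <- index_enum 'I_m].
  move=> R x y; have /matrixP/(_ i' j') := rho_mul x y; rewrite !mxE => ->.
  by rewrite big_map; apply: eq_bigr => l _; rewrite !mxE.
rewrite iterS IH linear_sum exprS.
transitivity (\sum_l (lie_mx ^+ n) l j *: \sum_l' d (rho l' l) *: rho i l').
  by apply: eq_bigr => l _; rewrite linearZ /= (lie_derE (dec _ _)) big_map.
under eq_bigr do rewrite scaler_sumr.
rewrite exchange_big; apply: eq_bigr => l _ /=; rewrite [X in X *: _]mxE scaler_suml.
by apply: eq_bigr => l' _; rewrite scalerA mxE mulrC.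
Qed.

Lemma lie_der_nil a : exists n, iter n lie_der a = 0.
Proof.
move: (rho_gen a); apply: (@alg_generated_min _ _ _ [set a | exists n, iter n lie_der a = 0]).
  split=> [|c x y [n nx] [n' ny]|x y [n nx] [n' ny]] /=.
  - exists 1%N; exact: (der1 lie_der_der).
  - exists (n + n')%N; exact: iter_der_lin.
  - exists (n + n')%N; exact: (iter_der_mul ch0 lie_der_der).
move=> _ [i [j ->]]; exists m; rewrite lie_der_iter big1// => l _.
by rewrite (strict_upper_nilp (n := m) lie_mx_upper) ?mxE ?scale0r.
Qed.

End Exp.

(** The value M of [rho] at the unit is idempotent and unitriangular: N = M - 1 is nilpotent with N
    ^ 2 = - N, hence zero. *)
Lemma rho_sone : map_mx (sone V K^o) rho = 1%:M.
Proof.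
set M := map_mx _ _; have [N NE] : exists N : 'M[K]_m, N = M - 1 by exists (M - 1).
have Nup (i j : 'I_m) : (j <= i)%N -> N i j = 0.
  by move=> ji; rewrite NE !mxE rho_tri// rmorph_nat subrr.
have MM : M *m M = M by rewrite -rho_mul smul1x.
have NN : N * N = - N.
  have ME : M = N + 1 by rewrite NE subrK.
  have H : N * N + N + (N + 1) = N + 1.
    have MM' : (N + 1) * (N + 1) = N + 1 by rewrite -ME; exact: MM.
    by rewrite -[RHS]MM' mulrDl !mulrDr !mulr1 mul1r.
  have : N * N + N = 0 by apply: (addIr (N + 1)); rewrite add0r.
  by move/eqP; rewrite addr_eq0 => /eqP.
have Nn n : N ^+ n.+1 = (-1) ^+ n * N.
  elim: n => [|n IH]; first by rewrite expr1 expr0 mul1r.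
  by rewrite exprSr IH -mulrA NN mulrN exprS mulN1r mulNr.
have := Nn m; rewrite (strict_upper_nilp Nup) ?leqnSn// => /esym N0.
have : N = 0.
  by rewrite -[LHS]mul1r -(sqrr_sign _ m) expr2 -mulrA N0 mulr0.
by rewrite NE => /eqP; rewrite subr_eq0 => /eqP.
Qed.

(** The point is the unit composed with the exponential of [lie_der], an algebra morphism. On [rho]
    the derivation acts by a strictly upper triangular matrix, so m terms suffice. *)
Lemma exp_point_exists (d : A -> K) : point_der d -> exists x : points V K^o,
  map_mx x rho = \sum_(j < m) (j`!%:R : K)^-1 *: map_mx d rho ^+ j.
Proof.
move=> Ld; pose E := expDm ch0 (lie_der_der Ld) (lie_der_nil Ld).
exists (sone V K^o \o E : points V K^o); apply/matrixP => i j.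
rewrite mxE /=.
have up := lie_mx_upper Ld.
have dE k : divpow (lie_der Ld) k (rho i j) = \sum_l ((k`!%:R : K)^-1 * (map_mx d rho ^+ k) l j) *: rho i l.
  by rewrite /divpow lie_der_iter scaler_sumr; apply: eq_bigr => l _; rewrite scalerA.
have -> : expD (lie_der_nil Ld) (rho i j) = \sum_(k < m) divpow (lie_der Ld) k (rho i j).
  apply: expD_sum => k mk; rewrite dE big1// => l _.
  by rewrite (strict_upper_nilp up mk) mxE mulr0 scale0r.
rewrite linear_sum summxE; apply: eq_bigr => k _.
rewrite dE linear_sum mxE (bigD1 i)//= big1 ?addr0 => [|l li].
  rewrite linearZ /=; have /matrixP/(_ i i) := rho_sone; rewrite !mxE eqxx => ->.
  exact: mulr1.
rewrite linearZ /=; have /matrixP/(_ i l) := rho_sone; rewrite !mxE eq_sym (negbTE li) => ->.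
exact: mulr0.
Qed.

Section Log.
Variable x : points V K^o.
Local Notation N := (map_mx x rho - 1%:M : 'M[K]_m).

Definition ppow n : points V K^o := iter n (smul x) (sone V K^o).

Lemma ppow_mx n : map_mx (ppow n) rho = (N + 1) ^+ n.
Proof.
elim: n => [|n IH]; first by rewrite rho_sone.
by rewrite /ppow iterS rho_mul IH exprS subrK.
Qed.

Lemma N_upper (i j : 'I_m) : (j <= i)%N -> N i j = 0.
Proof. by move=> ji; rewrite !mxE rho_tri// rmorph_nat subrr. Qed.

(** As M ^ n = (1 + N) ^ n is the sum of the binom(n, k) N ^ k, its entries are polynomials in n. *)
Definition log_poly (i j : 'I_m) : {poly K} := \sum_(k < m) (N ^+ k) i j *: binp K k.

Lemma log_polyE i j n : (log_poly i j).[n%:R] = ppow n (rho i j).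
Proof.
have -> : ppow n (rho i j) = ((N + 1) ^+ n) i j by rewrite -ppow_mx mxE.
have -> : (N + 1) ^+ n = \sum_(k < m + n.+1) N ^+ k *+ 'C(n, k).
  rewrite exprDn_comm; last exact: commr1.
  rewrite addnC big_split_ord /= [X in _ = _ + X]big1 ?addr0.
    rewrite [LHS](reindex_inj rev_ord_inj) /=; apply: eq_bigr => k _.
    by rewrite subSS subKn -1?ltnS// expr1n mulr1 bin_sub -1?ltnS.
  by move=> k _; rewrite bin_small ?mulr0n// ltnS leq_addr.
rewrite big_split_ord /= [X in _ + X]big1 ?addr0.
  rewrite horner_sum summxE; apply: eq_bigr => k _.
  by rewrite hornerZ (binpE ch0) mulmxnE mulr_natr.
by move=> k _; rewrite (strict_upper_nilp N_upper) ?mul0rn ?leq_addr.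
Qed.

Lemma ppow_poly a : exists P : {poly K}, forall n, P.[n%:R] = ppow n a.
Proof.
move: (rho_gen a); apply: (@alg_generated_min _ _ _ [set a | exists P : {poly K}, forall n, P.[n%:R] = ppow n a]).
  split=> [|c a1 a2 [P PE] [Q QE]|a1 a2 [P PE] [Q QE]] /=.
  - by exists 1 => n; rewrite hornerE rmorph1.
  - by exists (c *: P + Q) => n; rewrite !hornerE PE QE linearP.
  - by exists (P * Q) => n; rewrite hornerM PE QE rmorphM.
by move=> _ [i [j ->]]; exists (log_poly i j) => n; exact: log_polyE.
Qed.

Definition lpoly a : {poly K} := projT1 (cid (ppow_poly a)).
Lemma lpolyE a n : (lpoly a).[n%:R] = ppow n a.
Proof. by rewrite /lpoly; case: cid. Qed.
Lemma lpoly_uniq a (P : {poly K}) : (forall n, P.[n%:R] = ppow n a) -> lpoly a = P.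
Proof. by move=> PE; apply: (poly_nat_eq ch0) => n; rewrite lpolyE PE. Qed.
Lemma lpoly_rho i j : lpoly (rho i j) = log_poly i j.
Proof. by apply: lpoly_uniq => n; rewrite log_polyE. Qed.

(** The derivative at n = 0 of the polynomial a(x ^ n): the tangent vector of the one-parameter
    subgroup through x. *)
Definition logpt (a : A) : K := (lpoly a)`_1.

Lemma lpoly0 a : (lpoly a)`_0 = sone V K^o a.
Proof. by rewrite -horner_coef0 -[0]/(0%:R) lpolyE. Qed.

Lemma logpt_Lie : point_der logpt.
Proof.
split=> [c a b|a b]; rewrite /logpt.
  rewrite (@lpoly_uniq _ (c *: lpoly a + lpoly b)); first by rewrite !coefE.
  by move=> n; rewrite !hornerE !lpolyE linearP.
rewrite (@lpoly_uniq _ (lpoly a * lpoly b)).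
  by rewrite coefM !big_ord_recl big_ord0 /= !lpoly0 addr0.
by move=> n; rewrite hornerM !lpolyE rmorphM.
Qed.

Lemma logpt_rho i j : logpt (rho i j) = \sum_(k < m) (N ^+ k) i j * (binp K k)`_1.
Proof. by rewrite /logpt lpoly_rho coef_sum; apply: eq_bigr => k _; rewrite coefZ. Qed.

Lemma ppowD n k : ppow (n + k) = smul (ppow n) (ppow k).
Proof. by elim: n => [|n IH]; rewrite ?smul1x// addSn /ppow !iterS -!/(ppow _) IH smulA. Qed.

(** The matrix P of polynomials interpolating the powers of x satisfies P(n + t) = P(n) P(t).
    Differentiating at t = 0 gives P' = P L, hence P(t) = exp(t L), and x is its value at 1. *)
Lemma logpt_exp : map_mx x rho = \sum_(j < m) (j`!%:R : K)^-1 *: map_mx logpt rho ^+ j.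
Proof.
pose P i j := lpoly (rho i j); pose M k : 'M[K]_m := \matrix_(i, j) (P i j)`_k.
pose L := map_mx logpt rho.
have M0 : M 0%N = 1 by rewrite -[1]rho_sone; apply/matrixP => i j; rewrite !mxE lpoly0.
have der i j : (P i j)^`() = \sum_l L l j *: P i l.
  apply: (poly_nat_eq ch0) => n.
  have shift : P i j \Po ('X + (n%:R)%:P) = \sum_l (P i l).[n%:R] *: P l j.
    apply: (poly_nat_eq ch0) => k; rewrite horner_comp !hornerE -natrD horner_sum lpolyE addnC ppowD.
    have /matrixP/(_ i j) := rho_mul (ppow n) (ppow k); rewrite !mxE => ->.
    by apply: eq_bigr => l _; rewrite !mxE hornerZ !lpolyE.
  have := congr1 (fun Q : {poly K} => (Q^`()).[0]) shift.
  rewrite deriv_comp derivD derivX derivC addr0 mulr1 horner_comp !hornerE => ->.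
  rewrite linear_sum /= !horner_sum; apply: eq_bigr => l _.
  rewrite derivZ !hornerZ horner_coef0 coef_deriv mulr1n mulrC; congr (_ * _).
  by rewrite mxE.
have MS k : (k.+1)%:R *: M k.+1 = M k *m L.
  apply/matrixP => i j; rewrite !mxE mulr_natl -coef_deriv der coef_sum.
  by apply: eq_bigr => l _; rewrite coefZ !mxE mulrC.
have ME k : M k = (k`!%:R : K)^-1 *: L ^+ k.
  elim: k => [|k IH]; first by rewrite M0 fact0 invr1 scale1r.
  have nz : ((k.+1)%:R : K) != 0 by rewrite ch0.
  apply: (scalerI nz); rewrite MS IH -scalemxAl scalerA factS natrM invfM mulrA mulfV// mul1r.
  by rewrite exprSr.
apply/matrixP => i j; rewrite summxE mxE.
have -> : x (rho i j) = (P i j).[1].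
  by rewrite -[1]/(1%:R) lpolyE /ppow /= smulx1.
have sP : (size (P i j) <= m)%N.
  rewrite /P lpoly_rho; apply: (leq_trans (size_sum _ _ _)); apply/bigmax_leqP => k _.
  exact: leq_trans (size_scale_leq _ _) (leq_trans (binp_size _ _) (ltn_ord k)).
rewrite (horner_coef_wide _ sP); apply: eq_bigr => k _.
by rewrite expr1n mulr1 -ME mxE.
Qed.

End Log.
End UnipotentLie.

(** * The universal property *)

Section MatrixContinuity.
Variables (p : nat) (p_pr : prime p).
Local Notation K := (Qp p_pr).

Lemma mx_entry_cts m n (i : 'I_m) (j : 'I_n) : continuous (fun M : 'M[K]_(m, n) => M i j : K).
Proof.
move=> M A MA; exists (fun i' j' => if (i' == i) && (j' == j) then A else setT).
  by move=> i' j'; case: ifP => [/andP[/eqP-> /eqP->]//|_]; exact: filterT.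
by move=> N /(_ i j); rewrite !eqxx.
Qed.

Lemma mx_cts (T : topologicalType) m n (M : T -> 'M[K]_(m, n)) :
  (forall i j, continuous (fun t => M t i j : K)) -> continuous M.
Proof.
move=> cM t A [P Pij PA].
have : forall ij : 'I_m * 'I_n, \forall s \near t, P ij.1 ij.2 (M s ij.1 ij.2).
  by move=> ij; apply: cM; exact: Pij.
by move/filter_forall; apply: filterS => s sP; apply: PA => i j; exact: (sP (i, j)).
Qed.

Definition mcts (T : topologicalType) m n (M : T -> 'M[K]_(m, n)) :=
  forall i j, continuous (fun t => M t i j : K).

Lemma eq_cts (T U : topologicalType) (f g : T -> U) : f =1 g -> continuous f -> continuous g.
Proof. by move=> /funext ->. Qed.

Variable T : topologicalType.

Lemma mcts_cst m n (M : 'M[K]_(m, n)) : mcts (fun _ : T => M).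
Proof. by move=> i j; exact: cst_continuous. Qed.

Lemma mctsM m n q (M : T -> 'M[K]_(m, n)) (N : T -> 'M[K]_(n, q)) :
  mcts M -> mcts N -> mcts (fun t => M t *m N t).
Proof.
move=> cM cN i j; apply: (@eq_cts _ _ (fun t => \sum_l M t i l * N t l j)).
  by move=> t; rewrite mxE.
by apply: qp_continuous_sum => l _; apply: qp_continuousM.
Qed.

Lemma mctsX m (M : T -> 'M[K]_m) n : mcts M -> mcts (fun t => M t ^+ n).
Proof.
move=> cM; elim: n => [|n IH]; first exact: mcts_cst.
have := mctsM cM IH; congr mcts; apply/funext => t; by rewrite exprS.
Qed.

Lemma mcts_exp m (M : T -> 'M[K]_m) : mcts M -> mcts (fun t => mx_exp (M t)).
Proof.
move=> cM i j; apply: (@eq_cts _ _ (fun t => \sum_(k < m) (k`!%:R)^-1 * (M t ^+ k) i j)).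
  by move=> t; rewrite summxE; apply: eq_bigr => k _; rewrite mxE.
apply: qp_continuous_sum => k _; apply: qp_continuousM; first exact: cst_continuous.
exact: mctsX.
Qed.

End MatrixContinuity.

Section PointsToMalcev.
Variables (p : nat) (p_pr : prime p).
Local Notation K := (Qp p_pr).
Local Notation ch0 := (qp_natr_eq0 p_pr).

Lemma Lie_basis_exists (V : affGrpSch K) m (rho : 'M[coord V]_m) :
  unitriangular_embedding rho -> exists r (b : 'I_r -> coord V -> K), Lie_basis b.
Proof.
move=> emb; have [r [x [e [[Le ex] eE]]]] := point_der_basis emb.
exists r, e; split=> [i|d Ld]; first exact: Le.
exists (\row_i d (x i)); split=> [|c cE].
  by apply/funext => y; rewrite (eE _ Ld) /lin_comb; apply: eq_bigr => i _; rewrite mxE.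
apply/rowP => j; rewrite mxE cE /lin_comb (bigD1 j)//= ex eqxx mulr1 big1 ?addr0// => i ij.
by rewrite ex (negbTE ij) mulr0.
Qed.

Lemma Lie_lin_comb (V : affGrpSch K) r (b : 'I_r -> coord V -> K) c :
  (forall i, Lie (b i)) -> Lie (lin_comb b c).
Proof.
move=> Lb; rewrite /lin_comb.
apply: (@fsubspace_sum K (coord V) (@Lie p p_pr V) _ _ (fun i => c 0 i)) => //.
split; first exact: Lie0.
by move=> e f g; exact: LieD.
Qed.

(** In the exponential chart an entry of [rho] is a polynomial in the Lie coordinates, hence
    continuous, and every tangent vector has an exponential by [exp_point_exists]. *)
Lemma exp_open (V : affGrpSch K) m (rho : 'M[coord V]_m) i j (O : set K) :
  unitriangular_embedding rho -> open O ->
  unipotent_open [set x : rat_points V | O (x (rho i j))].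
Proof.
move=> emb oO; have [r [b Lb]] := Lie_basis_exists emb.
exists m, rho, r, b; split=> //.
rewrite (_ : [set c | _] = (fun c => mx_exp (map_mx (lin_comb b c) rho) i j) @^-1` O).
  apply: open_comp => // c _; apply: mcts_exp => {}i {}j.
  apply: (@eq_cts _ _ (fun c : 'rV[K]_r => \sum_l c 0 l * b l (rho i j))) => [t|].
    by rewrite mxE.
  by apply: qp_continuous_sum => l _; apply: qp_continuousM; [exact: mx_entry_cts|exact: cst_continuous].
apply/seteqP; split=> [c [x Ox xc]|c Oc] /=.
  by rewrite -xc mxE.
have [x xE] := exp_point_exists (qp_natr_eq0 p_pr) emb (Lie_lin_comb c Lb.1).
exists x => //=; suff -> : x (rho i j) = mx_exp (map_mx (lin_comb b c) rho) i j by [].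
by move/matrixP: xE => /(_ i j); rewrite mxE.
Qed.

Variable G : topGroupType.

Lemma deg_lt_eq n (f g : G -> K) : f =1 g -> deg_lt n f -> deg_lt n g.
Proof. by move=> /funext ->. Qed.

(** By unitriangularity, M(x y)_ij - M(x)_ij only involves the entries M(x)_il with l < j, so the
    distance to the diagonal bounds the degree. *)
Lemma unitriangular_deg_lt m (M : G -> 'M[K]_m) :
  (forall g h, M (g * h)%g = M g *m M h) ->
  (forall g (i j : 'I_m), (j <= i)%N -> M g i j = (i == j)%:R) ->
  forall n (i j : 'I_m), (j < i + n)%N -> deg_lt n (fun g => M g i j).
Proof.
move=> MM Mt; elim=> [|n IH] i j ij.
  move=> g; rewrite Mt; last by rewrite -(addn0 i) ltnW.
  by case: eqP ij => // ->; rewrite addn0 ltnn.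
move=> y; have key (s : seq 'I_m) : (forall l, l \in s -> (l < i + n)%N) ->
    deg_lt n (fun x => \sum_(l <- s) M x i l * M y l j).
  elim: s => [|l s IHs] ls; first by apply: deg_lt_eq0 => x; rewrite big_nil.
  apply: (@deg_lt_eq n (fun x => M y l j * M x i l + \sum_(l <- s) M x i l * M y l j)).
    by move=> x; rewrite big_cons mulrC.
  apply: deg_ltD; first by apply: IH; apply: ls; rewrite inE eqxx.
  by apply: IHs => l' ls'; apply: ls; rewrite inE ls' orbT.
have /key K0 : forall l : 'I_m, l \in [seq l : 'I_m <- index_enum 'I_m | (l < j)%N] -> (l < i + n)%N.
  move=> l; rewrite mem_filter => /andP[lj _]; apply: leq_trans lj _.
  by rewrite -ltnS -addnS.
refine (deg_lt_eq _ K0) => x.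
rewrite MM mxE [in RHS](bigID (fun l : 'I_m => (l < j)%N)) /= -addrA big_filter -[LHS]addr0; congr (_ + _).
rewrite (bigD1 j) ?ltnn//= (Mt y j j)// eqxx mulr1 big1 ?addr0 ?subrr// => l /andP[jl lj].
by rewrite (Mt y l j) ?(negbTE lj) ?mulr0//; rewrite leqNgt.
Qed.

Lemma polyfun_eq (f g : G -> K) : f =1 g -> polyfun f -> polyfun g.
Proof. by move=> /funext ->. Qed.

(** An algebraic quotient through c is unipotent; there c is a polynomial in the entries of a
    unitriangular embedding, which are continuous by [exp_open] and of finite degree by
    [unitriangular_deg_lt]. *)
Lemma hom_polyfun (V : affGrpSch K) (f : G -> rat_points V) (c : coord V) :
  pro_unipotent V -> continuous_hom f -> polyfun (fun g => f g c : K).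
Proof.
move=> pV [fM fc]; have [V' [q [[qh qi] aV' [c' <-]]]] := algebraic_quotient_through c.
have [m [rho emb]] := pV _ _ (conj qh qi) aV'.
pose F g : rat_points V' := f g \o q.
have FM g h : F (g * h)%g = smul (F g) (F h) by rewrite /F fM qh.
change (polyfun (fun g => F g c' : K)).
have oF W : unipotent_open W -> open [set t | W (F t)].
  exact: (fc V' q (conj qh qi) aV').
move: F FM oF => F FM oF.
have [rt rm rg] := emb.
have : alg_generated [set a | exists i j, a = rho i j] c' by rewrite rg.
apply: (@alg_generated_min _ _ _ [set c | polyfun (fun g => F g c : K)]).
  split=> [|a x y Px Py|x y Px Py] /=.
  - by apply: (@polyfun_eq (fun=> 1)) => [g|]; [rewrite rmorph1|exact: polyfun_cst].
  - by apply: (@polyfun_eq (fun g => a * F g x + F g y)) => [g|]; [rewrite linearP|exact: polyfunD].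
  - by apply: (@polyfun_eq (fun g => F g x * F g y)) => [g|]; [rewrite rmorphM|exact: polyfunM].
move=> _ [i [j ->]]; split.
  apply/continuousP => O oO; exact: (oF _ (exp_open i j emb oO)).
exists m.
apply: (@deg_lt_eq _ (fun g => map_mx (F g) rho i j)) => [g|]; first by rewrite mxE.
apply: (@unitriangular_deg_lt m (fun g => map_mx (F g) rho)) => [g h|g i' j' ij|].
- by rewrite FM rm.
- by rewrite mxE rt// rmorph_nat.
- by apply: leq_trans (ltn_ord j) (leq_addl _ _).
Qed.

Hypothesis fgG : top_finitely_generated G.
Local Notation A := (polyA p_pr G).
Local Notation U := (specA p_pr fgG).

(** The chart that defines an open set is arbitrary, so the coordinates in it of the logarithm of
    the point at t must be continuous in t. The logarithm is polynomial in the entries, which are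
    continuous functions on G, and the chart coordinates depend linearly on it. *)
Lemma etaA_continuous : continuous_points (etaA p_pr fgG).
Proof.
move=> V q [qh qi] aV W [m [rho [r [b [emb [Lb bu] oW]]]]].
pose x t : rat_points V := etaA p_pr fgG t \o q.
have Lx t : Lie (logpt ch0 emb (x t)) by exact: logpt_Lie.
have /choice[c cE] : forall t, exists c, logpt ch0 emb (x t) = lin_comb b c.
  by move=> t; have [c [cE _]] := bu _ (Lx t); exists c.
rewrite (_ : [set t | _] = c @^-1` [set c | exists2 x, W x & is_exp rho (lin_comb b c) x]).
  apply: open_comp => // t _; apply: mx_cts => {t} o j; rewrite ord1 {o}.
  pose ij l := enum_val (l : 'I_#|[the finType of ('I_m * 'I_m)%type]|).
  (* The chart vectors are already independent on the entries of [rho], so a pseudo-inverse of the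
     matrix of their values recovers the coordinates. *)
  pose B := \matrix_(i < r, l < #|[the finType of ('I_m * 'I_m)%type]|) b i (rho (ij l).1 (ij l).2).
  pose X t : 'rV[K]__ := \row_l logpt ch0 emb (x t) (rho (ij l).1 (ij l).2).
  have XE t : X t = c t *m B.
    by apply/rowP => l; rewrite !mxE cE /lin_comb; apply: eq_bigr => i _; rewrite !mxE.
  have fB : row_free B.
    rewrite -kermx_eq0; apply/eqP/row_matrixP => l; rewrite row0.
    have u0 : row l (kermx B) *m B = 0 by apply/sub_kermxP; exact: row_sub.
    set u := row _ _ in u0 *.
    have Lu := Lie_lin_comb u Lb.
    have [d [dE du]] := bu _ Lu.
    rewrite -(du _ erefl); apply: du; apply/funext => a.
    rewrite [LHS](Lie_eq0 emb Lu); last first.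
      move=> i' j'; have /rowP/(_ (enum_rank (i', j'))) := u0.
      rewrite !mxE => e; rewrite -[RHS]e; apply: eq_bigr => i _.
      by rewrite !mxE /ij enum_rankK.
    by rewrite /lin_comb big1// => i _; rewrite mxE mul0r.
  have cX t : c t = X t *m pinvmx B by rewrite XE mulmxKp.
  apply: (@eq_cts _ _ (fun t => (X t *m pinvmx B) 0 j)) => [t|]; first by rewrite cX.
  apply: mctsM => [o l|]; last exact: mcts_cst.
  apply: (@eq_cts _ _ (fun t => \sum_(k < m) (((map_mx (x t) rho - 1%:M) ^+ k) (ij l).1 (ij l).2) * (binp K k)`_1)) => [t|].
    by rewrite mxE (logpt_rho ch0 emb).
  apply: qp_continuous_sum => k _; apply: qp_continuousM; last exact: cst_continuous.
  apply: mctsX => i' j'.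
  apply: (@eq_cts _ _ (fun t => (q (rho i' j') : A) t + - (1%:M : 'M[K]_m) i' j')) => [t|].
    by rewrite !mxE.
  by apply: qp_continuousD; [exact: (polyAP _).1|exact: cst_continuous].
have xl t : is_exp rho (lin_comb b (c t)) (x t) by rewrite /is_exp -cE; exact: logpt_exp.
apply/seteqP; split=> t /= Wt; first by exists (x t).
(* Points that agree on [rho] are equal, so the point of W with this logarithm is the one given by
   t. *)
have [y Wy ye] := Wt; change (W (x t)); suff <- : y = x t by [].
by apply: (rho_points_eq emb); rewrite ye xl.
Qed.

Lemma etaA_hom : continuous_hom (etaA p_pr fgG).
Proof. by split; [exact: etaAM|exact: etaA_continuous]. Qed.

(** Polynomial functions are determined by their values on G, which forces the comorphism: c goes to
    the function g to f(g)(c). *)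
Lemma malcev_universal (V : affGrpSch K) (f : G -> rat_points V) :
  (forall g h, f (g * h)%g = smul (f g) (f h)) -> (forall c, polyfun (fun g => f g c : K)) ->
  exists! phi : {lrmorphism coord V -> coord U},
    is_hom phi /\ forall g, etaA p_pr fgG g \o phi = f g :> rat_points V.
Proof.
move=> fM fP; pose phi (c : coord V) : A := mkA (fP c).
have phi_lin : linear phi.
  by move=> a c d; apply: polyA_eq => x; rewrite A_linE; exact: linearP.
have phi_mon : monoid_morphism phi.
  split=> [|c d]; apply: polyA_eq => x; first by rewrite A_oneE; exact: rmorph1.
  by rewrite A_mulE; exact: rmorphM.
pose Phi : {lrmorphism coord V -> A} := HB.pack phi (GRing.isLinear.Build _ _ _ _ phi phi_lin)
    (GRing.isMonoidMorphism.Build _ _ phi phi_mon).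
exists Phi; split=> [|psi [_ psiE]].
  split=> [R x y|g]; last by apply: lrmorph_eq.
  apply: lrmorph_eq => a.
  apply: (@etrans _ _ (\sum_(b <- [seq (phi c.1, phi c.2) | c <- cdec a]) x b.1 * y b.2)).
    apply: (smulAE x y (a := phi a)) => g h; rewrite big_map.
    have -> : phi a (g * h)%g = f (g * h)%g a by [].
    by apply: etrans (congr1 (fun z : rat_points V => z a) (fM g h)) _; exact: cdecP.
  by rewrite big_map; exact: esym (cdecP a (x \o Phi : points V R) (y \o Phi)).
apply: lrmorph_eq => a; apply: polyA_eq => g.
by have := congr1 (fun x : rat_points V => x a) (psiE g).
Qed.

Lemma malcev_etaA : pro_unipotent U -> malcev_completion (etaA p_pr fgG).
Proof.
move=> pU; split=> //; first exact: etaA_hom.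
move=> V f pV fh; apply: malcev_universal => [|c]; first exact: fh.1.
exact: hom_polyfun.
Qed.

End PointsToMalcev.

(** * Pro-unipotence of the group of polynomial functions *)

Section Flags.
Variables (K : fieldType) (vT : vectType K).

(** A subspace of maximal dimension inside P contains every v in P, since otherwise the line of v
    could be added. *)
Lemma vspace_of_pred (P : set vT) : P 0 -> (forall a u v, P u -> P v -> P (a *: u + v)) ->
  exists E : {vspace vT}, forall v, v \in E <-> P v.
Proof.
move=> P0 PD; pose Q (E : {vspace vT}) := forall v, v \in E -> P v.
have ex0 : exists d, `[< exists2 E, Q E & \dim E = d >].
  by exists 0%N; apply/asboolP; exists 0%VS => [v|]; rewrite ?dimv0// memv0 => /eqP->.
have bd d : `[< exists2 E, Q E & \dim E = d >] -> (d <= \dim {:vT})%N.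
  by move=> /asboolP[E _ <-]; exact/dimvS/subvf.
case: (ex_maxnP ex0 bd) => d /asboolP[E QE dE] max; exists E => v; split; first exact: QE.
move=> Pv; have QE' : Q (E + <[v]>)%VS.
  move=> _ /memv_addP[u uE [_ /vlineP[a ->] ->]]; rewrite addrC; apply: PD => //; exact: QE.
have /max : `[< exists2 E', Q E' & \dim E' = \dim (E + <[v]>) >] by apply/asboolP; exists (E + <[v]>)%VS.
rewrite -dE => dle; have -> : E = (E + <[v]>)%VS by apply/eqP; rewrite eqEdim addvSl.
by apply: (subvP (addvSr _ _)); exact: memv_line.
Qed.

(** Bases of successive complements are concatenated, so D sends a basis vector into the span of the
    earlier ones. *)
Lemma adapted_basis (I : Type) (D : I -> vT -> vT) (E : nat -> {vspace vT}) :
  E 0%N = 0%VS -> (forall i, (E i <= E i.+1)%VS) ->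
  (forall i y v, v \in E i.+1 -> D y v \in E i) ->
  forall k, exists2 X, basis_of (E k) X &
    forall i, (i < size X)%N -> forall y, D y X`_i \in <<take i X>>%VS.
Proof.
move=> E0 ES ED; elim=> [|k [X bX XD]].
  by exists [::] => //; rewrite E0 basisEfree span_nil nil_free subvv dimv0.
pose Y := (vbasis (E k.+1 :\: E k) : seq vT).
have dir : directv (E k + (E k.+1 :\: E k)).
  by apply/directv_addP; rewrite capvC; exact: capv_diff.
have sE : (E k + (E k.+1 :\: E k) = E k.+1)%VS.
  by rewrite addvC -{2}(addv_diff_cap (E k.+1) (E k)) (capv_idPr (ES k)).
exists (X ++ Y) => [|i iX y].
  by rewrite -sE; apply: cat_basis => //; exact: vbasisP.
rewrite nth_cat take_cat; case: ltnP => [iX'|Xi]; first exact: XD.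
apply: (subvP (_ : (<<X>> <= _)%VS)); first by rewrite span_cat addvSl.
rewrite (span_basis bX); apply: ED; rewrite -sE; apply: (subvP (addvSr _ _)).
apply: vbasis_mem; rewrite mem_nth//.
by move: iX; rewrite size_cat -ltn_subLR// => ->; rewrite ?orbT.
Qed.

Lemma coord_take_eq0 m (t : m.-tuple vT) j (i : 'I_m) v :
  free t -> (j <= i)%N -> v \in <<take j t>>%VS -> vector.coord t i v = 0.
Proof.
move=> ft ji vj; pose L := linfun (vector.coord t i : vT -> K^o).
have : (<<take j t>> <= lker L)%VS.
  apply/span_subvP => _ /(nthP 0)[l + <-]; rewrite size_take size_tuple (leq_ltn_trans ji (ltn_ord i)) => lj.
  have lm : (l < m)%N by apply: ltn_trans lj (leq_ltn_trans ji (ltn_ord i)).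
  rewrite nth_take// memv_ker lfunE /= (coord_free (Ordinal lm) i)//.
  by rewrite -val_eqE /= ltn_eqF// (leq_trans lj).
by move/subvP/(_ v vj); rewrite memv_ker lfunE => /eqP.
Qed.

End Flags.

Section Unitriangular.
Variables (K : fieldType) (V : affGrpSch K) (G : groupType) (q : coord V -> G -> K).
Hypothesis q_lin : forall c a b x, q (c *: a + b) x = c * q a x + q b x.
Hypothesis q_one : forall x, q 1 x = 1.
Hypothesis q_inj : forall a, (forall x, q a x = 0) -> a = 0.
Hypothesis q_dec : forall a g h, q a (g * h)%g = \sum_(c <- cdec a) q c.1 g * q c.2 h.
Hypothesis q_interp : interpolated q.
Variables (n r : nat) (x : 'I_r -> G) (b : 'I_r -> coord V).
Hypothesis b_deg : forall i, deg_lt n (q (b i)).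
Hypothesis b_dual : forall i j, q (b i) (x j) = (i == j)%:R.
Hypothesis bE : forall a, deg_lt n (q a) -> a = \sum_i q a (x i) *: b i.
Hypothesis gen : alg_generated [set a | deg_lt n (q a)] = setT.

Let phi (v : 'rV[K]_r) : coord V := \sum_i v 0 i *: b i.

Let phi_lin c u v : phi (c *: u + v) = c *: phi u + phi v.
Proof.
rewrite /phi scaler_sumr -big_split; apply: eq_bigr => i _ /=.
by rewrite !mxE scalerDl scalerA.
Qed.

Let q_sum (I : Type) (s : seq I) (c : I -> K) (a : I -> coord V) y :
  q (\sum_(i <- s) c i *: a i) y = \sum_(i <- s) c i * q (a i) y.
Proof. exact: interp_sum. Qed.

Let q_eq a a' : (forall y, q a y = q a' y) -> a = a'.
Proof.
move=> aa'; apply/eqP; rewrite -subr_eq0 addrC -scaleN1r; apply/eqP/q_inj => y.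
by rewrite q_lin aa' mulN1r addNr.
Qed.

Let q_phi v i : q (phi v) (x i) = v 0 i.
Proof.
rewrite /phi q_sum (bigD1 i)//= b_dual eqxx mulr1 big1 ?addr0// => j ji.
by rewrite b_dual (negbTE ji) mulr0.
Qed.

Let phi_deg v : deg_lt n (q (phi v)).
Proof.
rewrite /phi; elim/big_ind: _ => [|a a' da da'|i _].
- apply: deg_lt_eq0 => y; have := q_lin (-1) 0 0 y.
  by rewrite scaler0 addr0 mulN1r addNr.
- have := deg_ltD 1 da da'; congr deg_lt; apply/funext => y.
  by rewrite -[in RHS](scale1r a) q_lin.
- have := deg_ltD (v 0 i) (b_deg i) (deg_lt_eq0 (f := fun=> 0) n (fun=> erefl)).
  congr deg_lt; apply/funext => y; rewrite -[v 0 i *: _]addr0 q_lin.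
  congr (_ + _); have := q_lin (-1) 0 0 y.
  by rewrite scaler0 addr0 mulN1r addNr.
Qed.

Let act (y : G) (v : 'rV[K]_r) : 'rV[K]_r := \row_i q (phi v) (x i * y)%g.

Let phi_of a : deg_lt n (q a) -> phi (\row_i q a (x i)) = a.
Proof. by move=> da; rewrite {2}(bE da) /phi; apply: eq_bigr => i _; rewrite mxE. Qed.

Let rt (y : G) a : coord V := \sum_(c <- cdec a) q c.2 y *: c.1.
Let lt (y : G) a : coord V := \sum_(c <- cdec a) q c.1 y *: c.2.

Let q_rt y a z : q (rt y a) z = q a (z * y)%g.
Proof. by rewrite /rt q_sum q_dec; apply: eq_bigr => c _; rewrite mulrC. Qed.

Let q_lt y a z : q (lt y a) z = q a (y * z)%g.
Proof. by rewrite /lt q_sum q_dec. Qed.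

Let q_act y v z : q (phi (act y v)) z = q (phi v) (z * y)%g.
Proof.
have -> : act y v = \row_i q (rt y (phi v)) (x i) by apply/rowP => i; rewrite !mxE q_rt.
rewrite phi_of ?q_rt//.
have -> : q (rt y (phi v)) = fun z => q (phi v) (z * y)%g by apply/funext => w; rewrite q_rt.
exact: deg_lt_right.
Qed.

Let act_lin y c u v : act y (c *: u + v) = c *: act y u + act y v.
Proof. by apply/rowP => i; rewrite !mxE phi_lin q_lin. Qed.

Let actM g h v : act (g * h)%g v = act g (act h v).
Proof. by apply/rowP => i; rewrite !mxE q_act mulgA. Qed.

(** The elements of degree < n form a finite-dimensional representation under right translation,
    filtered by the degree with trivial action on graded pieces. In an adapted basis the action is
    unitriangular; its entries span these elements, hence generate the coordinate ring. *)
Lemma unitriangular_coord : unipotent V.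
Proof.
have /choice[E EP] : forall k, exists E : {vspace 'rV[K]_r}, forall v, v \in E <-> deg_lt k (q (phi v)).
  move=> k; apply: (@vspace_of_pred _ _ (fun v => deg_lt k (q (phi v)))) => [|c u v du dv].
    by apply: deg_lt_eq0 => y; rewrite /phi q_sum big1// => i _; rewrite mxE mul0r.
  have := deg_ltD c du dv; congr deg_lt; apply/funext => y; by rewrite phi_lin q_lin.
have E0 : E 0%N = 0%VS.
  apply/vspaceP => v; rewrite memv0; apply/idP/eqP => [/EP v0|->]; last exact: mem0v.
  by apply/rowP => i; rewrite mxE -q_phi v0.
have ES k : (E k <= E k.+1)%VS by apply/subvP => v /EP vk; apply/EP; exact: deg_ltS.
pose D y v := act y v - v.
have ED k y v : v \in E k.+1 -> D y v \in E k.
  move=> /EP vk; apply/EP; have := vk y; congr deg_lt; apply/funext => z.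
  have -> : D y v = -1 *: v + act y v by rewrite scaleN1r addrC.
  by rewrite phi_lin q_lin q_act mulN1r addrC.
have En : E n = fullv by apply/vspaceP => v; rewrite memvf; apply/EP; exact: phi_deg.
have [X bX XD] := adapted_basis E0 ES ED n; rewrite En in bX.
have fX : free X := basis_free bX.
have [m mX] : exists m, size X = m by exists (size X).
pose t : m.-tuple 'rV[K]_r := Tuple (introT eqP mX).
have tE : t = X :> seq _ by [].
have ft : free t by [].
pose c i v := vector.coord t i v.
have cE v : v = \sum_i c i v *: t`_i.
  by apply: coord_basis (memvf v); exact: bX.
have [rho rhoE] : exists rho : 'M[coord V]_m, forall i j y, q (rho i j) y = c i (act y t`_j).
  (* The l-th coordinate of [act y v] is the value of v at x_l y, a left translate of v evaluated at
     y; so the coefficients of the action come from elements of [coord V]. *)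
  exists (\matrix_(i, j) \sum_l c i (delta_mx 0 l) *: lt (x l) (phi t`_j)) => i j y.
  rewrite mxE q_sum [act y _]row_sum_delta /c linear_sum; apply: eq_bigr => l _.
  by rewrite linearZ /= mulrC q_lt !mxE.
have act_t (j : 'I_m) y : act y t`_j = \sum_i q (rho i j) y *: t`_i.
  by rewrite {1}(cE (act y _)); apply: eq_bigr => i _; rewrite rhoE.
have act_sum y (d : 'I_m -> K) (u : 'I_m -> 'rV[K]_r) :
    act y (\sum_i d i *: u i) = \sum_i d i *: act y (u i).
  elim/big_rec2: _ => [|i w w' _ <-]; last exact: act_lin.
  by apply/rowP => i; rewrite !mxE /phi q_sum big1// => l _; rewrite mxE mul0r.
exists m, rho; split=> [i j ji|R z w|].
- apply: q_eq => y; rewrite rhoE.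
  have -> : act y t`_j = t`_j + D y t`_j by rewrite addrC subrK.
  rewrite /c linearD /= coord_free//; set d := vector.coord _ _ (D y _).
  have -> : d = 0 by apply: coord_take_eq0 ft ji _; rewrite tE; apply: XD; rewrite mX.
  rewrite addr0 [in RHS]eq_sym; case: (j == i) => /=; first by rewrite q_one.
  by have := q_lin (-1) 0 0 y; rewrite scaler0 addr0 mulN1r addNr.
- apply/matrixP => i j; rewrite !mxE (cdecP (rho i j)).
  transitivity (\sum_(b <- [seq (rho i l, rho l j) | l <- index_enum 'I_m]) z b.1 * w b.2).
    apply: (hb_conv_eq q_lin q_inj q_interp) => g h; rewrite -q_dec big_map rhoE actM act_t act_sum.
    rewrite /c linear_sum; apply: eq_bigr => l _; rewrite linearZ /= mulrC; congr (_ * _).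
    by rewrite rhoE.
  by rewrite big_map; apply: eq_bigr => l _; rewrite !mxE.
- apply/seteqP; split=> // a _.
  have : alg_generated [set a | deg_lt n (q a)] a by rewrite gen.
  apply: alg_generated_min => [|{}a da]; first exact: alg_generatedP.
  have sG := alg_generatedP [set a | exists i j : 'I_m, a = rho i j].
  rewrite -(phi_of da) (cE (\row_i _)).
  have phi_sum (d : 'I_m -> K) (u : 'I_m -> 'rV[K]_r) :
      phi (\sum_i d i *: u i) = \sum_i d i *: phi (u i).
    elim/big_rec2: _ => [|i w w' _ <-]; last exact: phi_lin.
    by rewrite /phi big1// => i _; rewrite mxE scale0r.
  rewrite phi_sum; apply: (subalg_sum sG) => j.
  (* A function is the value at 1 of its right translates, hence a combination of matrix
     coefficients. *)
  have -> : phi t`_j = \sum_(i < m) q (phi t`_i) 1%g *: rho i j.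
    apply: q_eq => y; rewrite [RHS]q_sum; have := q_act y t`_j 1%g; rewrite mul1g => <-; rewrite act_t phi_sum [LHS]q_sum.
    by apply: eq_bigr => i _; rewrite mulrC.
  by apply: (subalg_sum sG) => i; apply: alg_generated_sub; exists i, j.
Qed.

End Unitriangular.

Section SpecAProUnipotent.
Variables (p : nat) (p_pr : prime p) (G : topGroupType).
Hypothesis fgG : top_finitely_generated G.
Local Notation K := (Qp p_pr).
Local Notation A := (polyA p_pr G).
Local Notation U := (specA p_pr fgG).

(** A finitely generated sub-Hopf algebra is generated by its elements of degree < n as soon as n
    bounds the degrees of the generators. *)
Lemma pro_unipotent_specA : pro_unipotent U.
Proof.
move=> V q [qh qi] [s gens].
pose Q (a : coord V) : G -> K := (q a : A).
have Q_lin c a b x : Q (c *: a + b) x = c * Q a x + Q b x.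
  by rewrite /Q linearP; exact: A_linE.
have Q_one x : Q 1 x = 1 by rewrite /Q rmorph1; exact: A_oneE.
have Q0 x : Q 0 x = 0.
  by have := Q_lin (-1) 0 0 x; rewrite scaler0 addr0 mulN1r addNr.
have Q_inj a : (forall x, Q a x = 0) -> a = 0.
  by move=> a0; apply: qi; rewrite linear0; exact: A_eq0.
have Q_dec a g h : Q a (g * h)%g = \sum_(c <- cdec a) Q c.1 g * Q c.2 h.
  rewrite -(cdecP a (etaA p_pr fgG g \o q : points V (Qp p_pr)^o) (etaA p_pr fgG h \o q)).
  by rewrite -qh -etaAM.
have Q_interp : interpolated Q.
  by apply: polyfun_interp => // a; exact: polyAP.
have [n nP] := deg_lt_bound s (fun a => polyAP (q a)).
have [r [x [b [b1 b2 b3]]]] := polyfun_basis n fgG Q_lin Q_inj (fun a => (polyAP (q a)).1).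
apply: (@unitriangular_coord _ _ _ Q Q_lin Q_one Q_inj Q_dec Q_interp n r x b) => //.
apply/seteqP; split=> // a _; have : alg_generated [set` s] a by rewrite gens.
apply: alg_generated_min; first exact: alg_generatedP.
by move=> a' /= /(nthP 0)[i is_ <-]; apply: alg_generated_sub; exact: nP.
Qed.

Lemma malcev_specA : malcev_completion (etaA p_pr fgG).
Proof. exact: malcev_etaA pro_unipotent_specA. Qed.

End SpecAProUnipotent.

(** * Tensor automorphisms *)

Lemma linear_comb (k : nzRingType) (V W : lmodType k) (f : {linear V -> W}) (I : Type) (s : seq I)
    (c : I -> k) (a : I -> V) : f (\sum_(i <- s) c i *: a i) = \sum_(i <- s) c i *: f (a i).
Proof. by rewrite linear_sum; apply: eq_bigr => i _; exact: linearZ. Qed.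

Section Tannakian.
Variables (p : nat) (p_pr : prime p) (G : topGroupType).
Hypothesis fgG : top_finitely_generated G.
Local Notation K := (Qp p_pr).
Local Notation A := (polyA p_pr G).
Local Notation U := (specA p_pr fgG).
Local Notation urep := (urep p_pr G).

Lemma deg_lt_sum (I : Type) (s : seq I) (c : I -> K) (f : I -> G -> K) n :
  (forall i, deg_lt n (f i)) -> deg_lt n (fun x => \sum_(i <- s) c i * f i x).
Proof.
move=> df; elim: s => [|i s IH]; first by apply: deg_lt_eq0 => x; rewrite big_nil.
have := deg_ltD (c i) (df i) IH; congr deg_lt; apply/funext => x.
by rewrite big_cons.
Qed.

(** The flag consists of the vectors v whose orbit map g to rho(g) v has degree < k: its difference
    along y is the orbit map of rho(y) v - v. *)
Lemma polynomial_unipotent_rep d (rho : G -> 'M[K]_d) :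
  rho 1%g = 1%:M -> (forall g h, rho (g * h)%g = rho g *m rho h) ->
  (forall i j, polyfun (fun g => rho g i j)) -> unipotent_rep rho.
Proof.
move=> r1 rM rP; split=> //; first by apply: mx_cts => i j; exact: (rP i j).1.
have [n nP] := deg_lt_bound_fin (fun ij : 'I_d * 'I_d => rP ij.1 ij.2).
have /choice[E EP] : forall k, exists E : {vspace 'cV[K]_d}, forall v,
    v \in E <-> forall a, deg_lt k (fun g => (rho g *m v) a 0).
  move=> k; apply: (@vspace_of_pred _ _ (fun v => forall a, deg_lt k (fun g => (rho g *m v) a 0))).
    by move=> a; apply: deg_lt_eq0 => g; rewrite mulmx0 mxE.
  move=> c u v du dv a; have := deg_ltD c (du a) (dv a); congr deg_lt; apply/funext => g.
  by rewrite mulmxDr -scalemxAr !mxE.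
exists n, E; split.
- apply/vspaceP => v; rewrite memv0; apply/idP/eqP => [/EP v0|->]; last exact: mem0v.
  by apply/colP => i; have := v0 i 1%g; rewrite r1 mul1mx mxE.
- apply/vspaceP => v; rewrite memvf; apply/EP => a.
  have := deg_lt_sum (index_enum 'I_d) (fun j => v j 0) (fun j => nP (a, j)).
  by congr deg_lt; apply/funext => g; rewrite mxE; apply: eq_bigr => j _; rewrite mulrC.
- by move=> k; apply/subvP => v /EP vk; apply/EP => a; exact: deg_ltS.
move=> k g v /EP vk; apply/EP => a; have := vk a g; congr deg_lt; apply/funext => x.
by rewrite mulmxBr mulmxA -rM !mxE.
Qed.

(** Each difference of an orbit map moves the vector one step down the flag, so its length bounds
    the degree. *)
Lemma unipotent_rep_polyfun d (rho : G -> 'M[K]_d) i j :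
  unipotent_rep rho -> polyfun (fun g => rho g i j).
Proof.
move=> [r1 rM rc [l [E [E0 El ES ED]]]]; split.
  exact: (comp_cts rc (@mx_entry_cts _ _ _ _ i j)).
exists l; have key k v : v \in E k -> forall a, deg_lt k (fun g => (rho g *m v) a 0).
  elim: k v => [|k IH] v vE a.
    by move: vE; rewrite E0 memv0 => /eqP-> g; rewrite mulmx0 mxE.
  move=> y; have := IH _ (ED _ y _ vE) a; congr deg_lt; apply/funext => x.
  by rewrite mulmxBr mulmxA -rM !mxE.
have := key l (delta_mx j 0); rewrite El memvf => /(_ isT i); congr deg_lt.
by apply/funext => g; rewrite -colE mxE.
Qed.

Lemma uactP (X : urep) : unipotent_rep (uact X).
Proof. by case: X. Qed.

Lemma umat_sig (X : urep) : {M : 'M[A]_(udim X) | forall i j g, M i j g = uact X g i j}.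
Proof.
by exists (\matrix_(i, j) mkA (unipotent_rep_polyfun i j (uactP X))) => i j g; rewrite mxE.
Qed.

Definition umat (X : urep) := sval (umat_sig X).

Lemma umatE (X : urep) i j g : umat X i j g = uact X g i j.
Proof. exact: (svalP (umat_sig X)). Qed.

Lemma uactM (X : urep) g h : uact X (g * h)%g = uact X g *m uact X h.
Proof. by have [_ ->] := uactP X. Qed.

Lemma umat_splits (X : urep) i j : splits (umat X i j) [seq (umat X i l, umat X l j) | l <- index_enum 'I_(udim X)].
Proof.
move=> g h; rewrite umatE uactM mxE big_map; apply: eq_bigr => l _.
by rewrite !umatE.
Qed.

Lemma umat_smul (R : comAlgType K) (x y : points U R) X :
  map_mx (smul x y) (umat X) = map_mx x (umat X) *m map_mx y (umat X).
Proof.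
apply/matrixP => i j; rewrite !mxE; apply: etrans (smulAE x y (umat_splits i j)) _.
by rewrite big_map; apply: eq_bigr => l _; rewrite !mxE.
Qed.

Lemma umat_sone (R : comAlgType K) X : map_mx (sone U R) (umat X) = 1%:M.
Proof.
apply/matrixP => i j; rewrite !mxE sone_specA.
have [r1 _ _ _] := uactP X.
rewrite umatE r1 mxE; case: (i == j); first exact: scale1r.
exact: scale0r.
Qed.

Lemma comb_point (R : comAlgType K) (x : points U R) (I : Type) (s : seq I) (c : I -> K) (a : I -> A) :
  x (\sum_(i <- s) c i *: a i) = \sum_(i <- s) c i *: x (a i).
Proof. exact: linear_comb. Qed.

Lemma umat_tensor_automorphism (R : comAlgType K) (x : points U R) :
  tensor_automorphism (fun X => map_mx x (umat X)).
Proof.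
split=> [X|X Y f fXY|X Y XY|triv].
- exists (map_mx (sinv x) (umat X)); rewrite -!umat_smul smulVx smulxV.
  by rewrite !umat_sone.
- apply/matrixP => i j; rewrite !mxE.
  transitivity (x (\sum_l f i l *: umat X l j)).
    by rewrite comb_point; apply: eq_bigr => l _; rewrite !mxE mulr_algl.
  transitivity (x (\sum_l f l j *: umat Y i l)).
    congr (x _); apply: polyA_eq => g; rewrite !A_sumE.
    have /matrixP/(_ i j) := fXY g; rewrite !mxE => e.
    transitivity (\sum_l f i l * uact X g l j).
      by apply: eq_bigr => l _; rewrite A_scaleE umatE.
    rewrite e; apply: eq_bigr => l _; by rewrite A_scaleE umatE mulrC.
  by rewrite comb_point; apply: eq_bigr => l _; rewrite !mxE mulr_algr.
- rewrite -(mxtens.map_mxT x); congr (map_mx x _); apply/matrixP => i j; apply: polyA_eq => g.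
  by rewrite umatE !mxE A_mulE !umatE.
- apply/matrixP => i j; rewrite mxE (_ : umat _ i j = 1) ?rmorph1 ?mxE ?ord1//.
  by apply: polyA_eq => g; rewrite umatE A_oneE /= mxE.
Qed.

Record deg_basis n := DegBasis {
  db_size : nat; db_pt : 'I_db_size -> G; db_fun : 'I_db_size -> A;
  db_deg : forall i, deg_lt n (db_fun i);
  db_dual : forall i j, db_fun i (db_pt j) = (i == j)%:R;
  db_coord : forall a : A, deg_lt n a -> a = \sum_i a (db_pt i) *: db_fun i }.

Lemma deg_basis_exists n : deg_basis n.
Proof.
have /cid[r /cid[x /cid[e [h1 h2 h3]]]] :=
  polyfun_basis n fgG (@A_linE p p_pr G) (@A_eq0 p p_pr G) (fun a => (polyAP a).1).
exact: DegBasis h1 h2 h3.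
Qed.

Definition dim_lt n := db_size (deg_basis_exists n).
Definition dpt n : 'I_(dim_lt n) -> G := @db_pt _ _.
Definition dfun n : 'I_(dim_lt n) -> A := @db_fun _ _.

Lemma dfun_deg n (i : 'I_(dim_lt n)) : deg_lt n (dfun i).
Proof. exact: db_deg. Qed.

Lemma dfun_dual n (i j : 'I_(dim_lt n)) : dfun i (dpt j) = (i == j)%:R.
Proof. exact: db_dual. Qed.

Lemma dfun_coord n (a : A) : deg_lt n a -> a = \sum_(i < dim_lt n) a (dpt i) *: dfun i.
Proof. exact: db_coord. Qed.

Lemma dfunE n (a : A) g : deg_lt n a -> a g = \sum_(i < dim_lt n) a (dpt i) * dfun i g.
Proof.
move=> da; rewrite {1}(dfun_coord da) A_sumE.
by apply: eq_bigr => i _; rewrite A_scaleE.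
Qed.

(** Right translation on functions of degree < n in the basis [dfun], where the coordinates of a
    function are its values at the points [dpt]. *)
Definition reg_act n (g : G) : 'M[K]_(dim_lt n) := \matrix_(i, j) dfun j (dpt i * g)%g.

Lemma reg_unipotent n : unipotent_rep (@reg_act n).
Proof.
apply: polynomial_unipotent_rep => [|g h|i j].
- by apply/matrixP => i j; rewrite !mxE mulg1 dfun_dual eq_sym.
- apply/matrixP => i j; rewrite !mxE mulgA.
  have dj : deg_lt n (Aright h (dfun j)) by apply: deg_lt_right; exact: dfun_deg.
  rewrite -[LHS]/(Aright h (dfun j) _) (dfunE _ dj); apply: eq_bigr => l _.
  by rewrite !mxE mulrC.
- have := polyfun_left (dpt i) (polyAP (dfun j)).
  by congr polyfun; apply/funext => g; rewrite mxE.
Qed.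

Definition reg n : urep := URep (reg_unipotent n).

Lemma regE n g (i j : 'I_(dim_lt n)) : uact (reg n) g i j = dfun j (dpt i * g)%g.
Proof. by rewrite mxE. Qed.

Section FromAutomorphism.
Variables (R : comAlgType K) (lambda : forall X : urep, 'M[R]_(udim X)).
Hypothesis lP : tensor_automorphism lambda.

Definition mpair d (L : 'M[R]_d) (u : 'rV[K]_d) (v : 'cV[K]_d) : R :=
  (map_mx (in_alg R) u *m L *m map_mx (in_alg R) v) 0 0.

(** The value that lambda forces at a: by [reg_coef], a is the coefficient of [reg n] between
    evaluation at 1 and the vector a itself. *)
Definition reg_point n (a : A) : R :=
  mpair (lambda (reg n)) (\row_(i < dim_lt n) dfun i 1%g)
    (\col_(i < dim_lt n) a (dpt i)).

(* A matrix coefficient of X is one of the regular representation on functions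
   of degree < n, through an intertwiner. *)
Lemma mpair_reg (X : urep) (u : 'rV[K]_(udim X)) (v : 'cV[K]_(udim X)) (a : A) n :
  (forall i j, deg_lt n (umat X i j)) ->
  (forall g, a g = (u *m uact X g *m v) 0 0) -> mpair (lambda X) u v = reg_point n a.
Proof.
move=> dX aE;
pose T : 'M[K]_(dim_lt n, udim X) := \matrix_(i, k) (u *m uact X (dpt i)) 0 k.
have co k : exists f : A, deg_lt n f /\ forall g, f g = (u *m uact X g) 0 k.
  exists (\sum_l u 0 l *: umat X l k); split.
    have := deg_lt_sum (index_enum _) (fun l => u 0 l) (fun l => dX l k).
    by congr deg_lt; apply/funext => g; rewrite A_sumE; apply: eq_bigr => l _; rewrite A_scaleE.
  by move=> g; rewrite A_sumE mxE; apply: eq_bigr => l _; rewrite A_scaleE umatE.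
have TX : intertwines (X := X) (Y := reg n) T.
  move=> g; apply/matrixP => i k; rewrite !mxE.
  have [f [df fE]] := co k.
  transitivity (f (dpt i * g)%g).
    rewrite fE uactM mulmxA mxE; apply: eq_bigr => l _; by rewrite !mxE.
  rewrite (dfunE _ df); apply: eq_bigr => l _.
  by rewrite regE [T l k]mxE mulrC fE.
have uT : (\row_(i < dim_lt n) dfun i 1%g) *m T = u.
  apply/rowP => k; have [f [df fE]] := co k.
  have [r1 _ _ _] := uactP X.
  transitivity (f 1%g); last by rewrite fE r1 mulmx1.
  rewrite (dfunE _ df) mxE; apply: eq_bigr => l _.
  by rewrite [X in X * _]mxE [T l k]mxE mulrC fE.
have Tv : T *m v = \col_(i < dim_lt n) a (dpt i).
  apply/colP => i; rewrite !mxE aE mxE; apply: eq_bigr => l _; by rewrite !mxE.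
have [_ nat_l _ _] := lP.
rewrite /mpair /reg_point -{1}uT map_mxM -(mulmxA _ (map_mx _ T)) (nat_l _ _ _ TX).
by rewrite /mpair -Tv map_mxM !mulmxA.
Qed.

Lemma reg_coef n (a : A) : deg_lt n a -> forall g,
  a g = ((\row_(i < dim_lt n) dfun i 1%g) *m uact (reg n) g *m (\col_(i < dim_lt n) a (dpt i))) 0 0.
Proof.
move=> da g; rewrite mxE.
have dg : deg_lt n (Aleft 1%g (Aright g a)) by apply: deg_lt_left; exact: deg_lt_right.
rewrite (dfunE _ da) (eq_bigr _ (fun j _ => mulrC _ _)); apply: eq_bigr => j _.
congr (_ * _); last by rewrite mxE.
rewrite mxE.
have dj : deg_lt n (Aright g (dfun j)) by apply: deg_lt_right; exact: dfun_deg.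
rewrite -[g in LHS]mul1g -[LHS]/(Aright g (dfun j) _) (dfunE _ dj).
by apply: eq_bigr => i _; rewrite !mxE mulrC.
Qed.

Lemma umat_deg (X : urep) : exists n, forall i j, deg_lt n (umat X i j).
Proof.
have [n nP] := deg_lt_bound_fin (fun ij : 'I_(udim X) * 'I_(udim X) => polyAP (umat X ij.1 ij.2)).
by exists n => i j; exact: (nP (i, j)).
Qed.

(** [mpair_reg] is applied to [reg n] itself, whose coefficients have degree < n and therefore <
    m. *)
Lemma reg_point_le n m (a : A) : deg_lt n a -> (n <= m)%N -> reg_point n a = reg_point m a.
Proof.
move=> da nm; apply: mpair_reg; last exact: reg_coef.
move=> i j; apply: deg_lt_le nm _.
have := deg_lt_left (dpt i) (dfun_deg j).
congr deg_lt; apply/funext => g; rewrite umatE /= !mxE //.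
Qed.

Definition tpoint (a : A) : R := reg_point (projT1 (cid (polyAP a).2)) a.

Lemma tpointE n (a : A) : deg_lt n a -> tpoint a = reg_point n a.
Proof.
move=> da; rewrite /tpoint; case: cid => m /= ma.
by rewrite (reg_point_le ma (leq_addr n m)) (reg_point_le da (leq_addl m n)).
Qed.

Lemma tpoint_coef (X : urep) u v (a : A) :
  (forall g, a g = (u *m uact X g *m v) 0 0) -> tpoint a = mpair (lambda X) u v.
Proof.
move=> aE; have [n dX] := umat_deg X; rewrite (mpair_reg dX aE); apply: tpointE.
rewrite (_ : pval a = fun g => \sum_k (v k 0) * (\sum_l u 0 l * umat X l k g)).
  by do 2 apply: deg_lt_sum => ?; exact: dX.
apply/funext => g; rewrite aE mxE; apply: eq_bigr => k _; rewrite mulrC mxE; congr (_ * _).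
by apply: eq_bigr => l _; rewrite umatE.
Qed.

Lemma mpair_lin d (L : 'M[R]_d) u c v w : mpair L u (c *: v + w) = c *: mpair L u v + mpair L u w.
Proof.
rewrite /mpair map_mxD mulmxDr [LHS]mxE; congr (_ + _).
have -> : map_mx (in_alg R) (c *: v) = c%:A *: map_mx (in_alg R) v.
  by apply/colP => i; rewrite !mxE -[LHS]/(in_alg R (c * v i 0)) rmorphM.
by rewrite -scalemxAr mxE mulr_algl.
Qed.

Lemma tpoint_linear : linear tpoint.
Proof.
move=> c a b; have [n da] := (polyAP a).2; have [m db] := (polyAP b).2.
have {}da : deg_lt (n + m) a := deg_lt_le (leq_addr _ _) da.
have {}db : deg_lt (n + m) b := deg_lt_le (leq_addl _ _) db.
rewrite (tpointE da) (tpointE db) (@tpointE (n + m)); last first.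
  have := deg_ltD c da db; congr deg_lt; apply/funext => x; by rewrite A_linE.
rewrite /reg_point -mpair_lin; congr mpair; apply/colP => i; by rewrite !mxE A_linE.
Qed.

Lemma tensor_unipotent (X Y : urep) : unipotent_rep (fun g => mxtens.tensmx (uact X g) (uact Y g)).
Proof.
have [rX _ _ _] := uactP X; have [rY _ _ _] := uactP Y.
apply: polynomial_unipotent_rep => [|g h|i j].
- apply/matrixP => i j; rewrite rX rY !mxE -natrM mulnb; congr (_%:R); congr nat_of_bool.
  apply/andP/eqP => [[/eqP e1 /eqP e2]|->]; last by rewrite !eqxx.
  apply: (can_inj (@mxtens.mxtens_unindexK _ _)).
  by rewrite [LHS]surjective_pairing e1 e2 -surjective_pairing.
- by rewrite !uactM mxtens.tensmx_mul.
- have := polyfunM (polyAP (umat X (mxtens.mxtens_unindex i).1 (mxtens.mxtens_unindex j).1))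
     (polyAP (umat Y (mxtens.mxtens_unindex i).2 (mxtens.mxtens_unindex j).2)).
  by congr polyfun; apply/funext => g; rewrite !umatE mxE.
Qed.

Lemma trivial_unipotent : unipotent_rep (fun _ : G => 1%:M : 'M[K]_1).
Proof.
apply: polynomial_unipotent_rep => [//|g h|i j]; first by rewrite mulmx1.
exact: polyfun_cst.
Qed.

(** The product a b is a coefficient of the tensor product of two regular representations, on which
    lambda is the Kronecker product; the constant 1 is the coefficient of the trivial
    representation. *)
Lemma tpoint_monoid : monoid_morphism tpoint.
Proof.
have [_ _ l_tens l_triv] := lP; split=> [|a b].
  rewrite (@tpoint_coef (URep trivial_unipotent) 1%:M 1%:M).
    by rewrite /mpair l_triv !map_mx1 !mulmx1 mxE.
  by move=> g; rewrite A_oneE !mulmx1 mxE.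
have [n da] := (polyAP a).2; have [m db] := (polyAP b).2.
rewrite (tpoint_coef (reg_coef da)) (tpoint_coef (reg_coef db)).
set u := (\row_i dfun i 1%g : 'rV_(dim_lt n)); set v := (\col_i a _ : 'cV_(dim_lt n)).
set u' := (\row_i dfun i 1%g : 'rV_(dim_lt m)); set v' := (\col_i b _ : 'cV_(dim_lt m)).
rewrite (@tpoint_coef (URep (tensor_unipotent (reg n) (reg m))) (mxtens.tensmx u u') (mxtens.tensmx v v')).
  have mT q q' r r' (M : 'M[K]_(q, q')) (N : 'M[K]_(r, r')) : map_mx (in_alg R) (mxtens.tensmx M N) =
      mxtens.tensmx (map_mx (in_alg R) M) (map_mx (in_alg R) N).
    by apply/matrixP => i j; rewrite !mxE; exact: rmorphM.
  transitivity ((mxtens.tensmx (map_mx (in_alg R) u) (map_mx (in_alg R) u')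
    *m mxtens.tensmx (lambda (reg n)) (lambda (reg m))
    *m mxtens.tensmx (map_mx (in_alg R) v) (map_mx (in_alg R) v')) (0 : 'I_1) (0 : 'I_1)).
    have lt : lambda (URep (tensor_unipotent (reg n) (reg m))) = mxtens.tensmx (lambda (reg n)) (lambda (reg m)) := l_tens _ _ _.
    rewrite -!mT -lt; exact: erefl.
  rewrite !mxtens.tensmx_mul mxE.
  by congr (_ * _); congr fun_of_matrix; rewrite ord1.
move=> g; rewrite A_mulE (reg_coef da) (reg_coef db).
transitivity ((mxtens.tensmx u u' *m mxtens.tensmx (uact (reg n) g) (uact (reg m) g) *m
  mxtens.tensmx v v') (0 : 'I_1) (0 : 'I_1)); last exact: erefl.
rewrite !mxtens.tensmx_mul [RHS]mxE.
by congr (_ * _); congr fun_of_matrix; rewrite ord1.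
Qed.

Lemma from_tensor_automorphism : exists x : points U R, forall X, map_mx x (umat X) = lambda X.
Proof.
pose x : {lrmorphism A -> R} := HB.pack tpoint
  (GRing.isLinear.Build _ _ _ _ tpoint tpoint_linear)
  (GRing.isMonoidMorphism.Build _ _ tpoint tpoint_monoid).
exists x => X; apply/matrixP => i j; rewrite mxE.
rewrite -[x _]/(tpoint _) (@tpoint_coef X (delta_mx 0 i) (delta_mx j 0)).
  rewrite /mpair !map_delta_mx -rowE -colE !mxE //.
by move=> g; rewrite umatE -rowE -colE !mxE.
Qed.

End FromAutomorphism.

Lemma tannakian_specA : tannakian_group (etaA p_pr fgG).
Proof.
exists (fun R (x : points U R) X => map_mx x (umat X)); last first.
  by move=> g X; apply/matrixP => i j; rewrite mxE; exact: umatE.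
split=> [R x y xy|R|R x y|R S h x].
- apply: lrmorph_eq => a; have [n da] := (polyAP a).2.
  (* Every polynomial function is a combination of coefficients of a regular representation, so
     these determine a point. *)
  have aE : a = \sum_(ij : 'I_(dim_lt n) * 'I_(dim_lt n))
      (dfun ij.1 1%g * a (dpt ij.2)) *: umat (reg n) ij.1 ij.2.
    rewrite -(pair_bigA _ (fun i j => (dfun i 1%g * a (dpt j)) *: umat (reg n) i j)) /=.
    apply: polyA_eq => g; rewrite (reg_coef da g) mxE exchange_big A_sumE; apply: eq_bigr => j _.
    rewrite A_sumE [X in X * _]mxE mulr_suml; apply: eq_bigr => i _.
    by rewrite A_scaleE umatE [X in X * _ * _]mxE [X in _ * _ * X]mxE mulrAC.
  have zE (z : points U R) : z a = \sum_(ij : 'I_(dim_lt n) * 'I_(dim_lt n))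
      (dfun ij.1 1%g * a (dpt ij.2)) *: map_mx z (umat (reg n)) ij.1 ij.2.
    rewrite {1}aE comb_point; apply: eq_bigr => ij _; by rewrite mxE.
  rewrite !zE; apply: eq_bigr => ij _; congr (_ *: _).
  by have -> := congr1 (fun l : forall X : urep, 'M[R]_(udim X) => l (reg n)) xy.
- apply/seteqP; split=> [_ [x _ <-]|l lP]; first exact: umat_tensor_automorphism.
  by have [x xE] := from_tensor_automorphism lP; exists x => //; exact: functional_extensionality_dep.
- by apply: functional_extensionality_dep => X; exact: umat_smul.
- by apply: functional_extensionality_dep => X; apply/matrixP => i j; rewrite !mxE.
Qed.

End Tannakian.

(** * Completed group algebras *)

Section CompactTotallyDisconnected.
Variable T : topologicalType.
Hypotheses (cT : compact [set: T]) (hT : hausdorff_space T) (tdT : totally_disconnected [set: T]).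

(** Otherwise the sets C minus W, for C clopen around x, generate a proper filter, and by
    compactness some point outside W lies in all these C. *)
Lemma clopen_inside (x : T) (W : set T) : open W ->
  (forall y, (forall C, clopen C -> C x -> C y) -> W y) -> exists C, [/\ clopen C, C x & C `<=` W].
Proof.
move=> oW QW; apply: contrapT => noC.
pose F := filter_from [set C : set T | clopen C /\ C x] (fun C => C `\` W).
have FF : ProperFilter F.
  apply: filter_from_proper; last first.
    move=> C [cC Cx]; apply: contrapT => /set0P/negP; rewrite negbK => /eqP CW; apply: noC.
    by exists C; split=> // y Cy; apply: contrapT => Wy; have : (C `\` W) y by []; rewrite CW.
  apply: filter_from_filter; first by exists setT; split=> //; exact: clopenT.
  move=> C D [cC Cx] [cD Dx]; exists (C `&` D); first by split=> //; exact: clopenI.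
  by move=> y [[Cy Dy] Wy].
have [y [_ yF]] := cT FF filterT.
have yC C : clopen C -> C x -> closure (C `\` W) y.
  by move=> cC Cx B yB; apply: yF => //; exists C.
have cl C : clopen C -> C x -> (C `\` W) y.
  move=> cC Cx; have /closure_id -> : closed (C `\` W).
    by apply: closedI; [exact: cC.2|exact: open_closedC].
  exact: yC.
have [_] := cl setT clopenT I; apply; apply: QW => C cC Cx.
by have [] := cl C cC Cx.
Qed.

(** Suppose it splits into closed parts B, containing x, and B'. Normality gives an open O around B
    whose closure misses B'; by [clopen_inside] some clopen neighbourhood of x meets O in a clopen
    set, which contains x and avoids B'. *)
Lemma quasi_component_connected (x : T) :
  connected [set y | forall C, clopen C -> C x -> C y].
Proof.
set Q := [set y | _].
have cQ : closed Q.
  have -> : Q = \bigcap_(C in [set C : set T | clopen C /\ C x]) C.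
    by apply/seteqP; split=> y Qy C; [case=> cC Cx; exact: Qy|move=> cC Cx; exact: Qy].
  by apply: closed_bigI => C [[]].
have Qx : Q x by move=> C.
have key B B' : closed B -> closed B' -> B `&` B' = set0 -> Q = B `|` B' -> B x -> B' = set0.
  move=> cB cB' BB' QBB' Bx.
  have : set_nbhs B (~` B').
    apply/set_nbhsP; exists (~` B'); split=> //; first exact: closed_openC.
    by move=> y By B'y; have : (B `&` B') y by []; rewrite BB'.
  move=> /(compact_normal hT cT cB)[U /set_nbhsP[O [oO BO OU]] UB'].
  have oV : open (~` closure U) by apply: closed_openC; exact: closed_closure.
  have [C [cC Cx CW]] : exists C, [/\ clopen C, C x & C `<=` O `|` ~` closure U].
    apply: clopen_inside; first exact: openU.
    move=> y Qy; have : Q y by exact: Qy.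
    by rewrite QBB' => -[/BO|B'y]; [left|right => /UB'].
  have cCO : clopen (C `&` O).
    split; first by apply: openI => //; exact: cC.1.
    have -> : C `&` O = C `&` closure U.
      apply/seteqP; split=> y [Cy yO]; split=> //; first by apply: subset_closure; exact: OU.
      by have [] := CW y Cy.
    by apply: closedI; [exact: cC.2|exact: closed_closure].
  apply/seteqP; split=> // y B'y; have Qy : Q y by rewrite QBB'; right.
  have [_ Oy] := Qy _ cCO (conj Cx (BO _ Bx)).
  by apply: (UB' y) => //; apply: subset_closure; exact: OU.
move=> B [b Bb] [O oO BO] [F cF BF].
have cB : closed B by rewrite BF; exact: closedI.
pose B' := Q `&` ~` O.
have cB' : closed B' by apply: closedI => //; exact: open_closedC.
have BB' : B `&` B' = set0 by rewrite BO /B'; apply/seteqP; split=> // y [[_ Oy] [_]].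
have QBB' : Q = B `|` B'.
  rewrite BO /B'; apply/seteqP; split=> y; last by case=> -[].
  by move=> Qy; have [Oy|nOy] := EM (O y); [left|right].
have [Bx|B'x] : B x \/ B' x by move: Qx; rewrite QBB'.
  by rewrite [in RHS]QBB' (key _ _ cB cB' BB' QBB' Bx) setU0.
suff B0 : B = set0 by move: Bb; rewrite B0.
by apply: key cB' cB _ _ B'x; rewrite 1?setIC// setUC.
Qed.

Lemma clopen_nbhs (x : T) (W : set T) : nbhs x W -> exists C, [/\ clopen C, C x & C `<=` W].
Proof.
rewrite nbhsE => -[O [oO Ox] OW].
have [C [cC Cx CO]] : exists C, [/\ clopen C, C x & C `<=` O].
  apply: clopen_inside => // y Qy; suff -> : y = x by [].
  have : connected_component [set: T] x y.
    exists [set y | forall C, clopen C -> C x -> C y] => //.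
    by split=> //; exact: quasi_component_connected.
  by rewrite tdT.
by exists C; split=> //; exact: subset_trans CO OW.
Qed.

End CompactTotallyDisconnected.

Section ProfiniteGroup.
Local Open Scope group_scope.
Variable G : topGroupType.
Hypotheses (cG : compact [set: G]) (hG : hausdorff_space G) (tdG : totally_disconnected [set: G]).

Lemma clopen_cts (T U : topologicalType) (f : T -> U) (C : set U) (x : T) :
  clopen C -> {for x, continuous f} -> \forall y \near x, C (f y) <-> C (f x).
Proof.
move=> [oC cC] fx; have [Cx|Cx] := EM (C (f x)).
  have xC : nbhs (f x) C by exact: open_nbhs_nbhs.
  by refine (@filterS _ (nbhs x) _ _ _ _ (fx _ xC)) => y Cy.
have oC' : open (~` C) by exact: closed_openC.
have xC : nbhs (f x) (~` C) by exact: open_nbhs_nbhs.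
by refine (@filterS _ (nbhs x) _ _ _ _ (fx _ xC)) => y Cy; split.
Qed.

(** H consists of the h whose insertion in any product does not affect membership in the clopen U.
    Quantifying over both sides makes it a normal subgroup at once, and the tube lemma on G x G
    makes it a neighbourhood of 1. *)
Lemma open_normal_nbhs (W : set G) : nbhs 1 W -> exists2 H, open_normal H & H `<=` W.
Proof.
move=> /(clopen_nbhs cG hG tdG)[U [cU U1 UW]].
pose H := [set h | forall x y, U (x * y) <-> U (x * h * y)].
exists H; last by move=> h Hh; apply: UW; have := (Hh 1 1).1; rewrite !mul1g mulg1; apply.
have sH : subgroup H.
  split=> [x y|h k Hh Hk x y|h Hh x y]; first by rewrite mulg1.
    by rewrite (Hh x y) (Hk (x * h) y) !mulgA.
  by rewrite (Hh (x * h^-1) y) mulgVK.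
have H1 : nbhs 1 H.
  have cGG : compact ([set: G] `*` [set: G]) by exact: compact_setX.
  have := (iffLR (compact_near_coveringP _) cGG) G (nbhs 1)
    (fun h xy => U (xy.1 * xy.2) <-> U (xy.1 * h * xy.2)) _.
  move=> /(_ _) tube.
  have /tube : forall xy : G * G, ([set: G] `*` [set: G]) xy ->
      \forall xy' \near xy & h \near 1, U (xy'.1 * xy'.2) <-> U (xy'.1 * h * xy'.2).
    move=> [x y] _ /=.
    pose f (z : (G * G) * G) := z.1.1 * z.2 * z.1.2; pose g (z : (G * G) * G) := z.1.1 * z.1.2.
    have cfst (A B : topologicalType) : continuous (@fst A B) by move=> z; exact: cvg_fst.
    have csnd (A B : topologicalType) : continuous (@snd A B) by move=> z; exact: cvg_snd.
    have c11 : continuous (fun z : (G * G) * G => z.1.1) := comp_cts (@cfst _ _) (@cfst _ _).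
    have c12 : continuous (fun z : (G * G) * G => z.1.2) := comp_cts (@cfst _ _) (@csnd _ _).
    have c2 : continuous (fun z : (G * G) * G => z.2) := @csnd _ _.
    have cf : continuous f by apply: mulg_cts => //; exact: mulg_cts.
    have cg : continuous g by apply: mulg_cts.
    refine (@filterS2 _ (nbhs ((x, y), 1)) _ _ _ _ _ (clopen_cts cU (cf ((x, y), 1))) (clopen_cts cU (cg ((x, y), 1)))).
    by rewrite /f /g /= mulg1 => z fz gz; rewrite gz fz.
  by apply: filterS => h hP x y; exact: (hP (x, y) (conj I I)).
split; last first.
  split=> // h z Hh x y; rewrite conjgE.
  have := Hh (x * z^-1) (z * y); rewrite !mulgA !mulgVK => ->.
  by [].
rewrite openE => h Hh; rewrite /interior.
have -> : H = (fun x => h^-1 * x) @^-1` H.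
  have [_ HM HV] := sH.
  by apply/seteqP; split=> x /= Hx; [apply: HM => //; exact: HV|rewrite -[x](mulVKg h); exact: HM].
by apply: mulgl_cts; rewrite mulVg.
Qed.

End ProfiniteGroup.

Lemma malg_scaleU (R : nzRingType) (T : choiceType) (c : R) (t : T) : << c *g t >> = c *: << t >>.
Proof. by apply/malgP => u; rewrite mcoeffZ !mcoeffU mulrnAr mulr1. Qed.

(** * Integration of continuous functions against the completed group algebra *)

Section LimitFunctional.
Variables (p : nat) (p_pr : prime p).
Local Notation Zp := (Zp p_pr).
Local Notation K := (Qp p_pr).

Lemma zp_coordM (a b a' b' : Zp) k : a k = a' k -> b k = b' k -> (a * b) k = (a' * b') k.
Proof. by move=> aa bb; rewrite !zp_mulE aa bb. Qed.

Lemma zp_coord_le (a b : Zp) k m : a (m + k)%N = b (m + k)%N -> a m = b m.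
Proof. by move=> e; rewrite -(zp_mod a) -(zp_val_mod a m k) e zp_val_mod zp_mod. Qed.

Lemma free_lift_coord (T : choiceType) (f g : T -> Zp^o) (x : {malg Zp[T]}) k :
  (forall t, (f t : Zp) k = (g t : Zp) k) -> (free_lift f x : Zp) k = (free_lift g x : Zp) k.
Proof.
move=> fg; rewrite /free_lift; elim/big_rec2: _ => // t y z _ yz.
by rewrite !zp_addE yz; congr modz; congr (_ + _); apply: zp_coordM.
Qed.

Variables (I : choiceType) (le : rel I) (M : I -> lmodType Zp).
Variable t : forall i j, le i j -> {linear M i -> M j}.
Local Notation L := (mod_lim t).
Hypothesis directed : forall i j, exists l, le l i /\ le l j.

(** The f_i are compatible only modulo p ^ k, and only below an index depending on k; the limit is
    therefore defined residue by residue. *)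
Lemma limit_functional (f : forall i, {linear M i -> Zp^o}) :
  (forall k, exists i0, forall i (h : le i i0) z, (f i z : Zp) k = (f i0 (t h z) : Zp) k) ->
  exists l : L -> Zp, (forall a x y, l (a *: x + y) = a * l x + l y) /\
    forall k, exists i0, forall i, le i i0 -> forall x, l x k = (f i (x i) : Zp) k.
Proof.
move=> /choice[c cP].
have approx k i (h : le i (c k)) (x : L) : (f i (x i) : Zp) k = (f (c k) (x (c k)) : Zp) k.
  by rewrite (cP k i h) mod_limP.
have coh (x : L) : padic_seq p (fun k => (f (c k) (x (c k)) : Zp) k).
  move=> k; have [l [l0 l1]] := directed (c k) (c k.+1).
  by rewrite -(approx _ _ l0) -(approx _ _ l1) -zpvalP.
exists (fun x => MkZp p_pr (asboolT (coh x))); split=> [a x y|k].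
  apply: zpP => k.
  transitivity ((a * (f (c k) (x (c k)) : Zp) + (f (c k) (y (c k)) : Zp)) k).
    by have /(congr1 (fun z : Zp => z k)) := linearP (f (c k)) a (x (c k)) (y (c k)).
  by rewrite !zp_addE !zp_mulE.
by exists (c k) => i h x /=; rewrite approx.
Qed.

End LimitFunctional.

Section IwasawaFunctionals.
Variables (p : nat) (p_pr : prime p) (G : topGroupType).
Local Notation Zp := (Zp p_pr).
Local Notation K := (Qp p_pr).
Hypotheses (cG : compact [set: G]) (hG : hausdorff_space G) (tdG : totally_disconnected [set: G]).
Local Notation ons := (open_normal_subgroup G).
Local Notation iw := (iwasawa_alg p_pr G).
Implicit Types H : ons.

Lemma onsP H : open_normal H.
Proof. by case: H => H /= /asboolP. Qed.

Lemma normal_closure_id (S : set G) : normal_subgroup S -> normal_closure S = S.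
Proof.
move=> nS; apply/seteqP; split; first by apply: smallest_sub.
by apply: sub_gen_smallest.
Qed.

Lemma repr_ons H g : on_set H ((repr (to_quot H g))^-1 * g)%g.
Proof. by have := @repr_to_quot _ H g; rewrite (normal_closure_id (onsP H).2). Qed.

Lemma ons_directed H H' : exists H'', on_sub H'' H /\ on_sub H'' H'.
Proof.
have [oH [[H1 HM HV] HJ]] := onsP H; have [oH' [[H'1 H'M H'V] H'J]] := onsP H'.
have oI : open_normal (H `&` H').
  split; first exact: openI.
  split; last by move=> x y [Hx H'x]; split; [exact: HJ|exact: H'J].
  split=> //; first by move=> x y [Hx H'x] [Hy H'y]; split; [exact: HM|exact: H'M].
  by move=> x [Hx H'x]; split; [exact: HV|exact: H'V].
by exists (OpenNormal (asboolT oI)); split; apply/asboolP => x [].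
Qed.

Lemma ons_nbhs (W : set G) : nbhs (1%g : G) W -> exists H, H `<=` W.
Proof.
by move=> /(open_normal_nbhs cG hG tdG)[H oH HW]; exists (OpenNormal (asboolT oH)).
Qed.

Definition unif (b : G -> Zp) := forall k, exists H, forall g h, on_set H h -> b (g * h)%g k = b g k.

(** A Riemann sum: b is sampled at a representative of each coset and weighted by the mass of the
    coset. *)
Definition coset_sum (b : G -> Zp) H : group_alg p_pr H -> Zp^o :=
  free_lift (fun c : quot_group H => b (repr c) : Zp^o).
HB.instance Definition _ b H := GRing.Linear.on (@coset_sum b H).

Lemma unif_repr (b : G -> Zp) k H H' g : (forall g h, on_set H h -> b (g * h)%g k = b g k) -> H' `<=` H ->
  b (repr (to_quot H' g)) k = b g k.
Proof.
move=> bH H'H; rewrite -{2}[g](mulVKg (repr (to_quot H' g))) bH//.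
by apply: H'H; exact: repr_ons.
Qed.

Lemma coset_sum_push (b : G -> Zp) k H : (forall g h, on_set H h -> b (g * h)%g k = b g k) ->
  forall H' (h : on_sub H' H) z, coset_sum b z k = coset_sum b (push p_pr h z) k.
Proof.
move=> bH H' h z; rewrite /coset_sum free_lift_push; apply: free_lift_coord.
elim/quot_ind=> g; rewrite /comp quot_mapE//; have /asboolP hs := h.
by rewrite !(unif_repr _ bH).
Qed.

Definition approx_by (b : G -> Zp) (l : iw -> Zp) := forall k, exists H, forall H', on_sub H' H ->
  forall x : iw, l x k = coset_sum b (x H') k.

(** Uniform continuity makes the Riemann sums compatible modulo p ^ k for small H, which is what
    [limit_functional] asks. *)
Lemma iwasawa_functional b : unif b -> exists l : iw -> Zp,
  (forall a x y, l (a *: x + y) = a * l x + l y) /\ approx_by b l.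
Proof.
move=> ub; apply: (limit_functional ons_directed (f := fun H => coset_sum b (H := H))) => k.
by have [H bH] := ub k; exists H => H' h z; exact: coset_sum_push.
Qed.

Lemma ons_three H1 H2 H3 : exists H, [/\ on_sub H H1, on_sub H H2 & on_sub H H3].
Proof.
have [H [h1 h2]] := ons_directed H1 H2; have [H' [h h3]] := ons_directed H H3.
exists H'; split=> //; apply/asboolP; move: h h1 h2 => /asboolP h /asboolP h1 /asboolP h2.
  exact: subset_trans h h1.
exact: subset_trans h h2.
Qed.

Lemma coset_sumU b H g : coset_sum b (grp_elt p_pr g H) = b (repr (to_quot H g)).
Proof. by rewrite /coset_sum free_liftU. Qed.

Lemma approx_grp b l g : unif b -> approx_by b l -> l (grp_elt p_pr g) = b g.
Proof.
move=> ub lb; apply: zpP => k; have [H bH] := ub k; have [H' lH'] := lb k.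
have [H'' [h h']] := ons_directed H H'; rewrite (lH' _ h') coset_sumU.
by apply: unif_repr bH _; apply/asboolP.
Qed.

Local Notation sq := (iwasawa_sq p_pr G).

(** The same construction with Riemann sums of b(g) b'(h) over pairs of cosets. *)
Lemma square_functional b b' l l' : unif b -> unif b' -> approx_by b l -> approx_by b' l' ->
  exists T : sq -> Zp, [/\ forall a x y, T (a *: x + y) = a * T x + T y,
    forall k, exists H, forall x y : sq, (exists z, x H - y H = p%:R ^+ k *: z) -> T x k = T y k &
    forall x y : iw, T (iwasawa_tens x y) = l x * l' y].
Proof.
move=> ub ub' lb lb'.
have bf H : bilin (fun x y => coset_sum b (x : group_alg p_pr H) * coset_sum b' (y : group_alg p_pr H) : Zp^o).
  split=> [y a x x'|x a y y']; rewrite linearP.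
    by rewrite mulrDl -scalerAl.
  by rewrite mulrDr -scalerAr.
pose fl H : tensor (group_alg p_pr H) (group_alg p_pr H) -> Zp^o :=
  tensor_lift (fun x y => coset_sum b x * coset_sum b' y : Zp^o).
pose f H : {linear tensor (group_alg p_pr H) (group_alg p_pr H) -> Zp^o} :=
  HB.pack (@fl H) (GRing.isLinear.Build _ _ _ _ (@fl H) (tensor_lift_is_linear (bf H))).
have fE H x y : f H (tens x y) = coset_sum b x * coset_sum b' y.
  exact: (tensor_liftE (bf H)).
have [|T [Tl Ta]] := limit_functional ons_directed (f := f)
    (t := fun H H' (HH' : on_sub H H') => tensor_map (push p_pr HH') (push p_pr HH')).
  move=> k; have [H1 b1] := ub k; have [H2 b2] := ub' k.
  have [H [h1 h2]] := ons_directed H1 H2; exists H => H' h z.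
  elim/tensor_ind: z => [|x y u IH]; first by rewrite !linear0.
  transitivity ((f H' (tens x y) + f H' u : Zp) k); first by rewrite linearD.
  transitivity ((f H (tens (push p_pr h x) (push p_pr h y)) +
    f H (tensor_map (push p_pr h) (push p_pr h) u) : Zp) k); last first.
    by congr (zpval _ k); rewrite linearD [RHS]linearD; congr (f H _ + _); exact/esym/tensor_mapE.
  rewrite !fE !zp_addE IH; congr modz; congr (_ + _).
  move: h1 h2 => /asboolP h1 /asboolP h2.
  by apply: zp_coordM; apply: coset_sum_push => g w Hw; [apply: b1; exact: h1|apply: b2; exact: h2].
exists T; split; [exact Tl|move=> k|move=> x y].
  have [H TH] := Ta k; exists H => x y [z xyz].
  have hH : on_sub H H by apply/asboolP.
  rewrite !(TH H hH) -[x H](subrK (y H)) xyz linearD.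
  have -> : f H (p%:R ^+ k *: z) = p%:R ^+ k * (f H z : Zp) by exact: linearZ.
  by rewrite zp_addE zp_mulE zp_pE mul0r mod0z add0r zp_mod.
apply: zpP => k; have [H1 h1] := Ta k; have [H2 h2] := lb k; have [H3 h3] := lb' k.
have [H [k1 k2 k3]] := ons_three H1 H2 H3.
by rewrite (h1 _ k1) fE; apply: zp_coordM; [rewrite (h2 _ k2)|rewrite (h3 _ k3)].
Qed.

(** Continuity is stated at 0, on basic neighbourhoods; additivity propagates it. *)
Definition ctslin (l : iw -> K) :=
  (forall a x y, l (a *: x + y) = Zp_Qp a * l x + l y) /\
  forall k, exists H m, forall x : iw, (exists z, x H = p%:R ^+ m *: z) -> pid k (l x).

Lemma ctslin_sum (l : iw -> K) (J : Type) (s : seq J) (c : J -> Zp) (x : J -> iw) : ctslin l ->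
  l (\sum_(i <- s) c i *: x i) = \sum_(i <- s) Zp_Qp (c i) * l (x i).
Proof.
move=> [ll _]; elim: s => [|i s IH]; last by rewrite !big_cons ll IH.
rewrite !big_nil; have := ll 1 0 0; rewrite scaler0 addr0 rmorph1 mul1r.
exact: (@add_self_eq0 K).
Qed.

Lemma iw_sum (J : Type) (s : seq J) (x : J -> iw) H :
  (\sum_(i <- s) x i) H = \sum_(i <- s) x i H.
Proof. by elim: s => [|i s IH]; rewrite ?big_nil// !big_cons -IH. Qed.

Lemma iw_approx (x : iw) H : exists (s : seq (quot_group H)) (c : quot_group H -> Zp),
  (\sum_(i <- s) c i *: grp_elt p_pr (repr i)) H = x H.
Proof.
exists (msupp (x H)), (fun i => (x H)@_i); rewrite iw_sum [RHS]monalgE.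
apply: eq_bigr => i _; transitivity ((x H)@_i *: (grp_elt p_pr (repr i) H)) => //.
rewrite [grp_elt _ _ _]/= (_ : to_quot H (repr i) = i); last exact: reprK.
exact/esym/malg_scaleU.
Qed.

(** At each level H an element agrees with a finite combination of group elements, so these
    combinations are dense. *)
Lemma ctslin_eq0 (l : iw -> K) : ctslin l -> (forall g, l (grp_elt p_pr g) = 0) -> forall x, l x = 0.
Proof.
move=> cl l0 x; have [ll lc] := cl; apply: qp_eq0 => k; have [H [m Hm]] := lc k.
have [s [c scE]] := iw_approx x H; set y := \sum_(i <- s) _ in scE.
have ly : l y = 0 by rewrite (ctslin_sum _ _ _ cl) big1// => i _; rewrite l0 mulr0.
have := ll (-1) y x; rewrite ly mulr0 add0r => <-; apply: Hm; exists 0.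
rewrite scaler0; transitivity ((-1) *: y H + x H) => //.
by rewrite scE scaleN1r addNr.
Qed.

Lemma ctslin_comb (l l' : iw -> K) c : ctslin l -> ctslin l' -> ctslin (fun x => c * l x + l' x).
Proof.
move=> [ll lc] [ll' lc']; split=> [a x y|k]; first by rewrite ll ll'; ring.
have [m cm] := qp_pid_ex c.
have [H [n Hn]] := lc (k + m)%N; have [H' [n' Hn']] := lc' k.
have [H'' [h h']] := ons_directed H H'; exists H'', (n + n')%N => x [z xz].
apply: pidD.
  rewrite -(addnK m k); apply: cm; first exact: leq_addl.
  apply: Hn; exists (p%:R ^+ n' *: push p_pr h z).
  by rewrite -(mod_limP x h) xz linearZ /= scalerA -exprD.
apply: Hn'; exists (p%:R ^+ n *: push p_pr h' z).
by rewrite -(mod_limP x h') xz linearZ /= scalerA -exprD addnC.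
Qed.

Lemma cts_bounded (a : G -> K) : continuous a -> exists N, forall g, exists z, p%:R ^+ N * a g = Zp_Qp z.
Proof.
move=> /qp_continuousP ca.
have nP : forall g : G, [set: G] g -> \forall g' \near g & N \near \oo,
    exists z : Zp, p%:R ^+ N * a g' = Zp_Qp z.
  move=> g _; have [N0 [z0 z0E]] := qp_bounded (a g).
  exists ([set g' | pid 0 (a g' - a g)], [set N | (N0 <= N)%N]) => /=; first by split; [exact: ca|exists N0].
  move=> [g' N] /= [[z zE] NN0]; exists (p%:R ^+ N * z + p%:R ^+ (N - N0) * z0).
  have zq m (w : Zp) : Zp_Qp (p%:R ^+ m * w) = p%:R ^+ m * Zp_Qp w :> K.
    by rewrite rmorphM rmorphXn rmorph_nat.
  have zD (u w : Zp) : Zp_Qp (u + w) = Zp_Qp u + Zp_Qp w :> K by rewrite rmorphD.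
  rewrite zD !zq -z0E mulrA -exprD subnK//.
  by rewrite -mulrDr; congr (_ * _); rewrite -[a g'](subrK (a g)) zE expr0 mul1r.
have [N _ NP] := (iffLR (compact_near_coveringP _) cG) nat \oo
  (fun N g => exists z : Zp, p%:R ^+ N * a g = Zp_Qp z) _ nP.
by exists N => g; exact: (NP N (leqnn N) g I).
Qed.

(** Compactness makes the condition near each (g, 1) uniform in g, and open normal subgroups form a
    basis at 1. *)
Lemma cts_unif (b : G -> Zp) : continuous (fun g => Zp_Qp (b g) : K) -> unif b.
Proof.
move=> /qp_continuousP ca k.
have nP : forall g : G, [set: G] g -> \forall g' \near g & h \near (1%g : G), b (g' * h)%g k = b g' k.
  move=> g _; have c2 : {for (g, 1%g : G), continuous (fun z : G * G => (z.1 * z.2)%g)} by exact: mulg_continuous.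
  have c1 : {for (g, 1%g : G), continuous (@fst G G)} by exact: cvg_fst.
  have W : nbhs (g * 1)%g [set y | pid k (Zp_Qp (b y) - Zp_Qp (b g) : K)] by rewrite mulg1; exact: ca.
  refine (@filterS2 _ (nbhs (g, 1%g : G)) _ _ _ _ _ (c2 _ W) (c1 _ (ca g k))) => -[g' h] /= Ag Bg.
  by move/pidBE: Ag => ->; move/pidBE: Bg => ->.
have nW := (iffLR (compact_near_coveringP _) cG) G (nbhs (1%g : G))
  (fun h g => b (g * h)%g k = b g k) _ nP.
by have [H HP] := ons_nbhs (nW _); exists H => g h Hh; exact: (HP h Hh g I).
Qed.

(** Compactness bounds the denominators of a, so that p ^ N a takes values in Z_p and can be
    integrated. *)
Lemma integral_functional (a : G -> K) : continuous a ->
  exists N (b : G -> Zp) (l : iw -> Zp), [/\ unif b, forall c x y, l (c *: x + y) = c * l x + l y,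
    approx_by b l & forall g, p%:R ^+ N * a g = Zp_Qp (b g)].
Proof.
move=> ca; have [N /choice[b bE]] := cts_bounded ca.
have cb : continuous (fun g => Zp_Qp (b g) : K).
  rewrite (_ : (fun g => _) = fun g => p%:R ^+ N * a g); last by apply/funext => g; rewrite bE.
  by apply: qp_continuousM => //; exact: cst_continuous.
have ub := cts_unif cb; have [l [ll lb]] := iwasawa_functional ub.
by exists N, b, l.
Qed.

Lemma pN_neq0 N : (p%:R ^+ N : K) != 0.
Proof. by rewrite expf_neq0// qp_p_neq0. Qed.

Lemma integral_ctslin N (b : G -> Zp) (l : iw -> Zp) :
  (forall c x y, l (c *: x + y) = c * l x + l y) -> approx_by b l ->
  ctslin (fun x => (p%:R ^+ N)^-1 * Zp_Qp (l x)).
Proof.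
move=> ll lb; split=> [c x y|k]; first by rewrite ll rmorphD rmorphM; ring.
have [H lH] := lb (N + k)%N; exists H, (N + k)%N => x [z xz].
have hH : on_sub H H by apply/asboolP.
have : pid (N + k) (Zp_Qp (l x) : K).
  apply/zp_pid; rewrite (lH H hH) xz.
  have -> : coset_sum b (p%:R ^+ (N + k) *: z) = p%:R ^+ (N + k) * (coset_sum b z : Zp) by exact: linearZ.
  by rewrite zp_mulE zp_pE mul0r mod0z.
by move=> [w ->]; exists w; rewrite exprD mulrA mulrA mulVf ?pN_neq0// mul1r.
Qed.

Lemma cts_functional (a : G -> K) : continuous a ->
  exists2 l : iw -> K, ctslin l & forall g, l (grp_elt p_pr g) = a g.
Proof.
move=> /integral_functional[N [b [l [ub ll lb bE]]]].
exists (fun x => (p%:R ^+ N)^-1 * Zp_Qp (l x)) => [|g]; first exact: integral_ctslin.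
by rewrite (approx_grp _ ub lb) -bE mulKf ?pN_neq0.
Qed.

Lemma ctslin_eq (l l' : iw -> K) : ctslin l -> ctslin l' ->
  (forall g, l (grp_elt p_pr g) = l' (grp_elt p_pr g)) -> forall x, l x = l' x.
Proof.
move=> cl cl' ll' x; have := ctslin_eq0 (ctslin_comb (-1) cl' cl) _ x.
move=> /(_ _)/eqP; rewrite mulN1r addrC subr_eq0 => h; apply/eqP/h => g.
by rewrite ll' mulN1r addNr.
Qed.

Lemma square_cts_functional (a a' : G -> K) (l l' : iw -> K) :
  continuous a -> continuous a' -> ctslin l -> ctslin l' ->
  (forall g, l (grp_elt p_pr g) = a g) -> (forall g, l' (grp_elt p_pr g) = a' g) ->
  exists T : sq -> K, [/\ forall c x y, T (c *: x + y) = Zp_Qp c * T x + T y,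
    forall k, exists H m, forall x y : sq, (exists z, x H - y H = p%:R ^+ m *: z) -> pid k (T x - T y) &
    forall x y : iw, T (iwasawa_tens x y) = l x * l' y].
Proof.
move=> ca ca' cl cl' la la'.
have [N [b [m [ub ml mb bE]]]] := integral_functional ca.
have [N' [b' [m' [ub' ml' mb' bE']]]] := integral_functional ca'.
have lE x : l x = (p%:R ^+ N)^-1 * Zp_Qp (m x).
  apply: (ctslin_eq cl (integral_ctslin N ml mb)) => g.
  by rewrite (approx_grp _ ub mb) -bE mulKf ?pN_neq0.
have lE' x : l' x = (p%:R ^+ N')^-1 * Zp_Qp (m' x).
  apply: (ctslin_eq cl' (integral_ctslin N' ml' mb')) => g.
  by rewrite (approx_grp _ ub' mb') -bE' mulKf ?pN_neq0.
have [T [Tl Tc TE]] := square_functional ub ub' mb mb'.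
exists (fun x => (p%:R ^+ (N + N'))^-1 * Zp_Qp (T x)); split=> [c x y|k|x y].
- by rewrite Tl rmorphD rmorphM; ring.
- have [H TH] := Tc (N + N' + k)%N; exists H, (N + N' + k)%N => x y /TH/pidBE => -[w wE].
  by exists w; rewrite -mulrBr wE (exprD _ (N + N')%N k) !mulrA mulVf ?mul1r// pN_neq0.
- by rewrite TE rmorphM lE lE' exprD invfM; ring.
Qed.

End IwasawaFunctionals.

Section BilinearProduct.
Variables (A : comNzRingType) (T : choiceType) (op : T -> T -> T).
Variable mu : {malg A[T]} -> {malg A[T]} -> {malg A[T]}.
Hypothesis mul_l : forall a x x' y, mu (a *: x + x') y = a *: mu x y + mu x' y.
Hypothesis mul_r : forall a x y y', mu x (a *: y + y') = a *: mu x y + mu x y'.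
Hypothesis mulU : forall c d, mu << c >> << d >> = << op c d >>.

Lemma bilinear_malg0l y : mu 0 y = 0.
Proof. by have := mul_l (-1) 0 0 y; rewrite scaler0 addr0 scaleN1r addNr. Qed.

Lemma bilinear_malg0r x : mu x 0 = 0.
Proof. by have := mul_r (-1) x 0 0; rewrite scaler0 addr0 scaleN1r addNr. Qed.

Lemma bilinear_malgA : associative op -> associative mu.
Proof.
move=> opA x y z.
elim/malg_ind: x => [|a c x IHx]; first by rewrite !bilinear_malg0l.
rewrite !mul_l {}IHx; apply: (congr1 (fun u => a *: u + mu (mu x y) z)).
elim/malg_ind: y => [|b d y IHy]; first by rewrite bilinear_malg0l bilinear_malg0r bilinear_malg0l.
rewrite mul_l !mul_r mul_l {}IHy; apply: (congr1 (fun u => b *: u + mu (mu << c >> y) z)).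
elim/malg_ind: z => [|e f z IHz]; first by rewrite !bilinear_malg0r.
by rewrite !mul_r IHz !mulU opA.
Qed.

Lemma bilinear_malg1 e x : right_id e op -> mu x << e >> = x.
Proof.
move=> ope; elim/malg_ind: x => [|a c x IH]; first by rewrite bilinear_malg0l.
by rewrite mul_l IH mulU ope.
Qed.

End BilinearProduct.

Section MonoidAlgebraMul.
Variables (A : comNzRingType) (T : choiceType) (op : T -> T -> T).
Local Notation MA := ({malg A[T]} : lmodType A).
Implicit Types x y z : {malg A[T]}.

Definition malg_mul x y : {malg A[T]} :=
  free_lift (fun c => free_lift (fun d => << op c d >> : {malg A[T]}) y) x.

Lemma malg_mul_linl a x x' y : malg_mul (a *: x + x') y = a *: malg_mul x y + malg_mul x' y.
Proof. exact: linearP. Qed.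

Lemma malg_mul_linr a x y y' : malg_mul x (a *: y + y') = a *: malg_mul x y + malg_mul x y'.
Proof.
rewrite /malg_mul {1 3 5}/free_lift scaler_sumr -big_split; apply: eq_bigr => c _ /=.
by rewrite linearP scalerDr !scalerA mulrC.
Qed.

Lemma malg_mulUU c d : malg_mul << c >> << d >> = << op c d >>.
Proof. by rewrite /malg_mul !free_liftU. Qed.

Lemma malg_mulA : associative op -> associative malg_mul.
Proof. exact: bilinear_malgA malg_mul_linl malg_mul_linr malg_mulUU. Qed.

Lemma malg_mulZl a x y : malg_mul (a *: x) y = a *: malg_mul x y.
Proof.
have := malg_mul_linl a x 0 y.
by rewrite (bilinear_malg0l malg_mul_linl) !addr0.
Qed.

Lemma malg_mulZr a x y : malg_mul x (a *: y) = a *: malg_mul x y.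
Proof.
have := malg_mul_linr a x y 0.
by rewrite (bilinear_malg0r malg_mul_linr) !addr0.
Qed.

Lemma free_lift_scale (f : T -> A^o) a x : free_lift f (a *: x) = a * free_lift f x.
Proof. exact: linearZ. Qed.

Lemma malg_mul1 e x : right_id e op -> malg_mul x << e >> = x.
Proof. exact: (bilinear_malg1 malg_mul_linl malg_mulUU). Qed.

Lemma free_lift_cst (c : A^o) x : free_lift (fun _ => c) x = free_lift (fun _ => 1 : A^o) x * c.
Proof.
rewrite /free_lift mulr_suml; apply: eq_bigr => t _; by rewrite -scalerAl mul1r.
Qed.

Lemma free_lift_mul x y : free_lift (fun _ => 1 : A^o) (malg_mul x y) =
  free_lift (fun _ => 1 : A^o) x * free_lift (fun _ => 1 : A^o) y.
Proof.
rewrite /malg_mul (linear_free_lift _ (free_lift _)) -free_lift_cst.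
apply: eq_free_lift => c /=; rewrite (linear_free_lift _ (free_lift _)); apply: eq_free_lift => d /=.
by rewrite free_liftU.
Qed.

End MonoidAlgebraMul.

(** * Powers of the augmentation ideal and finite generation modulo them *)

Section AlgMul.
Variables (p : nat) (p_pr : prime p) (G : topGroupType).
Local Notation Zp := (Zp p_pr).
Local Notation ons := (open_normal_subgroup G).
Implicit Types H : ons.

Local Notation iw := (iwasawa_alg p_pr G).
Local Notation "x ** y" := (iwasawa_mul x y) (at level 40, left associativity).
Local Notation grp := (@grp_elt p p_pr G).

Lemma iw_mul_linl a (x x' y : iw) : (a *: x + x') ** y = a *: (x ** y) + x' ** y.
Proof. by apply: mod_lim_eq => H; exact: malg_mul_linl. Qed.

Lemma iw_mul_linr a (x y y' : iw) : x ** (a *: y + y') = a *: (x ** y) + x ** y'.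
Proof. by apply: mod_lim_eq => H; exact: malg_mul_linr. Qed.

Lemma iw_mulA (x y z : iw) : x ** (y ** z) = x ** y ** z.
Proof. by apply: mod_lim_eq => H; apply: malg_mulA; exact: mulgA. Qed.

Lemma iw_mul_grp g h : grp g ** grp h = grp (g * h)%g.
Proof. by apply: mod_lim_eq => H; rewrite [RHS]/= to_quotM; exact: malg_mulUU. Qed.

Lemma iw_mul0l (y : iw) : 0 ** y = 0.
Proof. by have := iw_mul_linl (-1) 0 0 y; rewrite scaler0 addr0 scaleN1r addNr. Qed.

Lemma iw_mul0r (x : iw) : x ** 0 = 0.
Proof. by have := iw_mul_linr (-1) x 0 0; rewrite scaler0 addr0 scaleN1r addNr. Qed.

Lemma iw_mul1 (x : iw) : x ** grp 1%g = x.
Proof.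
apply: mod_lim_eq => H; apply: malg_mul1; elim/quot_ind => g.
by rewrite -[RHS]mulg1.
Qed.

Lemma aug_lin a (x y : iw) : augmentation (a *: x + y) = a * augmentation x + augmentation y.
Proof.
exact: (linearP (free_lift (fun _ : quot_group (OpenNormal (@whole_subproof G)) => 1 : Zp^o)) a (x _) (y _)).
Qed.

Lemma aug_grp g : augmentation (grp g) = 1.
Proof. by rewrite /augmentation free_liftU. Qed.

Lemma aug_mul (x y : iw) : augmentation (x ** y) = augmentation x * augmentation y.
Proof. exact: free_lift_mul. Qed.

Lemma aug_powerS n : aug_power n.+1 = span [set z | exists x y : iw,
  [/\ augmentation x = 0, aug_power n y & z = x ** y]].
Proof. by []. Qed.

Lemma aug_power_submodule n : submodule (@aug_power p p_pr G n).
Proof. by case: n => [|n]; [split|exact: spanP]. Qed.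

Lemma aug_power_mul n (x y : iw) : augmentation x = 0 -> aug_power n y -> aug_power n.+1 (x ** y).
Proof. by move=> x0 ny; rewrite aug_powerS; apply: span_sub; exists x, y. Qed.

Lemma aug_power_left n (x y : iw) : aug_power n y -> aug_power n (x ** y).
Proof.
case: n => [//|n]; rewrite aug_powerS => ny.
have [S0 SP] := spanP [set z | exists x y : iw, [/\ augmentation x = 0, aug_power n y & z = x ** y]].
apply: (ny (fun y => aug_power n.+1 (x ** y))); split.
  split=> [|a u v xu xv]; first by rewrite iw_mul0r; exact: S0.
  by rewrite iw_mul_linr; exact: SP.
move=> _ [z [w [z0 nw ->]]]; rewrite iw_mulA; apply: span_sub; exists (x ** z), w; split=> //.
by rewrite aug_mul z0 mulr0.
Qed.

Lemma aug_sub1 g : augmentation (grp g - grp 1%g) = 0.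
Proof. by rewrite addrC -scaleN1r aug_lin !aug_grp mulr1 addNr. Qed.

Lemma mul_sub1 g h : (grp g - grp 1%g) ** grp h = grp (g * h)%g - grp h.
Proof. by rewrite addrC -scaleN1r iw_mul_linl !iw_mul_grp mul1g scaleN1r addrC. Qed.

(** Induction on n. The element g - 1 is a combination of terms (s_i - 1) h with h in the subgroup.
    Modulo I ^ n the factor h is a combination of the listed words w, and s_i - 1 pushes the error
    into I ^ (n + 1), leaving the new words s_i w. The list does not depend on g. *)
Lemma generated_span (s : seq G) n : exists ws : seq G, forall g, generated_subgroup [set` s] g ->
  exists (c : 'I_(size ws) -> Zp) (r : iw), aug_power n r /\ grp g = \sum_i c i *: grp (nth 1%g ws i) + r.
Proof.
elim: n => [|n [ws wsP]].
  by exists [::] => g _; exists (fun _ => 0), (grp g); rewrite big_ord0 add0r.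
pose ws' := 1%g :: ws ++ [seq (g * w)%g | g <- s, w <- ws].
pose W (y : iw) := exists (c : 'I_(size ws') -> Zp) (r : iw),
  aug_power n.+1 r /\ y = \sum_i c i *: grp (nth 1%g ws' i) + r.
have [P0 PP] := aug_power_submodule n.+1.
have W0 : W 0.
  by exists (fun=> 0), 0; split=> //; rewrite big1 ?addr0// => i _; rewrite scale0r.
have WP a u v : W u -> W v -> W (a *: u + v).
  move=> [c [r [nr ->]]] [c' [r' [nr' ->]]].
  exists (fun i => a * c i + c' i), (a *: r + r'); split; first exact: PP.
  rewrite scalerDr addrACA scaler_sumr -big_split; congr (_ + _).
  by apply: eq_bigr => i _ /=; rewrite scalerDl scalerA.
have Wgrp w : w \in ws' -> W (grp w).
  move=> /(nthP 1%g)[i iw <-]; exists (fun j => (j == Ordinal iw)%:R), 0; split=> //.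
  rewrite (bigD1 (Ordinal iw))//= eqxx scale1r big1 ?addr0// => j ji.
  by rewrite (negbTE ji) scale0r.
have Wr r : aug_power n.+1 r -> W r.
  by exists (fun=> 0), r; split=> //; rewrite big1 ?add0r// => i _; rewrite scale0r.
pose Gam := generated_subgroup [set` s].
pose S := [set z | exists g h, [/\ g \in s, Gam h & z = (grp g - grp 1%g) ** grp h]].
have [R0 RP] := spanP S.
have Rr h y : Gam h -> span S y -> span S (y ** grp h).
  move=> Gh Sy; apply: (Sy (fun y => span S (y ** grp h))); split.
    split=> [|a u v Su Sv]; first by rewrite iw_mul0l.
    by rewrite iw_mul_linl; exact: RP.
  move=> _ [g [k [gs Gk ->]]]; rewrite -iw_mulA iw_mul_grp; apply: span_sub; exists g, (k * h)%g; split=> //.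
  by move=> H [sH HS]; have [_ HM _] := sH; apply: HM; [exact: Gk|exact: Gh].
have SW y : span S y -> W y.
  move=> Sy; apply: (Sy W); split; first by split.
  move=> _ [g [h [gs Gh ->]]]; have [c [r [nr ->]]] := wsP h Gh.
  have -> : (grp g - grp 1%g) ** (\sum_i c i *: grp (nth 1%g ws i) + r) =
      \sum_i c i *: (grp (g * nth 1%g ws i)%g - grp (nth 1%g ws i)) + (grp g - grp 1%g) ** r.
    rewrite -[X in _ ** X]scale1r scalerDr scale1r.
    elim/big_rec2: _ => [|i u v _ IH]; first by rewrite add0r add0r scale1r.
    by rewrite -addrA iw_mul_linr IH mul_sub1 addrA.
  rewrite -[X in W X]scale1r scalerDr; apply: (WP); last first.
    by rewrite scale1r; apply: Wr; apply: aug_power_mul => //; exact: aug_sub1.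
  elim/big_ind: _ => [|u v Wu Wv|i _]; first exact: W0.
    by rewrite -[u]scale1r; exact: (WP).
  rewrite -[c i *: _]addr0; apply: (WP); last exact: W0.
  rewrite addrC -scaleN1r; apply: (WP); apply: Wgrp; rewrite inE mem_cat.
    by rewrite mem_nth ?orbT.
  by apply/or3P; apply: Or33; apply/allpairsP; exists (g, nth 1%g ws i); rewrite /= mem_nth.
have G1 : subgroup Gam.
  split=> [H [[]]//|x y Gx Gy H [sH HS]|x Gx H [sH HS]]; have [_ HM HV] := sH.
    by apply: HM; [exact: Gx|exact: Gy].
  by apply: HV; exact: Gx.
(* Stability follows from g h - 1 = (g - 1) h + (h - 1) and g^-1 - 1 = - (g - 1) g^-1. *)
have sub : subgroup [set g | Gam g /\ span S (grp g - grp 1%g)].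
  have [G_1 GM GV] := G1; split=> [|g h [Gg Sg] [Gh Sh]|g [Gg Sg]] /=.
  - by split=> //; rewrite subrr.
  - split; first exact: GM.
    have -> : grp (g * h)%g - grp 1%g = 1 *: ((grp g - grp 1%g) ** grp h) + (grp h - grp 1%g).
      by rewrite scale1r mul_sub1 addrA subrK.
    by apply: RP => //; exact: Rr.
  - split; first exact: GV.
    have -> : grp g^-1%g - grp 1%g = (-1) *: ((grp g - grp 1%g) ** grp g^-1%g) + 0.
      by rewrite mul_sub1 mulgV addr0 scaleN1r opprB.
    by apply: RP => //; apply: Rr => //; exact: GV.
exists ws' => g Gg.
have [_ Sg] : Gam g /\ span S (grp g - grp 1%g).
  apply: (Gg [set g | Gam g /\ span S (grp g - grp 1%g)]); split=> // h hs; split; first by move=> H [_]; apply.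
  by apply: span_sub; exists h, 1%g; split=> //; [by case: G1|rewrite iw_mul1].
have : W (1 *: (grp g - grp 1%g) + grp 1%g).
  by apply: (WP); [exact: SW|apply: Wgrp; rewrite inE eqxx].
by rewrite scale1r subrK.
Qed.

End AlgMul.

Section Levels.
Variables (p : nat) (p_pr : prime p) (G : topGroupType).
Local Notation Zp := (Zp p_pr).
Local Notation K := (Qp p_pr).
Hypotheses (cG : compact [set: G]) (hG : hausdorff_space G) (tdG : totally_disconnected [set: G]).
Hypothesis fgG : top_finitely_generated G.
Local Notation ons := (open_normal_subgroup G).
Local Notation iw := (iwasawa_alg p_pr G).
Local Notation "x ** y" := (iwasawa_mul x y) (at level 40, left associativity).
Local Notation grp := (@grp_elt p p_pr G).
Local Notation A := (polyA p_pr G).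
Implicit Types (H : ons) (a b : A).

Lemma iw_ball_open (s : seq ons) n (x : iw) : open (lim_ball s n x : set iw).
Proof.
move=> y xy; exists s, n => z yz i si; have [u uE] := xy i si; have [v vE] := yz i si.
by exists (v + u); rewrite scalerDr -uE -vE addrA subrK.
Qed.

Lemma iw_closureP (S : set iw) x : closure S x <->
  forall H m, exists2 y, S y & exists z, y H - x H = p%:R ^+ m *: z.
Proof.
split=> [cx H m|cx B].
  have : nbhs x (lim_ball [:: H] m x : set iw).
    apply: open_nbhs_nbhs; split; first exact: iw_ball_open.
    by move=> i _; exists 0; rewrite subrr scaler0.
  by move=> /cx[y [Sy xy]]; exists y => //; apply: xy; rewrite inE.
rewrite nbhsE => -[O [oO Ox] OB]; have [s [m sO]] := oO x Ox.
have [H Hs] : exists H, forall i, i \in s -> on_sub H i.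
  elim: (s) => [|i t [H Ht]]; first by exists (OpenNormal (@whole_subproof G)).
  have [H' [h h']] := ons_directed i H; exists H' => j; rewrite inE => /orP[/eqP->//|/Ht jt].
  by move: h' jt => /asboolP h' /asboolP jt; apply/asboolP; exact: subset_trans h' jt.
have [y Sy [z zE]] := cx H m; exists y; split=> //; apply: OB; apply: sO => i /Hs h.
by exists (push p_pr h z); rewrite -!(mod_limP _ h) -linearB zE linearZ.
Qed.

Lemma lA_exists a : {l : iw -> K | ctslin l & forall g, l (grp g) = a g}.
Proof. by apply: cid2; apply: cts_functional cG hG tdG _ _; exact: (polyAP a).1. Qed.

(** Integration of the polynomial function a against a measure. *)
Definition lA a : iw -> K := s2val (lA_exists a).
Lemma lA_cts a : ctslin (lA a). Proof. exact: (s2valP (lA_exists a)). Qed.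
Lemma lA_grp a g : lA a (grp g) = a g. Proof. exact: (s2valP' (lA_exists a)). Qed.

Lemma lA_uniq a l : ctslin l -> (forall g, l (grp g) = a g) -> forall x, l x = lA a x.
Proof. by move=> cl la; apply: ctslin_eq => //; [exact: lA_cts|move=> g; rewrite la lA_grp]. Qed.

Lemma lA_lin c a b x : lA (c *: a + b) x = c * lA a x + lA b x.
Proof.
symmetry; apply: (@lA_uniq _ (fun x => c * lA a x + lA b x)).
  by apply: ctslin_comb; exact: lA_cts.
by move=> g; rewrite !lA_grp A_linE.
Qed.

Lemma ctslin0 : ctslin (fun _ : iw => 0 : K).
Proof.
split=> [c x y|k]; first by rewrite mulr0 addr0.
by exists (OpenNormal (@whole_subproof G)), 0%N => x _; exact: pid0.
Qed.

Lemma ctslin_mulr (l : iw -> K) y : ctslin l -> ctslin (fun x => l (x ** y)).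
Proof.
move=> [ll lc]; split=> [c x x'|k]; first by rewrite iw_mul_linl ll.
have [H [m Hm]] := lc k; exists H, m => x [z xz]; apply: Hm; exists (alg_mul z (y H)).
by rewrite [LHS]/= xz; exact: malg_mulZl.
Qed.

Lemma ctslin_mull (l : iw -> K) x : ctslin l -> ctslin (fun y => l (x ** y)).
Proof.
move=> [ll lc]; split=> [c y y'|k]; first by rewrite iw_mul_linr ll.
have [H [m Hm]] := lc k; exists H, m => y [z yz]; apply: Hm; exists (alg_mul (x H) z).
by rewrite [LHS]/= yz; exact: malg_mulZr.
Qed.

Lemma ctslin_scale c (l : iw -> K) : ctslin l -> ctslin (fun x => c * l x).
Proof.
move=> cl; have := ctslin_comb c cl ctslin0; congr ctslin; apply/funext => x.
by rewrite addr0.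
Qed.

Lemma ctslin_aug : ctslin (fun x : iw => Zp_Qp (augmentation x) : K).
Proof.
split=> [c x y|k]; first by rewrite aug_lin rmorphD rmorphM.
exists (OpenNormal (@whole_subproof G)), k => x [z xz]; exists (free_lift (fun _ => 1 : Zp^o) z).
rewrite /augmentation xz; have -> : forall u : group_alg p_pr (OpenNormal (@whole_subproof G)),
  free_lift (fun _ => 1 : Zp^o) (p%:R ^+ k *: u) = p%:R ^+ k * free_lift (fun _ => 1 : Zp^o) u :> Zp.
  by move=> u; exact: free_lift_scale.
by rewrite rmorphM rmorphXn rmorph_nat.
Qed.

Lemma lA_translate a g y : lA a (grp g ** y) = lA (Aleft g a) y.
Proof.
apply: (@lA_uniq (Aleft g a) (fun y => lA a (grp g ** y))).
  by apply: ctslin_mull; exact: lA_cts.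
by move=> h; rewrite iw_mul_grp lA_grp.
Qed.

(** Both sides are continuous and linear in x and in y separately, so they are compared at group
    elements, one variable at a time. *)
Lemma lA_split a s x y : splits a s -> lA a (x ** y) = \sum_(b <- s) lA b.1 x * lA b.2 y.
Proof.
move=> as_; have cs (l : A * A -> K) : ctslin (fun x => \sum_(b <- s) l b * lA b.1 x).
  elim: (s) => [|b t IH].
    by have := ctslin0; congr ctslin; apply/funext => z; rewrite big_nil.
  have := ctslin_comb (l b) (lA_cts b.1) IH; congr ctslin; apply/funext => z; by rewrite big_cons.
have cs' (l : A * A -> K) : ctslin (fun x => \sum_(b <- s) l b * lA b.2 x).
  elim: (s) => [|b t IH].
    by have := ctslin0; congr ctslin; apply/funext => z; rewrite big_nil.
  have := ctslin_comb (l b) (lA_cts b.2) IH; congr ctslin; apply/funext => z; by rewrite big_cons.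
rewrite (eq_bigr (fun b : A * A => lA b.2 y * lA b.1 x)); last by move=> b _; rewrite mulrC.
apply: (ctslin_eq (l := fun x => lA a (x ** y)) (l' := fun x => \sum_(b <- s) lA b.2 y * lA b.1 x)).
- by apply: ctslin_mulr; exact: lA_cts.
- exact (cs (fun b : A * A => lA b.2 y)).
move=> g; rewrite (eq_bigr (fun b : A * A => b.1 g * lA b.2 y)); last by move=> b _; rewrite lA_grp mulrC.
apply: (ctslin_eq (l := fun y => lA a (grp g ** y)) (l' := fun y => \sum_(b <- s) b.1 g * lA b.2 y)).
- by apply: ctslin_mull; exact: lA_cts.
- exact (cs' (fun b : A * A => b.1 g)).
move=> h; rewrite iw_mul_grp lA_grp as_; apply: eq_bigr => b _; by rewrite lA_grp.
Qed.

(** For y in I ^ n and a of degree < n + 1, the left differences of a have degree < n and kill y by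
    induction, so g to lA a (g y) is constant. Hence lA a (u y) is the augmentation of u times lA a
    y. *)
Lemma lA_aug_power n a x : deg_lt n a -> aug_power n x -> lA a x = 0.
Proof.
elim: n a x => [|n IH] a x da nx.
  rewrite -(lA_uniq (l := fun=> 0) ctslin0)// => g; by rewrite da.
apply: (nx (fun x => lA a x = 0)); split.
  have [ll _] := lA_cts a; split=> [|c u v lu lv].
    by have := ctslin_sum [::] (fun _ : nat => 0 : Zp) (fun _ => 0 : iw) (lA_cts a); rewrite !big_nil.
  by rewrite ll lu lv mulr0 addr0.
move=> _ [u [y [u0 ny ->]]].
have -> : lA a (u ** y) = lA a y * Zp_Qp (augmentation u).
  apply: (ctslin_eq (l := fun u => lA a (u ** y)) (l' := fun u => lA a y * Zp_Qp (augmentation u))).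
  - by apply: ctslin_mulr; exact: lA_cts.
  - exact: ctslin_scale ctslin_aug.
  move=> g; rewrite aug_grp rmorph1 mulr1 lA_translate; apply/eqP; rewrite -subr_eq0; apply/eqP.
  rewrite addrC -mulN1r -lA_lin; apply: IH => //.
  have := deg_lt_leftB g da; congr deg_lt; apply/funext => h.
  by rewrite A_linE mulN1r addrC.
by rewrite u0 rmorph0 mulr0.
Qed.

Lemma lA_closure n a x : deg_lt n a -> closure (aug_power n) x -> lA a x = 0.
Proof.
move=> da /iw_closureP cx; have [ll lc] := lA_cts a; apply: qp_eq0 => k.
have [H [m Hm]] := lc k; have [y ny [z zE]] := cx H m.
have := Hm ((-1) *: x + y); rewrite ll (lA_aug_power da ny) rmorphN rmorph1 mulN1r addr0.
move=> /(_ _)/pidN; rewrite opprK; apply.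
by exists z; rewrite -zE; transitivity ((-1) *: x H + y H) => //; rewrite scaleN1r addrC.
Qed.

Lemma zp_ultra_all (X : Type) (F : set_system X) (UF : UltraFilter F) r (c : X -> 'I_r -> Zp) :
  exists z : 'I_r -> Zp, forall k, F [set x | forall i, c x i k = z i k].
Proof.
have /choice[z zP] i : exists z : Zp, forall k, F [set x | c x i k = z k].
  exact: (zp_ultra UF (fun x => c x i)).
exists z => k; have : forall i, \forall x \near F, c x i k = z i k by move=> i; exact: zP.
by move=> /filter_forall; apply: filterS.
Qed.

Lemma dense_coset (s : seq G) H g : dense (generated_subgroup [set` s]) ->
  exists2 h, generated_subgroup [set` s] h & to_quot H h = to_quot H g.
Proof.
move=> ds; have oC : open [set h | on_set H (g^-1 * h)%g].
  by apply: open_comp => [h _|]; [exact: mulgl_cts|exact: (onsP H).1].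
have [|h [Hh Gh]] := ds [set h | on_set H (g^-1 * h)%g] _ oC.
  by exists g => /=; rewrite mulVg; have [_ [[]]] := onsP H.
exists h => //; apply/esym/to_quotP; rewrite (normal_closure_id (onsP H).2); exact: Hh.
Qed.

Lemma iw_sumE (J : Type) (s : seq J) (c : J -> Zp) (x : J -> iw) H :
  (\sum_(i <- s) c i *: x i) H = \sum_(i <- s) c i *: x i H.
Proof. by rewrite iw_sum. Qed.

(** At each level H the element x is a combination of the words of [generated_span] plus a remainder
    in I ^ n. The coefficients converge along an ultrafilter on the H by compactness of Z_p, and the
    limit remainder lies in the closure of I ^ n. *)
Lemma iw_span n : exists ws : seq G, forall x : iw,
  exists (c : 'I_(size ws) -> Zp) (r : iw), closure (aug_power n) r /\
    x = \sum_i c i *: grp (nth 1%g ws i) + r.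
Proof.
have [s ds] := fgG; have [ws wsP] := generated_span p_pr s n; exists ws => x.
have approx H : exists (c : 'I_(size ws) -> Zp) (r : iw), aug_power n r /\
    (\sum_i c i *: grp (nth 1%g ws i) + r) H = x H.
  have [P0 PP] := aug_power_submodule p_pr G n.
  have [t [d dE]] := iw_approx x H.
  have [c [r [nr rE]]] : exists (c : 'I_(size ws) -> Zp) (r : iw), aug_power n r /\
      (\sum_i c i *: grp (nth 1%g ws i) + r) H = \sum_(i <- t) d i *: grp (repr i) H.
    elim: t {dE} => [|i t [c [r [nr rE]]]].
      exists (fun=> 0), 0; split=> //; rewrite big_nil big1 ?addr0// => i _; by rewrite scale0r.
    have [h Gh hE] := dense_coset H (repr i) ds; have [c' [r' [nr' hE']]] := wsP h Gh.
    exists (fun j => d i * c' j + c j), (d i *: r' + r); split; first exact: PP.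
    rewrite big_cons -rE.
    have -> : grp (repr i) H = grp h H by rewrite /= hE.
    rewrite hE'; transitivity ((d i *: (\sum_i c' i *: grp (nth 1%g ws i) + r') +
      (\sum_i c i *: grp (nth 1%g ws i) + r)) H) => //.
    congr (proj_lim _ H); rewrite scalerDr addrACA scaler_sumr -big_split; congr (_ + _).
    by apply: eq_bigr => j _ /=; rewrite scalerDl scalerA.
  by exists c, r; split=> //; rewrite rE -iw_sumE.
have /choice[c /choice[r cr]] := approx.
pose F0 := filter_from [set: ons] (fun H => [set H' | on_sub H' H]).
have FF0 : ProperFilter F0.
  apply: filter_from_proper; last by move=> H _; exists H; apply/asboolP.
  apply: filter_from_filter; first by exists (OpenNormal (@whole_subproof G)).
  move=> H H' _ _; have [H'' [h h']] := ons_directed H H'; exists H'' => // L Lh.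
  move: h h' Lh => /asboolP h /asboolP h' /asboolP Lh.
  by split; apply/asboolP; [exact: subset_trans Lh h|exact: subset_trans Lh h'].
have [F [UF F0F]] := ultraFilterLemma FF0.
have [z zP] := zp_ultra_all UF c.
pose y := x - \sum_i z i *: grp (nth 1%g ws i).
exists z, y; split; last by rewrite /y addrC subrK.
(* For H' below H at which the coefficients agree with their limits modulo p ^ m, the remainder
   [r H'] approximates y at level H to precision p ^ m. *)
apply/iw_closureP => H m.
have FH : F [set H' | on_sub H' H] by apply: F0F; exists H.
have [H' [/= h zE]] := filter_ex (filterI FH (zP m)).
have [nr rE] := cr H'; exists (r H') => //.
have /choice[w wE] i : exists w : Zp, z i - c H' i = p%:R ^+ m * w.
  by apply/zp_eqP; rewrite zE.
exists (\sum_i w i *: grp (nth 1%g ws i) H).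
have rH : (\sum_i c H' i *: grp (nth 1%g ws i) + r H') H = x H.
  by rewrite -!(mod_limP _ h) rE.
have e1 : r H' H = x H - \sum_i c H' i *: grp (nth 1%g ws i) H.
  rewrite -rH -iw_sumE; have addK (u v : group_alg p_pr H) : v = u + v - u by rewrite (addrC u) addrK.
  exact: addK.
have e2 : y H = x H - \sum_i z i *: grp (nth 1%g ws i) H.
  by rewrite -iw_sumE.
rewrite e1; transitivity ((x H - \sum_i c H' i *: grp (nth 1%g ws i) H) - (x H - \sum_i z i *: grp (nth 1%g ws i) H)).
  by congr (_ - _); exact: e2.
rewrite opprB addrC addrA subrK -sumrB scaler_sumr; apply: eq_bigr => i _.
by rewrite -scalerBl wE scalerA.
Qed.

End Levels.

Lemma subr_shift (V : zmodType) (u v w : V) : u - (v + u - w) = w - v.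
Proof. by rewrite (addrC v) -addrA opprD addrA subrr add0r opprB. Qed.

Lemma functional_comb2 (k : fieldType) (V : lmodType k) (f g : {linear V -> k^o}) c :
  exists h : {linear V -> k^o}, forall u, h u = c * f u + g u :> k.
Proof.
have lin : linear (fun u => c * f u + g u : k^o).
  have E (e a b x y : k) : c * (e * a + b) + (e * x + y) = e * (c * a + x) + (c * b + y) by ring.
  move=> e v w; have -> : f (e *: v + w) = e * f v + f w :> k by exact: linearP.
  have -> : g (e *: v + w) = e * g v + g w :> k by exact: linearP.
  exact: E.
pose h : {linear V -> k^o} := HB.pack (fun u => c * f u + g u : k^o)
  (GRing.isLinear.Build _ _ _ _ (fun u => c * f u + g u : k^o) lin).
by exists h.
Qed.

Section ExtScalarsFacts.
Variables (R S : comNzRingType) (phi : {rmorphism R -> S}) (M : lmodType R).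

Lemma ext_ind (P : ext_scalars phi M -> Prop) :
  P 0 -> (forall a x u, P u -> P (a *: to_ext phi x + u)) -> forall u, P u.
Proof.
move=> P0 PD; elim/qmod_ind; elim/malg_ind => [|a x g IH]; first by rewrite linear0.
by rewrite linearP; exact: PD.
Qed.

Lemma ext_linear_eq (W : lmodType S) (f g : {linear ext_scalars phi M -> W}) :
  (forall x, f (to_ext phi x) = g (to_ext phi x)) -> forall u, f u = g u.
Proof.
by move=> fg; elim/ext_ind => [|a x u IH]; rewrite ?linear0// !linearP fg IH.
Qed.

(* ext_lift is only meaningful on semilinear maps: here semilinearity of mul in
   each argument is read off a separating family of functionals. *)
Lemma ext_lift2E (mul : M -> M -> ext_scalars phi M) (I : Type)
    (f : I -> {linear ext_scalars phi M -> S^o})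
    (t : I -> seq ({linear ext_scalars phi M -> S^o} * {linear ext_scalars phi M -> S^o})) :
  (forall u v, (forall i, f i u = f i v) -> u = v) ->
  (forall i q q', f i (mul q q') = \sum_(b <- t i) b.1 (to_ext phi q) * b.2 (to_ext phi q')) ->
  forall i u v, f i (ext_lift (fun q => ext_lift (mul q) v) u) = \sum_(b <- t i) b.1 u * b.2 v.
Proof.
move=> sep mulE i u v.
have mul_r q c q1 q2 : mul q (c *: q1 + q2) = phi c *: mul q q1 + mul q q2.
  apply: sep => j; rewrite linearP !mulE to_extP scaler_sumr -big_split; apply: eq_bigr => b _ /=.
  by rewrite linearP mulrDr -scalerAr.
have Mr j q w : f j (ext_lift (mul q) w) = \sum_(b <- t j) b.1 (to_ext phi q) * b.2 w.
  have lin := ext_lift_is_linear (mul_r q).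
  elim/ext_ind: w => [|d q' w IH].
    rewrite big1 => [|b _]; last by rewrite linear0 mulr0.
    by have := lin (-1) 0 0; rewrite scaler0 addr0 scaleN1r addNr => ->; rewrite linear0.
  rewrite lin linearP IH (ext_liftE (mul_r q)) mulE scaler_sumr -big_split; apply: eq_bigr => b _ /=.
  by rewrite linearP mulrDr -scalerAr.
have mul_l c q1 q2 : ext_lift (mul (c *: q1 + q2)) v = phi c *: ext_lift (mul q1) v + ext_lift (mul q2) v.
  apply: sep => j; rewrite linearP !Mr to_extP scaler_sumr -big_split; apply: eq_bigr => b _ /=.
  by rewrite linearP mulrDl -scalerAl.
have lin := ext_lift_is_linear mul_l.
elim/ext_ind: u => [|d q u IH].
  rewrite big1 => [|b _]; last by rewrite linear0 mul0r.
  by have := lin (-1) 0 0; rewrite scaler0 addr0 scaleN1r addNr => ->; rewrite linear0.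
rewrite lin linearP IH (ext_liftE mul_l) Mr scaler_sumr -big_split; apply: eq_bigr => b _ /=.
by rewrite linearP mulrDl -scalerAl.
Qed.

End ExtScalarsFacts.

(** * Duality between functions of degree < n and the finite levels *)

Section LevelFunctionals.
Variables (p : nat) (p_pr : prime p) (G : topGroupType).
Local Notation Zp := (Zp p_pr).
Local Notation K := (Qp p_pr).
Hypotheses (cG : compact [set: G]) (hG : hausdorff_space G) (tdG : totally_disconnected [set: G]).
Hypothesis fgG : top_finitely_generated G.
Local Notation ons := (open_normal_subgroup G).
Local Notation iw := (iwasawa_alg p_pr G).
Local Notation "x ** y" := (iwasawa_mul x y) (at level 40, left associativity).
Local Notation grp := (@grp_elt p p_pr G).
Local Notation A := (polyA p_pr G).
Local Notation level := (@level p p_pr G).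
Local Notation lA := (lA cG hG tdG).
Implicit Types (H : ons) (a b : A).

Lemma to_level_lin n c (x y : iw) : to_level n (c *: x + y) = Zp_Qp c *: to_level n x + to_level n y.
Proof. by rewrite /to_level linearP to_extP. Qed.

Lemma to_level_eq0 n (x : iw) : closure (aug_power n) x -> to_level n x = 0.
Proof.
move=> nx; rewrite /to_level (_ : to_qmod _ x = 0); last first.
  rewrite -(linear0 (to_qmod (closure (aug_power n)))).
  by apply/to_qmodP; rewrite subr0; exact: span_sub.
have := @to_extP _ _ (@Zp_Qp p p_pr) (iwasawa_quot p_pr G n) 1 0 0.
rewrite scale1r addr0 rmorph1 scale1r => e; apply: (addrI (to_ext (@Zp_Qp p p_pr) (0 : iwasawa_quot p_pr G n))).
by rewrite addr0.
Qed.

Lemma to_level_sum n (J : Type) (s : seq J) (c : J -> Zp) (x : J -> iw) :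
  to_level n (\sum_(i <- s) c i *: x i) = \sum_(i <- s) Zp_Qp (c i) *: to_level n (x i).
Proof.
elim: s => [|i s IH]; last by rewrite !big_cons to_level_lin IH.
rewrite !big_nil; apply: to_level_eq0; apply: subset_closure.
by have [] := aug_power_submodule p_pr G n.
Qed.

Lemma level_linear_eq n (W : lmodType K) (f g : {linear level n -> W}) :
  (forall x, f (to_level n x) = g (to_level n x)) -> forall u, f u = g u.
Proof. by move=> fg; apply: ext_linear_eq; elim/qmod_ind => x; exact: fg. Qed.

Lemma level_grp_eq n (f g : {linear level n -> K^o}) :
  (forall h, f (to_level n (grp h)) = g (to_level n (grp h))) -> forall u, f u = g u.
Proof.
move=> fg; have [ws wsP] := iw_span p_pr fgG n.
apply: level_linear_eq => x; have [c [r [nr ->]]] := wsP x.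
rewrite -[\sum_i _]scale1r to_level_lin (to_level_eq0 nr) addr0 to_level_sum !linearZ !linear_sum /=.
by congr (_ *: _); apply: eq_bigr => i _; rewrite !linearZ /= fg.
Qed.

(** Integration against a of degree < n kills the closure of I ^ n and descends to [level n]. The
    default value 0 for other a keeps [fnl] total. *)
Lemma fnl_sig n a : {f : {linear level n -> K^o} | deg_lt n a -> forall x, f (to_level n x) = lA a x}.
Proof.
have [da|nda] := pselect (deg_lt n a); last by exists \0.
have reprE x : lA a (repr (to_qmod (closure (aug_power n)) x)) = lA a x.
  apply/eqP; rewrite -subr_eq0; apply/eqP.
  have [ll _] := lA_cts cG hG tdG a.
  have : span (closure (aug_power n)) (repr (to_qmod (closure (aug_power n)) x) - x) := @repr_qmod _ _ (closure (aug_power n)) x.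
  move=> sp.
  have <- : lA a ((-1) *: x + repr (to_qmod (closure (aug_power n)) x)) =
      lA a (repr (to_qmod (closure (aug_power n)) x)) - lA a x.
    by rewrite ll rmorphN rmorph1 mulN1r addrC.
  rewrite scaleN1r addrC; apply: (sp (fun y => lA a y = 0)); split; last by move=> y; exact: lA_closure.
  split=> [|c u v lu lv] /=; last by rewrite ll lu lv mulr0 addr0.
  by have := ctslin_sum [::] (fun _ : nat => 0 : Zp) (fun _ => 0 : iw) (lA_cts cG hG tdG a); rewrite !big_nil.
pose f (q : iwasawa_quot p_pr G n) : K^o := lA a (repr q).
have f_semi c q q' : f (c *: q + q') = Zp_Qp c *: f q + f q'.
  elim/qmod_ind: q => x; elim/qmod_ind: q' => y; have [ll _] := lA_cts cG hG tdG a.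
  by rewrite -linearP /f !reprE ll.
pose F : {linear level n -> K^o} := HB.pack (ext_lift f : level n -> K^o)
  (GRing.isLinear.Build _ _ _ _ (ext_lift f : level n -> K^o) (ext_lift_is_linear f_semi)).
by exists F => _ x; rewrite -reprE; exact: (ext_liftE f_semi).
Qed.

Definition fnl n a := sval (fnl_sig n a).

Lemma fnlE n a x : deg_lt n a -> fnl n a (to_level n x) = lA a x.
Proof. by move=> da; have h := svalP (fnl_sig n a); exact: h. Qed.

Lemma fnl_grp n a g : deg_lt n a -> fnl n a (to_level n (grp g)) = a g.
Proof. by move=> da; rewrite fnlE// lA_grp. Qed.

(** A difference along y multiplies z on the left by y - 1, which raises the power of the
    augmentation ideal by one, until [level n] kills it. *)
Lemma level_deg n (phi : {linear level n -> K^o}) k m z : (k + m = n)%N -> aug_power m z ->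
  deg_lt k (fun g => phi (to_level n (grp g ** z)) : K).
Proof.
elim: k m z => [|k IH] m z kmn mz.
  move=> g; rewrite to_level_eq0 ?linear0//; apply: subset_closure.
  by rewrite -kmn; exact: aug_power_left.
move=> y; have := IH m.+1 ((grp y - grp 1%g) ** z) _ (aug_power_mul (aug_sub1 p_pr y) mz).
rewrite addnS -addSn => /(_ kmn); congr deg_lt; apply/funext => x.
have -> : grp x ** ((grp y - grp 1%g) ** z) = (-1) *: (grp x ** z) + grp (x * y)%g ** z.
  by rewrite iw_mulA addrC -scaleN1r iw_mul_linr !iw_mul_grp mulg1 iw_mul_linl.
rewrite to_level_lin rmorphN rmorph1 scaleN1r addrC linearB //.
Qed.

(** Along an ultrafilter converging to g, elements h are written on the words of [iw_span]. The
    coefficients converge in Z_p, and the limit combination represents g in [level n]; phi is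
    continuous in the coefficients. *)
Lemma level_cts n (phi : {linear level n -> K^o}) : continuous (fun g => phi (to_level n (grp g)) : K).
Proof.
move=> g; apply: ultra_continuous => F UF Fg.
have [ws wsP] := iw_span p_pr fgG n.
have /choice[c /choice[r cr]] := fun h => wsP (grp h).
have [z zP] := zp_ultra_all UF c.
have [y yE] : exists y, y = grp g - \sum_i z i *: grp (nth 1%g ws i) by eexists.
pose a (i : 'I_(size ws)) : K := phi (to_level n (grp (nth 1%g ws i))).
have phiE (d : 'I_(size ws) -> Zp) (s : iw) : closure (aug_power n) s ->
    phi (to_level n (\sum_i d i *: grp (nth 1%g ws i) + s)) = \sum_i Zp_Qp (d i) * a i.
  move=> ns; rewrite -[\sum_i _]scale1r to_level_lin (to_level_eq0 ns) addr0 to_level_sum.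
  by rewrite rmorph1 scale1r linear_sum; apply: eq_bigr => i _; rewrite linearZ.
have ny : closure (aug_power n) y.
  have -> : closure (aug_power n) = closure (closure (aug_power n : set iw)).
    by apply/closure_id; exact: closed_closure.
  apply/iw_closureP => H m.
  have FH : F [set h | to_quot H h = to_quot H g].
    apply: Fg; have oC : open [set h | on_set H (g^-1 * h)%g].
      by apply: open_comp => [h _|]; [exact: mulgl_cts|exact: (onsP H).1].
    have : nbhs g [set h | on_set H (g^-1 * h)%g].
      by apply: open_nbhs_nbhs; split=> //=; rewrite mulVg; have [_ [[]]] := onsP H.
    apply: filterS => h Hh; apply/esym/to_quotP.
    by rewrite (normal_closure_id (onsP H).2); exact: Hh.
  have [h [/= hg zE]] := filter_ex (filterI FH (zP m)).
  have [nr rE] := cr h; exists (r h) => //.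
  have /choice[w wE] i : exists w : Zp, z i - c h i = p%:R ^+ m * w.
    by apply/zp_eqP; rewrite zE.
  exists (\sum_i w i *: grp (nth 1%g ws i) H).
  have gh : grp g H = grp h H by rewrite /= hg.
  have rH : grp g H = \sum_i c h i *: grp (nth 1%g ws i) H + r h H.
    by rewrite gh {1}rE -iw_sumE.
  have e2 : y H = grp g H - \sum_i z i *: grp (nth 1%g ws i) H by rewrite yE -iw_sumE.
  transitivity (r h H - (\sum_i c h i *: grp (nth 1%g ws i) H + r h H - \sum_i z i *: grp (nth 1%g ws i) H)).
    by congr (_ - _); rewrite -rH; exact: e2.
  by rewrite subr_shift -sumrB scaler_sumr; apply: eq_bigr => i _; rewrite -scalerBl wE scalerA.
have gE : grp g = \sum_i z i *: grp (nth 1%g ws i) + y by rewrite yE addrC subrK.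
have fg : phi (to_level n (grp g)) = \sum_i Zp_Qp (z i) * a i by rewrite -(phiE _ _ ny) -gE.
have fh h : phi (to_level n (grp h)) = \sum_i Zp_Qp (c h i) * a i.
  by have [nr rE] := cr h; rewrite -(phiE _ _ nr) -rE.
move=> B /qp_nbhsP[k kB]; rewrite /= nbhs_simpl /=.
have /choice[M MP] i := qp_pid_ex (a i).
pose N := (k + \sum_i M i)%N.
apply: filterS (zP N) => h hz; apply: kB.
have e : (phi (to_level n (grp h)) : K) - phi (to_level n (grp g)) =
  \sum_i Zp_Qp (c h i) * a i - \sum_i Zp_Qp (z i) * a i := congr2 (fun a b : K => a - b) (fh h) fg.
rewrite e -sumrB.
elim/big_ind: _ => [|u v|i _]; [exact: pid0|exact: pidD|].
have : pid N (Zp_Qp (c h i) - Zp_Qp (z i) : K) by apply/pidBE; exact: hz.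
rewrite -mulrBl mulrC => cz; have Mi : (M i <= \sum_i M i)%N by rewrite (bigD1 i)//= leq_addr.
apply: (pid_le (n := (N - M i)%N)); first by rewrite /N; lia.
by apply: MP => //; rewrite /N; lia.
Qed.

(** The function is the restriction of phi to group elements: continuous by [level_cts], of degree <
    n by [level_deg] with z = 1, and decisive because group elements span the level. *)
Lemma fnl_surj n (phi : {linear level n -> K^o}) : exists2 a : A, deg_lt n a &
  forall u, phi u = fnl n a u.
Proof.
have d : deg_lt n (fun g => phi (to_level n (grp g)) : K).
  have d1 : deg_lt n (fun g => phi (to_level n (grp g ** grp 1%g)) : K) := @level_deg n phi n 0%N (grp 1%g) (addn0 n) I.
  have e : (fun g => phi (to_level n (grp g ** grp 1%g)) : K) = (fun g => phi (to_level n (grp g)) : K).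
    by apply/funext => g; rewrite iw_mul1.
  by rewrite -e.
have P : polyfun (fun g => phi (to_level n (grp g)) : K) by split; [exact: level_cts|exists n].
exists (mkA P) => // ; apply: level_grp_eq => g; by rewrite fnl_grp.
Qed.

Lemma level_eq n (u v : level n) : (forall a, deg_lt n a -> fnl n a u = fnl n a v) -> u = v.
Proof.
move=> uv; apply/eqP; rewrite -subr_eq0; apply/eqP/functional_sep => phi.
have [a da phiE] := fnl_surj phi.
by rewrite linearB /= !phiE uv// subrr.
Qed.

Lemma level_mapE m n (nm : (n <= m)%N) (x : iw) :
  level_map p_pr G nm (to_level m x) = to_level n x.
Proof.
have := (asboolW (to_completed_subproof x)) m n nm; exact.
Qed.

Lemma fnl_level_map m n (nm : (n <= m)%N) a u : deg_lt n a ->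
  fnl n a (level_map p_pr G nm u) = fnl m a u.
Proof.
move=> da; apply: (level_linear_eq (f := fnl n a \o level_map p_pr G nm) (g := fnl m a)) => x /=.
by rewrite level_mapE !fnlE//; exact: deg_lt_le da.
Qed.

Lemma fnl_lin n c a b u : deg_lt n a -> deg_lt n b ->
  fnl n (c *: a + b) u = c * fnl n a u + fnl n b u.
Proof.
move=> da db.
have dab : deg_lt n (c *: a + b).
  by have := deg_ltD c da db; congr deg_lt; apply/funext => x; rewrite A_linE.
have [g gE] := functional_comb2 (fnl n a) (fnl n b) c.
rewrite -gE; apply: (level_linear_eq (f := fnl n (c *: a + b)) (g := g)) => x.
by rewrite gE fnlE// lA_lin -(fnlE _ da) -(fnlE _ db).
Qed.

Definition deg_splits n (d : A * seq (A * A)) := [/\ deg_lt n d.1, splits d.1 d.2 &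
  forall b : A * A, b \in d.2 -> deg_lt n b.1 /\ deg_lt n b.2].

Lemma deg_splits_exists n a : deg_lt n a -> exists s, deg_splits n (a, s).
Proof.
move=> da; have [r [x [e [e1 e2 e3]]]] := polyfun_basis n fgG (@A_linE p p_pr G) (@A_eq0 p p_pr G) (fun a => (polyAP a).1).
exists [seq (e i, Aleft (x i) a) | i <- index_enum 'I_r]; split=> // [g h|b /mapP[i _ ->]]; last first.
  by split; [exact: e1|exact: deg_lt_left].
rewrite /= big_map; have dr : deg_lt n (Aright h a) by exact: deg_lt_right.
rewrite -[LHS]/(Aright h a g) {1}(e3 _ dr) A_sumE; apply: eq_bigr => i _.
by rewrite A_scaleE mulrC.
Qed.

(** The functionals [fnl] separate the level, so [ext_lift2E] applies with [lA_split] as the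
    bilinear formula on generators. *)
Lemma fnl_level_mul n a s (u v : level n) : deg_splits n (a, s) ->
  fnl n a (level_mul u v) = \sum_(b <- s) fnl n b.1 u * fnl n b.2 v.
Proof.
move=> das.
pose f (i : {d | deg_splits n d}) := fnl n (sval i).1.
pose t (i : {d | deg_splits n d}) := [seq (fnl n b.1, fnl n b.2) | b : A * A <- (sval i).2].
have := @ext_lift2E _ _ (@Zp_Qp p p_pr) (iwasawa_quot p_pr G n) (fun q q' =>
    to_ext (@Zp_Qp p p_pr) (to_qmod _ (iwasawa_mul (repr q) (repr q')))) _ f t _ _ (exist _ _ das) u v.
rewrite big_map; apply=> {u v das} [u v uv|[[a' s'] [/= da as' ds]] q q'].
  apply: level_eq => a' /deg_splits_exists[s' das']; exact: (uv (exist _ _ das')).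
have -> : to_ext (@Zp_Qp p p_pr) (to_qmod _ (iwasawa_mul (repr q) (repr q'))) = to_level n (repr q ** repr q') by [].
rewrite /f /t big_map /= fnlE// (lA_split cG hG tdG _ _ as').
rewrite !big_seq; apply: eq_bigr => b /ds[d1 d2].
by rewrite -(fnlE _ d1) -(fnlE _ d2) /to_level /to_qmod !reprK.
Qed.

End LevelFunctionals.

Lemma mod_lim_ball_nbhs (p : nat) (p_pr : prime p) (I : choiceType) (le : rel I)
    (M : I -> lmodType (Zp p_pr)) (t : forall i j, le i j -> {linear M i -> M j})
    (s : seq I) n (x : mod_lim t) : nbhs x (lim_ball s n x).
Proof.
apply: open_nbhs_nbhs; split; last by move=> i _; exists 0; rewrite subrr scaler0.
move=> y xy; exists s, n => z yz i si; have [u uE] := xy i si; have [v vE] := yz i si.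
by exists (v + u); rewrite scalerDr -uE -vE addrA subrK.
Qed.

Lemma linear_comb_exists (k : fieldType) (V W : lmodType k) (J : Type) (s : seq J)
    (f : J -> {linear V -> k^o}) (b : J -> W) :
  exists D : {linear V -> W}, forall u, D u = \sum_(i <- s) (f i u : k) *: b i.
Proof.
have lin : linear (fun u => \sum_(i <- s) (f i u : k) *: b i).
  move=> c u v; rewrite scaler_sumr -big_split; apply: eq_bigr => i _ /=.
  by rewrite linearP scalerDl scalerA.
pose D : {linear V -> W} := HB.pack (fun u => \sum_(i <- s) (f i u : k) *: b i)
  (GRing.isLinear.Build _ _ _ _ (fun u => \sum_(i <- s) (f i u : k) *: b i) lin).
by exists D.
Qed.

Lemma tens_comb (k : fieldType) (V W : lmodType k) m n (f : 'I_m -> k) (g : 'I_n -> k)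
    (b : 'I_m -> V) (c : 'I_n -> W) :
  tens (\sum_i f i *: b i) (\sum_j g j *: c j) =
  \sum_(ij <- index_enum ('I_m * 'I_n)%type) (f ij.1 * g ij.2) *: tens (b ij.1) (c ij.2).
Proof.
rewrite -(pair_bigA _ (fun i j => (f i * g j) *: tens (b i) (c j))) /= tens_suml.
apply: eq_bigr => i _; rewrite tens_sumr; apply: eq_bigr => j _.
by rewrite tensZl tensZr scalerA.
Qed.

(** B assembles a tensor from its coordinates in a product of two bases. The coproduct of a level
    and its continuous extension can then be built from scalar functionals, coordinate by
    coordinate. *)
Lemma tensor_comb_family (k : fieldType) (V W P : lmodType k) m n (f : 'I_m -> {linear V -> k^o})
    (g : 'I_n -> {linear W -> k^o}) (b : 'I_m -> V) (c : 'I_n -> W)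
    (h : 'I_m * 'I_n -> {linear P -> k^o}) :
  (forall s, s = \sum_i (f i s : k) *: b i) -> (forall t, t = \sum_j (g j t : k) *: c j) ->
  exists (D : {linear P -> tensor V W}) (B : ('I_m * 'I_n -> k) -> tensor V W),
    [/\ forall a x y, B (fun ij => a * x ij + y ij) = a *: B x + B y,
        forall s t x, (forall ij, x ij = (f ij.1 s : k) * g ij.2 t) -> B x = tens s t,
        forall u x, (forall ij, h ij u = x ij) -> D u = B x &
        forall phi : {linear tensor V W -> k^o}, exists a : 'I_m * 'I_n -> k,
          forall x, phi (B x) = \sum_(ij <- index_enum ('I_m * 'I_n)%type) x ij * a ij].
Proof.
move=> sE tE; pose e (ij : 'I_m * 'I_n) := tens (b ij.1) (c ij.2).
have [D DE] := linear_comb_exists (index_enum ('I_m * 'I_n)%type) h e.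
exists D, (fun x => \sum_(ij <- index_enum ('I_m * 'I_n)%type) x ij *: e ij); split=> [a x y|s t x xE|u x xE|phi].
- by rewrite scaler_sumr -big_split; apply: eq_bigr => ij _; rewrite /= scalerDl scalerA.
- rewrite [in RHS](sE s) [in X in _ = tens _ X](tE t) tens_comb; apply: eq_bigr => ij _; congr (_ *: _).
  exact: xE.
- by rewrite DE; apply: eq_bigr => ij _; rewrite xE.
- exists (fun ij => phi (e ij)) => x; rewrite linear_sum; apply: eq_bigr => ij _; exact: linearZ.
Qed.

Lemma tensor_functional (k : fieldType) (V W : lmodType k) (f : {linear V -> k^o}) (g : {linear W -> k^o}) :
  exists2 h : {linear tensor V W -> k^o}, (forall z, h z = tensor_lift (fun a b => f a * g b : k^o) z) &
    forall x y, h (tens x y) = (f x : k) * g y.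
Proof.
have bf := bilin_prod f g.
pose h : {linear tensor V W -> k^o} := HB.pack (tensor_lift (fun a b => f a * g b : k^o) : tensor V W -> k^o)
  (GRing.isLinear.Build _ _ _ _ (tensor_lift (fun a b => f a * g b : k^o) : tensor V W -> k^o) (tensor_lift_is_linear bf)).
by exists h => // x y; exact: (tensor_liftE bf).
Qed.

Section MalcevUnique.
Variables (p : nat) (p_pr : prime p) (G : topGroupType).
Local Notation K := (Qp p_pr).

Lemma is_hom_id (U : affGrpSch K) : is_hom (idfun : {lrmorphism coord U -> coord U}).
Proof.
move=> R x y; have e (z : points U R) : z \o idfun = z :> points U R by exact: lrmorph_eq.
by rewrite !e.
Qed.

Lemma is_hom_comp (U V W : affGrpSch K) (f : {lrmorphism coord V -> coord U}) (g : {lrmorphism coord W -> coord V}) :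
  is_hom f -> is_hom g -> is_hom (f \o g : {lrmorphism coord W -> coord U}).
Proof.
move=> hf hg R x y.
have e (z : points U R) : z \o (f \o g) = (z \o f) \o g :> points W R by exact: lrmorph_eq.
rewrite (e x) (e y) -hg -hf; exact: e.
Qed.

Lemma malcev_unique (U V : affGrpSch K) (eta : G -> rat_points U) (eta' : G -> rat_points V) :
  malcev_completion eta -> malcev_completion eta' ->
  exists (phi : {lrmorphism coord V -> coord U}) (psi : {lrmorphism coord U -> coord V}),
    [/\ is_hom phi, is_hom psi, cancel phi psi, cancel psi phi &
       (forall g, eta g \o phi = eta' g :> rat_points V) /\ (forall g, eta' g \o psi = eta g :> rat_points U)].
Proof.
move=> [pU hU uU] [pV hV uV].
have [phi [[hphi phiE] _]] := uU V eta' pV hV.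
have [psi [[hpsi psiE] _]] := uV U eta pU hU.
exists phi, psi; split=> //.
- have [id' [_ idu]] := uV V eta' pV hV.
  have e1 : id' = psi \o phi :> {lrmorphism _ -> _}.
    apply: idu; split=> [|g]; first exact: is_hom_comp.
    apply: lrmorph_eq => a.
    exact: etrans (congr1 (fun z : rat_points U => z (phi a)) (psiE g)) (congr1 (fun z : rat_points V => z a) (phiE g)).
  have e2 : id' = idfun :> {lrmorphism _ -> _}.
    by apply: idu; split=> [|g]; [exact: is_hom_id|exact: lrmorph_eq].
  by move=> a; rewrite -[RHS]/((idfun : {lrmorphism coord V -> coord V}) a) -e2 e1.
- have [id' [_ idu]] := uU U eta pU hU.
  have e1 : id' = phi \o psi :> {lrmorphism _ -> _}.
    apply: idu; split=> [|g]; first exact: is_hom_comp.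
    apply: lrmorph_eq => a.
    exact: etrans (congr1 (fun z : rat_points V => z (psi a)) (phiE g)) (congr1 (fun z : rat_points U => z a) (psiE g)).
  have e2 : id' = idfun :> {lrmorphism _ -> _}.
    by apply: idu; split=> [|g]; [exact: is_hom_id|exact: lrmorph_eq].
  by move=> a; rewrite -[RHS]/((idfun : {lrmorphism coord U -> coord U}) a) -e2 e1.
Qed.

End MalcevUnique.

(** * The dual Hopf algebra and grouplike elements *)

Section HopfGroup.
Variables (p : nat) (p_pr : prime p) (G : topGroupType).
Local Notation Zp := (Zp p_pr).
Local Notation K := (Qp p_pr).
Hypotheses (cG : compact [set: G]) (hG : hausdorff_space G) (tdG : totally_disconnected [set: G]).
Hypothesis fgG : top_finitely_generated G.
Local Notation iw := (iwasawa_alg p_pr G).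
Local Notation grp := (@grp_elt p p_pr G).
Local Notation A := (polyA p_pr G).
Local Notation U := (specA p_pr fgG).
Local Notation level := (@level p p_pr G).
Local Notation comp := (completed_alg p_pr G).
Local Notation lA := (lA cG hG tdG).
Local Notation fnl := (fnl cG hG tdG).
Local Notation level_eq := (@level_eq p p_pr G cG hG tdG fgG _ _ _).
Local Notation dfun := (@dfun p p_pr G fgG).
Local Notation dpt := (@dpt p p_pr G fgG).
Local Notation dim_lt := (@dim_lt p p_pr G fgG).

Lemma fnl_sum n (J : Type) (s : seq J) (c : J -> K) (a : J -> A) u : (forall i, deg_lt n (a i)) ->
  fnl n (\sum_(i <- s) c i *: a i) u = \sum_(i <- s) c i * fnl n (a i) u.
Proof.
move=> da; have ds t : deg_lt n (\sum_(i <- t) c i *: a i : A).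
  have := deg_lt_sum t c da; congr deg_lt; apply/funext => g; rewrite A_sumE.
  by apply: eq_bigr => i _; rewrite A_scaleE.
elim: s => [|i s IH]; last by rewrite !big_cons fnl_lin// IH.
have d0 : deg_lt n (0 : A) by have := ds [::]; rewrite big_nil.
rewrite !big_nil; have := fnl_lin cG hG tdG (-1) u d0 d0.
by rewrite scaler0 addr0 mulN1r addNr.
Qed.

(** The group elements at the points [dpt] form the basis dual to the functions [dfun]. *)
Lemma level_basis n (u : level n) : u = \sum_i fnl n (@dfun n i) u *: to_level n (grp (@dpt n i)).
Proof.
apply: level_eq => a da; rewrite linear_sum [in LHS](dfun_coord fgG da) fnl_sum; last by move=> i; exact: dfun_deg.
by apply: eq_bigr => i _; rewrite linearZ /= fnl_grp// mulrC.
Qed.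

(** Composed with the coproduct, the product functional is continuous and linear; on a group element
    g, whose coproduct is g tensor g, it is a(g) b(g). *)
Lemma sq_cts_functional (a b : A) : exists L : iwasawa_sq p_pr G -> K,
  [/\ forall c x y, L (c *: x + y) = Zp_Qp c * L x + L y, continuous L,
      forall x y, L (iwasawa_tens x y) = lA a x * lA b y &
      forall x, L (iwasawa_coprod x) = lA (a * b) x].
Proof.
have [L [Ll Lc LE]] := square_cts_functional cG hG tdG (polyAP a).1 (polyAP b).1
  (lA_cts cG hG tdG a) (lA_cts cG hG tdG b) (lA_grp cG hG tdG a) (lA_grp cG hG tdG b).
have L0 : L 0 = 0.
  have := Ll 1 0 0; rewrite scaler0 addr0 rmorph1 mul1r; exact: (@add_self_eq0 K).
exists L; split=> //.
  apply/qp_continuousP => x k; have [H [m Hm]] := Lc k.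
  apply: filterS (mod_lim_ball_nbhs [:: H] m x) => y xy; apply: Hm; apply: xy.
  by rewrite inE.
apply: (@lA_uniq _ _ _ cG hG tdG (a * b) (fun x => L (iwasawa_coprod x))) => [|g].
  split=> [c x y|k].
    rewrite -Ll; congr L; apply: mod_lim_eq => H; exact: linearP.
  have [H [m Hm]] := Lc k; exists H, m => x [z xz].
  rewrite -[L _]subr0 -L0; apply: Hm; exists (alg_coprod z).
  rewrite [X in X - _](_ : _ = alg_coprod (x H))// xz [X in _ - X](_ : _ = 0)// subr0.
  exact: linearZ.
have -> : iwasawa_coprod (grp g) = iwasawa_tens (grp g) (grp g).
  by apply: mod_lim_eq => H; rewrite /= /alg_coprod free_liftU.
by rewrite LE !lA_grp A_mulE.
Qed.

Lemma deg_ltM_A m n (a b : A) : deg_lt m a -> deg_lt n b -> deg_lt (m + n) (a * b : A).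
Proof. by move=> da db; have := deg_ltM da db; congr deg_lt; apply/funext => g; rewrite A_mulE. Qed.

(** The coproduct is dual to multiplication, and functions of degrees < i and < j have a product of
    degree < i + j: hence the source [level (i + j)]. *)
Lemma induced_coprod_exists i j : exists2 D : {linear level (i + j) -> tensor (level i) (level j)},
  induced_coprod D & forall u s t,
    (forall a b : A, deg_lt i a -> deg_lt j b -> fnl (i + j) (a * b) u = fnl i a s * fnl j b t) ->
    D u = tens s t.
Proof.
have /choice[L LP] (kl : 'I_(dim_lt i) * 'I_(dim_lt j)) := sq_cts_functional (dfun kl.1) (dfun kl.2).
have [D [B [BL Btens DB Bphi]]] := tensor_comb_family
  (fun kl : 'I_(dim_lt i) * 'I_(dim_lt j) => fnl (i + j) (dfun kl.1 * dfun kl.2))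
  (@level_basis i) (@level_basis j).
exists D; last first.
  move=> u s t ust; rewrite -(Btens s t (fun kl => fnl i (dfun kl.1) s * fnl j (dfun kl.2) t))//.
  by apply: DB => kl; apply: ust; exact: dfun_deg.
exists (fun z => B (fun kl => L kl z)); split=> [a x y|phi|x y|x].
- by rewrite -BL; congr B; apply/funext => kl; have [-> _ _ _] := LP kl.
- have [a aE] := Bphi phi.
  rewrite (_ : (fun x => _) = fun x => \sum_(kl <- index_enum ('I_(dim_lt i) * 'I_(dim_lt j))%type) L kl x * a kl).
    apply: qp_continuous_sum => kl _; apply: qp_continuousM; last exact: cst_continuous.
    by have [] := LP kl.
  by apply/funext => x; rewrite aE.
- apply: Btens => kl; have [_ _ -> _] := LP kl.
  by rewrite !fnlE//; exact: dfun_deg.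
- apply: DB => kl; have [_ _ _ ->] := LP kl.
  by rewrite fnlE//; apply: deg_ltM_A; exact: dfun_deg.
Qed.

(** Pairing any such D with a and b is a functional on [level m], hence given by a function of
    degree < m; its values at group elements identify it as a b. *)
Lemma induced_coprod_eval i j m (D : {linear level m -> tensor (level i) (level j)}) (a b : A) :
  induced_coprod D -> deg_lt i a -> deg_lt j b ->
  deg_lt m (a * b : A) /\
  forall u, tensor_lift (fun s t => fnl i a s * fnl j b t : K^o) (D u) = fnl m (a * b) u.
Proof.
move=> [T [_ _ TE DT]] da db; have [h hE htens] := tensor_functional (fnl i a) (fnl j b).
have [c dc cE] := fnl_surj cG hG tdG fgG (h \o D).
suff abE : a * b = c.
  rewrite abE; split=> // u; rewrite -(cE u).
  exact: esym (hE (D u)).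
apply: polyA_eq => g; rewrite -(fnl_grp cG hG tdG g dc) -cE /= DT.
have -> : iwasawa_coprod (grp g) = iwasawa_tens (grp g) (grp g).
  by apply: mod_lim_eq => H; rewrite /= /alg_coprod free_liftU.
by rewrite TE htens !fnl_grp// A_mulE.
Qed.

Definition theta (a : A) (v : comp) : K := let n := projT1 (cid (polyAP a).2) in fnl n a (v n).

Lemma thetaE n (a : A) v : deg_lt n a -> theta a v = fnl n a (v n).
Proof.
have le_eq m m' : (m <= m')%N -> deg_lt m a -> fnl m a (v m) = fnl m' a (v m').
  by move=> mm dm; rewrite -(mod_limP v mm) fnl_level_map.
move=> da; rewrite /theta; case: cid => m /= dm.
by rewrite (le_eq m (m + n)%N)// ?leq_addr// -(le_eq n (m + n)%N)// leq_addl.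
Qed.

Lemma theta_grp (a : A) g : theta a (to_completed (grp g)) = a g.
Proof. have [n da] := (polyAP a).2; by rewrite (thetaE _ da) fnl_grp. Qed.

Lemma theta_lin c a b v : theta (c *: a + b) v = c * theta a v + theta b v.
Proof.
have [n da] := (polyAP a).2; have [m db] := (polyAP b).2.
have {}da : deg_lt (n + m) a := deg_lt_le (leq_addr _ _) da.
have {}db : deg_lt (n + m) b := deg_lt_le (leq_addl _ _) db.
have dab : deg_lt (n + m) (c *: a + b).
  by have := deg_ltD c da db; congr deg_lt; apply/funext => x; rewrite A_linE.
by rewrite (thetaE _ da) (thetaE _ db) (thetaE _ dab) fnl_lin.
Qed.

Lemma theta_inj : injective theta.
Proof.
move=> a b ab; apply: polyA_eq => g; by rewrite -!theta_grp ab.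
Qed.

Lemma theta_dual a : dual (theta a).
Proof.
by have [n da] := (polyAP a).2; exists n, (fnl n a) => v; exact: thetaE.
Qed.

Lemma theta_range : range theta = @dual p p_pr G.
Proof.
apply/seteqP; split=> [_ [a _ <-]|f [n [fn fE]]]; first exact: theta_dual.
have [a da aE] := fnl_surj cG hG tdG fgG fn; exists a => //.
by apply/funext => v; rewrite (thetaE _ da) fE aE.
Qed.

Lemma theta_one : dual_one (theta 1).
Proof.
split=> [|x]; first exact: theta_dual.
have [n d1] := (polyAP (1 : A)).2; rewrite (thetaE _ d1).
rewrite -[to_completed x n]/(to_level n x) fnlE//; apply/esym.
apply: (@lA_uniq _ _ _ cG hG tdG 1 (fun x => Zp_Qp (augmentation x))); first exact: ctslin_aug.
by move=> g; rewrite aug_grp rmorph1 A_oneE.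
Qed.

Lemma dual_one_uniq e : dual_one e -> e = theta 1.
Proof.
move=> [de eE]; have : range theta e by rewrite theta_range.
move=> [a _ ae]; rewrite -ae; congr theta; apply: polyA_eq => g.
by rewrite -theta_grp ae eE aug_grp rmorph1 A_oneE.
Qed.

Lemma theta_mul a b : dual_mul (theta a) (theta b) (theta (a * b)).
Proof.
have [i da] := (polyAP a).2; have [j db] := (polyAP b).2.
have [D iD _] := induced_coprod_exists i j.
exists i, j, (i + j)%N, (fnl i a), (fnl j b), D; split=> // v; try exact: thetaE.
have [dab ->] := induced_coprod_eval iD da db; exact: thetaE.
Qed.

Lemma spec_dual_theta : spec_dual (U := U) theta.
Proof.
split; [exact: theta_lin|exact: theta_inj|exact: theta_range|].
split; [exact: theta_mul|exact: theta_one|].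
move=> a; have [n da] := (polyAP a).2; have [s das] := deg_splits_exists fgG da.
have [_ as_ ds] := das; exists s; split=> [u v w uvw|R x y]; last exact: smulAE.
rewrite (thetaE _ da) uvw (fnl_level_mul cG hG tdG fgG _ _ das) !big_seq.
by apply: eq_bigr => b /ds[d1 d2]; rewrite (thetaE _ d1) (thetaE _ d2).
Qed.

Lemma hopf_specA : hopf_group (etaA p_pr fgG).
Proof.
exists theta; first exact: spec_dual_theta.
by move=> g a; rewrite theta_grp.
Qed.

(** The element whose pairing with each a of degree < n is x(a), written in the basis dual to
    [dfun]. *)
Definition gl_level (x : rat_points U) n : level n :=
  \sum_i (x (@dfun n i) : K) *: to_level n (grp (@dpt n i)).

Lemma gl_levelE x n (a : A) : deg_lt n a -> fnl n a (gl_level x n) = x a.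
Proof.
move=> da; rewrite /gl_level linear_sum [in RHS](dfun_coord fgG da) linear_sum.
by apply: eq_bigr => i _; rewrite !linearZ /= fnl_grp//; exact: mulrC.
Qed.

Lemma gl_coherent x : `[< coherent_family (@level_map p p_pr G) (gl_level x) >].
Proof.
apply/asboolP => m n nm; apply: level_eq => a da.
by rewrite fnl_level_map// !gl_levelE//; exact: deg_lt_le da.
Qed.

Definition gl (x : rat_points U) : comp := ModLim (gl_coherent x).

Lemma theta_gl x a : theta a (gl x) = x a.
Proof. by have [n da] := (polyAP a).2; rewrite (thetaE _ da) gl_levelE. Qed.

Lemma comp_eq (v w : comp) : (forall a, theta a v = theta a w) -> v = w.
Proof.
move=> vw; apply: mod_lim_eq => n; apply: level_eq => a da.
by rewrite -!thetaE.
Qed.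

Lemma gl_grouplike x : grouplike (gl x).
Proof.
split=> [i j|]; last by exists (theta 1); [exact: theta_one|rewrite theta_gl rmorph1].
have [D iD DE] := induced_coprod_exists i j; exists (i + j)%N, D; split=> //.
apply: DE => a b da db; rewrite !gl_levelE ?rmorphM//; exact: deg_ltM_A.
Qed.

(** By [induced_coprod_eval] a grouplike element pairs multiplicatively with polynomial functions,
    so the pairing is a point. *)
Lemma gl_surj v : grouplike v -> exists x, gl x = v.
Proof.
move=> [vD [e /dual_one_uniq-> v1]].
pose f (a : A) : K^o := theta a v.
have f_lin : linear f by move=> c a b; exact: theta_lin.
have f_mon : monoid_morphism f.
  split=> // a b; have [i da] := (polyAP a).2; have [j db] := (polyAP b).2.
  have [m [D [iD DE]]] := vD i j; have [dab abE] := induced_coprod_eval iD da db.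
  have [h hE htens] := tensor_functional (fnl i a) (fnl j b).
  by rewrite /f (thetaE _ dab) -abE DE -hE htens (thetaE _ da) (thetaE _ db).
pose x : {lrmorphism A -> K^o} := HB.pack f (GRing.isLinear.Build _ _ _ _ f f_lin)
  (GRing.isMonoidMorphism.Build _ _ f f_mon).
by exists x; apply: comp_eq => a; rewrite theta_gl.
Qed.

Lemma gl_mul x y : completed_mul (gl x) (gl y) (gl (smul x y)).
Proof.
move=> n; apply: level_eq => a da; have [s das] := deg_splits_exists fgG da.
rewrite (fnl_level_mul cG hG tdG fgG _ _ das) gl_levelE//; have [_ as_ ds] := das.
rewrite (smulAE x y as_) !big_seq; apply: eq_bigr => b /ds[d1 d2].
by rewrite !gl_levelE.
Qed.

Lemma gl_grp g : gl (etaA p_pr fgG g) = to_completed (grp g).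
Proof. by apply: comp_eq => a; rewrite theta_gl theta_grp. Qed.

Lemma hopf_malcev (M : affGrpSch K) (etaM : G -> rat_points M) : malcev_completion etaM ->
  canonically_isomorphic (etaA p_pr fgG) etaM /\ grouplike_isomorphic etaM.
Proof.
move=> mM; have [phi [psi [hphi hpsi phiK psiK [phiE psiE]]]] := malcev_unique (malcev_specA p_pr fgG) mM.
split; first by exists phi; split=> //; exists psi.
exists (fun x : rat_points M => gl (x \o psi)); split=> [x y xy||x y|g].
- apply: lrmorph_eq => a; have := congr1 (theta (phi a)) xy.
  by rewrite !theta_gl /= phiK.
- apply/seteqP; split=> [_ [x _ <-]|v /gl_surj[x <-]]; first exact: gl_grouplike.
  exists (x \o phi) => //; congr gl; apply: lrmorph_eq => a /=; by rewrite psiK.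
- by rewrite hpsi; exact: gl_mul.
- by rewrite psiE gl_grp.
Qed.

End HopfGroup.

(** * Central series and torsion *)

Section Commutators.
Local Open Scope group_scope.
Variable Q : groupType.
Implicit Types x y z : Q.

Lemma commgMr x y z : [~ x, y * z] = [~ x, z] * [~ x, y] ^ z.
Proof. by rewrite !commgEr !conjgE !invgM !mulgA !mulgK. Qed.

Lemma commgMl x y z : [~ x * y, z] = [~ x, z] ^ y * [~ y, z].
Proof. by rewrite !commgEl !conjgE !invgM !mulgA !mulgK. Qed.

Definition central z := forall y, commute z y.

Lemma central_conj z y : central z -> z ^ y = z.
Proof. by move=> cz; rewrite conjgE (cz y) mulKg. Qed.

Lemma central_commMr x y z : central [~ x, y] -> [~ x, y * z] = [~ x, y] * [~ x, z].
Proof. by move=> c; rewrite commgMr central_conj// c. Qed.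

Lemma central_commMl x y z : central [~ x, z] -> [~ x * y, z] = [~ x, z] * [~ y, z].
Proof. by move=> c; rewrite commgMl central_conj. Qed.

Lemma central_commVr x y : central [~ x, y] -> [~ x, y^-1] = [~ x, y]^-1.
Proof.
by move=> c; apply: (mulgI [~ x, y]); rewrite -central_commMr// !mulgV commg1.
Qed.

Lemma central_commVl x y : central [~ x, y] -> [~ x^-1, y] = [~ x, y]^-1.
Proof.
by move=> c; apply: (mulgI [~ x, y]); rewrite -central_commMl// !mulgV comm1g.
Qed.

Lemma central1 : central 1.
Proof. by move=> y; exact/commute_sym/commute1. Qed.

Lemma centralM x y : central x -> central y -> central (x * y).
Proof. by move=> cx cy z; apply/commute_sym/commuteM; exact/commute_sym. Qed.

Lemma centralV x : central x -> central x^-1.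
Proof. by move=> cx z; apply/commute_sym/commuteV/commute_sym. Qed.

Lemma central_prodM d (a b : 'I_d -> Q) : (forall i, central (b i)) ->
  \prod_(i < d) (a i * b i) = \prod_(i < d) a i * \prod_(i < d) b i.
Proof.
move=> cb; elim: d a b cb => [|d IH] a b cb; first by rewrite !big_ord0 mulg1.
rewrite !big_ord_recr /= IH; last by move=> i; exact: cb.
set A := \prod_(i < d) _; set B := \prod_(i < d) _.
have cB : central B by apply: big_ind => [||i _]; [exact: central1|exact: centralM|exact: cb].
by rewrite -mulgA (mulgA B) (cB (a ord_max)) !mulgA.
Qed.

Lemma central_prodV d (b : 'I_d -> Q) : (forall i, central (b i)) ->
  \prod_(i < d) (b i)^-1 = (\prod_(i < d) b i)^-1.
Proof.
move=> cb; apply: (mulgI (\prod_(i < d) b i)); rewrite -central_prodM ?mulgV.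
  by rewrite big1// => i _; rewrite mulgV.
by move=> i; exact: centralV.
Qed.

Lemma prod_single (d : nat) (f : 'I_d -> Q) i : (forall j, j != i -> f j = 1) ->
  \prod_(j < d) f j = f i.
Proof.
move=> f1; rewrite -[RHS](big_pred1_eq *%g) big_mkcond /=; apply: eq_bigr => j _.
by case: eqP => // /eqP/f1.
Qed.

End Commutators.

Lemma subgroup_prod (G : groupType) (H : set G) d (f : 'I_d -> G) :
  subgroup H -> (forall i, H (f i)) -> H (\prod_(i < d) f i)%g.
Proof. by move=> [H1 HM HV] Hf; elim/big_ind: _. Qed.

Lemma generated_subgroupP (G : groupType) (S : set G) : subgroup (generated_subgroup S).
Proof.
split=> [H [[]]//|x y Hx Hy H HS|x Hx H HS].
  by have [[_ HM _] _] := HS; apply: HM; [exact: Hx|exact: Hy].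
by have [[_ _ HV] _] := HS; apply: HV; exact: Hx.
Qed.

Lemma generated_subgroup_min (G : groupType) (S H : set G) :
  subgroup H -> S `<=` H -> generated_subgroup S `<=` H.
Proof. by move=> sH SH; apply: smallest_sub. Qed.

Section CentralChain.
Local Open Scope group_scope.
Variables (G : topGroupType) (L : nat -> set G).

Record central_chain := CentralChain {
  chain_normal : forall k, normal_subgroup (L k);
  chain_dec : forall k, L k.+1 `<=` L k;
  chain_comm : forall k x y, L k y -> L k.+1 [~ x, y] }.

Hypothesis cL : central_chain.
Local Notation q k := (to_quot (L k)).

Lemma quotE (S : set G) x y : normal_subgroup S -> to_quot S x = to_quot S y <-> S (x^-1 * y).
Proof. by move=> nS; rewrite to_quotP normal_closure_id. Qed.

Lemma to_quot1 (S : set G) : to_quot S 1 = 1.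
Proof. by apply: (mulgI (to_quot S 1)); rewrite -to_quotM !mulg1. Qed.

Lemma quot1P (S : set G) x : normal_subgroup S -> to_quot S x = 1 <-> S x.
Proof.
move=> nS; rewrite -(to_quot1 S) quotE// mulg1; have [_ _ HV] := nS.1.
by split=> /HV; rewrite ?invgK.
Qed.

Lemma to_quotR (S : set G) x y : to_quot S [~ x, y] = [~ to_quot S x, to_quot S y].
Proof. by rewrite !commgEl !conjgE !to_quotM !to_quotV. Qed.

Lemma to_quotJ (S : set G) x y : to_quot S (x ^ y) = to_quot S x ^ to_quot S y.
Proof. by rewrite !conjgE !to_quotM !to_quotV. Qed.

Lemma to_quot_prod (S : set G) d (f : 'I_d -> G) :
  to_quot S (\prod_(i < d) f i) = \prod_(i < d) to_quot S (f i).
Proof. by apply: big_morph; [exact: to_quotM|exact: to_quot1]. Qed.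

Lemma quot_sub (S S' : set G) x y : normal_subgroup S -> normal_subgroup S' -> S `<=` S' ->
  to_quot S x = to_quot S y -> to_quot S' x = to_quot S' y.
Proof. by move=> nS nS' SS' /(quotE _ _ nS) /SS' xy; apply/quotE. Qed.

Lemma chain_le k m : (k <= m)%N -> L m `<=` L k.
Proof.
move=> /subnKC <-; elim: (m - k)%N => [|j IH]; first by rewrite addn0.
by rewrite addnS; apply: subset_trans IH; exact: chain_dec.
Qed.

Lemma chain_central k y : L k y -> central (q k.+1 y).
Proof.
move=> Ly a; elim/quot_ind: a => x; apply/esym/commgP/eqP; rewrite -to_quotR.
by apply/quot1P; [exact: chain_normal|exact: chain_comm].
Qed.

Section Covering.
Variables (d : nat) (s : 'I_d -> G) (M : nat).
Hypothesis s_gen : forall x, exists2 h, generated_subgroup (range s) h & q M x = q M h.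
Hypothesis L_gen : forall k x, L k.+1 x -> exists2 h,
  generated_subgroup [set z | exists x y, L k y /\ z = [~ x, y]] h & q M x = q M h.

(** Modulo L k.+2, commutators with elements of L k are central and bilinear, so every [x, y]
    expands into commutators with the generators s_i, and those with the same s_i are collected. *)
Lemma commutator_sum k z : (k.+2 <= M)%N -> L k.+1 z ->
  exists2 w : 'I_d -> G, forall i, L k (w i) & q k.+2 z = \prod_i q k.+2 [~ s i, w i].
Proof.
move=> kM Lz; pose q' := q k.+2.
have [[L1 LM LV] LJ] := chain_normal cL k.
have ct x y : L k y -> central [~ q' x, q' y].
  by move=> Ly; rewrite -to_quotR; apply: chain_central; exact: chain_comm.
have qM x y : q M x = q M y -> q' x = q' y.
  by apply: quot_sub; [exact: chain_normal|exact: chain_normal|exact: chain_le].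
pose Z := [set z : G | exists2 w : 'I_d -> G, forall i, L k (w i) & q' z = \prod_i [~ q' (s i), q' (w i)]].
have sZ : subgroup Z.
  split.
  - exists (fun=> 1) => //; rewrite /q' to_quot1 big1// => i _; exact: commg1.
  - move=> x y [w Lw xE] [w' Lw' yE]; exists (fun i => w i * w' i) => [i|]; first exact: LM.
    rewrite /q' to_quotM -/q' xE yE -central_prodM; last by move=> i; exact: ct.
    by apply: eq_bigr => i _; rewrite /q' to_quotM central_commMr//; exact: ct.
  - move=> x [w Lw xE]; exists (fun i => (w i)^-1) => [i|]; first exact: LV.
    rewrite /q' to_quotV -/q' xE -central_prodV; last by move=> i; exact: ct.
    by apply: eq_bigr => i _; rewrite /q' to_quotV central_commVr//; exact: ct.
have ZE x y : q' x = q' y -> Z x -> Z y by move=> xy [w Lw xE]; exists w => //; rewrite -xy.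
have [Z1 ZM ZV] := sZ.
have Zs x y : generated_subgroup (range s) x -> L k y -> Z [~ x, y].
  move=> gx Ly.
  apply: (generated_subgroup_min (H := [set x | Z [~ x, y]]) _ _ gx).
    split=> /= [|x1 x2 Z1' Z2'|x1 Z1']; first by rewrite comm1g.
      apply: (ZE _ _ _ (ZM _ _ Z1' Z2')); rewrite /q' to_quotM !to_quotR to_quotM central_commMl//; exact: ct.
    apply: (ZE _ _ _ (ZV _ Z1')); rewrite /q' to_quotV !to_quotR to_quotV central_commVl//; exact: ct.
  move=> _ [i _ <-] /=; exists (fun j => if j == i then y else 1).
    by move=> j; case: ifP.
  rewrite (prod_single (i := i)); first by rewrite eqxx /q' to_quotR.
  by move=> j /negbTE ->; rewrite /q' to_quot1 commg1.
have [h gh zh] := L_gen Lz.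
suff [w Lw zE] : Z z.
  by exists w => //; apply: etrans zE _; apply: eq_bigr => i _; rewrite to_quotR.
apply: (ZE _ _ (esym (qM _ _ zh))); apply: (generated_subgroup_min sZ _ gh) => _ [x [y [Ly ->]]].
have [x' gx' /qM xx'] := s_gen x; apply: (ZE _ _ _ (Zs x' y gx' Ly)).
by rewrite /q' !to_quotR; congr ([~ _, _]); rewrite -/q' xx'.
Qed.

(* Correcting y_i to y_i w_i multiplies the product by [s_i, w_i] to the next order. *)
Lemma commutator_cover k z : L k.+1 z ->
  exists2 y : 'I_d -> G, forall i, L k (y i) & q M z = q M (\prod_i [~ s i, y i]).
Proof.
move=> Lz; have [[L1 LM LV] LJ] := chain_normal cL k.
suff H j : (k.+1 + j <= M)%N -> exists2 y : 'I_d -> G, forall i, L k (y i) &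
    q (k.+1 + j) z = q (k.+1 + j) (\prod_i [~ s i, y i]).
  have [/subnKC kM|Mk] := leqP k.+1 M; first by have := H (M - k.+1)%N; rewrite kM; apply.
  exists (fun=> 1) => //; rewrite big1; last by move=> i _; rewrite commg1.
  rewrite to_quot1; apply/quot1P; first exact: chain_normal.
  by apply: chain_le Lz; exact: ltnW.
elim: j => [|j IH] kj.
  exists (fun=> 1) => //; rewrite big1; last by move=> i _; rewrite commg1.
  by rewrite addn0 to_quot1; apply/quot1P => //; exact: chain_normal.
have [|y Ly zE] := IH; first by apply: leq_trans kj; rewrite leq_add2l.
set u := \prod_i _ in zE.
have Lr : L (k + j).+1 (u^-1 * z).
  by apply/quotE; rewrite -?addSn ?zE//; exact: chain_normal.
have [|w Lw rE] := commutator_sum _ Lr; first by rewrite -addnS -addSn.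
have Lkw i : L k (w i) by apply: chain_le (Lw i); exact: leq_addr.
exists (fun i => w i * y i) => [i|]; first exact: LM.
rewrite addSn addnS -[z in LHS](mulVKg u) to_quotM rE /u !to_quot_prod -central_prodM.
  apply: eq_bigr => i _; rewrite commgMr.
  have cw : central (q (k + j).+2 [~ s i, w i]).
    by apply: chain_central; exact: chain_comm.
  by rewrite [RHS]to_quotM (to_quotJ _ [~ _, _]) (central_conj _ cw).
by move=> i; apply: chain_central; exact: chain_comm.
Qed.

End Covering.
End CentralChain.

Lemma generated_normal (G : groupType) (S : set G) :
  (forall x y : G, S x -> S (x ^ y)%g) -> normal_subgroup (generated_subgroup S).
Proof.
move=> SJ; split=> [|x y gx]; first exact: generated_subgroupP.
have [G1 GM GV] := generated_subgroupP S.
apply: (generated_subgroup_min (H := [set x | generated_subgroup S (x ^ y)%g]) _ _ gx).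
  split=> /= [|u v gu gv|u gu]; first by rewrite conj1g.
    by rewrite conjMg; exact: GM.
  by rewrite conjVg; exact: GV.
by move=> u Su /=; apply: sub_gen_smallest; exact: SJ.
Qed.

(** * Torsion in nilpotent groups *)

Section Torsion.
Local Open Scope group_scope.
Variable Q : topGroupType.
Implicit Types x y z h : Q.

(* The lower central series of the subgroup generated by the torsion elements. *)
Fixpoint torsion_series k : set Q :=
  if k is k'.+1 then generated_subgroup [set u | exists h z,
    [/\ generated_subgroup (@torsion Q) h, torsion_series k' z & u = [~ h, z]]]
  else generated_subgroup (@torsion Q).
Local Notation S := torsion_series.
Local Notation q k := (to_quot (S k)).

Lemma torsion_series_normal k : normal_subgroup (S k).
Proof.
have n0 : normal_subgroup (S 0).
  apply: generated_normal => x y [m m0 xm]; exists m => //; by rewrite -conjXg xm conj1g.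
elim: k => [//|k IH]; apply: generated_normal => _ y [h [z [h0 zk ->]]].
by exists (h ^ y), (z ^ y); split; [exact: n0.2|exact: IH.2|rewrite conjRg].
Qed.

Lemma torsion_series_comm k h z : S 0 h -> S k z -> S k.+1 [~ h, z].
Proof. by move=> Sh Sz; apply: sub_gen_smallest; exists h, z. Qed.

Lemma torsion_series_dec k : S k.+1 `<=` S k.
Proof.
elim: k => [|k IH].
  have [[S1 SM SV] SJ] := torsion_series_normal 0.
  apply: generated_subgroup_min; first by have [] := torsion_series_normal 0.
  by move=> _ [h [z [Sh _ ->]]]; rewrite commgEl; apply: SM; [exact: SV|exact: SJ].
apply: generated_subgroup_min; first by have [] := torsion_series_normal k.+1.
by move=> _ [h [z [Sh /IH Sz ->]]]; exact: torsion_series_comm.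
Qed.

Lemma torsion_series_sub0 k : S k `<=` S 0.
Proof. by elim: k => [//|k IH]; apply: subset_trans IH; exact: torsion_series_dec. Qed.

Lemma torsion_series_commute k h z : S 0 h -> S k z -> commute (q k.+1 h) (q k.+1 z).
Proof.
move=> Sh Sz; apply/commgP/eqP; rewrite -to_quotR; apply/quot1P.
  exact: torsion_series_normal.
exact: torsion_series_comm.
Qed.

Lemma torsion_series_commMr k h y z : S 0 h -> S k y -> S k z ->
  q k.+2 [~ h, y * z] = q k.+2 [~ h, y] * q k.+2 [~ h, z].
Proof.
move=> Sh Sy Sz; rewrite commgMr [LHS]to_quotM (to_quotJ _ [~ _, _]).
have c : commute (q k.+2 z) (q k.+2 [~ h, y]).
  apply: torsion_series_commute; first exact: torsion_series_sub0 Sz.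
  exact: torsion_series_comm.
have -> : q k.+2 [~ h, y] ^ q k.+2 z = q k.+2 [~ h, y].
  by rewrite conjgE -c mulKg.
by apply: torsion_series_commute; [apply: torsion_series_sub0 (torsion_series_comm Sh Sz)|exact: torsion_series_comm].
Qed.

Lemma to_quotX (N : set Q) x m : to_quot N (x ^+ m) = to_quot N x ^+ m.
Proof.
elim: m => [|m IH]; first by rewrite !expg0 to_quot1.
by rewrite !expgS -IH -to_quotM.
Qed.

Lemma torsion_series_commXr k h z m : S 0 h -> S k z ->
  q k.+2 [~ h, z ^+ m] = q k.+2 [~ h, z] ^+ m.
Proof.
move=> Sh Sz; have [[S1 SM SV] SJ] := torsion_series_normal k.
have SX n : S k (z ^+ n) by elim: n => [|n IH] //; rewrite expgS; exact: SM.
elim: m => [|m IH]; first by rewrite !expg0 commg1 to_quot1.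
by rewrite !expgS torsion_series_commMr// -IH.
Qed.

Lemma torsion_series_generated k (B : set Q) z : B `<=` S k ->
  (forall z, B z -> exists2 m, (0 < m)%N & S k.+1 (z ^+ m)) ->
  generated_subgroup B z -> exists2 m, (0 < m)%N & S k.+1 (z ^+ m).
Proof.
move=> BS Bm Bz; have [sS _] := torsion_series_normal k; have nS' := torsion_series_normal k.+1.
have [sS' _] := nS'.
have : [set z | S k z /\ exists2 m, (0 < m)%N & S k.+1 (z ^+ m)] z; last by case.
apply: (generated_subgroup_min _ _ Bz); last by move=> u Bu; split; [exact: BS|exact: Bm].
have [S1 SM SV] := sS; have [S1' SM' SV'] := sS'.
split=> [|x y [Sx [m m0 xm]] [Sy [n n0 yn]]|x [Sx [m m0 xm]]].
- by split=> //; exists 1%N.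
- split; first exact: SM.
  exists (m * n)%N; first by rewrite muln_gt0 m0.
  apply/(quot1P _ nS'); rewrite to_quotX to_quotM expgMn; last first.
    by apply: torsion_series_commute => //; exact: torsion_series_sub0 Sx.
  rewrite expgnA -to_quotX (iffRL (quot1P _ nS') xm) expg1n mul1g mulnC expgnA -to_quotX.
  by rewrite (iffRL (quot1P _ nS') yn) expg1n.
- by split; [exact: SV|exists m => //; rewrite expVgn; exact: SV'].
Qed.

(** Modulo the term after next, [h, z ^ m] = [h, z] ^ m, so an exponent for z passes to the
    generators [h, z] of the next term; the factors are commutative, which handles products. *)
Lemma torsion_series_exponent k z : S k z -> exists2 m, (0 < m)%N & S k.+1 (z ^+ m).
Proof.
elim: k z => [|k IH] z Sz.
  apply: (torsion_series_generated _ _ Sz); first exact: sub_gen_smallest.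
  by move=> x [m m0 xm]; exists m => //; rewrite xm; have [[]] := torsion_series_normal 1.
apply: (torsion_series_generated _ _ Sz); first by move=> x Bx; exact: sub_gen_smallest.
move=> _ [h [x [Sh Sx ->]]]; have [m m0 xm] := IH x Sx.
exists m => //; apply/(quot1P _ (torsion_series_normal k.+2)).
rewrite to_quotX -torsion_series_commXr//; apply/(quot1P _ (torsion_series_normal k.+2)).
exact: torsion_series_comm.
Qed.

(** The torsion series lies below L and so reaches 1; multiplying the exponents of its factors shows
    that the subgroup generated by torsion is all torsion. *)
Lemma torsion_normal (L : nat -> set Q) M : central_chain L -> L 0 = setT -> L M `<=` [set 1] ->
  normal_subgroup (@torsion Q).
Proof.
move=> cL L0 LM.
have SL k : S k `<=` L k.
  elim: k => [|k IH]; first by rewrite L0.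
  apply: generated_subgroup_min; first by have [] := chain_normal cL k.+1.
  by move=> _ [h [z [_ /IH Lz ->]]]; exact: chain_comm.
have tor k z : S k z -> torsion z.
  have [kM|Mk] := leqP k M; last first.
    move=> /SL/(chain_le cL (ltnW Mk))/LM -> ; by exists 1%N.
  rewrite -(subKn kM); elim: (M - k)%N z => [|j IH] z.
    by rewrite subn0 => /SL/LM ->; exists 1%N.
  have [jM|Mj] := ltnP j M; last first.
    have -> : (M - j.+1 = M - j)%N by lia.
    exact: IH.
  move=> /torsion_series_exponent[m m0]; rewrite -subSn// subSS => /IH[n n0 zn].
  by exists (m * n)%N; rewrite ?muln_gt0 ?m0// expgnA.
have -> : @torsion Q = S 0.
  by apply/seteqP; split=> z; [exact: sub_gen_smallest|exact: tor].
exact: torsion_series_normal.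
Qed.

End Torsion.

(* fingroup redefines repr, so it is only imported locally. *)
Section FiniteQuotients.
Import all_fingroup all_solvable.
Local Open Scope group_scope.

Lemma card_finite_seq (T : eqType) m : ([set: T] #= `I_m)%card ->
  exists2 e : seq T, uniq e & size e = m /\ forall x, x \in e.
Proof.
move=> /card_set_bijP[f [fS /in2TT fi fs]].
have lt x : (f x < m)%N by exact: fS.
have /choice[g gP] (i : 'I_m) : exists x, f x = i.
  by have [x _ xi] := fs _ (ltn_ord i); exists x.
exists [seq g i | i : 'I_m]; last split.
- by rewrite map_inj_uniq ?enum_uniq// => i j /(congr1 f); rewrite !gP => /val_inj.
- by rewrite size_map size_enum_ord.
- move=> x; apply/mapP; exists (Ordinal (lt x)); first by rewrite mem_enum.
  by apply: fi => //; rewrite gP.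
Qed.

(** An enumeration makes Q a finite group type, for which Lagrange and nilpotency of p-groups are
    available. *)
Lemma finite_pgroup (Q : topGroupType) p n : prime p -> ([set: Q] #= `I_(p ^ n))%card ->
  (forall x : Q, x ^+ (p ^ n) = 1) /\ exists M, lower_central (G := Q) M `<=` [set 1].
Proof.
move=> p_pr /card_finite_seq[e ue [se eT]].
have ax : Finite.axiom (e : seq Q) by move=> x; rewrite count_uniq_mem// eT.
have pK : pcancel (fun x : Q => index x e) (fun i => nth None [seq Some x | x <- e] i).
  by move=> x; rewrite (nth_map 1) ?index_mem ?eT// nth_index ?eT.
pose gT : finGroupType := HB.pack (Group.sort (TopGroup.sort Q)) (Choice_isCountable.Build Q pK) (isFinite.Build Q ax).
have cT : #|[set: gT]%SET| = (p ^ n)%N.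
  by rewrite cardsT cardE -se; apply/perm_size/uniq_perm; rewrite ?enum_uniq// => x; rewrite mem_enum eT.
split=> [x|].
  have := @expg_cardG gT [set: gT]%G x (@finset.in_setT gT x); by rewrite cT.
have pG : pgroup p [set: gT]%SET by rewrite /pgroup cT pnatX pnat_id.
have /lcnP[M LM] := pgroup_nil pG; exists M => z /=.
suff L k (u : gT) : lower_central (G := Q) k u -> u \in 'L_k.+1([set: gT]%G).
  by move=> /L; rewrite LM => /set1P.
elim: k u => [|k IH] u; first by rewrite finset.in_setT.
apply: (generated_subgroup_min (H := [set x : Q | (x : gT) \in 'L_k.+2([set: gT]%G)])).
  split=> /= [|x y|x]; [exact: (@group1 gT)|exact: (@groupM gT)|exact: (@groupVr gT)].
(* The two lower central series take commutators in opposite orders, hence the inverse. *)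
move=> _ [x [y [/IH Ly ->]]] /=; apply: (@groupVl gT); rewrite invgR.
exact: (@mem_commg gT _ _ y x Ly (@finset.in_setT gT x)).
Qed.
End FiniteQuotients.

(** * p-adic powers and the lower central series *)

Section PropGroups.
Local Open Scope group_scope.
Variables (p : nat) (p_pr : prime p).
Local Notation Zp := (Zp p_pr).

Definition p_open (N : topGroupType) (H : set N) :=
  open_normal H /\ forall x, exists k, H (x ^+ (p ^ k)%N).

(** A form of the pro-p condition that passes to quotients by closed normal subgroups without
    counting cosets. *)
Record pro_p_like (N : topGroupType) := ProPLike {
  ppl_compact : compact [set: N];
  ppl_hausdorff : hausdorff_space N;
  ppl_base : forall W : set N, nbhs 1 W -> exists2 H, p_open H & H `<=` W }.

Lemma continuous_image_compact (T U : topologicalType) (f : T -> U) (A : set T) :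
  continuous f -> compact A -> compact (f @` A).
Proof. by move=> cf cA; apply: continuous_compact => //; exact: continuous_subspaceT. Qed.

Lemma continuousX (N : topGroupType) m : continuous (fun x : N => x ^+ m).
Proof.
elim: m => [|m IH]; first by rewrite (_ : (fun x : N => _) = fun=> 1)//; exact: cst_continuous.
rewrite (_ : (fun x : N => _) = fun x => x * x ^+ m); first by apply: mulg_cts => // x; exact: cvg_id.
by apply/funext => x; rewrite expgS.
Qed.

Section Basics.
Variable N : topGroupType.
Hypothesis ppl : pro_p_like N.

Lemma p_open_normal (H : set N) : p_open H -> normal_subgroup H.
Proof. by case=> -[]. Qed.

Lemma ppl_nbhs (x : N) W : nbhs x W -> exists2 H, p_open H & forall h, H h -> W (x * h).
Proof.
move=> xW; have : nbhs (1 : N) ((fun h => x * h) @^-1` W).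
  by apply: mulgl_cts; rewrite mulg1.
by move=> /(ppl_base ppl)[H pH HW]; exists H.
Qed.

Lemma p_open_nbhs (H : set N) x : p_open H -> nbhs x (fun y => H (x^-1 * y)).
Proof.
move=> [[oH [[H1 _ _] _]] _]; apply: (mulgl_cts (y := x^-1)).
by apply: open_nbhs_nbhs; split=> //; rewrite mulVg.
Qed.

Lemma ppl_closed (S : set N) x : closed S ->
  (forall H, p_open H -> exists2 h, H h & S (x * h)) -> S x.
Proof.
move=> cS Sx; apply: cS => W /ppl_nbhs[H /Sx[h Hh Sxh] HW].
by exists (x * h); split=> //; exact: HW.
Qed.

Lemma ppl_eq x y : (forall H : set N, p_open H -> to_quot H x = to_quot H y) -> x = y.
Proof.
move=> xy; have : closed [set x]; last move=> c1.
  by apply: accessible_closed_set1; exact/hausdorff_accessible/(ppl_hausdorff ppl).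
apply/esym; apply: (ppl_closed c1) => H pH; exists (y^-1 * x) => /=; last by rewrite mulVKg.
by apply/quotE; [exact: p_open_normal|rewrite xy].
Qed.

Lemma p_openI (H H' : set N) : p_open H -> p_open H' -> exists2 H'', p_open H'' & H'' `<=` H `&` H'.
Proof.
move=> [[oH [[H1 _ _] _]] _] [[oH' [[H'1 _ _] _]] _].
by apply: (ppl_base ppl); apply: open_nbhs_nbhs; split => //; exact: openI.
Qed.

End Basics.

Lemma expg_mod (Q : groupType) (x : Q) m a b : x ^+ m = 1 -> (a = b %[mod m])%N -> x ^+ a = x ^+ b.
Proof.
move=> xm ab; rewrite (divn_eq a m) (divn_eq b m) ab !expgnDr.
by rewrite mulnC expgnA xm expg1n mulnC expgnA xm expg1n.
Qed.

Lemma zp_abs_mod (l : Zp) n k : (k <= n)%N -> (`|l n|%N = `|l k|%N %[mod p ^ k])%N.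
Proof.
move=> /subnKC <-; have := zp_val_mod l k (n - k).
rewrite -(gez0_abs (zp_ge0 l k)) -(gez0_abs (zp_ge0 l (k + (n - k)))) !modz_nat.
by case=> ->; rewrite !absz_nat.
Qed.

Section Powers.
Variable N : topGroupType.
Hypothesis ppl : pro_p_like N.

(** Modulo H some x ^ (p ^ k) is trivial, while the residues of l stabilize modulo p ^ k: the powers
    are Cauchy, and a cluster point given by compactness is their limit. So the default value in
    [padic_power] never occurs. *)
Lemma padic_power_cvg (x : N) (l : Zp) : (fun n => x ^+ `|l n|%N) @ \oo --> padic_power x l.
Proof.
rewrite /padic_power; case: xgetP => // none; exfalso.
pose u n := x ^+ `|l n|%N.
have cau (H : set N) k n : p_open H -> H (x ^+ (p ^ k)%N) -> (k <= n)%N -> H ((u k)^-1 * u n).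
  move=> pH Hx kn; have nH := p_open_normal pH; apply/quotE => //.
  rewrite /u !to_quotX; apply: (@expg_mod _ _ (p ^ k)); last exact/esym/zp_abs_mod.
  by rewrite -to_quotX; apply/quot1P.
have [y [_ yu]] := ppl_compact ppl (F := u @ \oo) _ filterT.
apply: (none y) => /= W /(ppl_nbhs ppl)[H pH HW].
have [[oH nH] Hpow] := pH; have [k xk] := Hpow x.
have [|z [[n /= kn <-] Hz]] := yu (u @` [set n | (k <= n)%N]) _ _ (p_open_nbhs y pH).
  by exists k => // n kn; exists n.
exists k => // m km; change (W (u m)); rewrite -[u m](mulVKg y); apply: HW.
have [[H1 HM HV] HJ] := nH.
have := HM _ _ Hz (HM _ _ (HV _ (cau H k n pH xk kn)) (cau H k m pH xk km)).
by rewrite !invgM invgK !mulgA !mulgK.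
Qed.

Lemma padic_powerE (x : N) (l : Zp) (H : set N) k : p_open H -> H (x ^+ (p ^ k)%N) ->
  to_quot H (padic_power x l) = to_quot H x ^+ `|l k|%N.
Proof.
move=> pH xk; have nH := p_open_normal pH.
have [n _ /(_ (maxn n k))] : \forall n \near \oo, H ((padic_power x l)^-1 * x ^+ `|l n|%N).
  exact: (@padic_power_cvg x l _ (p_open_nbhs (padic_power x l) pH)).
move=> /(_ (leq_maxl _ _))/= /(quotE _ _ nH) ->; rewrite to_quotX.
apply: (@expg_mod _ _ (p ^ k)); last by apply: zp_abs_mod; exact: leq_maxr.
by rewrite -to_quotX; apply/quot1P.
Qed.

Lemma padic_power_eq (x : N) (H : set N) : p_open H -> exists k, forall l l' : Zp, l k = l' k ->
  to_quot H (padic_power x l) = to_quot H (padic_power x l').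
Proof.
by move=> pH; have [k xk] := pH.2 x; exists k => l l' ll; rewrite !(padic_powerE _ pH xk) ll.
Qed.

Lemma padic_powerD (x : N) (l l' : Zp) : padic_power x (l + l') = padic_power x l * padic_power x l'.
Proof.
apply: (ppl_eq ppl) => H pH; have [k xk] := pH.2 x.
rewrite to_quotM !(padic_powerE _ pH xk) -expgnDr.
apply: (@expg_mod _ _ (p ^ k)).
  by rewrite -to_quotX; apply/quot1P => //; exact: p_open_normal.
rewrite zp_addE -{1}(gez0_abs (zp_ge0 l k)) -{1}(gez0_abs (zp_ge0 l' k)) -PoszD modz_nat absz_nat.
by rewrite modn_mod.
Qed.

Lemma padic_power_nat (x : N) n : padic_power x (n%:R : Zp) = x ^+ n.
Proof.
apply: (ppl_eq ppl) => H pH; have [k xk] := pH.2 x.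
rewrite to_quotX !(padic_powerE _ pH xk); apply: (@expg_mod _ _ (p ^ k)).
  by rewrite -to_quotX; apply/quot1P => //; exact: p_open_normal.
by rewrite zp_natE modz_nat absz_nat modn_mod.
Qed.

Lemma padic_power0 (x : N) : padic_power x (0 : Zp) = 1.
Proof. exact: (padic_power_nat x 0). Qed.

End Powers.

(** Images of p-open subgroups form the basis at 1, and points are separated because a closed S is
    the intersection of the products S H. *)
Lemma quot_pro_p_like (N : topGroupType) (S : set N) : pro_p_like N -> closed S ->
  normal_subgroup S -> pro_p_like (quot_group S).
Proof.
move=> ppl cS nS; have [[S1 SM SV] SJ] := nS.
have imN (H : set N) : p_open H -> p_open (to_quot S @` H).
  move=> [[oH [[H1 HM HV] HJ]] Hp]; split; last first.
    by elim/quot_ind=> x; have [k xk] := Hp x; exists k; exists (x ^+ (p ^ k)%N); rewrite ?to_quotX.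
  split; first exact: to_quot_open.
  split; last by move=> _ y [x Hx <-]; elim/quot_ind: y => y; exists (x ^ y); [exact: HJ|exact: to_quotJ].
  split=> [|_ _ [x Hx <-] [y Hy <-]|_ [x Hx <-]].
  - by exists 1 => //; exact: to_quot1.
  - by exists (x * y); [exact: HM|exact: to_quotM].
  - by exists x^-1; [exact: HV|exact: to_quotV].
split.
- have -> : [set: quot_group S] = to_quot S @` setT.
    by apply/seteqP; split=> //; elim/quot_ind=> x _; exists x.
  by apply: continuous_image_compact; [exact: to_quot_continuous|exact: ppl_compact].
- move=> x y; elim/quot_ind: x => a; elim/quot_ind: y => b xy.
  apply/quotE => //; apply: (ppl_closed ppl cS) => H pH.
  have [[H1 HM HV] HJ] := p_open_normal pH; have oH := pH.1.1.
  have nb (c : N) : nbhs (to_quot S c) (to_quot S @` [set c * h | h in H]).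
    apply: open_nbhs_nbhs; split; last by exists c => //; exists 1; rewrite ?mulg1.
    apply: to_quot_open; have -> : [set c * h | h in H] = (fun y => c^-1 * y) @^-1` H.
      by apply/seteqP; split=> z /=; [case=> h Hh <-; rewrite mulKg|exists (c^-1 * z); rewrite ?mulVKg].
    by apply: open_comp => // z _; exact: mulgl_cts.
  have [_ [[_ [h Hh <-] <-] [_ [k Hk <-] /esym/(quotE _ _ nS) e]]] := xy _ _ (nb a) (nb b).
  exists (k * h^-1); first by apply: HM => //; exact: HV.
  by have := SJ _ h^-1 e; rewrite conjgE invgK invgM !mulgA mulgV mul1g.
- move=> W W1; have : nbhs (1 : N) (to_quot S @^-1` W).
    by apply: to_quot_continuous; rewrite to_quot1.
  move=> /(ppl_base ppl)[H pH HW]; exists (to_quot S @` H); first exact: imN.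
  by move=> _ [x Hx <-]; exact: HW.
Qed.

End PropGroups.

Section LowerCentral.
Local Open Scope group_scope.

Lemma lower_central_chain (G : topGroupType) : central_chain (lower_central (G := G)).
Proof.
have nL k : normal_subgroup (lower_central (G := G) k).
  elim: k => [|k IH]; first by split.
  apply: generated_normal => _ y [h [z [zk ->]]].
  by exists (h ^ y), (z ^ y); split; [exact: IH.2|exact: conjRg].
have cL k x y : lower_central k y -> lower_central (G := G) k.+1 [~ x, y].
  by move=> Ly; apply: sub_gen_smallest; exists x, y.
split=> //; elim=> [//|k IH]; apply: generated_subgroup_min; first by have [] := nL k.+1.
by move=> _ [x [y [/IH Ly ->]]]; exact: cL.
Qed.

Lemma lower_central_quot (G : topGroupType) (S : set G) k :
  lower_central (G := quot_group S) k = to_quot S @` lower_central k.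
Proof.
elim: k => [|k IH].
  by apply/seteqP; split=> //; elim/quot_ind=> x _; exists x.
have [[L1 LM LV] _] := chain_normal (lower_central_chain G) k.+1.
apply/seteqP; split.
  apply: generated_subgroup_min.
    split=> [|_ _ [x Lx <-] [y Ly <-]|_ [x Lx <-]].
    - by exists 1 => //; exact: to_quot1.
    - by exists (x * y); [exact: LM|exact: to_quotM].
    - by exists x^-1; [exact: LV|exact: to_quotV].
  move=> _ [x [y [yL ->]]]; elim/quot_ind: x => x; move: yL.
  change (lower_central k y -> (to_quot S @` lower_central k.+1) [~ to_quot S x, y]).
  rewrite IH => -[z Lz <-].
  by exists [~ x, z]; [exact: (chain_comm (lower_central_chain G) x Lz)|exact: to_quotR].
move=> _ [x Lx <-].
have [[Q1 QM QV] _] := chain_normal (lower_central_chain (quot_group S)) k.+1.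
apply: (generated_subgroup_min (H := [set x | lower_central (G := quot_group S) k.+1 (to_quot S x)]) _ _ Lx).
  split=> /= [|u v Lu Lv|u Lu]; first by rewrite to_quot1.
    by rewrite to_quotM; exact: QM.
  by rewrite to_quotV; exact: QV.
move=> _ [u [v [Lv ->]]] /=; rewrite to_quotR; apply: (chain_comm (lower_central_chain _)).
by rewrite IH; exists v.
Qed.

Variables (p : nat) (p_pr : prime p) (G : topGroupType).
Hypothesis ppl : pro_p_like p G.
Hypothesis nilp : forall H : set G, p_open p H -> exists M, lower_central (G := G) M `<=` H.
Variable s : seq G.
Hypothesis ds : dense (generated_subgroup [set` s]).
Local Notation L := (lower_central (G := G)).

(** One commutator for each generator, in order, with bounded length; the recursive form gives
    compactness by induction. *)
Fixpoint commutator_prods (k : nat) (t : seq G) : set G :=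
  if t is a :: t' then [set [~ a, z.1] * z.2 | z in L k `*` commutator_prods k t'] else [set 1].

Lemma commutator_prodsE k t z : commutator_prods k t z <->
  exists2 y : 'I_(size t) -> G, forall i, L k (y i) & z = \prod_(i < size t) [~ nth 1 t i, y i].
Proof.
elim: t z => [|a t IH] z /=.
  split=> [->|[y _ ->]]; last by rewrite big_ord0.
  by exists (fun=> 1) => [[]//|]; rewrite big_ord0.
split=> [[[y x] [/= Ly /IH[w Lw ->]] <-]|[y Ly ->]].
  exists (fun i => if unlift ord0 i is Some j then w j else y) => [i|]; first by case: unlift.
  rewrite big_ord_recl unlift_none; congr (_ * _).
  by apply: eq_bigr => i _; rewrite liftK.
exists (y ord0, \prod_(i < size t) [~ nth 1 t i, y (lift ord0 i)]).
  by split=> //=; apply/IH; exists (fun i => y (lift ord0 i)).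
by rewrite big_ord_recl.
Qed.

Lemma commutator_prods_compact k t : compact (L k) -> compact (commutator_prods k t).
Proof.
move=> cL; elim: t => [|a t IH]; first exact: compact_set1.
apply: continuous_image_compact; last exact: compact_setX.
have c1 : continuous (fun z : G * G => z.1) by move=> z; exact: cvg_fst.
have c2 : continuous (fun z : G * G => z.2) by move=> z; exact: cvg_snd.
apply: mulg_cts => //; rewrite (_ : (fun z : G * G => _) = fun z => a^-1 * (z.1^-1 * (a * z.1))).
  apply: (comp_cts _ (@mulgl_cts _ a^-1)); apply: mulg_cts; first exact: invg_cts.
  exact: comp_cts c1 (@mulgl_cts _ a).
by apply/funext => z; rewrite commgEl conjgE.
Qed.

Lemma dense_quot (H : set G) x : p_open p H ->
  exists2 h, generated_subgroup [set` s] h & to_quot H x = to_quot H h.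
Proof.
move=> pH; have nH := p_open_normal pH; have [[H1 _ _] _] := nH.
have oC : open [set h | H (x^-1 * h)].
  by apply: open_comp => [h _|]; [exact: mulgl_cts|exact: pH.1.1].
have [|h [Hh Gh]] := ds _ oC; first by exists x => /=; rewrite mulVg.
by exists h => //; apply/quotE.
Qed.

(** The quotient by H is nilpotent, so [commutator_cover] with M at the end of its lower central
    series gives an exact product there, which is lifted to G. *)
Lemma lower_central_cover k z (H : set G) : p_open p H -> L k.+1 z ->
  exists2 x, commutator_prods k s x & to_quot H z = to_quot H x.
Proof.
move=> pH Lz; have nH := p_open_normal pH; pose Q := quot_group H.
have cQ := lower_central_chain Q.
have [M LM] := nilp pH.
have QM : lower_central (G := Q) M `<=` [set 1].
  by rewrite lower_central_quot => _ [x /LM Hx <-]; apply/quot1P.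
have QMe (x y : Q) : to_quot (lower_central M) x = to_quot (lower_central M) y -> x = y.
  move=> /(quotE _ _ (chain_normal cQ M))/QM xy; by rewrite -[LHS]mulg1 -xy mulVKg.
pose s' (i : 'I_(size s)) : Q := to_quot H (nth 1 s i).
have sgen x : exists2 h, generated_subgroup (range s') h &
    to_quot (lower_central M) x = to_quot (lower_central M) h.
  elim/quot_ind: x => x; have [h gh xh] := dense_quot x pH; exists (to_quot H h); last by rewrite xh.
  have [g1 gM gV] := generated_subgroupP (range s').
  apply: (generated_subgroup_min (H := [set h | generated_subgroup (range s') (to_quot H h)]) _ _ gh).
    split=> /= [|u v gu gv|u gu]; first by rewrite to_quot1.
      by rewrite to_quotM; exact: gM.
    by rewrite to_quotV; exact: gV.
  move=> u /= /(nthP 1)[i si <-]; apply: sub_gen_smallest.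
  by exists (Ordinal si).
have Lgen k' (x : Q) : lower_central k'.+1 x -> exists2 h,
    generated_subgroup [set z | exists x y, lower_central k' y /\ z = [~ x, y]] h &
    to_quot (lower_central M) x = to_quot (lower_central M) h by exists x.
have Lqz : lower_central k.+1 (to_quot H z) by rewrite lower_central_quot; exists z.
have [y Ly zE] := commutator_cover cQ sgen Lgen Lqz.
have /choice[w wP] i : exists w, L k w /\ to_quot H w = y i.
  by move: (Ly i); rewrite lower_central_quot => -[w Lw wy]; exists w.
exists (\prod_(i < size s) [~ nth 1 s i, w i]).
  by apply/commutator_prodsE; exists w => // i; exact: (wP i).1.
rewrite to_quot_prod (QMe _ _ zE); apply: eq_bigr => i _.
by rewrite to_quotR (wP i).2.
Qed.

(** Elements of the closure of L k.+1 agree modulo every H with elements of [commutator_prods k s],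
    compact when L k is closed, hence belong to it. So L k.+1 is closed, and its elements are
    products of a bounded number of commutators. *)
Lemma lower_central_closed k : closed (L k) /\ forall z, L k.+1 z -> commutator_prods k s z.
Proof.
have cLG := lower_central_chain G.
have step k' : closed (L k') -> forall z, closure (L k'.+1) z -> commutator_prods k' s z.
  move=> cL z cz; have cpc : compact (commutator_prods k' s).
    by apply: commutator_prods_compact; apply: subclosed_compact cL (ppl_compact ppl) _.
  apply: (ppl_closed ppl (compact_closed (ppl_hausdorff ppl) cpc)) => H pH.
  have [z' [Lz' Hz']] := cz _ (p_open_nbhs z pH).
  have nH := p_open_normal pH.
  have [x cx z'x] := lower_central_cover pH Lz'; exists (z^-1 * x); last by rewrite mulVKg.
  by apply/quotE; rewrite -?z'x//; apply/quotE.
have cLk : closed (L k).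
  elim: k => [|k IH]; first exact: closedT.
  move=> z /(step k IH)/commutator_prodsE[y Ly ->].
  have [sL _] := chain_normal cLG k.+1.
  by apply: subgroup_prod => // i; exact: (chain_comm cLG).
by split=> // z Lz; apply: step => //; exact: subset_closure.
Qed.

End LowerCentral.

(** * Bounded torsion and the torsion-free quotients *)

Section Lattices.
Variables (p : nat) (p_pr : prime p).
Local Notation Zp := (Zp p_pr).

Lemma zp_natr_factor m : (0 < m)%N -> forall a : Zp, m%:R * a = 0 -> a = 0.
Proof.
move=> m0 a /eqP; rewrite mulf_eq0 => /orP[|/eqP//].
by have /pcharf0P -> := zp_pchar p_pr; rewrite -[_ == _]negbK -lt0n m0.
Qed.

Definition fun_submodule d (R : set ('I_d -> Zp)) :=
  [/\ R (fun=> 0), forall l m, R l -> R m -> R (fun i => l i + m i) &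
      forall a l, R l -> R (fun i => a * l i)].

Lemma zp_ideal (I : set Zp) : I 0 -> (forall a b, I a -> I b -> I (a + b)) ->
  (forall c a, I a -> I (c * a)) ->
  (forall a, I a -> a = 0) \/ exists2 e, I (p%:R ^+ e) & forall a, I a -> exists b, a = b * p%:R ^+ e.
Proof.
move=> I0 ID IM; have [z|/existsNP[a /not_implyP[Ia a0]]] := EM (forall a, I a -> a = 0).
  by left.
have pI c : I c -> c <> 0 -> exists k u, c = u * p%:R ^+ k /\ I (p%:R ^+ k).
  move=> Ic /eqP c0; have [k [u [u' [cE u'u _]]]] := zp_factor c0.
  by exists k, u; split; [rewrite mulrC|have := IM u' _ Ic; rewrite cE mulrCA u'u mulr1].
right; have ex : exists e, `[< I (p%:R ^+ e) >].
  by have [k [u [_ Ik]]] := pI a Ia a0; exists k; apply/asboolP.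
case: (ex_minnP ex) => e /asboolP Ie min; exists e => // c Ic.
have [->|/eqP c0] := eqVneq c 0; first by exists 0; rewrite mul0r.
have [k [u [-> Ik]]] := pI c Ic c0; exists (u * p%:R ^+ (k - e)).
by rewrite -mulrA -exprD subnK//; apply: min; exact/asboolP.
Qed.

(** Induction on d. The first coordinates of R form the zero ideal or one generated by p ^ e; in the
    second case subtracting a multiple of some r in R from p ^ e l kills the first coordinate, and
    the exponent grows by e. *)
Lemma bounded_torsion d (R : set ('I_d -> Zp)) : fun_submodule R ->
  exists E, forall l, (exists2 m, (0 < m)%N & R (fun i => m%:R * l i)) ->
    R (fun i => p%:R ^+ E * l i).
Proof.
elim: d R => [|d IH] R [R0 RD RM].
  exists 0%N => l _; rewrite (_ : (fun i => _) = fun=> 0)//; apply/funext => -[] //.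
pose ext (l : 'I_d -> Zp) (i : 'I_d.+1) : Zp := if unlift ord0 i is Some j then l j else 0.
have extE l : l ord0 = 0 -> l = ext (fun j => l (lift ord0 j)).
  by move=> l0; apply/funext => i; rewrite /ext; case: unliftP => [j ->|->].
have [|E EP] := IH [set l | R (ext l)].
  split=> /= [|l m Rl Rm|a l Rl].
  - by move: R0; congr R; apply/funext => i; rewrite /ext; case: unlift.
  - move: (RD _ _ Rl Rm); congr R; apply/funext => i; rewrite /ext; case: unlift => //; exact: addr0.
  - move: (RM a _ Rl); congr R; apply/funext => i; rewrite /ext; case: unlift => //; exact: mulr0.
have key l m : (0 < m)%N -> l ord0 = 0 -> R (fun i => m%:R * l i) -> R (fun i => p%:R ^+ E * l i).
  move=> m0 l0 Rm; rewrite (extE (fun i => _)) ?l0 ?mulr0//.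
  apply: (EP (fun j => l (lift ord0 j))); exists m => //=.
  by move: Rm; rewrite {1}(extE (fun i => m%:R * l i))// l0 mulr0.
have [|||z|[e [r Rr re] eI]] := @zp_ideal [set a | exists2 l : 'I_d.+1 -> Zp, R l & l ord0 = a].
- by exists (fun=> 0).
- by move=> a b [l Rl <-] [m Rm <-]; exists (fun i => l i + m i) => //; exact: RD.
- by move=> c a [l Rl <-]; exists (fun i => c * l i) => //; exact: RM.
- exists E => l [m m0 Rm]; refine (key l m m0 _ Rm).
  apply: (zp_natr_factor m0).
  by apply: (z (m%:R * l ord0)); exists (fun i => m%:R * l i).
exists (E + e)%N => l [m m0 Rm].
pose l' i := p%:R ^+ e * l i + (- l ord0) * r i.
have Rl' : R (fun i => p%:R ^+ E * l' i).
  apply: (key _ m) => //; first by rewrite /l' re; ring.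
  have := RD _ _ (RM (p%:R ^+ e) _ Rm) (RM (- (m%:R * l ord0)) _ Rr).
  by congr R; apply/funext => i; rewrite /l'; ring.
have := RD _ _ Rl' (RM (p%:R ^+ E * l ord0) _ Rr).
by congr R; apply/funext => i; rewrite /l' exprD; ring.
Qed.

End Lattices.

Section LowerCentralTorsion.
Local Open Scope group_scope.
Variables (p : nat) (p_pr : prime p) (G : topGroupType).
Local Notation Zp := (Zp p_pr).
Hypothesis ppl : pro_p_like p G.
Hypothesis nilp : forall H : set G, p_open p H -> exists M, lower_central (G := G) M `<=` H.
Variable s : seq G.
Hypothesis ds : dense (generated_subgroup [set` s]).
Local Notation L := (lower_central (G := G)).
Local Notation q k := (to_quot (L k)).

Let cL : central_chain L := lower_central_chain G.
Let nL k : normal_subgroup (L k) := chain_normal cL k.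
Let clL k : closed (L k) := (lower_central_closed ppl nilp ds k).1.

(** A continuous homomorphism from Z_p ^ d onto L k / L k.+1, stated on representatives; it
    transports the torsion bound for submodules of Z_p ^ d. *)
Record lc_param k d (phi : ('I_d -> Zp) -> G) : Prop := LcParam {
  lcp_in : forall l, L k (phi l);
  lcp_add : forall l m, q k.+1 (phi (fun i => (l i + m i)%R)) = q k.+1 (phi l) * q k.+1 (phi m);
  lcp_surj : forall x, L k x -> exists l, q k.+1 x = q k.+1 (phi l);
  lcp_cts : forall H : set G, p_open p H -> exists n, forall l m : 'I_d -> Zp, (forall i, l i n = m i n) ->
    exists2 h, H h & q k.+1 (phi m) = q k.+1 (phi l * h) }.

Definition word (l : 'I_(size s) -> Zp) : G := \prod_(i < size s) padic_power (nth 1 s i) (l i).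

Lemma word_cts (H : set G) : p_open p H -> exists n, forall l m : 'I_(size s) -> Zp,
  (forall i, l i n = m i n) -> to_quot H (word l) = to_quot H (word m).
Proof.
move=> pH; have /choice[k kP] i := padic_power_eq p_pr ppl (nth 1 s i) pH.
exists (\max_(i < size s) k i)%N => l m lm; rewrite !to_quot_prod; apply: eq_bigr => i _.
apply: kP; have ki : (k i <= \max_(i < size s) k i)%N by apply: (leq_bigmax i).
by apply: (zp_coord_le (k := (\max_(i < size s) k i - k i)%N)); rewrite subnKC.
Qed.

Lemma quot1_commute x y : q 1 x * q 1 y = q 1 y * q 1 x.
Proof.
apply/commgP/eqP; rewrite -to_quotR; apply/quot1P; first exact: nL.
exact: (chain_comm cL).
Qed.

Lemma wordD l m : q 1 (word (fun i => (l i + m i)%R)) = q 1 (word l) * q 1 (word m).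
Proof.
rewrite !to_quot_prod -central_prodM; last by move=> i; elim/quot_ind=> x; exact: quot1_commute.
by apply: eq_bigr => i _; rewrite -to_quotM padic_powerD.
Qed.

Lemma wordV l : q 1 (word (fun i => (- l i)%R)) = (q 1 (word l))^-1.
Proof.
apply: (mulgI (q 1 (word l))); rewrite -wordD mulgV.
rewrite /word big1 ?to_quot1// => i _; by rewrite subrr padic_power0.
Qed.

Lemma word_gen (H : set G) x : p_open p H -> exists l h, H h /\ q 1 x = q 1 (word l * h).
Proof.
move=> pH; have [y gy xy] := dense_quot ds x pH.
have [l lE] : exists l, q 1 y = q 1 (word l).
  apply: (generated_subgroup_min (H := [set y | exists l, q 1 y = q 1 (word l)]) _ _ gy).
    split=> [|u v [l ul] [m vm]|u [l ul]].
    - by exists (fun=> 0%R); rewrite /word big1// => i _; rewrite padic_power0.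
    - by exists (fun i => (l i + m i)%R); rewrite to_quotM ul vm wordD.
    - by exists (fun i => (- l i)%R); rewrite to_quotV ul wordV.
  move=> u /= /(nthP 1)[i si <-]; exists (fun j => (j == Ordinal si)%:R%R).
  rewrite /word (prod_single (i := Ordinal si)) ?eqxx /=.
    by rewrite (padic_power_nat p_pr ppl _ 1).
  by move=> j /negbTE ->; rewrite padic_power0.
exists l, (y^-1 * x); split; last by rewrite to_quotM -lE -to_quotM mulVKg.
by apply/quotE; [exact: p_open_normal pH|].
Qed.

(** Words approximate x modulo L 1 and every H; their exponents converge along an ultrafilter on the
    p-open subgroups, and L 1 is closed. *)
Lemma word_surj x : exists l, q 1 x = q 1 (word l).
Proof.
have /choice[l lP] : forall H : {H : set G | p_open p H}, exists l : 'I_(size s) -> Zp,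
    exists h, sval H h /\ q 1 x = q 1 (word l * h) by move=> [H pH]; exact: word_gen.
pose T := {H : set G | p_open p H}.
pose F0 := filter_from [set: T] (fun H => [set H' : T | sval H' `<=` sval H]).
have pT : p_open p [set: G].
  by split=> [|y]; [split; [exact: openT|split]|exists 0%N].
have FF0 : ProperFilter F0.
  apply: filter_from_proper; last by move=> H _; exists H.
  apply: filter_from_filter; first by exists (exist _ _ pT).
  move=> [H pH] [H' pH'] _ _; have [H2 pH2 sub] := p_openI ppl pH pH'.
  by exists (exist _ _ pH2) => // -[K pK] /= KH; split; apply: subset_trans KH _ => z /sub[].
have [F [UF F0F]] := ultraFilterLemma FF0.
have [z zP] := zp_ultra_all UF l; exists z.
apply/quotE; first exact: nL.
refine (ppl_closed ppl (@clL 1%N) _) => H pH; have [n nP] := word_cts pH.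
have FH : F [set H' : T | sval H' `<=` H] by apply: F0F; exists (exist _ _ pH).
have [[K pK] [/= KH lz]] := filter_ex (filterI FH (zP n)).
have [h [/KH Hh xE]] := lP (exist _ _ pK).
have nH := p_open_normal pH; have [[H1 HM HV] HJ] := nH.
have := nP _ _ lz => /(quotE _ _ nH) Hw.
exists ((word z)^-1 * word (l (exist _ _ pK)) * h).
  by apply: HM => //; have := HV _ Hw; rewrite invgM invgK.
have := iffLR (quotE _ _ (@nL 1%N)) xE.
by rewrite -!mulgA mulVKg.
Qed.

Lemma lc_param0 : exists d (phi : ('I_d -> Zp) -> G), lc_param 0 phi.
Proof.
exists (size s), word; split=> //; first exact: wordD.
- by move=> x _; exact: word_surj.
- move=> H pH; have [n nP] := word_cts pH; exists n => l m /nP/(quotE _ _ (p_open_normal pH)) Hh.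
  by exists ((word l)^-1 * word m); rewrite ?mulVKg.
Qed.

Lemma commr_central k x y : L k y -> central (q k.+2 [~ x, y]).
Proof. by move=> Ly; apply: (chain_central cL); exact: (chain_comm cL). Qed.

Lemma lc_congr k y z : L k y -> q k.+1 y = q k.+1 z -> L k z.
Proof.
move=> Ly /(quotE _ _ (nL _))/(chain_dec cL) yz; have [[_ LM _] _] := nL k.
by rewrite -[z](mulVKg y); exact: LM.
Qed.

Lemma commr_quot k x y z : L k y -> L k z -> q k.+1 y = q k.+1 z -> q k.+2 [~ x, y] = q k.+2 [~ x, z].
Proof.
move=> Ly Lz /(quotE _ _ (nL _)) yz; rewrite -[z in RHS](mulVKg y) !to_quotR to_quotM.
rewrite central_commMr; last by rewrite -to_quotR; exact: commr_central.
rewrite -(to_quotR _ x (y^-1 * z)) (iffRL (quot1P _ (nL _)) (chain_comm cL x yz)).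
by rewrite mulg1.
Qed.

(** By [lower_central_closed], commutators of the generators with a parametrization of L k reach all
    of L k.+1, and modulo L k.+2 they are additive. *)
Lemma lc_paramS k : (exists d (phi : ('I_d -> Zp) -> G), lc_param k phi) ->
  exists d (phi : ('I_d -> Zp) -> G), lc_param k.+1 phi.
Proof.
move=> [d [phi P]]; pose D := #|{: 'I_(size s) * 'I_d}|.
pose part (l : 'I_D -> Zp) i : 'I_d -> Zp := fun j => l (enum_rank (i, j)).
pose psi (l : 'I_D -> Zp) := \prod_(i < size s) [~ nth 1 s i, phi (part l i)].
have [[L1 LM LV] _] := nL k.+1.
exists D, psi; split.
- by move=> l; apply: subgroup_prod => // i; apply: (chain_comm cL); exact: lcp_in P _.
- move=> l m; rewrite !to_quot_prod -central_prodM; last first.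
    by move=> i; apply: commr_central; exact: lcp_in P _.
  apply: eq_bigr => i _; have Ll := lcp_in P (part l i); have Lm := lcp_in P (part m i).
  rewrite (commr_quot _ (lcp_in P _) _ (etrans (lcp_add P (part l i) (part m i)) (esym (to_quotM _ _ _)))).
    rewrite !to_quotR to_quotM central_commMr//; first by rewrite -to_quotR; exact: commr_central.
  by have [[_ LkM _] _] := nL k; exact: LkM.
- move=> x Lx; have := (lower_central_closed ppl nilp ds k).2 x Lx.
  move=> /commutator_prodsE[y Ly ->]; have /choice[l lP] i := lcp_surj P (Ly i).
  exists (fun a => let: (i, j) := enum_val a in l i j).
  rewrite !to_quot_prod; apply: eq_bigr => i _; apply: commr_quot => //; first exact: lcp_in P _.
  rewrite lP; congr (q _ (phi _)); apply/funext => j; by rewrite /part enum_rankK.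
- move=> H pH; have [n nP] := lcp_cts P pH; exists n => l m lm.
  have nH := p_open_normal pH; have [[H1 HM HV] HJ] := nH.
  have /choice[h hP] i : exists h, H h /\ q k.+1 (phi (part m i)) = q k.+1 (phi (part l i) * h).
    by have [|h Hh hE] := nP (part l i) (part m i); [move=> j; exact: lm|exists h].
  have mE : q k.+2 (psi m) = q k.+2 (\prod_(i < size s) [~ nth 1 s i, phi (part l i) * h i]).
    rewrite !to_quot_prod; apply: eq_bigr => i _; apply: commr_quot; [exact: lcp_in P _| |exact: (hP i).2].
    by apply: lc_congr (hP i).2; exact: lcp_in P _.
  exists ((psi l)^-1 * \prod_(i < size s) [~ nth 1 s i, phi (part l i) * h i]); last first.
    by rewrite mulVKg.
  apply/quotE => //; rewrite !to_quot_prod; apply: eq_bigr => i _.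
  rewrite !to_quotR to_quotM (iffRL (quot1P _ nH) (hP i).1) mulg1//.
Qed.

Lemma lc_param_ex k : exists d (phi : ('I_d -> Zp) -> G), lc_param k phi.
Proof. by elim: k => [|k IH]; [exact: lc_param0|exact: lc_paramS]. Qed.

Lemma lcp_natr k d (phi : ('I_d -> Zp) -> G) l n : lc_param k phi ->
  q k.+1 (phi (fun i => (n%:R * l i)%R)) = q k.+1 (phi l) ^+ n.
Proof.
move=> P; elim: n => [|n IH].
  have := lcp_add P (fun=> 0%R) (fun=> 0%R); rewrite expg0.
  have -> : (fun i : 'I_d => (0%:R * l i)%R) = fun=> 0%R by apply/funext => i; rewrite mul0r.
  have -> : (fun i : 'I_d => (0 + 0 : Zp)%R) = fun=> 0%R by apply/funext => i; rewrite addr0.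
  by move=> e; apply: (mulgI (q k.+1 (phi (fun=> 0%R)))); rewrite -e mulg1.
rewrite expgS -IH -(lcp_add P); congr (q _ (phi _)); apply/funext => i.
by rewrite mulrS mulrDl mul1r.
Qed.

(** The l with phi(l) in L k.+1 form a submodule: stability under natural numbers extends to Z_p
    because L k.+1 is closed. Then [bounded_torsion] applies. *)
Lemma lc_step_exponent k : exists E, forall x, L k x -> (exists2 m, (0 < m)%N & L k.+1 (x ^+ m)) ->
  L k.+1 (x ^+ (p ^ E)%N).
Proof.
have [d [phi P]] := lc_param_ex k; have nk := nL k.+1; have [[L1 LM LV] _] := nk.
have rX l n : L k.+1 (phi l) -> L k.+1 (phi (fun i => (n%:R * l i)%R)).
  by move=> /(quot1P _ nk) e; apply/(quot1P _ nk); rewrite (lcp_natr _ _ P) e expg1n.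
have sub : fun_submodule [set l | L k.+1 (phi l)].
  split=> /= [|l m /(quot1P _ nk) Ll /(quot1P _ nk) Lm|a l Ll].
  - apply/(quot1P _ nk); have := lcp_natr (fun=> 0%R) 0 P; rewrite expg0 => <-.
    by congr (q _ (phi _)); apply/funext => i; rewrite mul0r.
  - by apply/(quot1P _ nk); rewrite (lcp_add P) Ll Lm mulg1.
  - refine (ppl_closed ppl (@clL k.+1) _) => H pH; have [n nP] := lcp_cts P pH.
    have [|h Hh e] := nP (fun i => (a * l i)%R) (fun i => (`|a n|%N%:R * l i)%R).
      by move=> i; apply: zp_coordM => //; rewrite zp_natr.
    exists h => //; apply/(quot1P _ nk); rewrite -e; apply/(quot1P _ nk); exact: rX.
have [E EP] := bounded_torsion sub; exists E => x Lx [m m0 Lxm].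
have [l xl] := lcp_surj P Lx.
have qX n : q k.+1 (x ^+ n) = q k.+1 (phi (fun i => (n%:R * l i)%R)).
  by rewrite to_quotX xl (lcp_natr _ _ P).
apply/(quot1P _ nk); rewrite qX; apply/(quot1P _ nk).
have := EP l; rewrite -natrX; apply; exists m => //=.
by apply/(quot1P _ nk); rewrite -qX; apply/quot1P.
Qed.

Lemma lc_torsion_exponent n : exists E, forall x, (exists2 m, (0 < m)%N & L n (x ^+ m)) ->
  L n (x ^+ (p ^ E)%N).
Proof.
have H k : (k <= n)%N -> exists E, forall x, (exists2 m, (0 < m)%N & L n (x ^+ m)) -> L k (x ^+ (p ^ E)%N).
  elim: k => [_|k IH kn]; first by exists 0%N.
  have [E EP] := IH (ltnW kn); have [E' EP'] := lc_step_exponent k; exists (E + E')%N => x xm.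
  rewrite expnD expgnA; apply: EP'; first exact: EP.
  have [m m0 Lxm] := xm; exists m => //; apply: (chain_le cL kn).
  rewrite expgnAC; have [[L1 LM _] _] := nL n.
  by elim: (p ^ E)%N => [//|j IHj]; rewrite expgS; exact: LM.
exact: H.
Qed.

Lemma lc_quot_pro_p_like n : pro_p_like p (lc_quot G n).
Proof. exact: (quot_pro_p_like ppl (@clL n) (@nL n)). Qed.

(** A uniform exponent p ^ E makes the torsion the preimage of 1 under a continuous power map;
    nilpotency makes it a normal subgroup. *)
Lemma lc_quot_torsion n :
  closed (@torsion (lc_quot G n)) /\ normal_subgroup (@torsion (lc_quot G n)).
Proof.
split; last first.
  apply: (@torsion_normal _ (lower_central (G := lc_quot G n)) n) => //.
    exact: lower_central_chain.
  by rewrite lower_central_quot => _ [x Lx <-]; apply/quot1P.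
have [E EP] := lc_torsion_exponent n.
have -> : @torsion (lc_quot G n) = (fun x => x ^+ (p ^ E)%N) @^-1` [set 1].
  apply/seteqP; split; elim/quot_ind=> x /=.
    move=> [m m0]; rewrite -!to_quotX => /(quot1P _ (@nL n)) Lx.
    by apply/(quot1P _ (@nL n)); apply: EP; exists m.
  by move=> xE; exists (p ^ E)%N => //; rewrite expn_gt0 prime_gt0.
apply: closed_comp; first by move=> x _; exact: continuousX.
by apply: accessible_closed_set1; exact/hausdorff_accessible/(ppl_hausdorff (lc_quot_pro_p_like n)).
Qed.

Lemma lc_tf_quot_pro_p_like n : pro_p_like p (lc_tf_quot G n).
Proof.
by apply: quot_pro_p_like; [exact: lc_quot_pro_p_like|exact: (lc_quot_torsion n).1|exact: (lc_quot_torsion n).2].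
Qed.

End LowerCentralTorsion.

(** * Mal'cev coordinates *)

Section UpperCentral.
Local Open Scope group_scope.
Variable N : topGroupType.

Lemma upper_central_normal i : normal_subgroup (@upper_central N i).
Proof.
elim: i => [|i IH].
  split=> [|_ y ->]; last exact: conj1g.
  by split=> // [_ _ -> ->|_ ->]; [exact: mulg1|exact: invg1].
have [[U1 UM UV] UJ] := IH; split=> [|x z xU y /=].
  split=> [y|x x' xU x'U y|x xU y] /=.
  - by rewrite comm1g.
  - by rewrite commgMl; apply: UM; [exact/UJ/xU|exact: x'U].
  - have := UV _ (UJ _ x^-1 (xU y)); congr upper_central.
    by rewrite !commgEl !conjgE !invgM !invgK !mulgA !mulgK.
have -> : [~ x ^ z, y] = [~ x, y ^ z^-1] ^ z by rewrite conjRg conjgKV.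
exact/UJ/xU.
Qed.

Lemma upper_central_sub i : @upper_central N i `<=` upper_central i.+1.
Proof.
elim: i => [x -> y|i IH x xU y]; first by rewrite comm1g; have [[]] := upper_central_normal 0.
exact/IH/xU.
Qed.

End UpperCentral.

Section ZpChain.
Local Open Scope group_scope.
Variables (p : nat) (p_pr : prime p) (N : topGroupType).
Hypothesis ppl : pro_p_like p N.
Local Notation Zp := (Zp p_pr).

(** A central series whose factors are copies of Z_p, one for each member of the Mal'cev basis;
    coordinates are treated by induction along it. *)
Record zp_chain (v : nat -> N) (r : nat) (S : nat -> set N) := ZpChain {
  zc_bot : S 0%N = [set 1];
  zc_normal : forall k, (k <= r)%N -> normal_subgroup (S k);
  zc_sub : forall k, (k < r)%N -> S k `<=` S k.+1;
  zc_comm : forall k x y, (k < r)%N -> S k.+1 x -> S k [~ x, y];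
  zc_gen : forall k l, (k < r)%N -> S k.+1 (padic_power (v k) (l : Zp));
  zc_coord : forall k x, (k < r)%N -> S k.+1 x -> exists! l : Zp, S k (x * (padic_power (v k) l)^-1) }.

Lemma zp_chain_extend v r S (C : set N) : zp_chain v r S -> normal_subgroup C -> S r `<=` C ->
  (forall x y, C x -> S r [~ x, y]) -> (forall l : Zp, C (padic_power (v r) l)) ->
  (forall x, C x -> exists! l : Zp, S r (x * (padic_power (v r) l)^-1)) ->
  exists2 S', zp_chain v r.+1 S' & S' r.+1 = C.
Proof.
move=> zc nC SC commC Cv coordC; exists (fun k => if (k <= r)%N then S k else C); last by rewrite ltnn.
split=> [|k _|k|k x y|k l|k x].
- exact: zc_bot zc.
- by case: ifP => // kr; exact: zc_normal zc _ kr.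
- by rewrite ltnS => kr; rewrite kr; move: kr; rewrite leq_eqVlt => /orP[/eqP ->|kr]; [rewrite ltnn|rewrite kr; exact: zc_sub zc _ kr].
- by rewrite ltnS => kr; rewrite kr; move: kr; rewrite leq_eqVlt => /orP[/eqP ->|kr]; [rewrite ltnn; exact: commC|rewrite kr; by move=> Sx; apply: (zc_comm zc)].
- by rewrite ltnS leq_eqVlt => /orP[/eqP ->|kr]; [rewrite ltnn|rewrite kr; exact: (zc_gen zc)].
- by rewrite ltnS => kr; rewrite kr; move: kr; rewrite leq_eqVlt => /orP[/eqP ->|kr]; [rewrite ltnn; exact: coordC|rewrite kr; by move=> Sx; apply: (zc_coord zc)].
Qed.

Section Block.
Variables (i : nat) (t : seq N).
Local Notation U := (@upper_central N i).
Local Notation q := (to_quot U).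
Hypothesis t_in : forall x, x \in t -> upper_central i.+1 x.
Hypothesis t_basis : forall x, upper_central i.+1 x ->
  exists! l : 'I_(size t) -> Zp, U ((padic_word l)^-1 * x).

Let nU : normal_subgroup U := upper_central_normal N i.
Let nU' : normal_subgroup (upper_central i.+1) := upper_central_normal N i.+1.

Definition partial_word j (l : nat -> Zp) : N := \prod_(a < j) padic_power (nth 1 t a) (l a).

Lemma block_central x : upper_central i.+1 x -> central (q x).
Proof.
move=> xU a; elim/quot_ind: a => y; apply/commgP/eqP; rewrite -to_quotR; apply/quot1P; [exact: nU|exact: xU].
Qed.

Lemma closed1 : closed [set (1 : N)].
Proof. by apply: accessible_closed_set1; exact/hausdorff_accessible/(ppl_hausdorff ppl). Qed.

Lemma upper_central_closed k : closed (@upper_central N k).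
Proof.
elim: k => [|k IH]; first exact: closed1.
have -> : @upper_central N k.+1 = \bigcap_(y in [set: N]) (fun x => [~ x, y]) @^-1` upper_central k.
  by apply/seteqP; split=> x xU y; [move=> _; exact: xU|exact: xU y I].
apply: closed_bigI => y _; apply: closed_comp => // x _.
rewrite (_ : (fun x => [~ x, y]) = fun x => x^-1 * (y^-1 * (x * y))).
  apply: mulg_cts; first exact: invg_continuous.
  exact: comp_cts (@mulgr_cts _ y) (@mulgl_cts _ y^-1).
by apply/funext => z; rewrite commgEl conjgE.
Qed.

Lemma padic_power_closed (S : set N) x (l : Zp) : closed S -> subgroup S -> S x -> S (padic_power x l).
Proof.
move=> cS [S1 SM _] Sx; apply: (ppl_closed ppl cS) => H pH; have [k xk] := pH.2 x.
exists ((padic_power x l)^-1 * x ^+ `|l k|%N).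
  by apply/(quotE _ _ (p_open_normal pH)); rewrite to_quotX (padic_powerE ppl _ pH xk).
by rewrite mulVKg; elim: `|l k|%N => [//|m IH]; rewrite expgS; exact: SM.
Qed.

Lemma block_power a (l : Zp) : (a < size t)%N -> upper_central i.+1 (padic_power (nth 1 t a) l).
Proof.
move=> at_; apply: (@padic_power_closed (upper_central i.+1)); [exact: upper_central_closed|exact: nU'.1|].
by apply: t_in; exact: mem_nth.
Qed.

Lemma partial_word_in j l : (j <= size t)%N -> upper_central i.+1 (partial_word j l).
Proof.
move=> jt; apply: subgroup_prod => [|a]; first exact: nU'.1.
by apply: block_power; exact: leq_trans (ltn_ord a) jt.
Qed.

Lemma partial_wordD j l m : (j <= size t)%N ->
  q (partial_word j (fun a => (l a + m a)%R)) = q (partial_word j l) * q (partial_word j m).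
Proof.
move=> jt; rewrite !to_quot_prod -central_prodM.
  by apply: eq_bigr => a _; rewrite -to_quotM padic_powerD.
by move=> a; apply: block_central; apply: block_power; exact: leq_trans (ltn_ord a) jt.
Qed.

Lemma partial_word0 j : partial_word j (fun=> 0%R) = 1.
Proof. by rewrite /partial_word big1// => a _; rewrite padic_power0. Qed.

Lemma partial_wordN j l : (j <= size t)%N ->
  q (partial_word j (fun a => (- l a)%R)) = (q (partial_word j l))^-1.
Proof.
move=> jt; apply: (mulgI (q (partial_word j l))); rewrite -partial_wordD// mulgV.
rewrite (_ : (fun a => _) = fun=> 0%R) ?partial_word0 ?to_quot1//.
by apply/funext => a; rewrite subrr.
Qed.

Lemma partial_word_inj l m : q (partial_word (size t) l) = q (partial_word (size t) m) ->
  forall a, (a < size t)%N -> l a = m a.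
Proof.
move=> /(quotE _ _ nU) lm a at_.
have [l0 [_ uniq]] := t_basis (partial_word_in m (leqnn _)).
have e1 := uniq (fun a => l a) lm.
have e2 : l0 = fun a => m a by apply: uniq; rewrite /= -[X in X^-1 * _]/(partial_word _ _) mulVg; have [[]] := nU.
by have := congr1 (fun f => f (Ordinal at_)) (etrans (esym e1) e2).
Qed.

Definition block_level j : set N :=
  [set x | upper_central i.+1 x /\ exists l, q x = q (partial_word j l)].

Lemma block_level0 : block_level 0 = U.
Proof.
apply/seteqP; split=> x.
  by move=> [_ [l]]; rewrite /partial_word big_ord0 to_quot1 => /(quot1P _ nU).
move=> xU; split; first exact: upper_central_sub.
by exists (fun=> 0%R); rewrite partial_word0 to_quot1; apply/quot1P.
Qed.

Lemma block_level_top : block_level (size t) = upper_central i.+1.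
Proof.
apply/seteqP; split=> x; first by case.
move=> xU; split=> //; have [l [lU _]] := t_basis xU.
exists (fun a => if insub a is Some a' then l a' else 0%R).
apply/esym/quotE => //; move: lU; congr (U (_^-1 * _)); apply: eq_bigr => a _.
by rewrite valK.
Qed.

Lemma block_level_normal j : (j <= size t)%N -> normal_subgroup (block_level j).
Proof.
move=> jt; have [[U1 UM UV] UJ] := nU'; split=> [|x y [xU [l xl]]].
  split=> [|x y [xU [l xl]] [yU [m ym]]|x [xU [l xl]]].
  - by split=> //; exists (fun=> 0%R); rewrite partial_word0.
  - split; first exact: UM.
    by exists (fun a => (l a + m a)%R); rewrite to_quotM partial_wordD// xl ym.
  - by split; [exact: UV|exists (fun a => (- l a)%R); rewrite to_quotV partial_wordN// xl].
split; first exact: UJ.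
by exists l; rewrite to_quotJ (central_conj _ (block_central xU)).
Qed.

Lemma block_levelS j x l : (j < size t)%N -> upper_central i.+1 x ->
  q x = q (partial_word j.+1 l) -> block_level j (x * (padic_power (nth 1 t j) (l j))^-1).
Proof.
move=> jt xU xl; have [[U1 UM UV] UJ] := nU'; split.
  by apply: UM => //; apply: UV; exact: block_power.
by exists l; rewrite to_quotM to_quotV xl /partial_word big_ord_recr /= to_quotM mulgK.
Qed.

Lemma block_chain v r S : zp_chain v r S -> S r = U ->
  (forall j, (j < size t)%N -> v (r + j)%N = nth 1 t j) ->
  exists2 S', zp_chain v (r + size t) S' & S' (r + size t)%N = upper_central i.+1.
Proof.
move=> zc Sr vt.
suff H j : (j <= size t)%N -> exists2 S', zp_chain v (r + j) S' & S' (r + j)%N = block_level j.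
  by have [S' zc' SE] := H _ (leqnn _); exists S'; rewrite // SE block_level_top.
elim: j => [_|j IH jt]; first by rewrite addn0; exists S; rewrite // block_level0.
have [S' zc' SE] := IH (ltnW jt).
have nT := block_level_normal jt; have nT' := block_level_normal (ltnW jt).
have [||||S'' zc'' SE'] := zp_chain_extend (C := block_level j.+1) zc' nT.
- move=> x; rewrite SE => -[xU [l xl]]; split=> //.
  exists (fun a => if (a == j)%N then 0%R else l a).
  rewrite xl /partial_word big_ord_recr /= eqxx (padic_power0 _ ppl) mulg1; congr (q _).
  by apply: eq_bigr => a _; rewrite ltn_eqF.
- move=> x y [xU _]; rewrite SE; split; first exact/upper_central_sub/xU.
  by exists (fun=> 0%R); rewrite partial_word0 to_quot1; apply/quot1P => //; exact: xU.
- move=> l; rewrite vt//; split; first exact: block_power.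
  exists (fun a => if (a == j)%N then l else 0%R); rewrite /partial_word big_ord_recr /= eqxx.
  by rewrite big1 ?mul1g// => a _; rewrite ltn_eqF// (padic_power0 _ ppl).
- move=> x [xU [l xl]]; rewrite SE vt//; exists (l j); split; first exact: block_levelS.
  move=> m [_ [l' xl']].
  (* Both expressions of x are completed by zeros to words in the whole block, where the exponents
     are unique. *)
  pose ext (w : nat -> Zp) c a := if (a < j)%N then w a else if (a == j)%N then c else 0%R.
  have extE w c : q (partial_word (size t) (ext w c)) = q (partial_word j w) * q (padic_power (nth 1 t j) c).
    rewrite -to_quotM; congr q; rewrite /partial_word -(subnKC jt) big_split_ord big_ord_recr /=.
    rewrite /ext ltnn eqxx [X in _ * X]big1 ?mulg1.
      by congr (_ * _); apply: eq_bigr => a _; rewrite ltn_ord.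
    by move=> a _; rewrite ltnNge leqW ?leq_addr//= gtn_eqF ?padic_power0// leq_addr.
  have xe : q x = q (partial_word (size t) (ext l (l j))).
    by rewrite extE xl /partial_word big_ord_recr to_quotM.
  have xe' : q x = q (partial_word (size t) (ext l' m)).
    by rewrite extE -xl' to_quotM to_quotV mulgVK.
  have := partial_word_inj (etrans (esym xe) xe') jt.
  by rewrite /ext ltnn eqxx.
- by exists S''; rewrite addnS// SE'.
Qed.

End Block.

Lemma malcev_chain (b : seq (seq N)) : malcev_basis p_pr b ->
  exists2 S, zp_chain (nth 1 (flatten b)) (size (flatten b)) S & S (size (flatten b)) = setT.
Proof.
move=> [UT bP]; rewrite -UT.
suff H i : (i <= size b)%N -> exists2 S, zp_chain (nth 1 (flatten b)) (size (flatten (take i b))) S &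
    S (size (flatten (take i b))) = upper_central i.
  by have := H _ (leqnn _); rewrite take_size.
elim: i => [_|i IH ib].
  by rewrite take0 /=; exists (fun=> [set 1]) => //; split=> // k _; exact: (upper_central_normal N 0).
have [S zc SE] := IH (ltnW ib); have [inU basis] := bP i ib.
have := block_chain inU basis zc SE; rewrite (take_nth [::] ib) -cats1 flatten_cat /= cats0 size_cat; apply=> j jt.
rewrite -{1}(cat_take_drop i b) (drop_nth [::] ib) flatten_cat /= nth_cat ltnNge leq_addr /= addKn.
by rewrite nth_cat jt.
Qed.

End ZpChain.

(** * Left differences and Newton's formula *)

Section LeftDegree.
Variables (G : groupType) (K : comNzRingType) (M : set G).
Hypothesis MM : forall x y : G, M x -> M y -> M (x * y)%g.
Implicit Types f g : G -> K.

Definition dl (y : G) f : G -> K := fun x => f (y * x)%g - f x.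

(** Left differences fit Newton's formula with the power on the left. Restricting points and
    directions to M allows the degree of a coordinate to be bounded along the chain before it is
    known on the whole group. *)
Fixpoint ldeg n f : Prop :=
  if n is n'.+1 then forall y, M y -> ldeg n' (dl y f) else forall x, M x -> f x = 0.

Lemma ldeg_eq n f g : (forall x, M x -> f x = g x) -> ldeg n f -> ldeg n g.
Proof.
elim: n f g => [|n IH] f g fg /=; first by move=> f0 x Mx; rewrite -fg// f0.
move=> fn y My; apply: IH (fn y My) => x Mx; by rewrite /dl !fg//; exact: MM.
Qed.

Lemma ldeg0 n f : (forall x, M x -> f x = 0) -> ldeg n f.
Proof.
elim: n f => [//|n IH] f f0 y My; apply: IH => x Mx.
by rewrite /dl !f0 ?subrr//; exact: MM.
Qed.

Lemma ldegD n a f g : ldeg n f -> ldeg n g -> ldeg n (fun x => a * f x + g x).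
Proof.
elim: n f g => [|n IH] f g fn gn /=; first by move=> x Mx; rewrite fn// gn// mulr0 addr0.
move=> y My; apply: ldeg_eq (IH _ _ (fn y My) (gn y My)) => x _; rewrite /dl; ring.
Qed.

Lemma ldegS n f : ldeg n f -> ldeg n.+1 f.
Proof.
elim: n f => [|n IH] f fn y My; last by apply: IH; exact: fn.
by move=> x Mx; rewrite /dl !fn ?subrr//; exact: MM.
Qed.

Lemma ldeg_le m n f : (m <= n)%N -> ldeg m f -> ldeg n f.
Proof. by move=> /subnKC <-; elim: (n - m)%N => [|k IH]; rewrite ?addn0 ?addnS// => /IH/ldegS. Qed.

Lemma ldegM m n f g : ldeg m f -> ldeg n g -> ldeg (m + n) (fun x => f x * g x).
Proof.
move: {2}(m + n)%N (leqnn (m + n)) => k; elim: k m n f g => [|k IH] m n f g.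
  rewrite leqn0 addn_eq0 => /andP[/eqP-> /eqP->] /= f0 g0 x Mx; by rewrite f0// mul0r.
case: m => [|m]; first by move=> _ f0 _; apply: ldeg0 => x Mx; rewrite f0// mul0r.
case: n => [|n]; first by move=> _ _ g0; apply: ldeg0 => x Mx; rewrite g0// mulr0.
rewrite addSn ltnS => mnk fm gn y My.
have h1 := ldeg_le (leq_add (leqnn m) (leqnSn n)) (IH m n _ _ (leq_trans (leq_add (leqnn m) (leqnSn n)) mnk) (fm y My) (gn y My)).
have h2 := IH m n.+1 _ _ mnk (fm y My) gn.
have h3 : ldeg (m + n.+1) (fun x => f x * dl y g x).
  by rewrite addnS -addSn; apply: IH (gn y My) => //; rewrite addSnnS.
apply: ldeg_eq (ldegD 1 h1 (ldegD 1 h2 h3)) => x _; rewrite /dl; ring.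
Qed.

Lemma ldeg_cst n c : ldeg n.+1 (fun=> c).
Proof. by move=> y My; apply: ldeg0 => x _; rewrite /dl subrr. Qed.

Lemma ldeg_sum n (I : eqType) (s : seq I) (a : I -> K) (f : I -> G -> K) :
  (forall i, i \in s -> ldeg n (f i)) -> ldeg n (fun x => \sum_(i <- s) a i * f i x).
Proof.
elim: s => [|i s IH] fn; first by apply: ldeg0 => x _; rewrite big_nil.
apply: ldeg_eq (ldegD (a i) (fn i (mem_head i s)) (IH _)) => [x _|j js]; first by rewrite big_cons.
by apply: fn; rewrite inE js orbT.
Qed.

Lemma ldeg_dl n f y : M y -> ldeg n f -> ldeg n (dl y f).
Proof.
case: n => [|n] My fn; last exact/ldegS/fn.
by move=> x Mx; rewrite /dl !fn ?subrr//; exact: MM.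
Qed.

Lemma ldeg_iter_dl n f y j : M y -> ldeg n f -> ldeg n (iter j (dl y) f).
Proof. by move=> My fn; elim: j => [|j IH] //=; exact: ldeg_dl. Qed.

(** The difference along y of x to f(m a(x)) comes from the difference of f along m a(y) m^-1. *)
Lemma ldeg_affine n f (m : G) (a : G -> G) : subgroup M -> M m ->
  (forall x y, a (x * y)%g = (a x * a y)%g) -> (forall x, M x -> M (a x)) ->
  ldeg n f -> ldeg n (fun x => f (m * a x)%g).
Proof.
move=> [M1 _ MV] Mm aM Ma; elim: n f => [|n IH] f fn /=.
  by move=> x Mx; apply: fn; apply: MM => //; exact: Ma.
move=> y My; have := IH _ (fn (m * a y * m^-1)%g _).
move=> /(_ (MM (MM Mm (Ma _ My)) (MV _ Mm))); apply: ldeg_eq => x _.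
by rewrite /dl aM !mulgA mulgVK.
Qed.

Lemma ldeg_poly n d f : ldeg n f ->
  exists D, forall P : {poly K}, (size P <= d)%N -> ldeg D (fun x => P.[f x]).
Proof.
move=> fn.
have pow i : ldeg (i * n).+1 (fun x => f x ^+ i).
  elim: i => [|i IH]; first exact: ldeg_cst.
  by rewrite mulSn -addnS; apply: ldeg_eq (ldegM fn IH) => x _; rewrite exprS.
exists (d * n).+1 => P Pd.
apply: ldeg_eq (@ldeg_sum _ _ (enum 'I_d) (fun i => P`_i) (fun i x => f x ^+ i) _) => [x _|i _].
  by rewrite (horner_coef_wide _ Pd) big_enum.
by apply: ldeg_le (pow i); rewrite ltnS leq_mul2r ltnW ?orbT.
Qed.

(** From f(v ^ (m + 1) y) = f(v ^ m y) + (Delta_v f)(v ^ m y), Pascal's rule adds the two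
    expansions. *)
Lemma ldeg_taylor n f (v : G) : M v -> ldeg n f -> forall m y, M y ->
  f (v ^+ m * y)%g = \sum_(j < n) 'C(m, j)%:R * iter j (dl v) f y.
Proof.
move=> Mv; elim: n f => [|n IH] f fn m y My.
  rewrite big_ord0; apply: fn; elim: m => [|m IHm]; first by rewrite expg0 mul1g.
  by rewrite expgS -mulgA; exact: MM.
elim: m => [|m IHm].
  rewrite expg0 mul1g big_ord_recl /= bin0 mul1r big1 ?addr0// => j _.
  by rewrite /= bin_small// mul0r.
have -> : f (v ^+ m.+1 * y)%g = f (v ^+ m * y)%g + dl v f (v ^+ m * y)%g.
  by rewrite /dl addrC subrK expgS mulgA.
rewrite IHm (IH _ (fn v Mv))// big_ord_recl [RHS]big_ord_recl /= !bin0 -addrA; congr (_ + _).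
rewrite -big_split; apply: eq_bigr => j _ /=.
by rewrite -iterSr /= binS natrD mulrDl.
Qed.

End LeftDegree.

Section PadicTaylor.
Variables (p : nat) (p_pr : prime p) (N : topGroupType).
Hypothesis ppl : pro_p_like p N.
Local Notation Zp := (Zp p_pr).
Local Notation K := (Qp p_pr).

Lemma horner_continuous (P : {poly K}) : continuous (fun x : K => P.[x]).
Proof.
elim/poly_ind: P => [|P c IH].
  rewrite (_ : (fun x => _) = fun=> 0); first exact: cst_continuous.
  by apply/funext => x; rewrite horner0.
rewrite (_ : (fun x => _) = fun x => P.[x] * x + c).
  apply: qp_continuousD; last exact: cst_continuous.
  by apply: qp_continuousM => // x; exact: cvg_id.
by apply/funext => x; rewrite hornerMXaddC.
Qed.

(** The natural residues of l converge to l in Z_p and the corresponding powers of x to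
    [padic_power x l]; both sides are continuous. *)
Lemma padic_interpolation (f : N -> K) (P : {poly K}) x y (l : Zp) : continuous f ->
  (forall n, f (x ^+ n * y)%g = P.[n%:R]) -> f (padic_power x l * y)%g = P.[Zp_Qp l].
Proof.
move=> cf fP; apply/eqP; rewrite -subr_eq0; apply/eqP/qp_eq0 => k.
have /qp_continuousP/(_ (padic_power x l) k) : continuous (fun x => f (x * y)%g).
  exact: comp_cts (@mulgr_cts _ y) cf.
move=> /(padic_power_cvg ppl (x := x) (l := l))[n1 _ near1].
have /qp_continuousP/(_ (Zp_Qp l) k)/qp_nbhsP[n2 near2] := @horner_continuous P.
have := near1 (maxn n1 n2) (leq_maxl _ _); rewrite /= fP => fl.
have Pl := near2 (`|l (maxn n1 n2)|%N%:R).
have /Pl : pid n2 (`|l (maxn n1 n2)|%N%:R - Zp_Qp l).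
  apply: (pid_le (leq_maxr n1 n2)); rewrite -(rmorph_nat (@Zp_Qp p p_pr)) pidBE.
  exact: zp_natr.
move=> /= Pl'; have := pidB Pl' fl; congr pid; ring.
Qed.

Local Notation binp := (@binp K).

Lemma padic_taylor (M : set N) (f : N -> K) d (v : N) (l : Zp) y :
  (forall x y : N, M x -> M y -> M (x * y)%g) -> continuous f -> ldeg M d f -> M v -> M y ->
  f (padic_power v l * y)%g = \sum_(j <- iota 0 d) (binp j).[Zp_Qp l] * iter j (dl v) f y.
Proof.
move=> MM cf fd Mv My.
rewrite (padic_interpolation (P := \sum_(j < d) iter j (dl v) f y *: binp j) l cf).
  rewrite horner_sum -[d in iota 0 d]subn0 -/(index_iota 0 d) big_mkord.
  by apply: eq_bigr => j _; rewrite hornerZ mulrC.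
move=> n; rewrite (ldeg_taylor MM Mv fd)// horner_sum; apply: eq_bigr => j _.
by rewrite hornerZ (binpE (qp_natr_eq0 p_pr)) mulrC.
Qed.

Variable v : nat -> N.

Definition vword a n (l : nat -> Zp) : N := (\prod_(a <= i < n) padic_power (v i) (l i))%g.

Fixpoint multi_exps d n : seq (seq nat) :=
  if n is n'.+1 then [seq j :: J | j <- iota 0 d, J <- multi_exps d n'] else [:: [::]].

Fixpoint multi_bin a (J : seq nat) (t : nat -> K) : K :=
  if J is j :: J' then (binp j).[t a] * multi_bin a.+1 J' t else 1.

Fixpoint multi_dl a (J : seq nat) (f : N -> K) : N -> K :=
  if J is j :: J' then multi_dl a.+1 J' (iter j (dl (v a)) f) else f.

Lemma dl_continuous y (f : N -> K) : continuous f -> continuous (dl y f).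
Proof.
move=> cf; rewrite /dl (_ : (fun x => _) = fun x => f (y * x)%g + (-1) * f x).
  apply: qp_continuousD; first exact: comp_cts (@mulgl_cts _ y) cf.
  by apply: qp_continuousM => //; exact: cst_continuous.
by apply/funext => x; rewrite mulN1r.
Qed.

Lemma iter_dl_continuous y (f : N -> K) j : continuous f -> continuous (iter j (dl y) f).
Proof. by move=> cf; elim: j => [|j IH] //=; exact: dl_continuous. Qed.

Lemma multi_dl_continuous a J f : continuous f -> continuous (multi_dl a J f).
Proof.
by elim: J a f => [//|j J IH] a f cf /=; apply: IH; exact: iter_dl_continuous.
Qed.

Lemma multi_dl_ldeg (M : set N) d a J f : (forall x y : N, M x -> M y -> M (x * y)%g) ->
  (forall i, (a <= i < a + size J)%N -> M (v i)) -> ldeg M d f -> ldeg M d (multi_dl a J f).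
Proof.
move=> MM; elim: J a f => [//|j J IH] a f Mv fd /=; apply: IH => [i /andP[ai iJ]|].
  by apply: Mv; rewrite ltnW//= addnS -addSn.
by apply: ldeg_iter_dl => //; apply: Mv; rewrite leqnn /= addnS ltnS leq_addr.
Qed.

Lemma vword_in (M : set N) a n (l : nat -> Zp) y : (forall x y : N, M x -> M y -> M (x * y)%g) ->
  (forall i m, (a <= i < a + n)%N -> M (padic_power (v i) (m : Zp))) ->
  M y -> M (vword a (a + n) l * y)%g.
Proof.
move=> MM Mv My; elim: n a Mv => [|n IH] a Mv; first by rewrite addn0 /vword big_geq// mul1g.
rewrite /vword big_ltn ?addnS ?ltnS ?leq_addr// -addSn -mulgA; apply: MM.
  by apply: Mv; rewrite leqnn addnS ltnS leq_addr.
by apply: IH => i m /andP[ai ian]; apply: Mv; rewrite ltnW//= addnS -addSn.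
Qed.

(** One exponent is expanded after the other. The entries of a multi-index stay < d because d
    differences along M kill f. *)
Lemma multi_taylor (M : set N) d n a (f : N -> K) (l : nat -> Zp) y :
  (forall x y : N, M x -> M y -> M (x * y)%g) ->
  (forall i m, (a <= i < a + n)%N -> M (padic_power (v i) (m : Zp))) ->
  continuous f -> ldeg M d f -> M y ->
  f (vword a (a + n) l * y)%g =
  \sum_(J <- multi_exps d n) multi_bin a J (fun i => Zp_Qp (l i)) * multi_dl a J f y.
Proof.
move=> MM; elim: n a f => [|n IH] a f Mv cf fd My.
  by rewrite addn0 /vword big_geq// big_seq1 /= mul1g mul1r.
have Mva m : M (padic_power (v a) (m : Zp)) by apply: Mv; rewrite leqnn addnS ltnS leq_addr.
have Mv1 : M (v a) by have := Mva 1; rewrite (padic_power_nat p_pr ppl _ 1).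
have Mv' i m : (a.+1 <= i < a.+1 + n)%N -> M (padic_power (v i) (m : Zp)).
  by move=> /andP[ai ian]; apply: Mv; rewrite ltnW//= addnS -addSn.
rewrite /vword big_ltn ?addnS ?ltnS ?leq_addr// -addSn -mulgA.
rewrite (padic_taylor _ MM cf fd Mv1); last exact: vword_in.
rewrite big_allpairs_dep; apply: eq_bigr => j _.
rewrite (IH a.+1)//; [|exact: iter_dl_continuous|exact: ldeg_iter_dl].
by rewrite mulr_sumr; apply: eq_bigr => J _ /=; rewrite mulrA.
Qed.

End PadicTaylor.

Lemma ldeg_deg_lt (G : groupType) (K : comNzRingType) n (f : G -> K) :
  ldeg setT n f -> deg_lt n f.
Proof.
have inv m g : ldeg setT m g -> deg_lt m (fun x : G => g x^-1%g).
  elim: m g => [|m IH] g; first by move=> g0 x; exact: g0.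
  move=> gm y; have := IH _ (gm y^-1%g I); congr deg_lt; apply/funext => x.
  by rewrite /dl invgM.
move=> /inv/deg_lt_inv; congr deg_lt; apply/funext => x; by rewrite invgK.
Qed.

Lemma deg_lt_ldeg (G : groupType) (K : comNzRingType) n (f : G -> K) :
  deg_lt n f -> ldeg setT n f.
Proof.
elim: n f => [|n IH] f fn; first by move=> x _; exact: fn.
by move=> y _; apply: IH; exact: deg_lt_leftB.
Qed.

(** * Polynomiality of Mal'cev coordinates *)

Section Coordinates.
Variables (p : nat) (p_pr : prime p) (N : topGroupType).
Hypothesis ppl : pro_p_like p N.
Local Notation Zp := (Zp p_pr).
Local Notation K := (Qp p_pr).
Variables (v : nat -> N) (r : nat) (S : nat -> set N).
Hypothesis zc : zp_chain p_pr v r S.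
Hypothesis ST : S r = setT.
Local Open Scope group_scope.
Local Notation W := (vword v).

Lemma zc_le k m : (k <= m <= r)%N -> S k `<=` S m.
Proof.
move=> /andP[/subnKC <-]; elim: (m - k)%N => [|j IH]; first by rewrite addn0 => _ x.
rewrite addnS => kj; apply: subset_trans (IH (ltnW kj)) _; exact: (zc_sub zc).
Qed.

Lemma zc_normal_lt k : (k < r)%N -> normal_subgroup (S k) /\ normal_subgroup (S k.+1).
Proof. by move=> kr; split; apply: (zc_normal zc) => //; exact: ltnW. Qed.

Lemma vwordS m (l : nat -> Zp) : W 0 m.+1 l = W 0 m l * padic_power (v m) (l m).
Proof. by rewrite /vword big_nat_recr. Qed.

Lemma vword_eq a m (l l' : nat -> Zp) : (forall i, (a <= i < m)%N -> l i = l' i) -> W a m l = W a m l'.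
Proof. by move=> ll; apply: eq_big_nat => i im; rewrite ll. Qed.

Lemma vword_cat k m (l : nat -> Zp) : (k <= m)%N -> W 0 m l = W 0 k l * W k m l.
Proof. by move=> km; rewrite /vword (big_cat_nat (leq0n k) km). Qed.

Lemma vword_mem m (l : nat -> Zp) : (m <= r)%N -> S m (W 0 m l).
Proof.
elim: m => [|m IH] mr; first by rewrite /vword big_geq// (zc_bot zc).
have [nm [[_ SM _] _]] := zc_normal_lt mr.
by rewrite vwordS; apply: SM; [apply: (zc_sub zc) => //; exact/IH/ltnW|exact: (zc_gen zc)].
Qed.

Lemma vword_ex m x : (m <= r)%N -> S m x -> exists l : nat -> Zp, x = W 0 m l.
Proof.
elim: m x => [|m IH] x mr Sx.
  by exists (fun=> 0%R); move: Sx; rewrite /vword big_geq// (zc_bot zc).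
have [a [Sa _]] := zc_coord zc mr Sx; have [l lE] := IH _ (ltnW mr) Sa.
exists (fun i => if (i == m)%N then a else l i); rewrite vwordS eqxx.
rewrite (vword_eq (l' := l)) -?lE ?mulgVK// => i /andP[_ im]; by rewrite ltn_eqF.
Qed.

Lemma vword_inj m (l l' : nat -> Zp) : (m <= r)%N -> W 0 m l = W 0 m l' -> forall k, (k < m)%N -> l k = l' k.
Proof.
elim: m => [//|m IH] mr ll.
have [a [Sa uniq]] := zc_coord zc mr (vword_mem l mr).
have e1 : a = l m by apply: uniq; rewrite vwordS mulgK; apply: vword_mem; exact: ltnW.
have e2 : a = l' m by apply: uniq; rewrite ll vwordS mulgK; apply: vword_mem; exact: ltnW.
move=> k; rewrite ltnS leq_eqVlt => /orP[/eqP ->|km]; first by rewrite -e1.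
apply: IH => //; first exact: ltnW.
by apply: (mulIg (padic_power (v m) (l m))); rewrite -vwordS ll vwordS -e1 -e2.
Qed.

Variable c : N -> nat -> Zp.
Hypothesis cP : forall x, x = W 0 r (c x).

Lemma coord_vword (l : nat -> Zp) k : (k < r)%N -> c (W 0 r l) k = l k.
Proof. by move=> kr; apply: (vword_inj (leqnn r) (esym (cP _)) kr). Qed.

Lemma vword_trunc m (l : nat -> Zp) : (m <= r)%N -> W 0 m l = W 0 r (fun i => if (i < m)%N then l i else 0%R).
Proof.
move=> mr; rewrite [RHS](vword_cat _ mr) [X in _ * X]big_nat_cond [X in _ * X]big1 ?mulg1.
  by apply: vword_eq => i /andP[_ ->].
by move=> i /andP[/andP[mi _] _]; rewrite ltnNge mi padic_power0.
Qed.

Lemma coord_high m x k : S m x -> (m <= k < r)%N -> c x k = 0%R.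
Proof.
move=> Sx /andP[mk kr]; have mr := leq_trans mk (ltnW kr).
have [l ->] := vword_ex mr Sx; by rewrite vword_trunc// coord_vword// ltnNge mk.
Qed.

Lemma coord_mem m x : (m <= r)%N -> S m x -> x = W 0 m (c x).
Proof.
move=> mr Sx; rewrite {1}[x]cP (vword_cat _ mr) [X in _ * X]big_nat_cond [X in _ * X]big1 ?mulg1//.
by move=> i /andP[im _]; rewrite (coord_high Sx)// padic_power0.
Qed.

Lemma coord_eq k x (l : Zp) : (k < r)%N -> S k.+1 x -> S k (x * (padic_power (v k) l)^-1) -> c x k = l.
Proof.
move=> kr Sx Sxl; have [a [_ uniq]] := zc_coord zc kr Sx.
rewrite -(uniq _ Sxl); apply/esym/uniq; rewrite {1}(coord_mem kr Sx) vwordS mulgK.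
by apply: vword_mem; exact: ltnW.
Qed.

Lemma coord_div k x : (k < r)%N -> S k.+1 x -> S k (x * (padic_power (v k) (c x k))^-1).
Proof.
move=> kr Sx; rewrite {1}(coord_mem kr Sx) vwordS mulgK.
by apply: vword_mem; exact: ltnW.
Qed.

Lemma coord_congr k x w : (k < r)%N -> S k.+1 x -> S k w -> c (x * w) k = c x k.
Proof.
move=> kr Sx Sw; have [[[_ SM SV] SJ] [[_ SM' _] _]] := zc_normal_lt kr.
apply: coord_eq => //; first by apply: SM' => //; exact: (zc_sub zc).
have := SM _ _ (coord_div kr Sx) (SJ _ (padic_power (v k) (c x k))^-1 Sw).
by congr (S k); rewrite conjgE invgK !mulgA mulgVK.
Qed.

Lemma coord_conj k x y : (k < r)%N -> S k.+1 x -> c (x ^ y) k = c x k.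
Proof.
move=> kr Sx; have -> : x ^ y = x * [~ x, y] by rewrite commgEl mulVKg.
by apply: coord_congr => //; exact: (zc_comm zc).
Qed.

Lemma coord_in_add k x z : (k < r)%N -> S k.+1 x -> S k.+1 z -> c (x * z) k = (c x k + c z k)%R.
Proof.
move=> kr Sx Sz; have [[[_ SM SV] SJ] [[_ SM' _] _]] := zc_normal_lt kr.
apply: coord_eq => //; first exact: SM'.
have := SM _ _ (coord_div kr Sx) (SJ _ (padic_power (v k) (c x k))^-1 (coord_div kr Sz)).
by congr (S k); rewrite padic_powerD// conjgE invgK invgM !mulgA mulgVK.
Qed.

(** Write x = A R with A in S k.+1 and R a word in the later generators. Then x z = A z' R with z'
    conjugate to z; conjugation preserves the k-th coordinate, which is additive on S k.+1. *)
Lemma coord_add k x z : (k < r)%N -> S k.+1 z -> c (x * z) k = (c x k + c z k)%R.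
Proof.
move=> kr Sz; have [_ [[_ SM' _] SJ']] := zc_normal_lt kr.
set R := W k.+1 r (c x); set A := W 0 k.+1 (c x).
have xE : x = A * R by rewrite {1}[x]cP (vword_cat _ kr).
have SA : S k.+1 A by exact: vword_mem.
pose z' := z ^ R^-1; have Sz' : S k.+1 z' by exact: SJ'.
have xz : x * z = A * z' * R by rewrite {1}xE /z' conjgE invgK !mulgA mulgVK.
have -> : c (x * z) k = c (A * z') k.
  rewrite xz {1}(coord_mem kr (SM' _ _ SA Sz')).
  set y := A * z'; have -> : W 0 k.+1 (c y) * R = W 0 r (fun i => if (i < k.+1)%N then c y i else c x i).
    rewrite [RHS](vword_cat _ kr); congr (_ * _); apply: vword_eq => i; first by case/andP=> _ ->.
    by case/andP; rewrite ltnNge => ki _; rewrite ltnS (negbTE ki).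
  by rewrite coord_vword// ltnSn.
rewrite coord_in_add// coord_conj//; congr (_ + _)%R.
by rewrite /A vword_trunc// coord_vword// ltnSn.
Qed.

(** Along an ultrafilter converging to x the coordinates have limits in Z_p; modulo every p-open H
    the word in these limits is x, so they are the coordinates of x. *)
Lemma coord_continuous k : (k < r)%N -> continuous (fun x => Zp_Qp (c x k) : K).
Proof.
move=> kr x; apply: ultra_continuous => F UF Fx.
have [z zP] := zp_ultra_all UF (fun x (i : 'I_r) => c x i).
pose l i := if insub i is Some i' then z i' else 0%R.
have xz : x = W 0 r l.
  apply: (ppl_eq ppl) => H pH.
  have /choice[m mP] : forall i : nat, exists m, forall a a' : Zp, a m = a' m ->
      to_quot H (padic_power (v i) a) = to_quot H (padic_power (v i) a').
    by move=> i; exact: padic_power_eq.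
  pose M := (\max_(i < r) m i)%N.
  have [y [Hy zy]] := filter_ex (filterI (Fx _ (p_open_nbhs x pH)) (zP M)).
  transitivity (to_quot H y); first by apply/(quotE _ _ (p_open_normal pH)).
  rewrite {1}[y]cP /vword !big_mkord !to_quot_prod; apply: eq_bigr => i _.
  apply: mP; rewrite /l valK; have iM : (m i <= M)%N by apply: (leq_bigmax i).
  by apply: (zp_coord_le (k := (M - m i)%N)); rewrite subnKC.
move=> A /qp_nbhsP[n nA]; refine (@filterS _ F _ _ _ _ (zP n)) => y yn.
apply: nA; apply/pidBE.
by rewrite (yn (Ordinal kr)) {1}xz coord_vword// /l insubT.
Qed.

Lemma zc_power m i (l : Zp) : (m <= r)%N -> (i < m)%N -> S m (padic_power (v i) l).
Proof.
by move=> mr im; apply: (zc_le (k := i.+1)); [rewrite im|apply: (zc_gen zc); exact: leq_trans mr].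
Qed.

Local Notation cK k := (fun x => Zp_Qp (c x k) : K).

Lemma multi_bin_ldeg (M : set N) n d : (forall x y : N, M x -> M y -> M (x * y)) ->
  forall a, (forall i, (a <= i < a + n)%N -> exists e, ldeg M e (cK i)) ->
  exists D, forall J, J \in multi_exps d n -> ldeg M D (fun x => multi_bin a J (fun i => Zp_Qp (c x i))).
Proof.
move=> MM; elim: n => [|n IH] a ae.
  by exists 1%N => J; rewrite inE => /eqP ->; exact: ldeg_cst.
have [e /(ldeg_poly MM d.+1)[D1 D1P]] : exists e, ldeg M e (cK a).
  by apply: ae; rewrite leqnn addnS ltnS leq_addr.
have [|D2 D2P] := IH a.+1.
  by move=> i /andP[ai ian]; apply: ae; rewrite ltnW//= addnS -addSn.
exists (D1 + D2)%N => _ /allpairsP[[j J] [/= jd JJ ->]]; apply: ldegM => //; last exact: D2P.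
apply: D1P; apply: leq_trans (binp_size _ _) _; move: jd; rewrite mem_iota add0n => /ltnW jd.
by rewrite ltnS.
Qed.

(* Left translation by y changes c_k on S_(m+1) = S_m . <v_m> by a function which only
   depends on the coordinates above k, polynomially and with bounded degree. *)
Lemma coord_step m : (m < r)%N -> (forall k, (k < m)%N -> exists e, ldeg (S m) e (cK k)) ->
  forall k, (k < m.+1)%N -> exists e, ldeg (S m.+1) e (cK k).
Proof.
move=> mr IH; have [[[S1 SM SV] SJ] [[S1' SM' SV'] _]] := zc_normal_lt mr.
have mr' := ltnW mr.
have split_x x : S m.+1 x -> exists x', [/\ S m x', x = x' * padic_power (v m) (c x m) &
    forall k, (k < m)%N -> c x k = c x' k].
  move=> Sx; exists (W 0 m (c x)); split; first exact: vword_mem.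
    by rewrite -vwordS; exact: coord_mem.
  by move=> k km; rewrite vword_trunc// coord_vword ?km//; exact: ltn_trans mr.
have top : ldeg (S m.+1) 2 (cK m).
  move=> y Sy z Sz x Sx; rewrite /dl !coord_in_add//; last exact: SM'.
  by rewrite !rmorphD; ring.
(* Descending induction on k: the change of c_k is expanded in the coordinates between k and m,
   whose degrees must be known first. *)
suff H j : (j <= m)%N -> forall k, (m - j <= k <= m)%N -> exists e, ldeg (S m.+1) e (cK k).
  by move=> k; rewrite ltnS => km; apply: (H m) => //; rewrite subnn.
elim: j => [_ k|j IHj jm k /andP[jk km]].
  by rewrite subn0 -eqn_leq => /eqP <-; exists 2%N.
have [mjk|kmj] := leqP (m - j) k; first by apply: IHj; [exact: ltnW|rewrite mjk].
have kE : (k + j.+1 = m)%N by lia.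
have km' : (k < m)%N by lia.
have kr : (k < r)%N by exact: ltn_trans mr.
have [d kd] := IH k km'.
have [|D DP] := @multi_bin_ldeg (S m.+1) j d SM' k.+1.
  by move=> i ij; apply: IHj; lia.
exists D.+1 => y Sy; have [m' [Sm' yE _]] := split_x y Sy.
set g := padic_power (v m) (c y m) in yE.
(* With y = m' g and x = x' g', the product y x is m' (x' ^ g^-1) g g', so f(x') is the difference
   of c_k along y at x. *)
pose f (x : N) : K := Zp_Qp (c (m' * x ^ g^-1) k) - Zp_Qp (c x k).
have fd : ldeg (S m) d f.
  have h : ldeg (S m) d (fun x => cK k (m' * x ^ g^-1)).
    by apply: (ldeg_affine SM) kd => // [u w|u Su]; [exact: conjMg|exact: SJ].
  by apply: (ldeg_eq SM) (ldegD SM (-1) kd h) => x _; rewrite /f; ring.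
have cf : continuous f.
  rewrite (_ : f = fun x => (cK k (m' * x ^ g^-1)%g + (-1) * cK k x)%R); last first.
    by apply/funext => x; rewrite /f mulN1r.
  apply: qp_continuousD.
    apply: comp_cts (coord_continuous kr); rewrite (_ : (fun x => _) = fun x => m' * (g * (x * g^-1))).
      apply: comp_cts (@mulgl_cts _ m'); apply: comp_cts (@mulgl_cts _ g); exact: mulgr_cts.
    by apply/funext => x; rewrite conjgE invgK.
  by apply: qp_continuousM (coord_continuous kr); exact: cst_continuous.
(* Multiplying x by z in S k.+1 changes both terms by c_k(z), since conjugation preserves c_k
   there. *)
have finv z x : S k.+1 z -> f (z * x) = f x.
  move=> Sz; have [_ [_ SJ']] := zc_normal_lt kr.
  have Szx : S k.+1 (z ^ x) by exact: SJ'.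
  have e1 : c (x * z ^ x) k = (c x k + c z k)%R by rewrite coord_add// coord_conj.
  have e2 : c (m' * (x * z ^ x) ^ g^-1) k = (c (m' * x ^ g^-1)%g k + c z k)%R.
    by rewrite conjMg mulgA (coord_add _ kr (SJ' _ _ Szx)) (coord_conj _ kr Szx) (coord_conj _ kr Sz).
  by rewrite conjgC /f e1 e2 !rmorphD; ring.
(* Only the Taylor coefficients at 1 depend on y; the binomial factors do not, so D is uniform in
   y. *)
apply: (ldeg_eq SM') (@ldeg_sum _ _ _ SM' D _ (multi_exps d j)
    (fun J => multi_dl v k.+1 J f 1) (fun J x => multi_bin k.+1 J (fun i => Zp_Qp (c x i))) _) => [x Sx|J JJ]; last exact: DP.
have [x' [Sx' xE cx]] := split_x x Sx.
have -> : dl y (cK k) x = f x'.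
  rewrite /dl /f (cx k km'); congr (Zp_Qp _ - _)%R.
  have Sw : S m (m' * x' ^ g^-1) by apply: SM => //; exact: SJ.
  have -> : y * x = m' * x' ^ g^-1 * padic_power (v m) (c y m + c x m)%R.
    by rewrite {1}yE {1}xE padic_powerD// -/g conjgE invgK !mulgA mulgVK.
  rewrite {1}(coord_mem mr' Sw); set w := m' * _.
  have -> : W 0 m (c w) * padic_power (v m) (c y m + c x m)%R =
      W 0 m.+1 (fun i => if (i == m)%N then (c y m + c x m)%R else c w i).
    rewrite vwordS eqxx; congr (_ * _); apply: vword_eq => i /andP[_ im]; by rewrite ltn_eqF.
  by rewrite vword_trunc// coord_vword// ltnS km ltn_eqF.
rewrite {1}(coord_mem mr' Sx') (vword_cat _ km') finv; last exact: vword_mem.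
have -> : W k.+1 m (c x') = W k.+1 (k.+1 + j) (c x') by congr (vword _ _ _ _); lia.
rewrite -[W _ _ _]mulg1 (multi_taylor ppl _ SM _ cf fd S1); last first.
  by move=> i a im; apply: zc_power => //; lia.
apply: eq_big_seq => J JJ; rewrite mulrC; congr (_ * _)%R.
have : (k.+1 + size J <= m)%N.
  have -> : size J = j; last by lia.
  elim: (j) J JJ => [|i IHi] J; first by rewrite inE => /eqP ->.
  by move=> /allpairsP[[a J'] [_ /= /IHi <- ->]].
elim: J (k.+1) {JJ} => [//|a J IHJ] i /= im; rewrite IHJ; last by rewrite addSnnS.
by rewrite cx//; apply: leq_trans im; rewrite addnS ltnS leq_addr.
Qed.

Lemma coord_polynomial k : (k < r)%N -> exists n, deg_lt n (cK k).
Proof.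
move=> kr; have H m : (m <= r)%N -> forall k, (k < m)%N -> exists e, ldeg (S m) e (cK k).
  by elim: m => [//|m IH] mr; apply: coord_step => //; exact/IH/ltnW.
have [n kn] := H r (leqnn r) k kr; exists n.
by apply: ldeg_deg_lt; move: kn; rewrite ST.
Qed.

End Coordinates.

Section PolynomialMaps.
Import mpoly.
Variable k : fieldType.
Local Notation pe x q := (mmap (in_alg _) x q).

Lemma mmap_hom (R S : comAlgType k) (h : {lrmorphism R -> S}) n (x : 'I_n -> R) (q : mpoly n k) :
  h (pe x q) = pe (fun i => h (x i)) q.
Proof.
rewrite /mmap /mmap1 rmorph_sum; apply: eq_bigr => m _.
rewrite rmorphM rmorph_prod; congr (_ * _).
  by change (h (q@_m *: 1) = q@_m *: 1); rewrite linearZ rmorph1.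
by apply: eq_bigr => i _; rewrite rmorphXn.
Qed.

Section Eval.
Variables (R : comAlgType k) (n : nat) (x : 'I_n -> R).
Definition mmap_at (q : mpoly n k) : R := pe x q.
Lemma mmap_at_linear : linear mmap_at.
Proof. by move=> c a b; rewrite /mmap_at mmapD mmapZ /= -scalerAl mul1r. Qed.
Lemma mmap_at_monoid : monoid_morphism mmap_at.
Proof.
by have [mM m1] := mmap_is_multiplicative x (in_alg R); split=> // a b; exact: mM.
Qed.
Definition mmap_lr : {lrmorphism mpoly n k -> R} :=
  HB.pack mmap_at (GRing.isLinear.Build _ _ _ _ mmap_at mmap_at_linear)
    (GRing.isMonoidMorphism.Build _ _ mmap_at mmap_at_monoid).

Lemma mmap_linearP c (q q' : mpoly n k) : pe x (c *: q + q') = c *: (pe x q : R) + pe x q'.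
Proof. exact: (linearP mmap_lr c q q'). Qed.

Lemma mmap_mul (q q' : mpoly n k) : pe x (q * q') = (pe x q : R) * pe x q'.
Proof. exact: (rmorphM mmap_lr). Qed.

Lemma mmap_one : pe x (1 : mpoly n k) = 1 :> R.
Proof. exact: (rmorph1 mmap_lr). Qed.

Lemma mmap_var i : pe x 'X_i = x i.
Proof. by rewrite mmapX mmap1U. Qed.
End Eval.

Lemma mmap_join (R : comAlgType k) n (x y : 'I_n -> R) (q : mpoly (n + n) k) :
  pe (join_args x y) q =
  \sum_(m <- msupp q) (q@_m *: \prod_j x j ^+ m (lshift n j)) * \prod_j y j ^+ m (rshift n j).
Proof.
rewrite /mmap; apply: eq_bigr => m _; rewrite -!scalerAl mul1r; congr (_ *: _).
rewrite /mmap1 big_split_ord; congr (_ * _); apply: eq_bigr => j _.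
  by rewrite /join_args (unsplitK (inl j)).
by rewrite /join_args (unsplitK (inr j)).
Qed.

Definition mpoly_fun n (phi : ('I_n -> k) -> k) :=
  exists q : mpoly n k, forall t : 'I_n -> k^o, pe t q = phi t.

Lemma mpoly_fun_eq n (phi psi : ('I_n -> k) -> k) :
  (forall t, phi t = psi t) -> mpoly_fun phi -> mpoly_fun psi.
Proof. by move=> pp [q qP]; exists q => t; rewrite qP. Qed.

Lemma mpoly_fun_cst n c : @mpoly_fun n (fun=> c).
Proof. exists (c%:MP) => t; rewrite mmapC; exact: mulr1. Qed.

Lemma mpoly_fun_var n i : @mpoly_fun n (fun t => t i).
Proof. by exists 'X_i => t; exact: mmap_var. Qed.

Lemma mpoly_funD n (phi psi : ('I_n -> k) -> k) : mpoly_fun phi -> mpoly_fun psi ->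
  mpoly_fun (fun t => phi t + psi t).
Proof. by move=> [a aP] [b bP]; exists (a + b) => t; rewrite mmapD aP bP. Qed.

Lemma mpoly_funM n (phi psi : ('I_n -> k) -> k) : mpoly_fun phi -> mpoly_fun psi ->
  mpoly_fun (fun t => phi t * psi t).
Proof.
move=> [a aP] [b bP]; exists (a * b) => t; have [_ mM] := mmap_at_monoid (R := k^o) t.
by have := mM a b; rewrite /mmap_at aP bP.
Qed.

Lemma mpoly_fun_sum n (I : Type) (s : seq I) (phi : I -> ('I_n -> k) -> k) :
  (forall i, mpoly_fun (phi i)) -> mpoly_fun (fun t => \sum_(i <- s) phi i t).
Proof.
move=> pP; elim: s => [|i s IH].
  by apply: mpoly_fun_eq (mpoly_fun_cst n 0) => t; rewrite big_nil.
by apply: mpoly_fun_eq (mpoly_funD (pP i) IH) => t; rewrite big_cons.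
Qed.

Lemma mpoly_fun_horner n (P : {poly k}) (phi : ('I_n -> k) -> k) :
  mpoly_fun phi -> mpoly_fun (fun t => P.[phi t]).
Proof.
move=> pP; elim/poly_ind: P => [|P c IH].
  by apply: mpoly_fun_eq (mpoly_fun_cst n 0) => t; rewrite horner0.
by apply: mpoly_fun_eq (mpoly_funD (mpoly_funM IH pP) (mpoly_fun_cst n c)) => t; rewrite hornerMXaddC.
Qed.

Lemma mpoly_fun_sub m n (s : 'I_m -> 'I_n) (phi : ('I_m -> k) -> k) :
  mpoly_fun phi -> mpoly_fun (fun t => phi (fun i => t (s i))).
Proof.
move=> [q qP]; exists (pe (fun i => 'X_(s i) : mpoly n k) q) => t.
rewrite -(qP (fun i => t (s i))).
apply: etrans (mmap_hom (mmap_lr (R := k^o) t) (fun i => 'X_(s i) : mpoly n k) q) _.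
by congr (mmap _ _ q); apply/funext => i; exact: (@mmap_var k^o).
Qed.

Lemma digits_inj d n (a b : nat -> nat) : (forall i, (a i < d)%N) -> (forall i, (b i < d)%N) ->
  (\sum_(i < n) a i * d ^ i = \sum_(i < n) b i * d ^ i)%N -> forall i, (i < n)%N -> a i = b i.
Proof.
elim: n a b => [//|n IH] a b ad bd.
have d0 : (0 < d)%N by apply: leq_ltn_trans (ad 0%N).
have shift (c : nat -> nat) : (\sum_(i < n.+1) c i * d ^ i = c 0 + (\sum_(i < n) c i.+1 * d ^ i) * d)%N.
  rewrite big_ord_recl expn0 muln1 big_distrl; congr (_ + _)%N.
  by apply: eq_bigr => i _; rewrite /= /bump leq0n add1n expnSr mulnA.
rewrite !shift => e; have e0 : a 0%N = b 0%N.
  have := congr1 (modn^~ d) e; rewrite (addnC (a 0%N)) (addnC (b 0%N)) !modnMDl.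
  by rewrite !modn_small.
case=> [//|i]; rewrite ltnS; apply: (IH (fun i => a i.+1) (fun i => b i.+1)) => //.
by move: e; rewrite e0 => /addnI/eqP; rewrite eqn_pmul2r// => /eqP.
Qed.

(* Kronecker's substitution X_i = u ^ (d ^ i) reduces to one variable. *)
Lemma mpoly_nat_eq0 n (q : mpoly n k) : (forall j, ((j%:R : k) == 0) = (j == 0)%N) ->
  (forall t : 'I_n -> nat, pe (fun i => (t i)%:R : k^o) q = 0) -> q = 0.
Proof.
move=> ch0 q0; apply/mpolyP => m0; rewrite mcoeff0.
have [m0q|/memN_msupp_eq0//] := boolP (m0 \in msupp q).
pose d := (\max_(m <- msupp q) \max_(i < n) m i).+1.
have md m i : m \in msupp q -> (m i < d)%N.
  move=> mq; rewrite ltnS; apply: leq_trans (leq_bigmax_seq (F := fun m : 'X_{1..n} => \max_(i < n) m i) m mq isT).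
  exact: (leq_bigmax i).
pose kr (m : 'X_{1..n}) := (\sum_(i < n) m i * d ^ i)%N.
have krI m m' : m \in msupp q -> m' \in msupp q -> kr m = kr m' -> m = m'.
  move=> mq mq' e; pose ext (m : 'X_{1..n}) i := if insub i is Some i' then m i' else 0%N.
  have extE (u : 'X_{1..n}) (i : 'I_n) : ext u i = u i by rewrite /ext valK.
  have extd u i : u \in msupp q -> (ext u i < d)%N.
    by move=> uq; rewrite /ext; case: insub => // i'; exact: md.
  apply/mnmP => i; rewrite -!extE; apply: (@digits_inj d n (ext m) (ext m')) => // [j|j|].
  - exact: extd.
  - exact: extd.
  - by move: e; rewrite /kr => e; apply: etrans (etrans _ e) _; apply: eq_bigr => j _; rewrite extE.
pose P : {poly k} := \sum_(m <- msupp q) q@_m *: 'X^(kr m).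
have P0 : P = 0.
  apply: (poly_nat_eq ch0) => u; rewrite horner0 -[RHS](q0 (fun i => (u ^ d ^ i)%N)).
  rewrite /P horner_sum /mmap; apply: eq_bigr => m _; rewrite hornerZ hornerXn /=.
  congr (_ * _); first exact/esym/mulr1.
  rewrite /mmap1 /kr -prodrXr; apply: eq_bigr => i _.
  by rewrite natrX -exprM mulnC.
have := congr1 (fun P : {poly k} => P`_(kr m0)) P0; rewrite coef0 /P coef_sum.
rewrite (bigD1_seq m0)//= coefZ coefXn eqxx mulr1 big_seq_cond big1 ?addr0// => m /andP[mq mm0].
by rewrite coefZ coefXn; case: eqP => [e|]; rewrite ?mulr0//; move: mm0; rewrite (krI _ _ m0q mq e) eqxx.
Qed.

End PolynomialMaps.

(** In the group ring, w - 1 lies in the power m + 1 of the augmentation ideal; indices of the lower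
    central series are shifted by one. *)
Lemma deg_lt_lower_central (G : topGroupType) (K : comNzRingType) m n (f : G -> K) (w : G) :
  lower_central m w -> deg_lt (n + m).+1 f -> deg_lt n (fun x => f (x * w)%g - f x).
Proof.
elim: m n f w => [|m IH] n f w Lw; first by rewrite addn0; apply.
pose R (w : G) (f : G -> K) x := f (x * w)%g - f x.
move: n f; apply: (generated_subgroup_min
  (H := [set w | forall n (f : G -> K), deg_lt (n + m.+1).+1 f -> deg_lt n (R w f)]) _ _ Lw).
  split=> /= [n f _|a b Ra Rb n f fn|a Ra n f fn].
  - by apply: deg_lt_eq0 => x; rewrite /R mulg1 subrr.
  - have := deg_ltD 1 (deg_lt_right a (Rb n f fn)) (Ra n f fn).
    by congr deg_lt; apply/funext => x; rewrite /R mulgA; ring.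
  - have := deg_ltD (-1) (deg_lt_right a^-1%g (Ra n f fn)) (deg_lt_eq0 n (f := fun=> 0) (fun=> erefl)).
    by congr deg_lt; apply/funext => x; rewrite /R mulgVK addr0 mulN1r opprB.
move=> _ [u [y [Ly ->]]] n f fn; rewrite addnS in fn.
(* The difference along [u, y] is (R_u R_y - R_y R_u) f translated by (y u)^-1. *)
have h1 : deg_lt n (R u (R y f)) by apply: (IH n.+1 f y Ly); rewrite addSn.
have h2 : deg_lt n (R y (R u f)) by apply: IH => //; exact: fn.
have := deg_lt_right (y * u)^-1%g (deg_ltB h2 h1).
congr deg_lt; apply/funext => x; rewrite /R.
have -> : (x * (y * u)^-1 * u * y = x * [~ u, y])%g.
  by rewrite commgEl conjgE invgM !mulgA.
rewrite !mulgA; have -> : (x * (y * u)^-1 * y * u = x)%g by rewrite invgM !mulgA mulgVK mulgVK.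
ring.
Qed.

(** * Polynomial functions on the torsion-free quotients *)

Section Factorization.
Variables (p : nat) (p_pr : prime p) (G : topGroupType).
Local Notation K := (Qp p_pr).
Hypothesis ppl : pro_p_like p G.
Hypothesis nilp : forall H : set G, p_open p H -> exists M, lower_central (G := G) M `<=` H.
Variable s : seq G.
Hypothesis ds : dense (generated_subgroup [set` s]).

Lemma lower_central_invariant n (a : G -> K) x w : deg_lt n a -> lower_central n w -> a (x * w)%g = a x.
Proof.
move=> an Lw; apply/eqP; rewrite -subr_eq0; apply/eqP.
by apply: (deg_lt_lower_central (n := 0) Lw); exact: deg_ltS.
Qed.

(** The value a(w ^ i x) is a polynomial P(i). Since w ^ m acts trivially, P(m X) is the constant
    a(x), and X = 1/m gives P(1) = a(x). *)
Lemma lower_central_torsion_invariant n (a : G -> K) x w m : deg_lt n a -> (0 < m)%N ->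
  lower_central n (w ^+ m)%g -> a (w * x)%g = a x.
Proof.
move=> an m0 Lw; have nL := chain_normal (lower_central_chain G) n.
pose P : {poly K} := \sum_(j < n) iter j (dl w) a x *: binp K j.
have PE i : a (w ^+ i * x)%g = P.[i%:R].
  rewrite (ldeg_taylor (M := setT) _ _ (deg_lt_ldeg an))// horner_sum; apply: eq_bigr => j _.
  by rewrite hornerZ (binpE (qp_natr_eq0 p_pr)) mulrC.
have PQ : P \Po (m%:R *: 'X) = (a x)%:P.
  apply: (poly_nat_eq (qp_natr_eq0 p_pr)) => i.
  rewrite horner_comp hornerZ hornerX hornerC -natrM -PE expgnA conjgC.
  apply: (lower_central_invariant _ an); have [[L1 LM _] LJ] := nL; apply: LJ.
  by elim: i => [//|i IH]; rewrite expgS; exact: LM.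
have := congr1 (fun Q : {poly K} => Q.[m%:R^-1]) PQ.
rewrite horner_comp hornerZ hornerX hornerC mulfV; last by rewrite qp_natr_eq0 -lt0n.
by rewrite -[1]/(1%:R) -PE expg1.
Qed.

Lemma tf_quotE n x y : to_tf_quot (G := G) n x = to_tf_quot n y <->
  exists2 m, (0 < m)%N & lower_central n ((x^-1 * y) ^+ m)%g.
Proof.
have nT := (lc_quot_torsion p_pr ppl nilp ds n).2.
have nL := chain_normal (lower_central_chain G) n.
rewrite /to_tf_quot (quotE _ _ nT) -to_quotV -to_quotM.
split=> -[m m0]; first by rewrite -to_quotX => /(quot1P _ nL) Lm; exists m.
by move=> Lm; exists m; rewrite // -to_quotX; apply/quot1P.
Qed.

Lemma tf_quot_invariant n (a : G -> K) x y : deg_lt n a ->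
  to_tf_quot n x = to_tf_quot n y -> a x = a y.
Proof.
move=> an /tf_quotE[m m0 Lm]; have [_ LJ] := chain_normal (lower_central_chain G) n.
rewrite -[y](mulVKg x) conjgCV; apply/esym/(lower_central_torsion_invariant _ an m0).
by rewrite -conjXg; exact: LJ.
Qed.

Lemma to_tf_quotM n : {morph to_tf_quot (G := G) n : x y / (x * y)%g}.
Proof. by move=> x y; rewrite /to_tf_quot !to_quotM. Qed.

Lemma to_tf_quot_surj n (y : lc_tf_quot G n) : exists g, to_tf_quot n g = y.
Proof. by elim/quot_ind: y => y; elim/quot_ind: y => y; exists y. Qed.

Lemma to_tf_quot_continuous n : continuous (to_tf_quot (G := G) n).
Proof. exact: comp_cts (@to_quot_continuous _ _) (@to_quot_continuous _ _). Qed.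

Lemma tf_quot_cts n (T : topologicalType) (f : lc_tf_quot G n -> T) :
  continuous (fun g => f (to_tf_quot n g)) -> continuous f.
Proof. by move=> cf; apply/quotient_continuous/quotient_continuous. Qed.

Lemma tf_quot_deg n m (f : lc_tf_quot G n -> K) :
  deg_lt m (fun g => f (to_tf_quot n g)) -> deg_lt m f.
Proof.
elim: m f => [|m IH] f fm; first by move=> y; have [g <-] := to_tf_quot_surj y; exact: fm.
move=> y; have [g <-] := to_tf_quot_surj y; apply: IH.
by have := fm g; congr deg_lt; apply/funext => x; rewrite to_tf_quotM.
Qed.

Lemma tf_factor n m (a : G -> K) : continuous a -> deg_lt m a ->
  (forall x y, to_tf_quot n x = to_tf_quot n y -> a x = a y) ->
  exists f : lc_tf_quot G n -> K, [/\ continuous f, deg_lt m f & forall g, a g = f (to_tf_quot n g)].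
Proof.
move=> ca am inv; have /choice[l lP] := @to_tf_quot_surj n.
have aE g : a g = a (l (to_tf_quot n g)) by apply: inv; rewrite lP.
exists (a \o l); split=> //.
  by apply: tf_quot_cts; rewrite (_ : (fun g => _) = a)//; apply/funext => g; rewrite /= -aE.
by apply: tf_quot_deg; rewrite (_ : (fun g => _) = a)//; apply/funext => g; rewrite /= -aE.
Qed.

Lemma tf_quot_coarser n x y : to_tf_quot (G := G) n.+1 x = to_tf_quot n.+1 y -> to_tf_quot n x = to_tf_quot n y.
Proof.
move=> /tf_quotE[m m0 Lm]; apply/tf_quotE; exists m => //.
exact: (chain_dec (lower_central_chain G)) Lm.
Qed.

End Factorization.

Section MalcevCoordinates.
Variables (p : nat) (p_pr : prime p) (N : topGroupType).
Local Notation Zp := (Zp p_pr).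
Local Notation K := (Qp p_pr).
Hypothesis ppl : pro_p_like p N.
Variable b : seq (seq N).
Hypothesis bP : malcev_basis p_pr b.
Local Notation r := (size (flatten b)).
Let v : nat -> N := nth 1%g (flatten b).

Record malcev_coord (c : N -> 'I_r -> Zp) : Prop := MalcevCoord {
  mc_word : forall x, word_of (c x) = x;
  mc_coord : forall l, c (word_of l) = l;
  mc_cts : forall i, continuous (fun x => Zp_Qp (c x i) : K);
  mc_deg : forall i, exists n, deg_lt n (fun x => Zp_Qp (c x i) : K);
  mc_poly : forall n (f : N -> K), continuous f -> deg_lt n f ->
    exists Q : mpoly.mpoly r K, forall x, f x = poly_eval (padic_point (c x)) Q;
  mc_poly2 : forall n (f : N -> K), continuous f -> deg_lt n f ->
    exists Q : mpoly.mpoly (r + r) K, forall x y,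
      f (x * y)%g = poly_eval (join_args (padic_point (c x)) (padic_point (c y))) Q }.

Definition ext_fun (T : Type) (z : T) n (l : 'I_n -> T) i := if insub i is Some i' then l i' else z.

Lemma word_ofE (l : 'I_r -> Zp) : word_of l = vword v 0 r (ext_fun 0 l).
Proof.
by rewrite /vword big_mkord; apply: eq_bigr => i _; rewrite /ext_fun valK.
Qed.

Lemma multi_bin_mpoly n a J : @mpoly_fun K n (fun t => multi_bin a J (ext_fun 0 t)).
Proof.
elim: J a => [|j J IH] a /=; first exact: mpoly_fun_cst.
apply: mpoly_funM; last exact: IH.
apply: mpoly_fun_horner; rewrite /ext_fun; case: insub => [i|]; last exact: mpoly_fun_cst.
exact: mpoly_fun_var.
Qed.

Lemma malcev_coord_ex : exists c, malcev_coord c.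
Proof.
have [S zc ST] := malcev_chain ppl bP.
have /choice[c' c'P] x : exists l : nat -> Zp, x = vword v 0 r l.
  by apply: (vword_ex zc (leqnn r)); rewrite ST.
pose c x (i : 'I_r) := c' x i.
have cword x : word_of (c x) = x.
  rewrite word_ofE [RHS]c'P; apply: eq_big_nat => i /andP[_ ir].
  by rewrite /ext_fun insubT.
have coord l : c (word_of l) = l.
  apply/funext => i; rewrite /c word_ofE (coord_vword zc c'P) ?ltn_ord// /ext_fun valK //.
have cts i : continuous (fun x => Zp_Qp (c x i) : K).
  by apply: (coord_continuous ppl zc c'P); exact: ltn_ord.
have taylor n (f : N -> K) : continuous f -> deg_lt n f -> forall x y,
    f (x * y)%g = \sum_(J <- multi_exps n r)
      multi_bin 0 J (ext_fun 0 (padic_point (c x))) * multi_dl v 0 J f y.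
  move=> cf fn x y; rewrite -{1}(cword x) word_ofE -[X in vword _ _ X]add0n.
  rewrite (multi_taylor (M := setT) ppl _ _ _ cf (deg_lt_ldeg fn))//.
  apply: eq_bigr => J _; congr (multi_bin 0 J _ * _); apply/funext => i.
  by rewrite /ext_fun; case: insub => // ; rewrite rmorph0.
have poly n (f : N -> K) : continuous f -> deg_lt n f -> 
    @mpoly_fun K r (fun t => \sum_(J <- multi_exps n r) multi_bin 0 J (ext_fun 0 t) * multi_dl v 0 J f 1%g).
  by move=> cf fn; apply: mpoly_fun_sum => J; apply: mpoly_funM; [exact: multi_bin_mpoly|exact: mpoly_fun_cst].
have polyE n (f : N -> K) : continuous f -> deg_lt n f -> 
    exists2 phi : ('I_r -> K) -> K, mpoly_fun phi & forall x, f x = phi (padic_point (c x)).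
  move=> cf fn; exists (fun t => \sum_(J <- multi_exps n r) multi_bin 0 J (ext_fun 0 t) * multi_dl v 0 J f 1%g).
    exact: poly.
  by move=> x; rewrite -[in LHS](mulg1 x) (taylor n f).
exists c; split=> // [i|n f cf fn|n f cf fn].
- by apply: (coord_polynomial ppl zc ST c'P); exact: ltn_ord.
- have [phi [Q QP] fE] := polyE n f cf fn; exists Q => x; rewrite fE; exact/esym/QP.
(* The Taylor coefficients of f(x y) in the coordinates of x are polynomial functions of y, to be
   expanded in turn. *)
have /choice[phi phiP] J : exists phi : ('I_r -> K) -> K,
    mpoly_fun phi /\ forall x, multi_dl v 0 J f x = phi (padic_point (c x)).
  have dJ : deg_lt n (multi_dl v 0 J f).
    apply: ldeg_deg_lt; apply: multi_dl_ldeg => //; exact: deg_lt_ldeg.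
  by have [phi phiP phiE] := polyE n _ (multi_dl_continuous (a := 0) (J := J) cf) dJ; exists phi.
pose Phi (t : 'I_(r + r) -> K) := \sum_(J <- multi_exps n r)
  multi_bin 0 J (ext_fun 0 (fun i => t (lshift r i))) * phi J (fun i => t (rshift r i)).
have [Q QP] : mpoly_fun Phi.
  apply: mpoly_fun_sum => J; apply: mpoly_funM.
    exact: (mpoly_fun_sub _ (multi_bin_mpoly r 0 J)).
  exact: (mpoly_fun_sub _ (phiP J).1).
exists Q => x y; rewrite (taylor n f)//; apply: etrans _ (esym (QP _)); rewrite /Phi.
apply: eq_bigr => J _; congr (multi_bin 0 J (ext_fun 0 _) * _).
  by apply/funext => i; rewrite /join_args (unsplitK (inl i)).
by rewrite (phiP J).2; congr (phi J _); apply/funext => i; rewrite /join_args (unsplitK (inr i)).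
Qed.

End MalcevCoordinates.

(** * The analytic tower *)

Section AnalyticTower.
Import mpoly.
Variables (p : nat) (p_pr : prime p) (G : topGroupType).
Local Notation Zp := (Zp p_pr).
Local Notation K := (Qp p_pr).
Hypothesis fgG : top_finitely_generated G.
Hypothesis ppl : pro_p_like p G.
Hypothesis nilp : forall H : set G, p_open p H -> exists M, lower_central (G := G) M `<=` H.
Variable s : seq G.
Hypothesis ds : dense (generated_subgroup [set` s]).
Variable b : forall n, seq (seq (lc_tf_quot G n)).
Local Notation r n := (size (flatten (b n))).
Variable c : forall n, lc_tf_quot G n -> 'I_(r n) -> Zp.
Hypothesis cP : forall n, malcev_coord (c (n := n)).
Local Notation A := (polyA p_pr G).
Local Notation pi n := (to_tf_quot (G := G) n).

Lemma coord_polyfun n i : polyfun (fun g => Zp_Qp (c (pi n g) i) : K).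
Proof.
split; first by refine (@comp_cts _ _ _ _ _ (@to_tf_quot_continuous G n) (@mc_cts _ _ _ _ _ (cP n) i)).
have [d dP] := mc_deg (cP n) i; exists d.
exact: (deg_lt_hom (@to_tf_quotM G n) dP).
Qed.

Definition acoord n (i : 'I_(r n)) : A := mkA (coord_polyfun i).
Arguments acoord n i : clear implicits.

Lemma poly_eval_fun m (q : mpoly.mpoly m K) (x : 'I_m -> A) g :
  (poly_eval x q : A) g = poly_eval (fun i => x i g : K^o) q.
Proof. exact: (mmap_hom (evAm p_pr g) x q). Qed.

Lemma poly_eval_acoord n q g : (poly_eval (acoord n) q : A) g = poly_eval (padic_point (c (pi n g))) q.
Proof. exact: poly_eval_fun. Qed.

Lemma acoord_poly n (a : A) : (forall x y, pi n x = pi n y -> a x = a y) ->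
  exists q, a = poly_eval (acoord n) q.
Proof.
move=> inv; have [d ad] := (polyAP a).2.
have [f [cf fd fE]] := tf_factor (polyAP a).1 ad inv.
have [q qE] := mc_poly (cP n) cf fd; exists q.
by apply: polyA_eq => g; rewrite poly_eval_acoord -qE fE.
Qed.

Variable F : forall n, 'I_(r n) -> mpoly.mpoly (r n + r n) K.
Hypothesis FP : forall n i x y, Zp_Qp (c (x * y)%g i) =
  poly_eval (join_args (padic_point (c x)) (padic_point (c y))) (@F n i).
Variable tau : forall n, 'I_(r n) -> mpoly.mpoly (r n.+1) K.
Hypothesis tauP : forall n i, acoord n i = poly_eval (acoord n.+1) (@tau n i).

Lemma group_law_F n : group_law (@F n).
Proof.
move=> l l' l'' e i; have := FP i (word_of l) (word_of l').
by rewrite e !(mc_coord (cP n)).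
Qed.

Lemma tower_map_tau : tower_map tau.
Proof.
move=> n g l l' lE l'E i; have := congr1 (fun a : A => a g) (tauP i).
rewrite poly_eval_acoord -lE (mc_coord (cP _)) => <-.
by change (Zp_Qp (c (pi n g) i) = Zp_Qp (l' i)); rewrite -l'E (mc_coord (cP n)).
Qed.

(** Mal'cev coordinates take all tuples of natural numbers as values, and these are Zariski
    dense. *)
Lemma acoord_inj n (q q' : mpoly.mpoly (r n) K) :
  poly_eval (acoord n) q = poly_eval (acoord n) q' -> q = q'.
Proof.
move=> e; apply: subr0_eq; apply: (mpoly_nat_eq0 (qp_natr_eq0 p_pr)) => t.
have [g gE] := to_tf_quot_surj (word_of (fun i => (t i)%:R : Zp)).
have := congr1 (fun a : A => a g) e; rewrite !poly_eval_acoord gE (mc_coord (cP n)) => eq.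
have tE : padic_point (fun i => (t i)%:R : Zp) = fun i => (t i)%:R :> K^o.
  by apply/funext => i; rewrite /padic_point rmorph_nat.
rewrite tE in eq; apply: etrans (linearB (mmap_lr (R := K^o) (fun i => (t i)%:R)) q q') _.
by rewrite -[RHS](subrr (poly_eval (fun i => (t i)%:R : K^o) q)) {2}eq.
Qed.

Definition lift_poly n (q : mpoly.mpoly (r n) K) : mpoly.mpoly (r n.+1) K :=
  mpoly.mmap (in_alg _) (@tau n) q.

Lemma lift_polyE (R : comAlgType K) (z : forall n, 'I_(r n) -> R) n q :
  (forall i, poly_eval (z n.+1) (@tau n i) = z n i) ->
  poly_eval (z n.+1) (lift_poly q) = poly_eval (z n) q.
Proof.
move=> zt; apply: etrans (mmap_hom (mmap_lr (z n.+1)) (@tau n) q) _.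
by congr (mpoly.mmap _ _ q); apply/funext => i; exact: zt.
Qed.

Lemma acoord_lift n q : poly_eval (acoord n.+1) (lift_poly q) = poly_eval (acoord n) q.
Proof. by apply: (lift_polyE (R := A) (z := acoord)) => i; rewrite -tauP. Qed.

(** By [tf_quot_invariant] a function of degree < n descends to level n, so the algebra is the union
    of the polynomial rings of the tower. *)
Lemma acoord_level (a : A) : exists n q, a = poly_eval (acoord n) q.
Proof.
have [n an] := (polyAP a).2; exists n; apply: acoord_poly => x y.
exact: (tf_quot_invariant ppl nilp ds an).
Qed.

Lemma acoord_level_add (a : A) n d q : a = poly_eval (acoord n) q ->
  exists q', a = poly_eval (acoord (d + n)) q'.
Proof.
move=> ->; elim: d => [|d [q' ->]]; first by exists q.
by exists (lift_poly q'); rewrite acoord_lift.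
Qed.

Lemma acoord_level2 (a a' : A) : exists n q q', a = poly_eval (acoord n) q /\ a' = poly_eval (acoord n) q'.
Proof.
have [n [q aE]] := acoord_level a; have [n' [q' a'E]] := acoord_level a'.
have [u uE] := acoord_level_add n' aE; have [u' u'E] := acoord_level_add n a'E.
by rewrite addnC in u' u'E; exists (n' + n)%N, u, u'.
Qed.

Section LimitPoint.
Variables (R : comAlgType K) (z : forall n, 'I_(r n) -> R).
Hypothesis zP : forall n i, poly_eval (@z n.+1) (@tau n i) = @z n i.

Lemma limit_indep_add d n m q q' : (d + n = m)%N ->
  poly_eval (acoord n) q = poly_eval (acoord m) q' -> poly_eval (@z n) q = poly_eval (@z m) q'.
Proof.
elim: d n q => [|d IH] n q.
  by rewrite add0n => nm; case: m / nm q' => q' /acoord_inj ->.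
rewrite addSnnS => nm e; rewrite -(lift_polyE q (zP (n := n))).
by apply: IH => //; rewrite acoord_lift.
Qed.

Lemma limit_indep n m q q' :
  poly_eval (acoord n) q = poly_eval (acoord m) q' -> poly_eval (@z n) q = poly_eval (@z m) q'.
Proof.
move=> e; have [nm|mn] := leqP n m; first exact: limit_indep_add (subnK nm) e.
by apply/esym; exact: limit_indep_add (subnK (ltnW mn)) (esym e).
Qed.

Lemma level_ex (a : A) : exists u : {n & mpoly (r n) K}, a = poly_eval (acoord (tag u)) (tagged u).
Proof. by have [n [q aE]] := acoord_level a; exists (existT _ n q). Qed.

(** The compatible family z is substituted at any level where a is a polynomial in the coordinates;
    [limit_indep] makes the choice immaterial. *)
Definition limit_fun (a : A) : R :=
  let u := projT1 (cid (level_ex a)) in poly_eval (@z (tag u)) (tagged u).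

Lemma limit_funE n q : limit_fun (poly_eval (acoord n) q) = poly_eval (@z n) q.
Proof. exact/esym/(limit_indep (projT2 (cid (level_ex (poly_eval (acoord n) q))))). Qed.

Lemma limit_fun_linear : linear limit_fun.
Proof.
move=> k a a'; have [n [q [q' [-> ->]]]] := acoord_level2 a a'.
have -> : k *: (poly_eval (acoord n) q : A) + poly_eval (acoord n) q' = poly_eval (acoord n) (k *: q + q').
  exact/esym/mmap_linearP.
by rewrite !limit_funE; exact: mmap_linearP.
Qed.

Lemma limit_fun_monoid : monoid_morphism limit_fun.
Proof.
have [n [_ _]] := acoord_level 1; split.
  have -> : (1 : A) = poly_eval (acoord 0) 1 by exact/esym/mmap_one.
  by rewrite limit_funE; exact: mmap_one.
move=> a a'; have [m [q [q' [-> ->]]]] := acoord_level2 a a'.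
have -> : (poly_eval (acoord m) q : A) * poly_eval (acoord m) q' = poly_eval (acoord m) (q * q').
  exact/esym/mmap_mul.
by rewrite !limit_funE; exact: mmap_mul.
Qed.

Definition limit_point : {lrmorphism A -> R} :=
  HB.pack limit_fun (GRing.isLinear.Build _ _ _ _ limit_fun limit_fun_linear)
    (GRing.isMonoidMorphism.Build _ _ limit_fun limit_fun_monoid).

Lemma limit_pointE n i : limit_point (acoord n i) = @z n i.
Proof.
have -> : acoord n i = poly_eval (acoord n) (mpoly.mpolyX K (mpoly.mnm1 i)).
  exact/esym/(mmap_var (acoord n) i).
by apply: etrans (limit_funE _) _; exact: (mmap_var (@z n) i).
Qed.

End LimitPoint.

(** The polynomial group law, expanded by monomials, is a decomposition of the coordinate function,
    so products of points follow F. *)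
Lemma acoord_splits n i : splits (acoord n i)
  [seq (mpoly.mcoeff m (@F n i) *: \prod_j acoord n j ^+ m (lshift (r n) j),
        \prod_j acoord n j ^+ m (rshift (r n) j)) | m <- mpoly.msupp (@F n i)].
Proof.
have expE (f : A) k x : (f ^+ k : A) x = (f x : K^o) ^+ k by exact: (rmorphXn (evAm p_pr x)).
have prodE (f : 'I_(r n) -> A) (e : 'I_(r n) -> nat) x :
    (\prod_j f j ^+ e j : A) x = \prod_j (f j x : K^o) ^+ e j.
  apply: etrans (rmorph_prod (evAm p_pr x) _ _ _) _; apply: eq_bigr => j _; exact: expE.
move=> g h; rewrite [LHS]/(acoord n i (g * h)%g) /= to_tf_quotM FP.
apply: etrans (mmap_join (R := K^o) _ _ _) _; rewrite big_map; apply: eq_bigr => m _.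
by rewrite A_scaleE !prodE.
Qed.

Definition tower_point (R : comAlgType K) (x : points (specA p_pr fgG) R) n (i : 'I_(r n)) : R := x (acoord n i).
Arguments tower_point {R} x n i.

Lemma analytic_specA : analytic_group F tau (etaA p_pr fgG).
Proof.
exists (@tower_point); last first.
  by move=> g n; exists (c (pi n g)); [exact: mc_word (cP n) _|].
have evalE (R : comAlgType K) (x : points (specA p_pr fgG) R) n q :
    x (poly_eval (acoord n) q) = poly_eval (tower_point x n) q.
  exact: (mmap_hom x).
split=> [R x y xy|R|R x y|//].
- apply: lrmorph_eq => a; have [n [q ->]] := acoord_level a.
  by rewrite !evalE xy.
- apply/seteqP; split=> [_ [x _ <-] n i|z zP].
    by rewrite -evalE -tauP.
  exists (limit_point zP) => //; do 2!apply: functional_extensionality_dep => ?.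
  exact: limit_pointE.
- do 2!apply: functional_extensionality_dep => ?; rewrite /tower_point.
  apply: etrans (smulAE _ _ (acoord_splits _)) _; rewrite big_map.
  apply: etrans (esym (mmap_join _ _ _)); apply: eq_bigr => m _ /=.
  rewrite linearZ !rmorph_prod; congr ((_ *: _) * _); apply: eq_bigr => j _; exact: rmorphXn.
Qed.

End AnalyticTower.

Section ProP.
Variables (p : nat) (p_pr : prime p) (G : topGroupType).
Hypothesis proG : pro_p_group p G.

Lemma pro_p_p_open (H : set G) : open_normal H ->
  p_open p H /\ exists M, lower_central (G := G) M `<=` H.
Proof.
case: proG => _ _ _ card oH; have [n cn] := card H oH; have [_ nH] := oH.
have [pow [M LM]] := finite_pgroup p_pr cn; split.
  by split=> // x; exists n; apply/(quot1P _ nH); rewrite to_quotX pow.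
exists M => x Lx; apply/(quot1P _ nH)/LM; rewrite lower_central_quot; by exists x.
Qed.

Lemma pro_p_group_like : pro_p_like p G.
Proof.
case: proG => cG hG tdG _; split=> // W /(open_normal_nbhs cG hG tdG)[H oH HW].
by exists H => //; exact: (pro_p_p_open oH).1.
Qed.

End ProP.

Theorem theorem0p1 (p : nat) (p_pr : prime p) (G : topGroupType)
    (proG : pro_p_group p G) (fgG : top_finitely_generated G) :
  [/\ exists (U : affGrpSch (Qp p_pr)) (eta : G -> rat_points U),
        tannakian_group eta /\ malcev_completion eta,
      exists (U : affGrpSch (Qp p_pr)) (eta : G -> rat_points U),
        [/\ hopf_group eta, pro_unipotent U &
            forall (M : affGrpSch (Qp p_pr)) (etaM : G -> rat_points M),
              malcev_completion etaM ->
              canonically_isomorphic eta etaM /\ grouplike_isomorphic etaM] &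
      forall b : (forall n, seq (seq (lc_tf_quot G n))),
        (forall n, malcev_basis p_pr (b n)) ->
        exists F tau,
          [/\ forall n, group_law (b := b n) (F n), tower_map (b := b) tau &
              exists (U : affGrpSch (Qp p_pr)) (eta : G -> rat_points U),
                analytic_group F tau eta /\ malcev_completion eta]].
Proof.
have [cG hG tdG _] := proG; split.
- exists (specA p_pr fgG), (etaA p_pr fgG); split; [exact: tannakian_specA|exact: malcev_specA].
- exists (specA p_pr fgG), (etaA p_pr fgG); split.
  + exact: hopf_specA.
  + exact: pro_unipotent_specA.
  + by move=> M etaM; exact: hopf_malcev.
move=> b bP; have [s ds] := fgG.
have ppl := pro_p_group_like p_pr proG.
have nilp (H : set G) : p_open p H -> exists M, lower_central (G := G) M `<=` H.
  by move=> [oH _]; exact: (pro_p_p_open p_pr proG oH).2.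
have pplN n := lc_tf_quot_pro_p_like p_pr ppl nilp ds n.
pose c n := projT1 (cid (malcev_coord_ex (pplN n) (bP n))).
have cP n : malcev_coord (c n) := projT2 (cid (malcev_coord_ex (pplN n) (bP n))).
(* A coordinate is itself a polynomial function, so its value on a product is a polynomial in both
   sets of coordinates. *)
have Fex n (i : 'I_(size (flatten (b n)))) : exists q : mpoly.mpoly (size (flatten (b n)) + size (flatten (b n))) (Qp p_pr),
    forall x y, Zp_Qp (c n (x * y)%g i) = poly_eval (join_args (padic_point (c n x)) (padic_point (c n y))) q.
  have [d dP] := mc_deg (cP n) i; exact: (mc_poly2 (cP n) (@mc_cts _ _ _ _ _ (cP n) i) dP).
(* A coordinate at level n factors through the next quotient, hence is a polynomial in the
   coordinates there. *)
have tauex n (i : 'I_(size (flatten (b n)))) : exists q, acoord cP i = poly_eval (acoord cP (n := n.+1)) q.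
  apply: acoord_poly => x y /(tf_quot_coarser p_pr ppl nilp ds) xy.
  exact: (congr1 (fun u => Zp_Qp (c n u i)) xy).
exists (fun n i => projT1 (cid (Fex n i))), (fun n i => projT1 (cid (tauex n i))).
have FP n i := projT2 (cid (Fex n i)); have tauP n i := projT2 (cid (tauex n i)).
split; [exact: (group_law_F cP FP)|exact: (tower_map_tau tauP)|].
exists (specA p_pr fgG), (etaA p_pr fgG); split; last exact: malcev_specA.
exact: (analytic_specA fgG ppl nilp ds FP tauP).
Qed.
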